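(* Let $\Omega\subset\mathbb{R}^2$ be a convex polygonal domain, let $(\mathcal{T}_h)_{0<h\le h_0}$ be a regular family of admissible triangulations of $\Omega$, and let $A\in L^\infty(\Omega;\mathcal{M}_2(\mathbb{R}))$ be uniformly elliptic, i.e. there is $c>0$ with $A(x)\xi\cdot\xi\ge c|\xi|^2$ for a.e. $x\in\Omega$ and all $\xi\in\mathbb{R}^2$. Assume that for all $f\in L^2(\Omega)$ the weak solution $u\in W^{1,2}_0(\Omega)$ of $\mathrm{div}(A\nabla u)=f$ belongs to $W^{2,2}(\Omega)$. Then there exists $\varepsilon>0$ such that for all $p\in(2,2+\varepsilon)$ there exist $\theta\in(0,1)$ and $C>0$ such that for all $f\in L^2(\Omega)$ and all $h$, $$\|u_h-u\|_{W^{1,p}(\Omega)}\le Ch^\theta\|f\|_{L^2(\Omega)},$$ where $u\in W^{1,2}_0(\Omega)$ is the weak solution of $\mathrm{div}(A\nabla u)=f$ and $u_h$ is the unique element of $V^1_0(\mathcal{T}_h)$ with $\int_\Omega A\nabla u_h\cdot\nabla v\,dx=-\int_\Omega fv\,dx$ for all $v\in V^1_0(\mathcal{T}_h)$.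
   Context: A triangulation of the polygonal domain $\Omega$ is a finite family $\mathcal{T}$ of closed triangles with $\overline\Omega=\bigcup_{T\in\mathcal{T}}T$. It is admissible if for all distinct $T,T'\in\mathcal{T}$ the set $T\cap T'$ is empty, or a vertex, or a common side. For a triangle $T$, $h_T$ is its diameter and $\rho_T$ is the diameter of the largest ball included in $T$. The family $(\mathcal{T}_h)_{0<h\le h_0}$ consists of admissible triangulations of $\Omega$ with $\sup_{T\in\mathcal{T}_h}h_T=h$; it is regular if there exists $\sigma>0$ with $h_T/\rho_T\le\sigma$ for all $T\in\mathcal{T}_h$ and all $h$. $V^1(\mathcal{T})$ is the space of continuous functions on $\overline\Omega$ whose restriction to each $T\in\mathcal{T}$ is a polynomial of degree at most $1$, and $V^1_0(\mathcal{T})$ is the subspace of those vanishing on $\partial\Omega$; $V^1_0(\mathcal{T})\subset W^{1,2}_0(\Omega)$. The weak solution $u\in W^{1,2}_0(\Omega)$ of $\mathrm{div}(A\nabla u)=f$ is characterised by $\int_\Omega A\nabla u\cdot\nabla\varphi\,dx=-\int_\Omega f\varphi\,dx$ for all $\varphi\in C_c^\infty(\Omega)$. *)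

(* Defs.v *)
(* MathComp-Analysis, over an arbitrary realType R. *)
From HB Require Import structures.
From mathcomp Require Import all_boot all_order all_algebra.
From mathcomp Require Import all_classical all_reals all_analysis.

Set Implicit Arguments.
Unset Strict Implicit.
Unset Printing Implicit Defensive.

Import Order.TTheory GRing.Theory Num.Theory.
Import numFieldNormedType.Exports.

Local Open Scope classical_set_scope.
Local Open Scope ring_scope.

(* The plane with its product topology and product (= Borel) sigma-algebra.
   Its library norm is the sup norm, hence the explicit Euclidean norm. *)
Notation plane R := (measurableTypeR R * measurableTypeR R)%type.

Section Geometry.
Variable R : realType.
Implicit Types (Om T S : set (plane R)) (TT : set (set (plane R))).
Implicit Types (a b c x y : plane R).

Definition enorm x : R := Num.sqrt (x.1 ^+ 2 + x.2 ^+ 2).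

Definition is_convex T : Prop := @convex_set R (plane R) T.

Definition conv_hull T : set (plane R) := smallest is_convex T.

Definition convex_polygonal_domain Om : Prop :=
  [/\ open Om, Om !=set0, is_convex Om &
      exists F : set (plane R), finite_set F /\ closure Om = conv_hull F].

Definition noncollinear a b c : Prop :=
  (b.1 - a.1) * (c.2 - a.2) - (b.2 - a.2) * (c.1 - a.1) != 0 :> R.

Definition has_vertices T a b c : Prop :=
  noncollinear a b c /\ T = conv_hull [set a; b; c].

Definition is_triangle T : Prop := exists a b c, has_vertices T a b c.

Definition is_vertex a T : Prop := exists b c, has_vertices T a b c.

Definition is_side S T : Prop :=
  exists a b c, has_vertices T a b c /\ S = conv_hull [set a; b].

Definition ediam T : R :=
  sup [set d | exists x y, [/\ T x, T y & d = enorm (x - y)]].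

Definition inball_diam T : R :=
  sup [set 2 * r | r in [set r | 0 <= r /\
    exists x, [set y | enorm (y - x) <= r] `<=` T]].

Definition triangulation Om TT : Prop :=
  [/\ finite_set TT, (forall T, TT T -> is_triangle T) &
      closure Om = \bigcup_(T in TT) T].

Definition admissible TT : Prop :=
  forall T T', TT T -> TT T' -> T <> T' ->
    [\/ T `&` T' = set0,
        exists a, [/\ is_vertex a T, is_vertex a T' & T `&` T' = [set a]] |
        is_side (T `&` T') T /\ is_side (T `&` T') T'].

Definition mesh_size TT : R := sup [set ediam T | T in TT].

Definition triangulation_family Om (h0 : R) (Th : R -> set (set (plane R)))
    : Prop :=
  forall h, 0 < h <= h0 ->
    [/\ triangulation Om (Th h), admissible (Th h) & mesh_size (Th h) = h].

Definition regular_family (h0 : R) (Th : R -> set (set (plane R))) : Prop :=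
  exists2 sigma : R, 0 < sigma &
    forall h, 0 < h <= h0 ->
    forall T, Th h T -> ediam T / inball_diam T <= sigma.

End Geometry.

(* Functions on Om are total functions on the plane; every notion below
   depends only on their values on Om (on its closure for V1 and V1_0). *)
Section Sobolev.
Variable R : realType.
Implicit Types (Om : set (plane R)) (u v w f phi : plane R -> R).

Definition leb2 : {measure set (plane R) -> \bar R} :=
  ((@lebesgue_measure R) \x (@lebesgue_measure R))%E.

Definition in_Lp Om (p : \bar R) u : Prop := u \_ Om \in Lfun leb2 p.

Definition Lp_norm Om (p : \bar R) u : \bar R :=
  Lnorm leb2 p (EFin \o (u \_ Om)).

Definition basis_vec (i : 'I_2) : plane R := ((i == 0)%:R, (i == 1)%:R).

Definition partial (i : 'I_2) (g : plane R -> R) : plane R -> R :=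
  fun x => derive (g : R^o * R^o -> R^o) x (basis_vec i).

(* All iterated partial derivatives are (Frechet) differentiable. *)
Definition smooth phi : Prop :=
  forall (s : seq 'I_2) (x : plane R),
    differentiable (foldr partial phi s : R^o * R^o -> R^o) x.

Definition test_function Om phi : Prop :=
  [/\ smooth phi, compact (closure [set x | phi x != 0]) &
      closure [set x | phi x != 0] `<=` Om].

Definition loc_integrable Om u : Prop :=
  forall K : set (plane R), compact K -> K `<=` Om ->
    leb2.-integrable K (EFin \o u).

Definition is_weak_partial Om (i : 'I_2) u w : Prop :=
  [/\ loc_integrable Om u, loc_integrable Om w &
      forall phi, test_function Om phi ->
        \int[leb2]_(x in Om) (u x * partial i phi x) =
        - \int[leb2]_(x in Om) (w x * phi x)].

(* W^{k,p}(Om) *)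
Fixpoint in_Sobolev Om (k : nat) (p : \bar R) u : Prop :=
  if k is k'.+1 then
    in_Lp Om p u /\
    forall i, exists w, is_weak_partial Om i u w /\ in_Sobolev Om k' p w
  else in_Lp Om p u.

(* A choice of the (a.e. unique) weak derivative; 0 when there is none. *)
Definition weak_partial Om (i : 'I_2) u : plane R -> R :=
  xget (cst 0) [set w | is_weak_partial Om i u w].

Definition weak_grad Om u (x : plane R) : 'cV[R]_2 :=
  \col_i weak_partial Om i u x.

(* Meaningful when in_Sobolev Om 1 p%:E u. *)
Definition W1p_norm Om (p : R) u : \bar R :=
  ((Lp_norm Om p%:E u `^ p +
    \sum_(i < 2) Lp_norm Om p%:E (weak_partial Om i u) `^ p) `^ p^-1)%E.

(* W^{1,2}_0(Om), the closure of C_c^oo(Om) in W^{1,2}(Om) *)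
Definition in_W012 Om u : Prop :=
  in_Sobolev Om 1 2%:E u /\
  forall e : R, 0 < e ->
    exists2 phi, test_function Om phi & (W1p_norm Om 2 (u \- phi)%R < e%:E)%E.

End Sobolev.

Section Problem.
Variable R : realType.
Implicit Types (Om : set (plane R)) (A : plane R -> 'M[R]_2).
Implicit Types (u v f : plane R -> R) (TT : set (set (plane R))).

Definition dot (xi eta : 'cV[R]_2) : R := \sum_(i < 2) xi i 0 * eta i 0.

Definition in_Linfty_mx Om A : Prop :=
  forall i j, in_Lp Om +oo%E (fun x => A x i j).

Definition uniformly_elliptic Om A : Prop :=
  exists2 c : R, 0 < c &
    {ae leb2 R, forall x, Om x ->
       forall xi : 'cV[R]_2, dot (A x *m xi) xi >= c * dot xi xi}.

Definition bilin_form Om A u v : R :=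
  \int[leb2 R]_(x in Om) dot (A x *m weak_grad Om u x) (weak_grad Om v x).

Definition weak_solution Om A f u : Prop :=
  in_W012 Om u /\
  forall phi, test_function Om phi ->
    bilin_form Om A u phi = - \int[leb2 R]_(x in Om) (f x * phi x).

Definition in_V1 Om TT v : Prop :=
  {within closure Om, continuous (v : plane R -> R^o)} /\
  forall T, TT T -> exists a b c : R,
    forall x, T x -> v x = a + b * x.1 + c * x.2.

Definition in_V10 Om TT v : Prop :=
  in_V1 Om TT v /\ forall x, (closure Om `\` interior Om) x -> v x = 0.

Definition discrete_solution Om A TT f u : Prop :=
  in_V10 Om TT u /\
  forall v, in_V10 Om TT v ->
    bilin_form Om A u v = - \int[leb2 R]_(x in Om) (f x * v x).

End Problem.

(* Main.v *)
(** On a regular mesh a discrete Lewis truncation (Lipschitz truncation of the nodal values at the levels of a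
mesh maximal function of the gradient) applied to the adjoint discrete problem gives a Meyers estimate
|u_h|_{1,p1} <= C |f|_2 for some p1 > 2. By hypothesis each solution u has a Laplacian in L^2; a gliding-hump argument
makes this uniform, |int grad u . grad phi| <= C |f|_2 |phi|_2, and together with Cea's lemma, applied to the
interpolant of a mollified dilation of u, it yields the rate h^(1/16) in the energy norm. Fatou's lemma transfers the
L^p1 bound from grad u_h to grad u, and interpolating between L^2 and L^p1 gives a rate in every W^{1,p}, 2 < p < p1. *)
Require Import Defs.
From HB Require Import structures.
From mathcomp Require Import all_boot all_order all_algebra.
From mathcomp Require Import all_classical all_reals all_analysis.
From mathcomp Require Import measurable_realfun.
From mathcomp Require Import ring lra.
Set Implicit Arguments.
Unset Strict Implicit.
Unset Printing Implicit Defensive.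
Import Order.TTheory GRing.Theory Num.Theory.
Import numFieldNormedType.Exports.
Local Open Scope classical_set_scope.
Local Open Scope ring_scope.

(** The coefficients are merely bounded and may be nonsymmetric, so integrability of gradients above
    exponent 2 must come from ellipticity alone, uniformly in the mesh. Testing with a truncated
    function can only lower the exponent, to 2 - d. For the adjoint problem, whose right-hand side
    is a power of the slopes of [u_h], this is enough: duality turns 2 - d into the conjugate
    exponent (2 - d) / (1 - d), which exceeds 2. The meshes are regular but may be far from
    quasi-uniform. Every constant therefore depends on a single shape constant [k], and a lower
    bound for the distance of two vertices in terms of the local size ([separation]) takes the place
    of a global mesh size; it is what makes the truncated nodal values Lipschitz. The regularity
    hypothesis carries no constant. It is exploited through one family of scalar functionals, the
    pairings of grad u with gradients of test functions, to which uniform boundedness applies. The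
    resulting energy rate is far from optimal, but interpolation against the bound in L^p1 turns any
    positive power of h into a positive power. *)

Lemma eqle (d : Order.disp_t) (T : porderType d) (x y : T) : x = y -> (x <= y)%O.
Proof. by move->. Qed.

(** The form in which density arguments end: an approximant at distance e leaves a defect that is a
    multiple of e. No sign of K is assumed, hence the division by |K| + 1. *)
Lemma le_lim (R : realType) (a K : R) : (forall e, 0 < e -> a <= K * e) -> a <= 0.
Proof.
move=> h; apply/ler_addgt0Pr => e e0; rewrite add0r.
have K1 : 0 < `|K| + 1 by rewrite ltr_wpDl.
apply: le_trans (h (e / (`|K| + 1)) (divr_gt0 e0 K1)) _.
rewrite mulrCA ler_piMr ?(ltW e0)// ler_pdivrMr// mul1r.
by apply: le_trans (ler_norm K) _; rewrite lerDl.
Qed.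

(** In finite dimension uniqueness gives existence. The Galerkin problem and its adjoint are both
    solved in this way, with uniqueness coming from ellipticity. *)
Lemma fin_solve (R : fieldType) n (B : 'I_n -> 'I_n -> R) (b : 'I_n -> R) :
  (forall d, (forall t, \sum_s d s * B s t = 0) -> forall s, d s = 0) ->
  exists d, forall t, \sum_s d s * B s t = b t.
Proof.
move=> inj; pose M : 'M[R]_n := \matrix_(s, t) B s t.
have uM : M \in unitmx.
  rewrite -row_free_unit; apply: inj_row_free => d dM; apply/rowP => s; rewrite mxE.
  apply: (inj (fun s => d 0 s)) => t; have := congr1 (fun A : 'rV_n => A 0 t) dM; rewrite !mxE => e; apply: etrans e.
  by apply: eq_bigr => s' _; rewrite mxE.
exists (fun s => (\row_t b t *m invmx M) 0 s) => t.
have := congr1 (fun A : 'rV_n => A 0 t) (mulmxKV uM (\row_t b t)); rewrite !mxE => <-.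
by apply: eq_bigr => s _; rewrite [M s t]mxE.
Qed.

Local Notation mfun := (measurable_fun setT).

(** * Real integrals and square integrable functions on a measure space *)

Section Integrals.
Variables (d : measure_display) (T : measurableType d) (R : realType).
Variable mu : {measure set T -> \bar R}.
Implicit Types (f g h : T -> R) (c : R).

(** Integrals run over the whole space: functions on a domain are later replaced by their extensions
    by zero, so that no domain has to be carried along. *)
Definition itg f : R := \int[mu]_x f x.
Definition itb f : Prop := mu.-integrable setT (EFin \o f).

Lemma itb_m f : itb f -> mfun f.
Proof. by move=> /(measurable_int mu)/measurable_EFinP. Qed.

Lemma itbP f : mfun f -> (\int[mu]_x `|f x|%:E < +oo)%E -> itb f.
Proof. by move=> mf h; apply/integrableP; split=> //; exact/measurable_EFinP. Qed.

Lemma itb_le f g : mfun f -> (forall x, `|f x| <= g x) ->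
  itb g -> itb f.
Proof.
move=> mf fg; apply: le_integrable => //; first exact/measurable_EFinP.
by move=> x _ /=; rewrite lee_fin (le_trans (fg x)) ?ler_norm.
Qed.

Lemma itbD f g : itb f -> itb g -> itb (fun x => f x + g x).
Proof. by move=> hf hg; exact: (integrableD _ hf hg). Qed.

Lemma itbZ c f : itb f -> itb (fun x => c * f x).
Proof. by move=> hf; exact: (integrableZl _ _ hf). Qed.

Lemma itbN f : itb f -> itb (fun x => - f x).
Proof. by move=> hf; exact: (integrableN hf). Qed.

Lemma itbB f g : itb f -> itb g -> itb (fun x => f x - g x).
Proof. by move=> hf /itbN; exact: itbD. Qed.

Lemma itb_norm f : itb f -> itb (fun x => `|f x|).
Proof. by move=> hf; exact: (integrable_norm hf). Qed.

Lemma itb0 : itb (fun=> 0).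
Proof. exact: integrable0. Qed.

Lemma itb_sum (I : Type) (s : seq I) (F : I -> T -> R) :
  (forall i, itb (F i)) -> itb (fun x => \sum_(i <- s) F i x).
Proof.
move=> h; elim: s => [|i s IH].
  by rewrite (_ : (fun _ => _) = fun=> 0) ?funeqE=> [|x]; rewrite ?big_nil//; exact: itb0.
rewrite (_ : (fun _ => _) = fun x => F i x + \sum_(i <- s) F i x); first exact: itbD.
by rewrite funeqE => x; rewrite big_cons.
Qed.

Lemma itgD f g : itb f -> itb g -> itg (fun x => f x + g x) = itg f + itg g.
Proof. by move=> hf hg; exact: RintegralD. Qed.

Lemma itgZ c f : itb f -> itg (fun x => c * f x) = c * itg f.
Proof. by move=> hf; exact: RintegralZl. Qed.

Lemma itgN f : itb f -> itg (fun x => - f x) = - itg f.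
Proof.
move=> hf; rewrite -mulN1r -itgZ//; congr itg.
by rewrite funeqE => x; rewrite mulN1r.
Qed.

Lemma itgB f g : itb f -> itb g -> itg (fun x => f x - g x) = itg f - itg g.
Proof. by move=> hf hg; exact: RintegralB. Qed.

Lemma itg0 : itg (fun=> 0) = 0.
Proof. by rewrite /itg Rintegral_cst// mul0r. Qed.

Lemma itg_sum (I : Type) (s : seq I) (F : I -> T -> R) :
  (forall i, itb (F i)) ->
  itg (fun x => \sum_(i <- s) F i x) = \sum_(i <- s) itg (F i).
Proof.
move=> h; elim: s => [|i s IH].
  by rewrite big_nil -[RHS]itg0; congr itg; rewrite funeqE => x; rewrite big_nil.
rewrite big_cons -IH -itgD//; last exact: itb_sum.
by congr itg; rewrite funeqE => x; rewrite big_cons.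
Qed.

Lemma itg_ge0 f : (forall x, 0 <= f x) -> 0 <= itg f.
Proof. by move=> f0; exact: Rintegral_ge0. Qed.

Lemma itg_le f g : itb f -> itb g -> (forall x, f x <= g x) -> itg f <= itg g.
Proof. by move=> hf hg fg; apply: le_Rintegral. Qed.

Lemma itgE f : itb f -> (itg f)%:E = (\int[mu]_x (f x)%:E)%E.
Proof. by move=> hf; rewrite /itg /Rintegral fineK//; exact: integrable_fin_num. Qed.

Lemma itg_norm f : itb f -> `|itg f| <= itg (fun x => `|f x|).
Proof. by move=> hf; exact: le_normr_Rintegral. Qed.

Lemma itg_ae f g : mfun f -> mfun g ->
  {ae mu, forall x, f x = g x} -> itg f = itg g.
Proof.
move=> mf mg fg; congr fine; apply: ae_eq_integral => //; try exact/measurable_EFinP.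
by apply: filterS fg => x -> _.
Qed.

Lemma itb_ae f g : mfun f -> mfun g ->
  {ae mu, forall x, f x = g x} -> itb f -> itb g.
Proof.
move=> mf mg fg /integrableP[_ h]; apply: itbP => //.
rewrite (_ : \int[mu]_x _ = \int[mu]_x `|(EFin \o f) x|)%E//; apply: ae_eq_integral => //.
- by apply/measurable_EFinP; exact: measurableT_comp.
- by apply/measurable_EFinP; apply: measurableT_comp.
- by apply: filterS fg => x /= -> _.
Qed.

Lemma itg_le_ae f g : itb f -> itb g -> {ae mu, forall x, f x <= g x} -> itg f <= itg g.
Proof.
move=> hf hg fg.
have mf := itb_m hf; have mg := itb_m hg.
have mm : mfun (fun x => Order.max (f x) (g x)) by exact: measurable_funD_max || exact: measurable_maxr.
have ae : {ae mu, forall x, g x = Order.max (f x) (g x)}.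
  by apply: filterS fg => x fg; rewrite max_r.
rewrite (itg_ae mg mm ae); apply: itg_le => //; first exact: itb_ae ae hg.
by move=> x; rewrite le_max lexx.
Qed.

Lemma itg_eq0 f : itb f -> (forall x, 0 <= f x) -> itg f = 0 ->
  {ae mu, forall x, f x = 0}.
Proof.
move=> hf f0 h.
have : (\int[mu]_x `|(EFin \o f) x| = 0)%E.
  rewrite (_ : 0%E = \int[mu]_x (f x)%:E)%E; last by rewrite -itgE// h.
  by apply: eq_integral => x _ /=; rewrite ger0_norm.
move=> /(ae_eq_integral_abs mu measurableT (measurable_int mu hf)).
by apply: filterS => x /(_ I)[].
Qed.

Lemma dct (fn : nat -> T -> R) f g :
  (forall n, mfun (fn n)) -> mfun f -> itb g ->
  {ae mu, forall x, fn n x @[n --> \oo] --> f x} ->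
  (forall n x, `|fn n x| <= g x) ->
  [/\ itb f, (forall n, itb (fn n)) & itg (fn n) @[n --> \oo] --> itg f].
Proof.
move=> mfn mf ig cv dom.
have hn n : itb (fn n) by exact: (itb_le (mfn n) (dom n) ig).
have [] := @dominated_convergence _ T R mu setT measurableT (fun n => EFin \o fn n)
  (EFin \o f) (EFin \o g).
- by move=> n; exact/measurable_EFinP.
- exact/measurable_EFinP.
- by apply: filterS cv => x h _; apply: cvg_comp h _.
- exact: ig.
- by apply: aeW => x n _ /=; rewrite lee_fin.
by move=> h1 _; rewrite -(itgE h1) => /fine_cvgP[_ h2]; split.
Qed.

Lemma fatouR (fn : nat -> T -> R) f c :
  (forall n, itb (fn n)) -> mfun f -> (forall n x, 0 <= fn n x) ->
  {ae mu, forall x, fn n x @[n --> \oo] --> f x} -> (forall n, itg (fn n) <= c) ->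
  itb f /\ itg f <= c.
Proof.
move=> hn mf fn0 cv le.
have f0 : {ae mu, forall x, 0 <= f x}.
  apply: filterS cv => x h; rewrite -(cvg_lim (@Rhausdorff R) h).
  by apply: limr_ge; [apply/cvg_ex; exists (f x)|apply: nearW].
(* The limit is nonnegative almost everywhere only; its positive part is nonnegative everywhere and
   has the same integral. *)
pose g x := Order.max 0 (f x).
have mg : mfun g by apply: measurable_maxr => //.
have fg : {ae mu, forall x, f x = g x} by apply: filterS f0 => x h; rewrite /g max_r.
have gf : {ae mu, forall x, g x = f x} by apply: filterS fg => x ->.
have F : (\int[mu]_x (g x)%:E <= c%:E)%E.
  apply: (@le_trans _ _ (\int[mu]_x (limn_einf (fun n => (fn n x)%:E)))%E); last first.
    apply: le_trans (@fatou _ T R mu setT measurableT (fun n => EFin \o fn n) _ _) _.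
    - by move=> n; exact: (measurable_int mu (hn n)).
    - by move=> n x _; rewrite lee_fin.
    have le' n : (\int[mu]_x (EFin \o fn n) x <= c%:E)%E by rewrite -itgE ?lee_fin//; exact: hn.
    rewrite limn_einf_lim; apply: lime_le.
      by apply: ereal_nondecreasing_is_cvgn; exact: nondecreasing_einfs.
    by apply: nearW => n; apply: le_trans (le' n); apply: ereal_inf_lbound; exists n => /=.
  apply: ae_ge0_le_integral => //.
  - by move=> x _; rewrite lee_fin le_max lexx.
  - exact/measurable_EFinP.
  - move=> x _; rewrite limn_einf_lim; apply: lime_ge.
      by apply: ereal_nondecreasing_is_cvgn; exact: nondecreasing_einfs.
    by apply: nearW => n; apply: le_ereal_inf_tmp => _ [m _ <-]; rewrite lee_fin.
  - rewrite (_ : (fun x => _) = fun x => - limn_esup (fun n => - (fn n x)%:E))%E; last first.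
      by rewrite funeqE => x; rewrite -limn_einfN; congr limn_einf; apply/funext => n; rewrite /comp oppeK.
    apply: measurableT_comp => //; apply: measurable_fun_limn_esup => n.
    by apply: measurableT_comp => //; exact: (measurable_int mu (hn n)).
  - apply: filterS2 cv fg => x h <- _.
    have h' : (fn n x)%:E @[n --> \oo] --> (f x)%:E by apply: cvg_comp h _.
    by rewrite (is_cvg_limn_einfE _) ?(cvg_lim _ h')//; apply/cvg_ex; exists (f x)%:E.
have ig : itb g.
  apply: itbP => //; apply: le_lt_trans (ltry c); apply: le_trans F.
  by apply/eqle/eq_integral => x _; rewrite ger0_norm// le_max lexx.
split; first exact: itb_ae gf ig.
by rewrite (itg_ae mf mg fg) -lee_fin itgE.
Qed.

Definition L2 f : Prop := mfun f /\ itb (fun x => f x ^+ 2).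
Definition n2 f : R := Num.sqrt (itg (fun x => f x ^+ 2)).

Lemma n2_ge0 f : 0 <= n2 f. Proof. exact: sqrtr_ge0. Qed.

Lemma n2K f : n2 f ^+ 2 = itg (fun x => f x ^+ 2).
Proof. by rewrite sqr_sqrtr// itg_ge0// => x; rewrite sqr_ge0. Qed.

Lemma n2_le f c : 0 <= c -> itg (fun x => f x ^+ 2) <= c ^+ 2 -> n2 f <= c.
Proof. by move=> c0; rewrite -n2K ler_pXn2r// nnegrE ?n2_ge0. Qed.

Lemma L2M f g : L2 f -> L2 g -> itb (fun x => f x * g x).
Proof.
move=> [mf hf] [mg hg]; apply: itb_le (itbD hf hg); first exact: measurable_funM.
move=> x; rewrite normrM -[f x ^+ 2]real_normK ?num_real// -[g x ^+ 2]real_normK ?num_real//.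
have := sqr_ge0 (`|f x| - `|g x|); have := mulr_ge0 (normr_ge0 (f x)) (normr_ge0 (g x)); nra.
Qed.

Lemma L2Z c f : L2 f -> L2 (fun x => c * f x).
Proof.
move=> [mf hf]; split; first exact: measurable_funM.
rewrite (_ : (fun _ => _) = fun x => c ^+ 2 * f x ^+ 2); first exact: itbZ.
by rewrite funeqE => x; rewrite exprMn.
Qed.

Lemma L2D f g : L2 f -> L2 g -> L2 (fun x => f x + g x).
Proof.
move=> hf hg; split; first by apply: measurable_funD; [case: hf|case: hg].
rewrite (_ : (fun _ => _) = fun x => f x ^+ 2 + 2 * (f x * g x) + g x ^+ 2).
  by apply: itbD; [apply: itbD; [case: hf|apply/itbZ/L2M]|case: hg].
by rewrite funeqE => x; ring.
Qed.

Lemma L2N f : L2 f -> L2 (fun x => - f x).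
Proof. by move=> /(L2Z (-1)); congr L2; rewrite funeqE => x; rewrite mulN1r. Qed.

Lemma L2B f g : L2 f -> L2 g -> L2 (fun x => f x - g x).
Proof. by move=> hf /L2N; exact: L2D. Qed.

Lemma L20 : L2 (fun=> 0).
Proof. by split=> //; rewrite expr0n/=; exact: itb0. Qed.

Lemma L2_norm f : L2 f -> L2 (fun x => `|f x|).
Proof.
move=> [mf hf]; split; first exact: measurableT_comp.
by congr itb: hf; rewrite funeqE => x; rewrite real_normK ?num_real.
Qed.

Lemma L2_le f g : mfun f -> L2 g -> (forall x, `|f x| <= `|g x|) -> L2 f.
Proof.
move=> mf [mg hg] fg; split=> //; apply: itb_le hg; first exact: measurable_funX.
by move=> x; rewrite normrX -[leRHS]real_normK ?num_real// lerXn2r ?nnegrE.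
Qed.

Lemma n2Z c f : L2 f -> n2 (fun x => c * f x) = `|c| * n2 f.
Proof.
move=> hf; rewrite -sqrtr_sqr -sqrtrM ?sqr_ge0// -itgZ; last by case: hf.
by congr (Num.sqrt (itg _)); rewrite funeqE => x; rewrite exprMn.
Qed.

Lemma n2N f : n2 (fun x => - f x) = n2 f.
Proof. by congr (Num.sqrt (itg _)); rewrite funeqE => x; rewrite sqrrN. Qed.

Lemma n2_abs f : n2 (fun x => `|f x|) = n2 f.
Proof. by congr (Num.sqrt (itg _)); apply/funext => x; rewrite real_normK ?num_real. Qed.

Lemma n2BC f g : n2 (fun x => f x - g x) = n2 (fun x => g x - f x).
Proof. by rewrite -n2N; congr n2; rewrite funeqE => x; rewrite opprB. Qed.

Lemma n20 : n2 (fun=> 0) = 0.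
Proof. by rewrite /n2 expr0n/= itg0 sqrtr0. Qed.

(** The polynomial t -> n2 (f - t g)^2 is nonnegative; its value at the minimum t = b / n2 g^2 gives
    the inequality. *)
Lemma itg_mul_le f g : L2 f -> L2 g -> itg (fun x => f x * g x) <= n2 f * n2 g.
Proof.
move=> hf hg.
set b := itg _; have F t : 0 <= n2 f ^+ 2 - 2 * t * b + t ^+ 2 * n2 g ^+ 2.
  have h1 := hf.2; have h2 := hg.2; have h3 := L2M hf hg.
  rewrite !n2K -(itgZ (t ^+ 2) h2) -(itgZ (2 * t) h3).
  rewrite -(itgB h1 (itbZ _ h3)) -itgD; [|by apply: itbB => //; exact: itbZ|exact: itbZ].
  apply: itg_ge0 => x; have := sqr_ge0 (f x - t * g x); congr (_ <= _); ring.
have f0 := n2_ge0 f; have g0 := n2_ge0 g.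
have [g1|g1] := eqVneq (n2 g) 0.
  (* Here the polynomial is affine in t; this value of t would make it negative if b were not 0. *)
  have := F ((n2 f ^+ 2 + 1) / b); rewrite g1 mulr0 expr0n/= mulr0 addr0.
  have [->//|b0] := eqVneq b 0.
  by rewrite -mulrA divfK//; have := sqr_ge0 (n2 f); lra.
rewrite leNgt; apply/negP => lt.
have gp : 0 < n2 g ^+ 2 by rewrite exprn_gt0// lt_neqAle eq_sym g1.
have := F (b / n2 g ^+ 2); rewrite (_ : _ - _ + _ = n2 f ^+ 2 - b ^+ 2 / n2 g ^+ 2); last by field.
rewrite subr_ge0 ler_pdivrMr// -exprMn ler_pXn2r ?nnegrE ?mulr_ge0//; last first.
  by rewrite (le_trans _ (ltW lt)) ?mulr_ge0.
by rewrite leNgt lt.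
Qed.

Lemma CS f g : L2 f -> L2 g -> `|itg (fun x => f x * g x)| <= n2 f * n2 g.
Proof.
move=> hf hg; rewrite ler_norml itg_mul_le// andbT lerNl -itgN; last exact: L2M.
rewrite -(n2N f); apply: le_trans (itg_mul_le (L2N hf) hg).
by apply/eqle; congr itg; rewrite funeqE => x; rewrite mulNr.
Qed.

Lemma n2D f g : L2 f -> L2 g -> n2 (fun x => f x + g x) <= n2 f + n2 g.
Proof.
move=> hf hg; apply: n2_le; first by rewrite addr_ge0 ?n2_ge0.
rewrite (_ : (fun _ => _) = fun x => f x ^+ 2 + 2 * (f x * g x) + g x ^+ 2); last first.
  by rewrite funeqE => x; ring.
have h1 := hf.2; have h2 := hg.2; have h3 := L2M hf hg.
rewrite itgD ?itgD ?itgZ//; [|exact: itbZ|by apply: itbD => //; exact: itbZ].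
by rewrite -!n2K; have := itg_mul_le hf hg; lra.
Qed.

Lemma n2B f g : L2 f -> L2 g -> n2 (fun x => f x - g x) <= n2 f + n2 g.
Proof. by move=> hf hg; rewrite -(n2N g); exact: n2D hf (L2N hg). Qed.

Lemma n2_split f g h : L2 f -> L2 g -> L2 h ->
  n2 (fun x => f x - h x) <= n2 (fun x => f x - g x) + n2 (fun x => g x - h x).
Proof.
move=> hf hg hh; apply: le_trans (n2D (L2B hf hg) (L2B hg hh)).
by apply/eqle; congr n2; rewrite funeqE => x; ring.
Qed.

Lemma n2_eq0 f : L2 f -> n2 f = 0 -> {ae mu, forall x, f x = 0}.
Proof.
move=> [mf hf] h; have := itg_eq0 hf (fun x => sqr_ge0 _); rewrite -n2K h expr0n/= => /(_ erefl).
by apply: filterS => x /eqP; rewrite sqrf_eq0 => /eqP.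
Qed.

Lemma n2_mono f g : L2 g -> mfun f -> (forall x, `|f x| <= `|g x|) -> n2 f <= n2 g.
Proof.
move=> hg mf fg; have hf := L2_le mf hg fg.
rewrite ler_wsqrtr//; apply: itg_le; [by case: hf|by case: hg|move=> x].
by rewrite -[leLHS]real_normK ?num_real// -[leRHS]real_normK ?num_real// lerXn2r ?nnegrE.
Qed.

Lemma n2_sum (I : Type) (s : seq I) (F : I -> T -> R) : (forall i, L2 (F i)) ->
  L2 (fun x => \sum_(i <- s) F i x) /\ n2 (fun x => \sum_(i <- s) F i x) <= \sum_(i <- s) n2 (F i).
Proof.
move=> h; elim: s => [|i s [IH1 IH2]].
  rewrite (_ : (fun _ => _) = fun=> 0) ?big_nil ?n20; first by split=> //; exact: L20.
  by rewrite funeqE => x; rewrite big_nil.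
rewrite (_ : (fun _ => _) = fun x => F i x + \sum_(i <- s) F i x); last first.
  by rewrite funeqE => x; rewrite big_cons.
split; first exact: L2D.
by rewrite big_cons (le_trans (n2D (h i) IH1))// lerD2l.
Qed.

Lemma geo4 n : \sum_(i < n) (4^-1 : R) ^+ i <= 2.
Proof.
suff : \sum_(i < n) (4^-1 : R) ^+ i <= 2 - 4 / 3 * (4^-1) ^+ n.
  by move=> /le_trans; apply; rewrite gerBl mulr_ge0 ?exprn_ge0//.
elim: n => [|n IH]; first by rewrite big_ord0 expr0; lra.
rewrite big_ord_recr/= exprS; have : 0 <= (4^-1 : R) ^+ n by exact: exprn_ge0.
move: IH; set a := \sum_(i < n) _; set b := 4^-1 ^+ n; lra.
Qed.

(* Fast Cauchy sequences converge a.e.: the increments have summable norms. *)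
Lemma fast_ae (fn : nat -> T -> R) : (forall n, L2 (fn n)) ->
  (forall n, n2 (fun x => fn n.+1 x - fn n x) <= (4^-1) ^+ n) ->
  exists f, L2 f /\ {ae mu, forall x, fn n x @[n --> \oo] --> f x}.
Proof.
move=> hf le.
pose S n x : R := \sum_(i < n) `|fn i.+1 x - fn i x|.
have hS n : L2 (S n) /\ n2 (S n) <= 2.
  have [|h1 h2] := @n2_sum _ (index_enum 'I_n) (fun i x => `|fn i.+1 x - fn i x|).
    by move=> i; apply/L2_norm/L2B.
  split=> //; apply: le_trans h2 _; apply: le_trans (geo4 n); apply: ler_sum => i _.
  apply: le_trans (le i); apply/eqle/(congr1 Num.sqrt)/(congr1 itg).
  by rewrite funeqE => x; rewrite real_normK ?num_real.
have Sm x : nondecreasing_seq (S ^~ x).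
  by apply/nondecreasing_seqP => n; rewrite /S big_ord_recr/= lerDl.
have mS n : mfun (fun x => (S n x ^+ 2)%:E).
  by apply/measurable_EFinP/measurable_funX; case: (hS n) => -[].
have S0 n x : 0 <= S n x by apply: sumr_ge0.
have cvgS : {ae mu, forall x, cvgn (S ^~ x)}.
  have := @cvg_monotone_convergence _ T R mu setT measurableT (fun n x => (S n x ^+ 2)%:E) mS.
  move=> /(_ (fun n x _ => sqr_ge0 _)) h.
  pose g x := limn (fun n => (S n x ^+ 2)%:E).
  have nd x : nondecreasing_seq (fun n => (S n x ^+ 2)%:E).
    by move=> m n mn; rewrite lee_fin lerXn2r ?nnegrE// Sm.
  have {}h := h (fun x _ => nd x).
  have gle : (\int[mu]_x g x <= 4%:E)%E.
    rewrite -(cvg_lim _ h)//; apply: lime_le; first by apply/cvg_ex; eexists; exact: h.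
    apply: nearW => n; rewrite -itgE ?lee_fin; last by case: (hS n) => -[].
    rewrite -n2K (_ : 4 = 2 ^+ 2); last by ring.
    by rewrite lerXn2r ?nnegrE ?n2_ge0; case: (hS n).
  have mg : mfun g.
    by apply: (emeasurable_fun_cvg (fun n x => (S n x ^+ 2)%:E)) => // x _; exact: ereal_nondecreasing_is_cvgn.
  have ig : mu.-integrable setT g.
    apply/integrableP; split=> //; apply: le_lt_trans (ltry 4); apply: le_trans gle.
    apply/eqle/eq_integral => x _; rewrite gee0_abs// /g.
    apply: lime_ge; first exact: ereal_nondecreasing_is_cvgn.
    by apply: nearW => n; rewrite lee_fin sqr_ge0.
  apply: filterS (integrable_ae measurableT ig) => x /(_ I) fin.
  apply: nondecreasing_is_cvgn; first exact: Sm.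
  exists (fine (g x) + 1) => _ [n _ <-].
  have : S n x ^+ 2 <= fine (g x).
    rewrite -lee_fin fineK//; apply: lime_ge; first exact: ereal_nondecreasing_is_cvgn.
    by exists n => // m /= nm; exact: nd.
  have := S0 n x; have := sqr_ge0 (S n x - 1/2); lra.
have cvf : {ae mu, forall x, cvgn (fn ^~ x)}.
  apply: filterS cvgS => x h.
  have : cvgn (series (fun i => fn i.+1 x - fn i x)).
    apply: normed_cvg; rewrite (_ : [normed series _] = S ^~ x)//; apply/funext => n.
    exact: big_mkord.
  move=> /cvg_ex[l hl]; apply/cvg_ex; exists (l + fn 0%N x).
  have -> : fn ^~ x = (fun n => series (fun i => fn i.+1 x - fn i x) n + fn 0%N x).
    by rewrite funeqE => n; rewrite /series /= telescope_sumr// subrK.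
  by apply: cvgD hl _; exact: cvg_cst.
pose f x := limn (fn ^~ x).
(* The finite part of the upper limit is measurable and agrees with the limit wherever the sequence
   converges. *)
have mlim : {f' : T -> R | mfun f' /\ {ae mu, forall x, fn n x @[n --> \oo] --> f' x}}.
  apply: cid; exists (fun x => fine (limn_esup (fun n => (fn n x)%:E))); split.
    apply: measurableT_comp => //.
    by apply: measurable_fun_limn_esup => n; apply/measurable_EFinP; case: (hf n).
  apply: filterS cvf => x h.
  have h' : (fn n x)%:E @[n --> \oo] --> (f x)%:E by apply: cvg_comp h _.
  rewrite (is_cvg_limn_esupE _) ?(cvg_lim _ h')//.
have {f mlim} [f [mf cf]] := mlim; exists f; split=> //; split=> //.
have bd n : n2 (fn n) <= n2 (fn 0%N) + 2.
  suff : n2 (fn n) <= n2 (fn 0%N) + \sum_(i < n) (4^-1) ^+ i.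
    by move=> /le_trans; apply; rewrite lerD2l geo4.
  elim: n => [|n IH]; first by rewrite big_ord0 addr0.
  rewrite big_ord_recr/= addrA; apply: le_trans (lerD IH (le n)).
  apply: le_trans (n2D (hf n) (L2B (hf n.+1) (hf n))).
  by apply/eqle; congr n2; rewrite funeqE => x; ring.
have [] := @fatouR (fun n x => fn n x ^+ 2) (fun x => f x ^+ 2) ((n2 (fn 0%N) + 2) ^+ 2) => //.
- by move=> n; case: (hf n).
- exact: measurable_funX.
- by move=> n x; exact: sqr_ge0.
- by apply: filterS cf => x h; apply: cvgM h h || (rewrite !expr2; exact: cvgM).
- by move=> n; rewrite -n2K lerXn2r ?nnegrE ?n2_ge0// addr_ge0 ?n2_ge0.
Qed.

Lemma n2_fatou (fn : nat -> T -> R) f c : 0 <= c -> (forall n, L2 (fn n)) -> mfun f ->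
  {ae mu, forall x, fn n x @[n --> \oo] --> f x} -> (forall n, n2 (fn n) <= c) ->
  L2 f /\ n2 f <= c.
Proof.
move=> c0 hf mf cv le.
have [] := @fatouR (fun n x => fn n x ^+ 2) (fun x => f x ^+ 2) (c ^+ 2).
- by move=> n; case: (hf n).
- exact: measurable_funX.
- by move=> n x; exact: sqr_ge0.
- by apply: filterS cv => x h; rewrite expr2; under eq_fun do rewrite expr2; exact: cvgM.
- by move=> n; rewrite -n2K lerXn2r ?nnegrE ?n2_ge0.
by move=> h1 h2; split=> //; exact: n2_le.
Qed.

(** Riesz-Fischer for geometrically convergent sequences, with the rate kept: the increments after n
    sum to at most 2 * 4^-n, and Fatou's lemma carries this bound to the limit. *)
Lemma L2_complete (fn : nat -> T -> R) : (forall n, L2 (fn n)) ->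
  (forall n, n2 (fun x => fn n.+1 x - fn n x) <= (4^-1) ^+ n) ->
  exists f, [/\ L2 f, {ae mu, forall x, fn n x @[n --> \oo] --> f x} &
    forall n, n2 (fun x => f x - fn n x) <= 2 * (4^-1) ^+ n].
Proof.
move=> hf le; have [f [f2 cf]] := fast_ae hf le; exists f; split=> // n.
have tel m : n2 (fun x => fn (m + n)%N x - fn n x) <= (4^-1) ^+ n * \sum_(i < m) (4^-1) ^+ i.
  elim: m => [|m IH].
    rewrite big_ord0 mulr0 (_ : (fun _ => _) = fun=> 0) ?n20//.
    by rewrite funeqE => x; rewrite subrr.
  rewrite big_ord_recr/= mulrDr -exprD [(n + m)%N]addnC.
  by apply: le_trans (n2_split (hf _) (hf (m + n)%N) (hf _)) _; rewrite addrC lerD// le.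
have [] := @n2_fatou (fun m x => fn (m + n)%N x - fn n x) (fun x => f x - fn n x) (2 * 4^-1 ^+ n).
- by rewrite mulr_ge0// exprn_ge0.
- by move=> m; exact: L2B.
- by case: (L2B f2 (hf n)).
- apply: filterS cf => x h; apply: cvgB; last exact: cvg_cst.
  by rewrite (_ : (fun m => _) = (fun m => [sequence fn k x]_k (m + n)%N))// cvg_shiftn.
- by move=> m; apply: le_trans (tel m) _; rewrite mulrC ler_pM2r ?exprn_gt0// geo4.
by [].
Qed.

End Integrals.

(** * A smooth bump function on the line *)

Section SmoothLine.
Variable R : realType.
Implicit Types (f g : R -> R) (s t a b C : R) (p q : {poly R}).

Lemma derM f g (x : R) a b c : is_derive x (1 : R) f a -> is_derive x (1 : R) g b ->
  a * g x + f x * b = c -> is_derive x (1 : R) (fun s => f s * g s) c.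
Proof.
move=> h1 h2 <-; have h := is_deriveM h1 h2.
rewrite (_ : a * _ + _ = f x *: b + g x *: a); last by rewrite /GRing.scale/=; ring.
exact: h.
Qed.

Lemma MVT2 f df : (forall t, is_derive t 1 f (df t)) -> forall s t,
  exists2 c, `|c - t| <= `|s - t| & f s - f t = df c * (s - t).
Proof.
move=> h s t; have cf a b : {within `[a, b], continuous f}.
  by apply: derivable_within_continuous => x _; case: (h x).
have [ts|st] := leP t s.
  have [c] := MVT_segment ts (fun x _ => h x) (cf _ _).
  rewrite in_itv/= => /andP[c1 c2] e; exists c => //.
  by rewrite !ger0_norm ?subr_ge0// lerD2r.
have [c] := MVT_segment (ltW st) (fun x _ => h x) (cf _ _).
rewrite in_itv/= => /andP[c1 c2] e; exists c; last by rewrite -opprB e; ring.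
by rewrite !ler0_norm ?subr_le0 ?(ltW st)// lerN2 lerD2r.
Qed.

(** All derivatives exist and are bounded, in coinductive form: f belongs to a class that is closed
    under differentiation and whose members obey uniform first and second order bounds. No order of
    differentiation has to be counted. *)
Definition sm f : Prop := exists S : set (R -> R), S f /\
  forall g, S g -> exists g' C, S g' /\ forall t s, [/\ `|g t| <= C,
    `|g s - g t| <= C * `|s - t| & `|g s - g t - g' t * (s - t)| <= C * (s - t) ^+ 2].

Lemma sm_class (S : set (R -> R)) f : S f ->
  (forall g, S g -> exists2 g', S g' & forall t, is_derive t 1 g (g' t)) ->
  (forall g, S g -> exists C, forall t, `|g t| <= C) -> sm f.
Proof.
move=> Sf hd hb; exists S; split=> // g Sg.
have [g1 Sg1 d1] := hd g Sg; have [g2 Sg2 d2] := hd g1 Sg1.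
have [C0 b0] := hb g Sg; have [C1 b1] := hb g1 Sg1; have [C2 b2] := hb g2 Sg2.
exists g1, (Num.max C0 (Num.max C1 C2)); split=> // t s; split.
- by rewrite le_max b0.
- by have [c _ ->] := MVT2 d1 s t; rewrite normrM ler_wpM2r// !le_max b1 orbT.
have d3 (x : R) : is_derive (x : R) (1 : R) (fun y : R => g y - g1 t * y) (g1 x - g1 t).
  have dx := d1 x; apply: is_derive_eq; rewrite /GRing.scale/=; ring.
have [c hc] := MVT2 d3 s t; rewrite (_ : _ - _ - _ = g s - g t - g1 t * (s - t)); last by ring.
move=> ->; rewrite normrM -[(s - t) ^+ 2]real_normK ?num_real// expr2 mulrA ler_wpM2r//.
have [e _ ->] := MVT2 d2 c t; rewrite normrM; apply: ler_pM => //.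
by rewrite !le_max b2 !orbT.
Qed.

(** Induction on the polynomial with the rate halved at each step: one half of the exponential
    absorbs the new factor s, the other the induction hypothesis. *)
Lemma poly_expR p a : 0 < a -> exists C, forall s, 0 <= s -> `|p.[s]| <= C * expR (a * s).
Proof.
elim/poly_ind: p a => [a a0|p c IH a a0].
  by exists 0 => s _; rewrite horner0 normr0 mul0r.
have a2 : 0 < a / 2 by rewrite divr_gt0.
have [C hC] := IH _ a2; exists (`|C| * (2 / a) + `|c|) => s s0.
rewrite hornerMXaddC (le_trans (ler_normD _ _))// mulrDl lerD//; last first.
  by rewrite ler_peMr// -expR0 ler_expR mulr_ge0// ltW.
have -> : expR (a * s) = expR (a / 2 * s) * expR (a / 2 * s) by rewrite -expRD; congr expR; field.
rewrite normrM (ger0_norm s0) mulrACA ler_pM//.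
  by apply: le_trans (hC s s0) _; rewrite ler_wpM2r ?expR_ge0 ?ler_norm.
have := expR_ge1Dx (a / 2 * s); set e := expR _ => h.
have -> : s = 2 / a * (a / 2 * s) by field; rewrite gt_eqF.
by rewrite ler_wpM2l ?divr_ge0 ?(ltW a0)//; lra.
Qed.

(* Closed under differentiation: the derivative replaces p by X^2 (p - p'). *)
Definition fp p t : R := if 0 < t then p.[t^-1] * expR (- t^-1) else 0.

(** The growth bound for X^2 p at the point 1 / t makes [fp p] vanish to second order at 0, which
    yields both its derivative there and its boundedness on bounded sets. *)
Lemma fp_quad p : exists C, forall t, `|fp p t| <= C * t ^+ 2.
Proof.
have [C hC] := poly_expR ('X^2 * p) ltr01; exists C => t; rewrite /fp; case: ifP => t0.
  have it : 0 <= t^-1 by rewrite invr_ge0 ltW.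
  have h : t^-1 ^+ 2 * `|p.[t^-1]| <= C * expR t^-1.
    by have := hC _ it; rewrite mul1r hornerM hornerXn normrM (ger0_norm (exprn_ge0 _ it)).
  have G : `|p.[t^-1]| <= C * expR t^-1 * t ^+ 2.
    by move: h; rewrite exprVn mulrC ler_pdivrMr ?exprn_gt0.
  rewrite normrM (ger0_norm (expR_ge0 _)); apply: le_trans (ler_wpM2r (expR_ge0 _) G) _.
  by apply: eqle; rewrite expRN; field; rewrite gt_eqF ?expR_gt0.
rewrite normr0 mulr_ge0 ?sqr_ge0//.
by have := hC 0 (lexx 0); rewrite mulr0 expR0 mulr1; apply: le_trans.
Qed.

Lemma quad_derive f x l C : (forall h, `|f (h + x) - f x - l * h| <= C * h ^+ 2) -> is_derive x 1 f l.
Proof.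
move=> H.
have lim : (fun h => h^-1 *: ((f \o shift x) (h *: (1 : R)) - f x)) @ 0^' --> l.
  apply/cvgrPdist_le => e e0.
  have C0 : 0 <= C by have := H 1; rewrite expr1n (mulr1 C); apply: le_trans.
  near=> h; have h0 : h != 0 by near: h; exact: nbhs_dnbhs_neq.
  rewrite /GRing.scale/= mulr1 distrC.
  have -> : h^-1 * (f (h + x) - f x) - l = h^-1 * (f (h + x) - f x - l * h) by field.
  rewrite normrM normfV ler_pdivrMl ?normr_gt0//; apply: le_trans (H h) _.
  rewrite -real_normK ?num_real// expr2 mulrCA ler_wpM2l//.
  have : `|h| < e / (C + 1).
    near: h; apply: dnbhs0_lt; rewrite divr_gt0// ltr_wpDl//.
  rewrite ltr_pdivlMr ?ltr_wpDl// => /ltW; apply: le_trans; rewrite mulrC ler_wpM2l//.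
  by rewrite lerDl.
by apply: DeriveDef; [apply/cvg_ex; exists l|exact: cvg_lim lim].
Unshelve. all: by end_near. Qed.

Lemma fp_derive p t : is_derive t 1 (fp p) (fp ('X^2 * (p - p^`())) t).
Proof.
have [t0|t0|->] := ltgtP t 0.
- rewrite [fp _ t]/fp ltNge ltW//=; apply: near_eq_is_derive (is_derive_cst (0 : R) t 1).
  have : \near t, t < 0 by apply: lt_nbhsl.
  by apply: filterS => s s0; rewrite /fp ltNge ltW.
- rewrite [fp _ t]/fp t0; have tn : t != 0 by rewrite gt_eqF.
  have dV : is_derive t 1 (fun s : R => s^-1) (- t ^- 2).
    by apply: is_derive_eq; [exact: (is_deriveV tn (is_derive_id t 1))|rewrite /GRing.scale/= mulr1].
  have d1 : is_derive t 1 (fun s : R => p.[s^-1]) (p^`().[t^-1] * - t ^- 2).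
    exact: (is_derive1_comp (is_derive_poly p t^-1) dV).
  have dN : is_derive t 1 (fun s : R => - s^-1) (- - t ^- 2) by exact: is_deriveN.
  have d2 : is_derive t 1 (fun s : R => expR (- s^-1)) (expR (- t^-1) * - - t ^- 2).
    exact: (@is_derive1_comp _ expR (fun s : R => - s^-1) t _ _ (is_derive_expR (- t^-1)) dN).
  apply: (@near_eq_is_derive _ _ _ (fun s => p.[s^-1] * expR (- s^-1))).
    have : \near t, 0 < t by apply: lt_nbhsr.
    by apply: filterS => s s0; rewrite /fp s0.
  by apply: (derM d1 d2); rewrite hornerM hornerXn hornerD hornerN -exprVn; ring.
- have [C hC] := fp_quad p; rewrite [fp _ 0]/fp ltxx.
  by apply: (@quad_derive _ _ _ C) => h; rewrite addr0 mul0r subr0 [fp p 0]/fp ltxx subr0.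
Qed.

(** Sums of products of two functions flat at -1 and at 1. Differentiation only changes the
    polynomials, so the product rule stays inside the class. *)
Inductive bumps : (R -> R) -> Prop :=
| bumps1 p q : bumps (fun t => fp p (1 + t) * fp q (1 - t))
| bumpsD f g : bumps f -> bumps g -> bumps (fun t => f t + g t).

Lemma bumps_derive f : bumps f -> exists2 f', bumps f' & forall t, is_derive t 1 f (f' t).
Proof.
pose D p := 'X^2 * (p - p^`()).
elim=> [p q|{}f g _ [f' b1 d1] _ [g' b2 d2]].
  exists (fun t => fp (D p) (1 + t) * fp q (1 - t) + fp (- p) (1 + t) * fp (D q) (1 - t)).
    by apply: bumpsD; exact: bumps1.
  move=> t.
  have dD : is_derive t 1 (fun s : R => 1 + s) (0 + 1) by exact: is_deriveD.
  have dB : is_derive t 1 (fun s : R => 1 - s) (0 - 1) by exact: is_deriveB.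
  have e1 := is_derive1_comp (fp_derive p (1 + t)) dD.
  have e2 := @is_derive1_comp _ (fp q) (fun s => 1 - s) t _ _ (fp_derive q (1 - t)) dB.
  apply: (derM e1 e2).
  have -> : fp (- p) (1 + t) = - fp p (1 + t).
    by rewrite /fp; case: ifP; rewrite ?oppr0// hornerN mulNr.
  by rewrite /D/=; ring.
by exists (fun t => f' t + g' t) => [|t]; [exact: bumpsD|exact: is_deriveD].
Qed.

Lemma bumps_bd f : bumps f -> exists C, forall t, `|f t| <= C.
Proof.
elim=> [p q|{}f g _ [C1 h1] _ [C2 h2]]; last first.
  by exists (C1 + C2) => t; rewrite (le_trans (ler_normD _ _))// lerD.
have [C hC] := fp_quad p; have [D hD] := fp_quad q; exists (C * 2 ^+ 2 * (D * 2 ^+ 2)) => t.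
have C0 : 0 <= C by have := hC 1; rewrite expr1n mulr1; apply: le_trans.
have D0 : 0 <= D by have := hD 1; rewrite expr1n mulr1; apply: le_trans.
rewrite normrM.
have [t1|t1] := leP (1 + t) 0.
  by rewrite {1}/fp ltNge t1/= normr0 mul0r !mulr_ge0 ?exprn_ge0.
have [t2|t2] := leP (1 - t) 0.
  by rewrite mulrC {1}/fp ltNge t2/= normr0 mul0r !mulr_ge0 ?exprn_ge0.
apply: ler_pM => //; first apply: le_trans (hC _) _; last apply: le_trans (hD _) _.
  by rewrite ler_wpM2l// ler_pXn2r ?nnegrE//; lra.
by rewrite ler_wpM2l// ler_pXn2r ?nnegrE//; lra.
Qed.

(** On (-1, 1) this is exp (-2 / (1 - t^2)), the classical bump. *)
Definition bmp t : R := fp 1 (1 + t) * fp 1 (1 - t).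

Lemma bmp_sm : sm bmp.
Proof. by apply: (sm_class (bumps1 1 1)); [exact: bumps_derive|exact: bumps_bd]. Qed.

Lemma bmp_ge0 t : 0 <= bmp t.
Proof. by rewrite /bmp /fp !hornerC !mul1r; case: ifP; case: ifP; rewrite ?mulr0 ?mul0r ?mulr_ge0 ?expR_ge0. Qed.

Lemma bmp_even t : bmp (- t) = bmp t.
Proof. by rewrite /bmp opprK mulrC. Qed.

Lemma bmp_out t : 1 <= `|t| -> bmp t = 0.
Proof.
rewrite ler_normr /bmp /fp => /orP[h|h].
  by rewrite [0 < 1 - t]ltNge (_ : 1 - t <= 0) ?mulr0//; lra.
by rewrite [0 < 1 + t]ltNge (_ : 1 + t <= 0) ?mul0r//; lra.
Qed.

Lemma bmp_gt0 t : `|t| <= 1 / 2 -> expR (- 2) ^+ 2 <= bmp t.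
Proof.
rewrite ler_norml => /andP[h1 h2]; rewrite /bmp /fp !ifT; [|lra..].
rewrite !hornerC !mul1r expr2; apply: ler_pM; rewrite ?expR_ge0// ler_expR lerN2.
  by rewrite -[leRHS]invrK lef_pV2 ?posrE//; lra.
by rewrite -[leRHS]invrK lef_pV2 ?posrE//; lra.
Qed.

End SmoothLine.

(** * Linear forms on the plane, the candidates for Fréchet differentials *)

Section Linear2.
Variables (R : realType) (a b : R).
Definition lin2 (h : R^o * R^o) : R^o := a * h.1 + b * h.2.
Lemma lin2_linear : linear lin2.
Proof.
have H (k u1 u2 v1 v2 : R) : a * (k * u1 + v1) + b * (k * u2 + v2) = k * (a * u1 + b * u2) + (a * v1 + b * v2).
  by ring.
by move=> k u v; exact: H.
Qed.
HB.instance Definition _ := GRing.isLinear.Build R (R^o * R^o)%type R^o _ lin2 lin2_linear.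
End Linear2.

(** * The Lewis inequality for finite weighted sums *)

Section Lewis.
Variable R : realType.
Implicit Types (c K d th x t g p e : R).

Lemma powR_nat_comm t r (k : nat) : 0 <= t -> (t ^+ k) `^ r = (t `^ r) ^+ k.
Proof. by move=> t0; rewrite -(powR_mulrn k t0) -(powR_mulrn k (powR_ge0 t r)) -!powRrM mulrC. Qed.

Lemma two_pow d (k : nat) : [/\ (2 ^+ k) `^ (- d) = (2 `^ (- d)) ^+ k,
  (2 ^+ k) `^ (1 - d) = (2 * 2 `^ (- d) : R) ^+ k & (2 ^+ k) `^ (2 - d) = (4 * 2 `^ (- d) : R) ^+ k].
Proof.
split; rewrite powR_nat_comm//; congr (_ ^+ k); rewrite powRD ?pnatr_eq0 ?implybT//.
  by rewrite powRr1.
by rewrite powR_mulrn//; congr (_ * _); ring.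
Qed.

(** If g <= e t the first term dominates. Otherwise t < g / e, so t^d <= g^d / e because d and e are
    at most 1, and the second term dominates. The number t will be a dyadic value of the maximal
    function. *)
Lemma split_pow d g t e : 0 < d <= 1 -> 0 <= g -> 0 < t -> 0 < e <= 1 ->
  g `^ (2 - d) <= e * t `^ (2 - d) + e^-1 * (g ^+ 2 * t `^ (- d)).
Proof.
move=> /andP[d0 d1] g0 t0 /andP[e0 e1].
have t1 : 0 <= e * t `^ (2 - d) by rewrite mulr_ge0 ?powR_ge0// ltW.
have t2 : 0 <= e^-1 * (g ^+ 2 * t `^ (- d)).
  by rewrite mulr_ge0 ?invr_ge0 ?(ltW e0)// mulr_ge0 ?powR_ge0 ?sqr_ge0.
have [h|h] := leP g (e * t).
  apply: le_trans (_ : e * t `^ (2 - d) <= _); last by rewrite lerDl.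
  apply: le_trans (ge0_ler_powR _ _ _ h) _; rewrite ?nnegrE ?mulr_ge0 ?(ltW e0) ?(ltW t0)//; first by lra.
  by apply: ge1r_powRZ; rewrite ?e0 ?(ltW t0)//; lra.
have gp : 0 < g by apply: le_lt_trans h; rewrite mulr_ge0// ltW.
apply: le_trans (_ : e^-1 * (g ^+ 2 * t `^ (- d)) <= _); last by rewrite lerDr.
have E : g `^ (2 - d) = g ^+ 2 * g `^ (- d) by rewrite powRD ?(gt_eqF gp) ?implybT// -powR_mulrn.
rewrite E mulrCA ler_pM2l ?exprn_gt0// !powRN.
rewrite ler_pdivlMr ?powR_gt0// mulrC ler_pdivrMr ?powR_gt0//.
have te : t <= e^-1 * g by rewrite mulrC ler_pdivlMr// mulrC ltW.
apply: le_trans (ge0_ler_powR _ _ _ te) _; rewrite ?nnegrE ?mulr_ge0 ?invr_ge0 ?(ltW e0) ?(ltW t0) ?(ltW d0)//.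
rewrite powRM ?invr_ge0 ?(ltW e0)//; apply: ler_wpM2r; first exact: powR_ge0.
by rewrite -[leRHS]powRr1 ?invr_ge0 ?(ltW e0)//; apply: ler_powR => //; rewrite invf_ge1.
Qed.

Lemma split_young d p t e : 0 < d < 1 -> 0 <= p -> 0 < t -> 0 < e <= 1 ->
  p * t `^ (1 - d) <= e * t `^ (2 - d) + e^-1 * p `^ (2 - d).
Proof.
move=> /andP[d0 d1] p0 t0 /andP[e0 e1]; have E : 2 - d - 1 = 1 - d by ring.
have q0 : 0 < 2 - d by lra.
have M x : 0 <= x -> x `^ (2 - d) = x * x `^ (1 - d) by move=> x0; have := @mulr_powRB1 R x (2 - d) x0 q0; rewrite E.
have t1 : 0 <= e * t `^ (2 - d) by rewrite mulr_ge0 ?powR_ge0// ltW.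
have t2 : 0 <= e^-1 * p `^ (2 - d) by rewrite mulr_ge0 ?powR_ge0// invr_ge0 ltW.
have [h|h] := leP p (e * t).
  apply: le_trans (_ : e * t `^ (2 - d) <= _); last by rewrite lerDl.
  by rewrite (M t) ?(ltW t0)// mulrA; apply: ler_wpM2r => //; exact: powR_ge0.
apply: le_trans (_ : e^-1 * p `^ (2 - d) <= _); last by rewrite lerDr.
rewrite M// mulrCA; apply: ler_wpM2l => //.
have te : t <= e^-1 * p by rewrite mulrC ler_pdivlMr// mulrC ltW.
apply: le_trans (ge0_ler_powR _ _ _ te) _; rewrite ?nnegrE ?mulr_ge0 ?invr_ge0 ?(ltW e0) ?(ltW t0)//; first by lra.
rewrite powRM ?invr_ge0 ?(ltW e0)//; apply: ler_wpM2r; first exact: powR_ge0.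
by rewrite -[leRHS]powRr1 ?invr_ge0 ?(ltW e0)//; apply: ler_powR; [rewrite invf_ge1|lra].
Qed.

Lemma geo_le x (j : nat) : 3 / 2 <= x -> \sum_(k < j) x ^+ k <= 2 * x ^+ j.
Proof.
move=> hx; elim: j => [|j IH]; first by rewrite big_ord0 expr0; lra.
rewrite big_ord_recr/= exprS; have : 0 <= (x - 3 / 2) * x ^+ j by rewrite mulr_ge0 ?exprn_ge0//; lra.
by move: IH; move: (\sum_(_ < _) _) (x ^+ j) => a b; lra.
Qed.

(** Summation by parts: the weights (1 - th) th^k on the levels k >= j, with th^N at the last one,
    telescope to th^j. So weighting inequalities that carry the indicator of m <= 2^k produces the
    weight m^-d. *)
Lemma abelA th (N j : nat) : (j <= N)%N ->
  \sum_(k < N) (1 - th) * th ^+ k * (j <= k)%N%:R + th ^+ N = th ^+ j.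
Proof.
elim: N => [|N IH]; first by rewrite leqn0 => /eqP ->; rewrite big_ord0 add0r.
rewrite leq_eqVlt => /predU1P[->|]; last first.
  by rewrite ltnS => jN; rewrite big_ord_recr/= jN mulr1 -(IH jN) exprS; ring.
by rewrite big1 ?add0r// => k _; rewrite leqNgt ltn_ord mulr0.
Qed.

Lemma sum_lt (F : nat -> R) (N j : nat) : (j <= N)%N -> \sum_(k < N) F k * (k < j)%N%:R = \sum_(k < j) F k.
Proof.
elim: N => [|N IH]; first by rewrite leqn0 => /eqP ->; rewrite !big_ord0.
rewrite leq_eqVlt => /predU1P[->|]; last first.
  by rewrite ltnS => jN; rewrite big_ord_recr/= ltnNge jN mulr0 addr0 IH.
by apply: eq_bigr => k _; rewrite ltn_ord mulr1.
Qed.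

Lemma geo_tele x (j : nat) : x ^+ j = 1 + \sum_(k < j) (x - 1) * x ^+ k.
Proof. by elim: j => [|j IH]; rewrite ?big_ord0 ?expr0 ?addr0// big_ord_recr/= addrA -IH exprS; ring. Qed.

(** The absorption argument, with X = sum of m^(2-d), Y = sum of g^2 m^-d, Z = sum of p m^(1-d), G =
    sum of g^(2-d), Q = sum of p^(2-d) and V the total mass, where m is rounded to a dyadic value.
    The choice of e makes the contribution of G to X at most X / 2 + A Y / 2, hence X <= 2 V + A Y;
    the smallness of ze and 1 - th relative to A then lets c Y absorb what X contributes to it. *)
Lemma lewis_arith c K A e ze th X Y Z G V Q : 0 < c -> 1 <= K -> A = (64 * K) ^+ 2 -> e = (64 * K)^-1 -> 0 < ze -> 0 <= V ->
  0 <= Y -> 3 * K * ze * A <= c / 4 -> 2 * K ^+ 2 * (1 - th) * A <= c / 4 -> 0 <= 1 - th -> 0 <= X -> 0 <= Q ->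
  c * Y <= 3 * K * Z + 2 * K ^+ 2 * (1 - th) * X -> X <= V + 32 * K * G -> G <= e * X + e^-1 * Y ->
  Z <= ze * X + ze^-1 * Q -> G <= (6 + 12 * A * K * ze^-1 / c) * (Q + V).
Proof.
move=> c0 K1 AE eE z0 V0 Y0 h1 h2 t0 X0 Q0 hY hX hG hZ.
have K0 : 0 < K by exact: lt_le_trans K1.
have A0 : 0 < A by rewrite AE exprn_gt0// mulr_gt0.
have e32 : 32 * K * e = 1 / 2 by rewrite eE; field; rewrite gt_eqF.
have eV : 32 * K * e^-1 = A / 2 by rewrite eE invrK AE; field.
have X2 : X <= 2 * V + A * Y.
  have k32 : 0 <= 32 * K by rewrite mulr_ge0// ltW.
  have := ler_wpM2l k32 hG; rewrite mulrDr !mulrA e32 eV; lra.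
pose al := 3 * K * ze + 2 * K ^+ 2 * (1 - th).
have al0 : 0 <= al by rewrite addr_ge0 ?mulr_ge0 ?exprn_ge0 ?(ltW K0) ?(ltW z0).
have alA : al * A <= c / 2 by rewrite /al mulrDl; lra.
have alc : al <= c / 2 / A by rewrite ler_pdivlMr.
have hY2 : c * Y <= al * X + 3 * K * ze^-1 * Q.
  have k3 : 0 <= 3 * K by rewrite mulr_ge0// ltW.
  by have := ler_wpM2l k3 hZ; rewrite /al mulrDr mulrDl !mulrA; lra.
have Y2 : A * Y <= 2 * V + 6 * A * K * ze^-1 / c * Q.
  have r1 : al * X <= al * (2 * V + A * Y) by exact: ler_wpM2l.
  have r2 : al * A * Y <= c / 2 * Y by exact: ler_wpM2r.
  have r3 : al * V <= c / 2 / A * V by exact: ler_wpM2r.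
  have r4 : c / 2 * Y <= c / A * V + 3 * K * ze^-1 * Q.
    have -> : c / A * V = 2 * (c / 2 / A * V) by field; rewrite gt_eqF.
    by move: r1 r2 r3 hY2; rewrite mulrDr mulrA; lra.
  have k5 : 0 <= 2 * A / c by rewrite divr_ge0 ?mulr_ge0 ?(ltW A0)// ltW.
  have := ler_wpM2l k5 r4; rewrite (_ : 2 * A / c * (c / 2 * Y) = A * Y); last by field; rewrite gt_eqF.
  rewrite (_ : 2 * A / c * _ = 2 * V + 6 * A * K * ze^-1 / c * Q)//.
  by field; rewrite !gt_eqF.
have G2 : G <= X + A * Y.
  apply: le_trans hG _; apply: lerD; first by rewrite ler_piMl// eE invf_le1 ?mulr_gt0//; lra.
  apply: ler_wpM2r => //; rewrite eE invrK AE.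
  have : 0 <= (K - 1) * K by rewrite mulr_ge0 ?subr_ge0// ltW.
  by lra.
apply: le_trans G2 _; apply: (@le_trans _ _ (6 * V + 12 * A * K * ze^-1 / c * Q)).
  rewrite (_ : 12 * A * K * ze^-1 / c * Q = 2 * (6 * A * K * ze^-1 / c * Q)); last by ring.
  by move: X2 Y2; move: (A * Y) (_ * Q) => *; lra.
have w : 0 <= 12 * A * K * ze^-1 / c by rewrite !mulr_ge0 ?invr_ge0 ?(ltW A0) ?(ltW K0) ?(ltW z0) ?(ltW c0).
set W := 12 * A * K * ze^-1 / c in w *; rewrite (_ : (6 + W) * (Q + V) = 6 * V + W * Q + (6 * Q + W * V)); last by ring.
by rewrite lerDl; apply: addr_ge0; apply: mulr_ge0 => //; exact: ler0n.
Qed.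

Lemma th_ge x : 1 - x <= 1 / 4 -> 3 / 2 <= 2 * x.
Proof. lra. Qed.

Lemma lewis_add a a' b x y z : a <= a' -> x <= y -> b <= z + 2 * x -> a + b <= a' + 2 * y + z.
Proof. lra. Qed.

Lemma ge_1B d : d <= 1 / 4 -> 0 <= 1 - d.
Proof. lra. Qed.

Lemma gt_2B d : d <= 1 / 4 -> 0 < 2 - d.
Proof. lra. Qed.

Section OneLewis.
Variables (K d : R) (n : nat) (mu g p m : 'I_n -> R).
Hypotheses (K1 : 1 <= K) (d0 : 0 < d) (d4 : d <= 1 / 4).
Hypotheses (mu0 : forall i, 0 <= mu i) (g0 : forall i, 0 <= g i) (p0 : forall i, 0 <= p i).
Implicit Types (i : 'I_n).

Local Notation th := (2 `^ (- d)).
Let K0 : 0 < K. Proof. exact: lt_le_trans K1. Qed.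
Let th0 : 0 < th. Proof. by rewrite powR_gt0. Qed.
Let th1 : th <= 1.
Proof. by rewrite -[leRHS](powRr0 2); apply: ler_powR; rewrite ?ler1n// oppr_le0 ltW. Qed.

(** The gain of the method: a small d makes the factor 1 - th small, and this factor multiplies the
    term that has to be absorbed. It follows from exp y >= 1 + y and ln 2 <= 1. *)
Lemma thd : 1 - th <= d.
Proof.
rewrite lerBlDl -lerBlDr; have := expR_ge1Dx (- d * ln 2).
have : ln 2 <= (1 : R) by have := @le_ln1Dx R 1; rewrite (_ : 1 + 1 = 2)//; apply; lra.
rewrite /powR pnatr_eq0/= => l2; apply: le_trans; rewrite mulNr lerD2l lerN2.
by rewrite ler_piMr// ltW.
Qed.

Let thk k : 0 <= th ^+ k. Proof. by rewrite exprn_ge0// ltW. Qed.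

(** Levels start at 2^0, so every x <= 1 has level 0. This cutoff is what brings the total mass into
    [lewis1]; a scaling removes it in [lewis]. *)
Lemma level (x : R) : exists j : nat, forall k : nat, (2 ^+ k < x) = (k < j)%N.
Proof.
have ex : exists j : nat, x <= 2 ^+ j.
  exists (Num.truncn x).+1; apply: ltW; apply: lt_trans (truncnS_gt x) _.
  by rewrite -natrX ltr_nat ltn_expl.
exists (ex_minn ex) => k; rewrite ltNge [RHS]ltnNge; congr negb; case: ex_minnP => j h0 hmin.
by apply/idP/idP => [/hmin//|h]; apply: le_trans h0 _; rewrite ler_weXn2l// ler1n.
Qed.

Variables (ki : 'I_n -> nat) (N : nat).
Hypotheses (kiN : forall i (k : nat), (2 ^+ k < m i) = (k < ki i)%N) (kN : forall i, (ki i <= N)%N).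

(** The inequality at level 2^k is multiplied by (1 - th) th^k and summed. The good sets give the
    weight m^-d; the bad sets give (1 - th) times a geometric sum of (2 th)^k, dominated by its last
    term, so that the small factor 1 - th survives in front of the sum of m^(2-d). *)
Lemma lewis_Y c : (forall i, g i <= K * m i) ->
  (forall t, 0 < t -> c * \sum_i mu i * g i ^+ 2 * (m i <= t)%R%:R <=
     \sum_i mu i * (p i * g i) * (m i <= t)%R%:R + K * (t * \sum_i mu i * (g i + p i) * (t < m i)%R%:R)) ->
  c * \sum_i mu i * (g i ^+ 2 * th ^+ ki i) <=
  3 * K * \sum_i mu i * (p i * (2 * th) ^+ ki i) + 2 * K ^+ 2 * (1 - th) * \sum_i mu i * (4 * th) ^+ ki i.
Proof.
move=> gm H2.
have kiP i (k : nat) : (m i <= 2 ^+ k) = (ki i <= k)%N by rewrite leNgt kiN -leqNgt.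
have g2k i : g i <= K * 2 ^+ ki i by apply: le_trans (gm i) _; rewrite ler_pM2l// kiP.
have w0 k : 0 <= (1 - th) * th ^+ k by rewrite mulr_ge0 ?subr_ge0.
pose a k i : R := (ki i <= k)%N%:R; pose b k i : R := (k < ki i)%N%:R.
have h k : c * \sum_i mu i * g i ^+ 2 * a k i <=
   \sum_i mu i * (p i * g i) * a k i + K * (2 ^+ k * \sum_i mu i * (g i + p i) * b k i).
  have := H2 (2 ^+ k) (exprn_gt0 _ (ltr0n _ 2)); rewrite /a /b.
  rewrite (eq_bigr _ (fun i _ => congr1 (fun q : bool => mu i * g i ^+ 2 * q%:R) (kiP i k))).
  rewrite (eq_bigr _ (fun i _ => congr1 (fun q : bool => mu i * (p i * g i) * q%:R) (kiP i k))).
  by rewrite (eq_bigr _ (fun i _ => congr1 (fun q : bool => mu i * (g i + p i) * q%:R) (kiN i k))).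
have W (F : 'I_n -> R) : \sum_(k < N) (1 - th) * th ^+ k * \sum_i F i * a k i + th ^+ N * \sum_i F i * a N i =
    \sum_i F i * th ^+ ki i.
  under eq_bigr do rewrite mulr_sumr; rewrite exchange_big mulr_sumr -big_split/=; apply: eq_bigr => i _.
  rewrite -(abelA th (kN i)) mulrDr mulr_sumr /a kN mulr1 [th ^+ N * _]mulrC; congr (_ + _).
  by apply: eq_bigr => k _; ring.
have W2 (F : 'I_n -> R) : \sum_(k < N) (1 - th) * th ^+ k * (2 ^+ k * \sum_i F i * b k i) + th ^+ N * (2 ^+ N * \sum_i F i * b N i) =
    \sum_i F i * ((1 - th) * \sum_(k < ki i) (2 * th) ^+ k).
  rewrite [X in _ + _ * (_ * X)]big1 ?mulr0 ?addr0 => [|i _]; last by rewrite /b ltnNge kN mulr0.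
  under eq_bigr do rewrite !mulr_sumr; rewrite exchange_big/=; apply: eq_bigr => i _.
  rewrite -(sum_lt _ (kN i)) !mulr_sumr; apply: eq_bigr => k _; rewrite exprMn /b; ring.
have s1 : c * \sum_i mu i * g i ^+ 2 * th ^+ ki i <= \sum_i mu i * (p i * g i) * th ^+ ki i +
    K * \sum_i mu i * (g i + p i) * ((1 - th) * \sum_(k < ki i) (2 * th) ^+ k).
  rewrite -!W -W2 mulrDr [K * (_ + _)]mulrDr addrACA; apply: lerD.
    by rewrite !mulr_sumr -big_split/=; apply: ler_sum => k _; have := ler_wpM2l (w0 k) (h k); rewrite mulrDr [_ * (c * _)]mulrCA [_ * (K * _)]mulrCA.
  by have := ler_wpM2l (thk N) (h N); rewrite mulrDr [_ * (c * _)]mulrCA [_ * (K * _)]mulrCA.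
rewrite (eq_bigr _ (fun i _ => mulrA (mu i) _ _)); apply: le_trans s1 _.
rewrite !mulr_sumr -!big_split/=; apply: ler_sum => i _.
have x32 : 3 / 2 <= 2 * th by exact: th_ge (le_trans thd d4).
have S := geo_le (ki i) x32; have T := g2k i.
have S0 : 0 <= \sum_(k < ki i) (2 * th) ^+ k by apply: sumr_ge0 => k _; rewrite exprn_ge0// mulr_ge0// ltW.
have e2 : (2 * th) ^+ ki i = 2 ^+ ki i * th ^+ ki i by rewrite exprMn.
have e4 : (4 * th) ^+ ki i = 2 ^+ ki i * (2 ^+ ki i * th ^+ ki i).
  by rewrite -!exprMn; congr (_ ^+ _); ring.
rewrite e4; rewrite e2 in S *; have u0 := thk (ki i); have t0 := exprn_ge0 (ki i) (ler0n R 2).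
move: S S0 T u0 t0 (mu0 i) (g0 i) (p0 i).
move: (\sum_(_ < _) _) (2 ^+ _) (th ^+ _) (mu i) (g i) (p i) => s t u m' g' p' S S0 T u0 t0 m0 g0' p0'.
have h1 : m' * (p' * g') * u <= m' * (p' * (K * t)) * u.
  by apply: ler_wpM2r => //; apply: ler_wpM2l => //; apply: ler_wpM2l.
have t1 : 0 <= 1 - th by rewrite subr_ge0.
have h2 : m' * (g' + p') * ((1 - th) * s) <= m' * (K * t + p') * ((1 - th) * (2 * (t * u))).
  have A : m' * (g' + p') <= m' * (K * t + p') by apply: ler_wpM2l => //; rewrite lerD2r.
  have B : (1 - th) * s <= (1 - th) * (2 * (t * u)) by apply: ler_wpM2l.
  by apply: ler_pM => //; apply: mulr_ge0 => //; exact: addr_ge0.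
have h3 : (1 - th) * (m' * p' * (t * u)) <= 1 * (m' * p' * (t * u)).
  by apply: ler_wpM2r; [rewrite !mulr_ge0|have := th0; lra].
have := ler_wpM2l (ltW K0) h2; have := ler_wpM2l (ltW K0) h3.
have -> : K * (m' * (K * t + p') * ((1 - th) * (2 * (t * u)))) =
  2 * K ^+ 2 * (1 - th) * (m' * (t * (t * u))) + 2 * (K * ((1 - th) * (m' * p' * (t * u)))) by ring.
have -> : 3 * K * (m' * (p' * (t * u))) = m' * (p' * (K * t)) * u + 2 * (K * (1 * (m' * p' * (t * u)))) by ring.
move=> q1 q2; exact: lewis_add h1 q1 q2.
Qed.

(** From weak type to strong type by a dyadic layer cake formula: on the right only levels below 2 g
    contribute, and their geometric sum is at most 8 g^(1-d). The mass term comes from level 0. *)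
Lemma lewis_X : (forall t, 0 < t -> t * \sum_i mu i * (t < m i)%R%:R <= K * \sum_i mu i * g i * (t < 2 * g i)%R%:R) ->
  \sum_i mu i * (4 * th) ^+ ki i <= \sum_i mu i + 32 * K * \sum_i mu i * g i `^ (2 - d).
Proof.
move=> H3; have /choice[ji hj] i := level (2 * g i).
pose N' := maxn N (\max_i ji i); have kN' i : (ki i <= N')%N by rewrite leq_max kN.
have jN' i : (ji i <= N')%N by rewrite leq_max leq_bigmax orbT.
have x32 : 3 / 2 <= 2 * th by exact: th_ge (le_trans thd d4).
have t4 : 0 <= 4 * th by rewrite mulr_ge0// ltW.
have t2 : 0 <= 2 * th by rewrite mulr_ge0// ltW.
have step1 i : mu i * (4 * th) ^+ ki i <= mu i + 4 * \sum_(k < N') (2 * th) ^+ k * (2 ^+ k * (mu i * (k < ki i)%N%:R)).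
  rewrite geo_tele mulrDr mulr1 lerD2l mulr_sumr -(sum_lt (fun k => mu i * ((4 * th - 1) * (4 * th) ^+ k)) (kN' i)) mulr_sumr; apply: ler_sum => k _.
  have -> : 4 * ((2 * th) ^+ k * (2 ^+ k * (mu i * (k < ki i)%N%:R))) = mu i * (4 * (4 * th) ^+ k) * (k < ki i)%N%:R.
    by rewrite (_ : 4 * th = 2 * (2 * th)) ?exprMn; ring.
  apply: ler_wpM2r => //; apply: ler_wpM2l => //; apply: ler_wpM2r; first exact: exprn_ge0.
  by have := th1; lra.
have step2 i : \sum_(k < N') (2 * th) ^+ k * (k < ji i)%N%:R <= 8 * g i `^ (1 - d).
  rewrite (sum_lt _ (jN' i)); case E : (ji i) => [|j]; first by rewrite big_ord0 mulr_ge0// powR_ge0.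
  have : 2 ^+ j < 2 * g i by rewrite hj E.
  move=> lt; apply: le_trans (geo_le _ x32) _; have [_ <- _] := two_pow d j.+1.
  rewrite -[8](_ : 2 * 4 = 8 :> R); last by ring.
  rewrite -mulrA ler_pM2l//; apply: (@le_trans _ _ ((4 * g i) `^ (1 - d))).
    apply: ge0_ler_powR; rewrite ?nnegrE ?exprn_ge0 ?mulr_ge0 ?ge_1B//.
    by rewrite exprS (_ : 4 * g i = 2 * (2 * g i)) ?ler_pM2l ?(ltW lt)//; ring.
  rewrite powRM//; apply: ler_wpM2r; first exact: powR_ge0.
  by rewrite -[leRHS](powRr1 (ler0n R 4)); apply: ler_powR; rewrite ?ler1n// lerBlDr lerDl ltW.
apply: le_trans (ler_sum _ (fun i _ => step1 i)) _; rewrite big_split/= lerD2l -mulr_sumr.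
rewrite exchange_big/=; under eq_bigr do rewrite -mulr_sumr -mulr_sumr.
rewrite (_ : 32 * K * _ = 4 * (K * (8 * \sum_i mu i * g i `^ (2 - d)))); last by ring.
rewrite ler_pM2l//; apply: (@le_trans _ _ (\sum_(k < N') (2 * th) ^+ k * (K * \sum_i mu i * g i * (k < ji i)%N%:R))).
  apply: ler_sum => k _; apply: ler_wpM2l; first exact: exprn_ge0.
  have := H3 (2 ^+ k) (exprn_gt0 _ (ltr0n _ 2)).
  rewrite (eq_bigr _ (fun i _ => congr1 (fun q : bool => mu i * q%:R) (kiN i k))).
  by rewrite (eq_bigr _ (fun i _ => congr1 (fun q : bool => mu i * g i * q%:R) (hj i k))).
under eq_bigr do rewrite mulrCA; rewrite -mulr_sumr ler_pM2l//.
under eq_bigr do rewrite mulr_sumr; rewrite exchange_big/= mulr_sumr; apply: ler_sum => i _.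
rewrite (eq_bigr (fun k : 'I_N' => mu i * g i * ((2 * th) ^+ k * (k < ji i)%N%:R))); last by move=> k _; ring.
rewrite -mulr_sumr; apply: le_trans (ler_wpM2l _ (step2 i)) _; first exact: mulr_ge0.
have := @mulr_powRB1 R (g i) (2 - d) (g0 i) (gt_2B d4); rewrite (_ : 2 - d - 1 = 1 - d); last by ring.
by move=> <-; apply: eqle; ring.
Qed.

End OneLewis.

(* The dyadic levels of the maximal function replace the integral over all levels in Lewis' argument;
   th = 2^-d, so that m^(2-d) is (4 th)^k for m = 2^k. *)
Lemma lewis1 c K : 0 < c -> 1 <= K -> exists d C, [/\ 0 < d <= 1 / 4, 0 < C &
  forall n (mu g p m : 'I_n -> R), (forall i, 0 <= mu i) -> (forall i, 0 <= g i) -> (forall i, 0 <= p i) ->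
  (forall i, g i <= K * m i) ->
  (forall t, 0 < t -> c * \sum_i mu i * g i ^+ 2 * (m i <= t)%R%:R <=
     \sum_i mu i * (p i * g i) * (m i <= t)%R%:R + K * (t * \sum_i mu i * (g i + p i) * (t < m i)%R%:R)) ->
  (forall t, 0 < t -> t * \sum_i mu i * (t < m i)%R%:R <= K * \sum_i mu i * g i * (t < 2 * g i)%R%:R) ->
  \sum_i mu i * g i `^ (2 - d) <= C * (\sum_i mu i * p i `^ (2 - d) + \sum_i mu i)].
Proof.
move=> c0 K1; have K0 : 0 < K by exact: lt_le_trans K1.
pose A := (64 * K) ^+ 2; have A0 : 0 < A by rewrite exprn_gt0// mulr_gt0.
(* ze here and d below are chosen so that each of the two terms to be absorbed costs at most c /
   4. *)
pose ze := Num.min 1 (c / (12 * K * A)).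
have ze0 : 0 < ze by rewrite lt_min ltr01/= divr_gt0// !mulr_gt0.
have ze1 : ze <= 1 by rewrite ge_min lexx.
have zeA : 3 * K * ze * A <= c / 4.
  have : ze <= c / (12 * K * A) by rewrite ge_min lexx orbT.
  rewrite ler_pdivlMr ?mulr_gt0//; lra.
pose d := Num.min (1 / 4) (c / (8 * K ^+ 2 * A)).
have d0 : 0 < d by rewrite lt_min !divr_gt0// !mulr_gt0// exprn_gt0.
have d4 : d <= 1 / 4 by rewrite ge_min lexx.
have thA : 2 * K ^+ 2 * (1 - 2 `^ (- d)) * A <= c / 4.
  have : d <= c / (8 * K ^+ 2 * A) by rewrite ge_min lexx orbT.
  have q0 : 0 < 8 * K ^+ 2 * A by rewrite !mulr_gt0// exprn_gt0.
  rewrite ler_pdivlMr// => h; have := thd d0; rewrite -(ler_pM2r q0); lra.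
have w : 0 < 12 * A * K * ze^-1 / c by rewrite !mulr_gt0 ?invr_gt0.
exists d, (6 + 12 * A * K * ze^-1 / c); split; [by rewrite d0|by rewrite addr_gt0|].
move=> n mu g p m mu0 g0 p0 gm H2 H3; have /choice[ki kiN] i := level (m i).
pose N := \max_i ki i; have kN i : (ki i <= N)%N by exact: leq_bigmax.
have th0 k : 0 <= (2 `^ (- d)) ^+ k by rewrite exprn_ge0 ?powR_ge0.
have hY := lewis_Y K1 d0 d4 mu0 g0 p0 kiN kN gm H2; have hX := lewis_X K1 d0 d4 mu0 g0 kiN kN H3.
apply: (lewis_arith c0 K1 (A := A) erefl erefl ze0 _ _ zeA thA _ _ _ hY hX).
- exact: sumr_ge0.
- by apply: sumr_ge0 => i _; rewrite mulr_ge0// mulr_ge0 ?sqr_ge0.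
- by rewrite subr_ge0 -[leRHS](powRr0 2); apply: ler_powR; rewrite ?ler1n// oppr_le0 ltW.
- by apply: sumr_ge0 => i _; rewrite mulr_ge0// exprn_ge0// mulr_ge0 ?powR_ge0.
- by apply: sumr_ge0 => i _; rewrite mulr_ge0 ?powR_ge0.
- rewrite !mulr_sumr -big_split/=; apply: ler_sum => i _.
  have [E1 _ E3] := two_pow d (ki i); have d01 : 0 < d <= 1 by rewrite d0; lra.
  have he : 0 < (64 * K)^-1 <= 1 by rewrite invr_gt0 mulr_gt0//= invf_le1 ?mulr_gt0//; lra.
  have := ler_wpM2l (mu0 i) (split_pow d01 (g0 i) (exprn_gt0 (ki i) (ltr0n R 2)) he).
  by rewrite E1 E3; move/le_trans; apply; apply: eqle; ring.
rewrite !mulr_sumr -big_split/=; apply: ler_sum => i _.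
have [_ E2 E3] := two_pow d (ki i); have d01 : 0 < d < 1 by rewrite d0; lra.
have he : 0 < ze <= 1 by rewrite ze0.
have := ler_wpM2l (mu0 i) (split_young d01 (p0 i) (exprn_gt0 (ki i) (ltr0n R 2)) he).
by rewrite E2 E3; move/le_trans; apply; apply: eqle; ring.
Qed.

(** The hypotheses are invariant when g, p and m are divided by the same s > 0, while both power
    sums are multiplied by s^-(2-d) and the total mass is unchanged. Letting s tend to 0 removes the
    mass from [lewis1]. *)
Lemma lewis c K : 0 < c -> 1 <= K -> exists d C, [/\ 0 < d <= 1 / 4, 0 < C &
  forall n (mu g p m : 'I_n -> R), (forall i, 0 <= mu i) -> (forall i, 0 <= g i) -> (forall i, 0 <= p i) ->
  (forall i, g i <= K * m i) ->
  (forall t, 0 < t -> c * \sum_i mu i * g i ^+ 2 * (m i <= t)%R%:R <=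
     \sum_i mu i * (p i * g i) * (m i <= t)%R%:R + K * (t * \sum_i mu i * (g i + p i) * (t < m i)%R%:R)) ->
  (forall t, 0 < t -> t * \sum_i mu i * (t < m i)%R%:R <= K * \sum_i mu i * g i * (t < 2 * g i)%R%:R) ->
  \sum_i mu i * g i `^ (2 - d) <= C * \sum_i mu i * p i `^ (2 - d)].
Proof.
move=> c0 K1; have [d [C [dd C0 L]]] := lewis1 c0 K1; exists d, C; split=> //.
move=> n mu g p m mu0 g0 p0 gm H2 H3; have d1 : 0 <= 2 - d - 1 by case/andP: dd => _; lra.
rewrite -subr_le0; apply: (@le_lim _ _ (C * \sum_i mu i)) => e e0.
pose s := Num.min 1 e; have s0 : 0 < s by rewrite lt_min ltr01.
have s1 : s <= 1 by rewrite ge_min lexx.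
have V0 : 0 <= \sum_i mu i by exact: sumr_ge0.
have sV : 0 <= s^-1 by rewrite invr_ge0 ltW.
have sn : s != 0 by rewrite gt_eqF.
have lt (a t : R) : (t < s^-1 * a) = (s * t < a) by rewrite mulrC ltr_pdivlMr// mulrC.
have le (a t : R) : (s^-1 * a <= t) = (a <= s * t) by rewrite mulrC ler_pdivrMr// mulrC.
have sP (a : R) : 0 <= a -> (s^-1 * a) `^ (2 - d) = s `^ (- (2 - d)) * a `^ (2 - d).
  by move=> a0; rewrite powRM// -powR_inv1 ?(ltW s0)// -powRrM mulN1r.
have E (F : 'I_n -> R) : (forall i, 0 <= F i) ->
    \sum_i mu i * (s^-1 * F i) `^ (2 - d) = s `^ (- (2 - d)) * \sum_i mu i * F i `^ (2 - d).
  by move=> F0; rewrite mulr_sumr; apply: eq_bigr => i _; rewrite sP// mulrCA.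
have H1' i : s^-1 * g i <= K * (s^-1 * m i) by rewrite mulrCA ler_wpM2l.
have H2' t : 0 < t -> c * \sum_i mu i * (s^-1 * g i) ^+ 2 * (s^-1 * m i <= t)%R%:R <=
    \sum_i mu i * (s^-1 * p i * (s^-1 * g i)) * (s^-1 * m i <= t)%R%:R + K * (t * \sum_i mu i * (s^-1 * g i + s^-1 * p i) * (t < s^-1 * m i)%R%:R).
  move=> t0; have := ler_wpM2l (sqr_ge0 s^-1) (H2 (s * t) (mulr_gt0 s0 t0)).
  have -> : \sum_i mu i * (s^-1 * g i) ^+ 2 * (s^-1 * m i <= t)%R%:R = s^-1 ^+ 2 * \sum_i mu i * g i ^+ 2 * (m i <= s * t)%R%:R.
    by rewrite mulr_sumr; apply: eq_bigr => i _; rewrite le; ring.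
  have -> : \sum_i mu i * (s^-1 * p i * (s^-1 * g i)) * (s^-1 * m i <= t)%R%:R = s^-1 ^+ 2 * \sum_i mu i * (p i * g i) * (m i <= s * t)%R%:R.
    by rewrite mulr_sumr; apply: eq_bigr => i _; rewrite le; ring.
  have -> : \sum_i mu i * (s^-1 * g i + s^-1 * p i) * (t < s^-1 * m i)%R%:R = s^-1 * \sum_i mu i * (g i + p i) * (s * t < m i)%R%:R.
    by rewrite mulr_sumr; apply: eq_bigr => i _; rewrite lt; ring.
  move: (\sum_(_ < _) _) (\sum_(_ < _) _) (\sum_(_ < _) _) => a b a'; apply: etrans.
  by congr (_ <= _); [ring|field].
have H3' t : 0 < t -> t * \sum_i mu i * (t < s^-1 * m i)%R%:R <= K * \sum_i mu i * (s^-1 * g i) * (t < 2 * (s^-1 * g i))%R%:R.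
  move=> t0; have := ler_wpM2l sV (H3 (s * t) (mulr_gt0 s0 t0)).
  have -> : \sum_i mu i * (t < s^-1 * m i)%R%:R = \sum_i mu i * (s * t < m i)%R%:R.
    by apply: eq_bigr => i _; rewrite lt.
  have -> : \sum_i mu i * (s^-1 * g i) * (t < 2 * (s^-1 * g i))%R%:R = s^-1 * \sum_i mu i * g i * (s * t < 2 * g i)%R%:R.
    by rewrite mulr_sumr; apply: eq_bigr => i _; rewrite [2 * _]mulrCA lt; ring.
  move: (\sum_(_ < _) _) (\sum_(_ < _) _) => a b; apply: etrans.
  by congr (_ <= _); [field|ring].
have := L n mu _ _ _ mu0 (fun i => mulr_ge0 sV (g0 i)) (fun i => mulr_ge0 sV (p0 i)) H1' H2' H3'.
have q0 : 0 < s `^ (2 - d) by rewrite powR_gt0.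
have qe : s `^ (2 - d) <= e.
  apply: (@le_trans _ _ s); last by rewrite ge_min lexx orbT.
  rewrite -[leRHS]powRr1 ?(ltW s0)//; apply: ger_powR; first by rewrite s0.
  by rewrite -subr_ge0.
rewrite !E// powRN => h; have := ler_wpM2l (ltW q0) h.
rewrite mulrA mulfV ?gt_eqF// mul1r.
set a := \sum_i mu i * g i `^ _; set b := \sum_i mu i * p i `^ _.
rewrite mulrCA mulrDr mulrA mulfV ?gt_eqF// mul1r mulrDr lerBlDl => /le_trans; apply.
by rewrite lerD2l -mulrA ler_pM2l// mulrC; apply: ler_wpM2l.
Qed.

End Lewis.

(** * Uniform boundedness by a gliding hump *)

Section UniformBoundedness.
Variable R : realType.
Implicit Types (s t : R).

Lemma hump_size (T n a q : R) : 0 < n -> 0 <= q -> 3 / 4 * T * n <= `|a| -> 3 / 4 * T * q <= `|q / n * a|.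
Proof.
move=> n0 q0 h; have r0 : 0 <= q / n by rewrite divr_ge0// ltW.
rewrite normrM (ger0_norm r0); have := ler_wpM2l r0 h; apply: le_trans; apply: eqle; field.
by rewrite gt_eqF.
Qed.

Lemma hump_sign (a b r : R) : r <= `|a| -> `|a + b| < r -> r <= `|- a + b|.
Proof.
move=> h1 h2; have : `|a + a| <= `|a + b| + `|- a + b|.
  by rewrite (_ : a + a = (a + b) - (- a + b)) ?ler_normB//; ring.
by rewrite -mulr2n normrMn; move: (`|a + b|) h2 (`|- a + b|) (`|a|) h1 => *; lra.
Qed.

Lemma hump_end (T a b q r : R) : r <= T * q -> 3 / 4 * T * q <= `|a| -> `|-1 * a + b| <= T * (2 * (4^-1 * q)) -> r / 4 <= `|b|.
Proof.
move=> h1 h2 h3; have : `|a| <= `|b| + `|-1 * a + b| by have {1}-> : a = b - (-1 * a + b); [ring|exact: ler_normB].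
have e1 : 3 / 4 * T * q = 3 / 4 * (T * q) by ring.
have e2 : T * (2 * (4^-1 * q)) = (T * q) / 2 by field.
rewrite e1 in h2; rewrite e2 in h3.
move: h2 h3; clear e1 e2; move: (`|-1 * a + b|) (`|a|) (`|b|) (T * q) h1 => x y z t; lra.
Qed.

Section Abstract.
Variables (X I : Type) (S : X -> Prop) (J : I -> Prop) (N : X -> R) (ax : R -> X -> X -> X) (o : X) (L : I -> X -> R).
Hypotheses (So : S o) (Sax : forall s x y, S x -> S y -> S (ax s x y)).
Hypothesis Lax : forall i s x y, J i -> S x -> S y -> L i (ax s x y) = s * L i x + L i y.
Hypotheses (N0 : forall x, 0 <= N x) (Nax : forall s x z, S x -> S z -> N (ax (-1) z (ax s x z)) = `|s| * N x).
Hypothesis Lb : forall i, J i -> exists M, forall x, S x -> `|L i x| <= M * N x.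
Hypothesis cpl : forall x : nat -> X, (forall n, S (x n)) -> (forall n, N (ax (-1) (x n) (x n.+1)) <= 4^-1 ^+ n) ->
  exists2 y, S y & forall n, N (ax (-1) (x n) y) <= 2 * 4^-1 ^+ n.
Hypothesis pw : forall y, S y -> exists C, forall i, J i -> `|L i y| <= C.

(** T is the least admissible constant. If no vector reached 3/4 of it, then 3/4 T would be
    admissible as well. *)
Lemma opnorm i : J i -> exists T, [/\ 0 <= T, forall x, S x -> `|L i x| <= T * N x &
  0 < T -> exists x, [/\ S x, 0 < N x & 3 / 4 * T * N x <= `|L i x|]].
Proof.
move=> Ji; pose E := [set M : R | 0 <= M /\ forall x, S x -> `|L i x| <= M * N x].
have En : E !=set0.
  have [M hM] := Lb Ji; exists `|M|; split=> // x Sx; apply: le_trans (hM x Sx) _.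
  by apply: ler_wpM2r => //; exact: ler_norm.
have lb0 : lbound E 0 by move=> M [].
have hi : has_inf E by split=> //; exists 0.
have bd x : S x -> `|L i x| <= inf E * N x.
  move=> Sx; have [n0|n0] := eqVneq (N x) 0.
    by have [M [_ /(_ x Sx)]] := En; rewrite n0 !mulr0.
  have np : 0 < N x by rewrite lt_neqAle eq_sym n0 N0.
  by rewrite -ler_pdivrMr//; apply: lb_le_inf => // M [_ /(_ x Sx)]; rewrite ler_pdivrMr.
exists (inf E); split=> //; first exact: lb_le_inf.
move=> T0; apply: contrapT => no.
have : E (3 / 4 * inf E).
  split=> [|x Sx]; first by rewrite mulr_ge0// ltW.
  rewrite leNgt; apply/negP => lt; apply: no; exists x; split=> //; last exact: ltW.
  rewrite lt_neqAle N0 andbT eq_sym; apply/eqP => n0.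
  by have := bd x Sx; rewrite n0 !mulr0 in lt *; rewrite leNgt lt.
by move/(ge_inf hi.2); move: T0; move: (inf E) => t; lra.
Qed.

(** Only the combination [ax s x y], read as s x + y, is assumed, because the space will consist of
    triples of data, solution and gradient. If the bound fails there are functionals of norm T >=
    16^n. The n-th step of the series has size 4^-n and makes the n-th functional at least 3/4 T
    4^-n; the later steps change it by at most half of T 4^-n. So its value at the limit is at least
    4^n / 4, against pointwise boundedness. *)
Lemma unif_bound : exists C, forall i x, J i -> S x -> `|L i x| <= C * N x.
Proof.
apply: contrapT => no.
have pick (n : nat) : exists o : I * R * X, [/\ J o.1.1, S o.2, (16 : R) ^+ n <= o.1.2, 0 < N o.2 &
    (forall x, S x -> `|L o.1.1 x| <= o.1.2 * N x) /\ 3 / 4 * o.1.2 * N o.2 <= `|L o.1.1 o.2|].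
  apply: contrapT => nx; apply: no; exists (16 ^+ n) => i x Ji Sx; rewrite leNgt; apply/negP => lt.
  have [T [T0 h1 h2]] := opnorm Ji; have Tn : 16 ^+ n <= T.
    rewrite leNgt; apply/negP => Tl; move: lt; rewrite ltNge; apply/negP/negPn.
    by apply: le_trans (h1 x Sx) _; apply: ler_wpM2r => //; exact: ltW.
  have Tp : 0 < T by apply: lt_le_trans Tn; rewrite exprn_gt0.
  by have [y [y1 y2 y3]] := h2 Tp; apply: nx; exists (i, T, y).
have [w hw] := choice pick.
pose st n : R := 4^-1 ^+ n / N (w n).2.
(* One of the two signs gives a value at z plus the hump at least as large as at the hump alone: if
   both values were smaller, so would be half their difference. *)
pose sg n (z : X) : R := if `|L (w n).1.1 (ax (st n) (w n).2 z)| < 3 / 4 * (w n).1.2 * 4^-1 ^+ n then - st n else st n.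
pose xs := fix xs n := if n is n'.+1 then ax (sg n' (xs n')) (w n').2 (xs n') else o.
have Sx n : S (xs n) by elim: n => //= n IH; apply: Sax => //; have [] := hw n.
have big n : 3 / 4 * (w n).1.2 * 4^-1 ^+ n <= `|L (w n).1.1 (xs n.+1)|.
  rewrite /= /sg; case: ifPn => [lt|]; last by rewrite -leNgt.
  have [Jw Sw _ Nw [_ hL]] := hw n.
  rewrite !(Lax _ Jw Sw (Sx n)) in lt *.
  have e := hump_size Nw (exprn_ge0 n (ltac:(by rewrite invr_ge0) : 0 <= 4^-1)) hL.
  by rewrite mulNr; exact: hump_sign e lt.
have step n : N (ax (-1) (xs n) (xs n.+1)) <= 4^-1 ^+ n.
  have [_ Sw _ Nw _] := hw n; rewrite /= Nax//.
  have -> : `|sg n (xs n)| = st n.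
    by rewrite /sg; case: ifP => _; rewrite ?normrN ger0_norm// divr_ge0 ?exprn_ge0 ?invr_ge0.
  by rewrite /st divfK// gt_eqF.
have [y Sy hy] := cpl Sx step; have [C hC] := pw Sy.
have lo n : 4 ^+ n / 4 <= C.
  have [Jw Sw Tw Nw [hT _]] := hw n; apply: le_trans (hC _ Jw).
  have := hT _ (Sax (-1) (Sx n.+1) Sy); rewrite Lax// => h1.
  have T0 : 0 <= (w n).1.2 by apply: le_trans Tw; rewrite exprn_ge0.
  have := le_trans h1 (ler_wpM2l T0 (hy n.+1)); rewrite exprS => h2.
  have e4 : (4 : R) ^+ n = 16 ^+ n * 4^-1 ^+ n by rewrite -exprMn; congr (_ ^+ _); field.
  apply: hump_end (big n) h2; rewrite e4; apply: ler_wpM2r => //.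
have := lo (Num.truncn (4 * C)).+1; rewrite ler_pdivrMr// [C * 4]mulrC leNgt => /negP; apply.
apply: lt_trans (truncnS_gt _) _; rewrite -natrX ltr_nat; exact: ltn_expl.
Qed.

End Abstract.

End UniformBoundedness.

Section Plane.
Variable R : realType.
Notation P := (plane R).
Notation leb := (@lebesgue_measure R).
Notation leb2 := (leb2 R).
Notation itgp := (itg leb2).
Notation itbp := (itb leb2).
Notation n2p := (n2 leb2).
Notation L2p := (L2 leb2).
Implicit Types (x y z : P) (r s t e C : R) (Om : set P) (f g u phi psi : P -> R) (G : 'I_2 -> P -> R).

(** * Lebesgue measure on the plane, boxes and affine changes of variables *)

Section PlaneMeasure.
Implicit Types (a : P) (c : R).

Lemma dist3 (a b c e r : R) : `|a - c| <= e -> `|b - c| < e -> e < r / 2 -> `|a - b| < r.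
Proof. by rewrite !ler_norml !ltr_norml => /andP[? ?] /andP[? ?] ?; apply/andP; split; lra. Qed.

Lemma nbhs_boxP (U : set P) x :
  nbhs x U <-> exists2 r : R, 0 < r & forall y, `|y.1 - x.1| < r -> `|y.2 - x.2| < r -> U y.
Proof.
split=> [/nbhs_ballP[r r0 h]|[r r0 h]].
  by exists r => // y h1 h2; apply: h; split; rewrite /ball/= distrC.
apply/nbhs_ballP; exists r => // y [h1 h2]; apply: h; rewrite distrC; [exact: h1|exact: h2].
Qed.

Lemma open_boxP (U : set P) : open U <-> forall x, U x ->
  exists2 r : R, 0 < r & forall y, `|y.1 - x.1| < r -> `|y.2 - x.2| < r -> U y.
Proof.
rewrite openE; split=> h x Ux; first by have /nbhs_boxP := h x Ux.
by apply/nbhs_boxP; exact: h.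
Qed.

Definition box x (r : R) : set P := [set y | `|y.1 - x.1| <= r /\ `|y.2 - x.2| <= r].

Lemma boxE x r : box x r = `[x.1 - r, x.1 + r]%classic `*` `[x.2 - r, x.2 + r]%classic.
Proof.
apply/seteqP; split=> y; rewrite /box /= !in_itv/= !ler_distl => -[h1 h2]; split=> //.
Qed.

Lemma box_meas x r : measurable (box x r).
Proof. by rewrite boxE; exact: measurableX. Qed.

Lemma leb2X (A B : set (measurableTypeR R)) : measurable A -> measurable B ->
  leb2 (A `*` B) = (leb A * leb B)%E.
Proof. by move=> mA mB; rewrite -product_measure1E. Qed.

Lemma leb2_box x r : 0 <= r -> leb2 (box x r) = ((2 * r) ^+ 2)%:E.
Proof.
move=> r0; rewrite boxE leb2X// !lebesgue_measure_itv/= !lte_fin.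
have [->|rn] := eqVneq r 0; first by rewrite subr0 addr0 ltxx mul0e mulr0 expr0n.
have rp : 0 < r by rewrite lt_neqAle eq_sym rn.
have lt (a : R) : a - r < a + r by lra.
by rewrite !lt -!EFinB -EFinM; congr EFin; ring.
Qed.

Lemma rat_box x r : 0 < r -> exists j : rat * rat * nat, [/\ `|x.1 - ratr j.1.1| < (j.2.+1%:R)^-1,
  `|x.2 - ratr j.1.2| < (j.2.+1%:R)^-1 & (j.2.+1%:R)^-1 < r / 2].
Proof.
move=> r0; have [n hn] : exists n : nat, (n.+1%:R)^-1 < r / 2.
  exists (Num.truncn (r / 2)^-1); rewrite -[ltRHS]invrK ltf_pV2 ?posrE ?invr_gt0 ?divr_gt0//.
  by rewrite truncnS_gt.
have n0 : 0 < (n.+1%:R : R)^-1 by rewrite invr_gt0.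
have near (a : R) : exists p : rat, `|a - ratr p| < (n.+1%:R)^-1.
  have [|p] := @rat_in_itvoo R (a - (n.+1%:R)^-1) (a + (n.+1%:R)^-1).
    by rewrite ltrBlDr -addrA ltrDl addr_gt0.
  by rewrite in_itv/= => hp; exists p; rewrite distrC ltr_distl.
by have [[p hp] [q hq]] := (near x.1, near x.2); exists ((p, q), n).
Qed.

Lemma open_meas (U : set P) : open U -> measurable U.
Proof.
move=> /open_boxP oU.
pose B (i : rat * rat * nat) := box (ratr i.1.1, ratr i.1.2) (i.2.+1%:R)^-1.
rewrite (_ : U = \bigcup_(i in [set i | B i `<=` U]) B i).
  rewrite bigcup_mkcond; apply: countable_bigcupT_measurable => // i.
  by case: ifP => // _; exact: box_meas.
apply/seteqP; split=> [x Ux|x [i h]]; last exact: h.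
have [r r0 h] := oU x Ux; have [[[p q] n] [/= hp hq hn]] := rat_box x r0.
exists ((p, q), n); last by split; apply: ltW.
by move=> y [/=h1 h2]; apply: h; [apply: dist3 h1 hp hn|apply: dist3 h2 hq hn].
Qed.

Lemma closed_meas (U : set P) : closed U -> measurable U.
Proof. by move=> /closed_openC/open_meas; rewrite -[X in _ -> _ X]setCK; exact: measurableC. Qed.

Lemma cont_meas (f : P -> R^o) : continuous f -> mfun (f : P -> R).
Proof.
move=> cf; apply: (measurability _ (RGenOpens.measurableE R)).
move=> _ [_ [a [b ->]] <-]; rewrite setTI; apply: open_meas.
by apply: open_comp => // x _; exact: cf.
Qed.

Lemma sfin_leb2 : sigma_finite setT leb2.
Proof.
exists (fun n => box 0 n%:R).
  apply/seteqP; split=> // x _; exists (Num.truncn (Num.max `|x.1| `|x.2|)).+1 => //.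
  split; rewrite subr0; apply: (@le_trans _ _ (Num.max `|x.1| `|x.2|));
    by rewrite ?le_max ?lexx ?orbT// ltW// truncnS_gt.
by move=> n; split; [exact: box_meas|rewrite leb2_box// ltry].
Qed.

(** A copy of [leb2] that carries sigma-finiteness, for Tonelli's theorem on pairs of points of the
    plane. *)
Definition sleb2 : set P -> \bar R := leb2.
HB.instance Definition _ := Measure.copy sleb2 leb2.
HB.instance Definition _ := @Measure_isSigmaFinite.Build _ P R sleb2 sfin_leb2.

Lemma tonelli12 (f : P -> \bar R) : mfun f -> (forall x, 0 <= f x)%E ->
  (\int[leb2]_x f x = \int[leb]_s \int[leb]_t f (s, t))%E.
Proof. by move=> mf f0; rewrite /leb2 fubini_tonelli1. Qed.

Lemma tonelli21 (f : P -> \bar R) : mfun f -> (forall x, 0 <= f x)%E ->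
  (\int[leb2]_x f x = \int[leb]_t \int[leb]_s f (s, t))%E.
Proof. by move=> mf f0; rewrite -(@fubini_tonelli _ _ _ _ _ leb leb f mf f0) -fubini_tonelli1. Qed.

Lemma tonelli22 (f : P * P -> \bar R) : mfun f -> (forall z : P * P, 0 <= f z)%E ->
  (\int[leb2]_x \int[leb2]_y f (x, y) = \int[leb2]_y \int[leb2]_x f (x, y))%E.
Proof. by move=> mf f0; exact: (@fubini_tonelli _ _ _ _ R sleb2 sleb2 f mf f0).
Qed.

Lemma push_int (d : measure_display) (T : measurableType d) (mu : {measure set T -> \bar R})
    (phi : T -> T) (c : R) (f : T -> \bar R) : mfun phi -> 0 <= c ->
  (forall A, measurable A -> mu (phi @^-1` A) = c%:E * mu A)%E ->
  mfun f -> (forall z : T, 0 <= f z)%E ->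
  (\int[mu]_x f (phi x) = c%:E * \int[mu]_x f x)%E.
Proof.
move=> mphi c0 h mf f0.
have := @ge0_integral_pushforward _ _ _ _ R phi mphi mu setT f measurableT mf (fun b _ => f0 b).
rewrite preimage_setT => <-.
rewrite -(@ge0_integral_mscale _ _ R mu setT measurableT (NngNum c0) f mf (fun b _ => f0 b)).
by apply: eq_measure_integral => A mA _; rewrite /mscale /pushforward/=; apply: h.
Qed.

(** Uniqueness of Lebesgue measure: the image measure times t has the right value on half-open
    intervals. *)
Lemma leb_aff (a t : R) (A : set (measurableTypeR R)) : 0 < t -> measurable A ->
  leb ((fun s => a + t * s) @^-1` A) = (t^-1%:E * leb A)%E.
Proof.
move=> t0 mA.
have mphi : mfun (fun s : measurableTypeR R => a + t * s : measurableTypeR R).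
  by apply: measurable_funD => //; exact: measurable_funM.
pose m' := mscale (NngNum (ltW t0)) (pushforward leb (fun s : measurableTypeR R => a + t * s : measurableTypeR R)).
have -> : leb A = m' mphi A.
  apply: (@lebesgue_measure_unique R (m' mphi)) => // _ /ocitvP[->|[[u v] /= uv ->]].
    by rewrite !measure0.
  rewrite /m' /mscale/= /pushforward/=.
  rewrite (_ : _ @^-1` _ = `](u - a) / t, (v - a) / t]%classic); last first.
    apply/seteqP; split=> s /=; rewrite !in_itv/= ltr_pdivrMr// ler_pdivlMr//; lra.
  rewrite !lebesgue_measure_itv/= !lte_fin uv ltr_pM2r ?invr_gt0// ltrD2r uv -!EFinB -EFinM.
  by congr EFin; field; rewrite gt_eqF.
by rewrite /m' /mscale/= muleA -EFinM mulVf ?gt_eqF// mul1e.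
Qed.

(** One family for all changes of variables below: translations (t = 1), point reflections (t = -1)
    and dilations. *)
Definition aff (a : P) (t : R) (x : P) : P := (a.1 + t * x.1, a.2 + t * x.2).

Lemma aff_m (a : P) (t : R) : mfun (aff a t).
Proof.
apply: measurable_fun_pair.
  by apply: measurable_funD => //; exact: measurable_funM.
by apply: measurable_funD => //; exact: measurable_funM.
Qed.

Lemma leb2_aff (a : P) (t : R) (A : set P) : 0 < t -> measurable A ->
  leb2 (aff a t @^-1` A) = ((t ^- 2)%:E * leb2 A)%E.
Proof.
move=> t0 mA.
have t20 : 0 <= t ^+ 2 by rewrite exprn_ge0// ltW.
pose m' := mscale (NngNum t20) (pushforward leb2 (aff a t)).
have -> : leb2 A = m' (aff_m a t) A.
  apply: (@product_measure_unique _ _ _ _ R leb leb (m' (aff_m a t))) => // B C mB mC.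
  transitivity ((t ^+ 2)%:E * leb2 (aff a t @^-1` (B `*` C)))%E; first by [].
  rewrite (_ : _ @^-1` _ = ((fun s => a.1 + t * s) @^-1` B) `*` ((fun s => a.2 + t * s) @^-1` C))//.
  have mf (c : R) : mfun (fun s : measurableTypeR R => c + t * s : measurableTypeR R).
    by apply: measurable_funD => //; exact: measurable_funM.
  rewrite leb2X; [|by rewrite -[X in measurable X]setTI; exact: mf..].
  have E (b c : \bar R) : ((t ^+ 2)%:E * ((t^-1)%:E * b * ((t^-1)%:E * c)) = b * c)%E.
    rewrite -[((t^-1)%:E * b * _)%E]muleA [(b * ((t^-1)%:E * c))%E]muleCA !muleA -!EFinM.
    by rewrite (_ : _ / t = 1) ?mul1e//; field; rewrite gt_eqF.
  by rewrite !leb_aff// E.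
by rewrite /m' /mscale/= muleA -EFinM mulVf ?mul1e// expf_neq0// gt_eqF.
Qed.

Lemma aff_int (a : P) (t : R) (f : P -> \bar R) : 0 < t -> mfun f -> (forall x, 0 <= f x)%E ->
  (\int[leb2]_x f (aff a t x) = (t ^- 2)%:E * \int[leb2]_x f x)%E.
Proof.
move=> t0 mf f0; apply: push_int => //; first exact: aff_m.
  by rewrite invr_ge0 exprn_ge0// ltW.
by move=> A mA; exact: leb2_aff.
Qed.

Lemma itb_aff (a : P) (t : R) f : 0 < t -> itbp f -> itbp (f \o aff a t).
Proof.
move=> t0 hf; have mf := itb_m hf; apply: itbP.
  by apply: measurableT_comp => //; exact: aff_m.
rewrite /comp (@aff_int a t (fun x => `|f x|%:E))//; last first.
  by apply/measurable_EFinP; exact: measurableT_comp.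
by rewrite -itgE ?ltry//; exact: itb_norm.
Qed.

Lemma itg_aff (a : P) (t : R) f : 0 < t -> itbp f -> itgp (f \o aff a t) = t ^- 2 * itgp f.
Proof.
move=> t0 hf.
(* Tonelli settles nonnegative functions; a general f is then written as (f + |f|) - |f|. *)
have pos g : itbp g -> (forall x, 0 <= g x) -> itgp (g \o aff a t) = t ^- 2 * itgp g.
  move=> hg g0; apply: EFin_inj; rewrite EFinM !itgE//; last exact: itb_aff.
  by rewrite /comp (@aff_int a t (EFin \o g))//; apply: (measurable_int leb2).
have h1 := pos _ (itb_norm hf) (fun x => normr_ge0 _).
have h2 := pos _ (itbD hf (itb_norm hf)) (fun x => _).
have {}h2 := h2 (ltac:(move=> x; have := ler_norm (- f x); rewrite normrN; lra)).
have e : itgp (f \o aff a t) = itgp ((fun x => f x + `|f x|) \o aff a t) -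
    itgp ((fun x => `|f x|) \o aff a t).
  rewrite -itgB.
  - by congr itg; apply/funext => x /=; ring.
  - by apply: itb_aff => //; apply: itbD => //; exact: itb_norm.
  - by apply: itb_aff => //; exact: itb_norm.
by rewrite e h1 h2 itgD//; [ring|exact: itb_norm].
Qed.

Lemma L2_aff (a : P) (t : R) f : 0 < t -> L2p f -> L2p (f \o aff a t).
Proof.
move=> t0 [mf hf]; split; last exact: (itb_aff a t0 hf).
by apply: measurableT_comp => //; exact: aff_m.
Qed.

Lemma n2_aff (a : P) (t : R) f : 0 < t -> L2p f -> n2p (f \o aff a t) = t^-1 * n2p f.
Proof.
move=> t0 [mf hf]; rewrite /n2 (itg_aff a t0 hf) sqrtrM ?invr_ge0 ?exprn_ge0 ?ltW//.
by rewrite -exprVn sqrtr_sqr gtr0_norm// invr_gt0.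
Qed.

Lemma itb_bnd f c x r : mfun f -> (forall y, `|f y| <= c) ->
  (forall y, ~ box x r y -> f y = 0) -> itbp f.
Proof.
move=> mf fc f0; apply: itbP => //.
apply: (@le_lt_trans _ _ (\int[leb2]_y (c * \1_(box x `|r|) y)%:E)%E).
  apply: ge0_le_integral => //.
  - by apply/measurable_EFinP; exact: measurableT_comp.
  - by apply/measurable_EFinP/measurable_funM => //; apply: measurable_indic; exact: box_meas.
  move=> y _; rewrite lee_fin indicE; have [hy|hy] := pselect (box x r y).
    rewrite mem_set ?mulr1//; case: hy => h1 h2.
    by split; apply: le_trans (ler_norm r).
  by rewrite f0// normr0 mulr_ge0// (le_trans _ (fc 0)).
under eq_integral do rewrite EFinM.
rewrite ge0_integralZl_EFin//; [|by apply/measurable_EFinP; apply: measurable_indic; exact: box_meas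
  |exact: le_trans (normr_ge0 _) (fc 0)].
rewrite integral_indic// ?setIT; last exact: box_meas.
by rewrite leb2_box// -EFinM ltry.
Qed.

End PlaneMeasure.

(** * Smooth functions on the plane and convolution *)

Section SmoothPlane.
Implicit Types (k : P -> R) (c : R) (a b : R -> R) (i : 'I_2).

Definition taylor2 f g0 g1 C := forall x y,
  `|f y - f x - (g0 x * (y.1 - x.1) + g1 x * (y.2 - x.2))| <= C * ((y.1 - x.1) ^+ 2 + (y.2 - x.2) ^+ 2).

Lemma quad_small (C n p q e : R) : 0 <= C -> 0 <= n -> 0 <= p -> p <= n -> 0 <= q -> q <= n ->
  n * (2 * C + 1) < e -> C * (p ^+ 2 + q ^+ 2) <= e * n.
Proof.
move=> C0 n0 p0 pn q0 qn h; apply: (@le_trans _ _ (C * (n ^+ 2 + n ^+ 2))).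
  by rewrite ler_wpM2l// lerD// lerXn2r ?nnegrE.
by have : 0 <= n * (e - n * (2 * C + 1)); [rewrite mulr_ge0// subr_ge0 ltW|nra].
Qed.

(** A quadratic remainder is o(|h|), so a Taylor bound alone yields differentiability and identifies
    the partial derivatives. *)
Lemma quad_diff f (x : P) (a0 b0 C : R) :
  (forall y : P, `|f y - f x - (a0 * (y.1 - x.1) + b0 * (y.2 - x.2))| <=
    C * ((y.1 - x.1) ^+ 2 + (y.2 - x.2) ^+ 2)) ->
  [/\ differentiable (f : R^o * R^o -> R^o) x, partial 0 f x = a0 & partial 1 f x = b0].
Proof.
move=> H.
have C0 : 0 <= C.
  have := le_trans (normr_ge0 _) (H (x.1 + 1, x.2)); rewrite /= subrr expr0n addr0.
  by rewrite (_ : _ - x.1 = 1) ?expr1n ?(mulr1 C)//; ring.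
have cl : continuous (lin2 a0 b0).
  move=> h; apply: cvgD; apply: cvgM; try exact: cvg_cst; [exact: cvg_fst|exact: cvg_snd].
pose F : R^o * R^o -> R^o := f.
have E : F \o shift (x : R^o * R^o) = cst (F x) + (lin2 a0 b0 : R^o * R^o -> R^o) +o_ (0 : R^o * R^o) id.
  apply/eqaddoP => _ /posnumP[e]; near=> h.
  rewrite !fctE/= /lin2/= opprD addrA /F.
  have := H (h + x); rewrite /= !addrK => /le_trans; apply.
  have nE : `|h| = Num.max `|h.1| `|h.2| by [].
  have h1 : `|h.1| <= `|h| by rewrite nE le_max lexx.
  have h2 : `|h.2| <= `|h| by rewrite nE le_max lexx orbT.
  have he : `|h| < e%:num / (2 * C + 1).
    near: h; apply/nbhs_ballP; exists (e%:num / (2 * C + 1)) => /=.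
      by rewrite divr_gt0// ltr_wpDl// mulr_ge0.
    by move=> h; rewrite -ball_normE /ball_ /= sub0r normrN.
  move: he; rewrite ltr_pdivlMr ?ltr_wpDl ?mulr_ge0// => he.
  rewrite -[h.1 ^+ 2]real_normK ?num_real// -[h.2 ^+ 2]real_normK ?num_real//.
  exact: quad_small C0 (normr_ge0 _) (normr_ge0 _) h1 (normr_ge0 _) h2 he.
have dE : 'd (f : R^o * R^o -> R^o) x = lin2 a0 b0 :> (R^o * R^o -> R^o) by exact: diff_unique.
have df : differentiable (f : R^o * R^o -> R^o) x by apply/diff_locallyP; rewrite dE.
by split=> //; rewrite /partial deriveE// dE /lin2/=; ring.
Unshelve. all: by end_near. Qed.

(** The planar analogue of [sm]: a class closed under partial derivatives, with bounds and quadratic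
    Taylor remainders. Mollifiers, test functions and convolutions all have this form. *)
Definition Ker f : Prop := exists S : set (P -> R), S f /\
  forall g, S g -> exists g0 g1 C, [/\ S g0, S g1, (forall x, `|g x| <= C) & taylor2 g g0 g1 C].

Lemma KerP f : Ker f -> [/\ forall i, Ker (partial i f), exists C, forall x, `|f x| <= C,
  (exists C, taylor2 f (partial 0 f) (partial 1 f) C) &
  forall x, differentiable (f : R^o * R^o -> R^o) x].
Proof.
move=> [S [Sf hS]]; have [g0 [g1 [C [S0 S1 b T]]]] := hS f Sf.
have e0 : partial 0 f = g0 by apply/funext => x; have [_ -> _] := quad_diff (T x).
have e1 : partial 1 f = g1 by apply/funext => x; have [_ _ ->] := quad_diff (T x).
split; [|by exists C|by exists C; rewrite e0 e1|by move=> x; have [] := quad_diff (T x)].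
case=> -[|[|//]] hi; exists S; split=> //.
  by rewrite (_ : Ordinal _ = 0) ?e0//; exact: val_inj.
by rewrite (_ : Ordinal _ = 1) ?e1//; exact: val_inj.
Qed.

Lemma ord2P i : i = 0 \/ i = 1.
Proof. by case: i => -[|[|//]] hi; [left|right]; exact: val_inj. Qed.

Lemma Ker_smooth f : Ker f -> smooth f.
Proof.
move=> kf s x; suff /KerP[] : Ker (foldr (@partial R) f s) by [].
by elim: s => //= i s /KerP[].
Qed.

Lemma Ker_cont f : Ker f -> continuous (f : P -> R^o).
Proof. by move=> /KerP[_ _ _ h] x; exact: (differentiable_continuous (h x)). Qed.

Lemma Ker_meas f : Ker f -> mfun f.
Proof. by move=> /Ker_cont/cont_meas. Qed.

Lemma taylor2_partial f g0 g1 C : taylor2 f g0 g1 C -> partial 0 f = g0 /\ partial 1 f = g1.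
Proof. by move=> T; split; apply/funext => x; have [_ h0 h1] := quad_diff (T x). Qed.

Lemma Ker_tens a b : sm a -> sm b -> Ker (fun x => a x.1 * b x.2).
Proof.
move=> [Sa [Saa ha]] [Sb [Sbb hb]].
exists [set f | exists a b, [/\ Sa a, Sb b & f = fun x => a x.1 * b x.2]]; split.
  by exists a, b.
move=> _ [{Saa}a [{Sbb}b [Saa Sbb ->]]].
have [a' [C [Sa' hA]]] := ha a Saa; have [b' [D [Sb' hB]]] := hb b Sbb.
have [a'' [C' [_ hA']]] := ha a' Sa'.
have C0 : 0 <= C by have [h _ _] := hA 0 0; exact: le_trans h.
have D0 : 0 <= D by have [h _ _] := hB 0 0; exact: le_trans h.
have C'0 : 0 <= C' by have [h _ _] := hA' 0 0; exact: le_trans h.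
exists (fun x => a' x.1 * b x.2), (fun x => a x.1 * b' x.2), (2 * C * D + C' * D); split.
- by exists a', b.
- by exists a, b'.
- move=> x; have [h1 _ _] := hA x.1 0; have [h2 _ _] := hB x.2 0.
  rewrite normrM; apply: (@le_trans _ _ (C * D)); first exact: ler_pM.
  have := mulr_ge0 C0 D0; have := mulr_ge0 C'0 D0; lra.
move=> x y; have [a1 a2 a3] := hA x.1 y.1; have [b1 b2 b3] := hB x.2 y.2.
have [a4 _ _] := hA' x.1 0; have [b4 _ _] := hB y.2 0.
rewrite (_ : _ - _ = (a y.1 - a x.1 - a' x.1 * (y.1 - x.1)) * b y.2 +
   a x.1 * (b y.2 - b x.2 - b' x.2 * (y.2 - x.2)) +
   a' x.1 * (y.1 - x.1) * (b y.2 - b x.2)); last by ring.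
apply: le_trans (ler_normD _ _) _; apply: le_trans (lerD (ler_normD _ _) (lexx _)) _.
have q1 := ler_pM (normr_ge0 _) (normr_ge0 _) a3 b4.
have q2 := ler_pM (normr_ge0 _) (normr_ge0 _) a1 b3.
have q3 := ler_pM (mulr_ge0 (normr_ge0 _) (normr_ge0 _)) (normr_ge0 _) (ler_wpM2r (normr_ge0 (y.1 - x.1)) a4) b2.
rewrite -!normrM in q1 q2 q3.
apply: le_trans (lerD (lerD q1 q2) q3) _.
rewrite -[(y.1 - x.1) ^+ 2]real_normK ?num_real// -[(y.2 - x.2) ^+ 2]real_normK ?num_real//.
have p1 := normr_ge0 (y.1 - x.1); have p2 := normr_ge0 (y.2 - x.2).
have cd := mulr_ge0 C0 D0; have cd' := mulr_ge0 C'0 D0.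
move: (`|y.1 - x.1|) (`|y.2 - x.2|) p1 p2 => p q p0 q0.
have -> : C * p ^+ 2 * D + C * (D * q ^+ 2) + C' * p * (D * q) =
  (C * D) * (p ^+ 2 + q ^+ 2) + (C' * D) * (p * q) by ring.
rewrite mulrDl; apply: lerD.
  by rewrite ler_wpM2r ?addr_ge0 ?sqr_ge0//; lra.
by rewrite ler_wpM2l//; have := sqr_ge0 (p - q); have := mulr_ge0 p0 q0; nra.
Qed.

Lemma taylor2_aff f g0 g1 C c (p : P) t : taylor2 f g0 g1 C ->
  taylor2 (fun x => c * f (aff p t x)) (fun x => c * t * g0 (aff p t x))
    (fun x => c * t * g1 (aff p t x)) (`|c| * t ^+ 2 * C).
Proof.
move=> T x y; have := T (aff p t x) (aff p t y); rewrite /aff/=.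
set Y := (_, _); set X := (_, _) => h.
rewrite (_ : _ - _ = c * (f Y - f X - (g0 X * (p.1 + t * y.1 - (p.1 + t * x.1)) +
  g1 X * (p.2 + t * y.2 - (p.2 + t * x.2))))); last by ring.
rewrite normrM; apply: le_trans (ler_wpM2l (normr_ge0 c) h) _.
by apply: eqle; ring.
Qed.

Lemma Ker_aff f c (p : P) t : Ker f -> Ker (fun x => c * f (aff p t x)) /\
  forall i, partial i (fun x => c * f (aff p t x)) = fun x => c * t * partial i f (aff p t x).
Proof.
move=> kf; have [_ _ [C T] _] := KerP kf; split; last first.
  by move=> i; have [] := taylor2_partial (taylor2_aff c p t T); case: (ord2P i) => ->.
case: kf => S [Sf hS].
exists [set f | exists c g, S g /\ f = fun x => c * g (aff p t x)]; split; first by exists c, f.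
move=> _ [{}c [g [Sg ->]]]; have [g0 [g1 [{T}C [S0 S1 b T]]]] := hS g Sg.
have C0 : 0 <= C by exact: le_trans (normr_ge0 _) (b 0).
exists (fun x => c * t * g0 (aff p t x)), (fun x => c * t * g1 (aff p t x)), (`|c| * (1 + t ^+ 2) * C); split.
- by exists (c * t), g0.
- by exists (c * t), g1.
- move=> x; rewrite normrM -mulrA ler_wpM2l//; apply: le_trans (b _) _.
  by rewrite ler_peMl// lerDl sqr_ge0.
move=> x y; apply: le_trans (taylor2_aff c p t T x y) _.
rewrite ler_wpM2r ?addr_ge0 ?sqr_ge0// ler_wpM2r// ler_wpM2l//; lra.
Qed.

Definition conv u k x : R := itgp (fun y => u y * k (x.1 - y.1, x.2 - y.2)).

Lemma conv_m k (x : P) : mfun k ->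
  mfun (fun y : P => k (x.1 - y.1, x.2 - y.2)).
Proof.
move=> mk; apply: measurableT_comp => //; apply: measurable_fun_pair => //.
  by apply: measurable_funB.
by apply: measurable_funB.
Qed.

Lemma conv_itb u k C (x : P) : itbp u -> mfun k -> (forall x, `|k x| <= C) ->
  itbp (fun y => u y * k (x.1 - y.1, x.2 - y.2)).
Proof.
move=> hu mk hk; apply: (@itb_le _ _ _ _ _ (fun y => C * `|u y|)).
- by apply: measurable_funM; [exact: itb_m hu|exact: conv_m].
- by move=> y; rewrite normrM mulrC ler_wpM2r.
by apply: itbZ; exact: itb_norm.
Qed.

(** The Taylor bound of k, uniform in the base point, is integrated against u; this differentiates
    the convolution by linearity and monotonicity of the integral. *)
Lemma conv_taylor u k C : itbp u -> Ker k -> taylor2 k (partial 0 k) (partial 1 k) C ->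
  taylor2 (conv u k) (conv u (partial 0 k)) (conv u (partial 1 k)) (C * itgp (fun y => `|u y|)).
Proof.
move=> hu kk T x y.
have hi g z : Ker g -> itbp (fun y => u y * g (z.1 - y.1, z.2 - y.2)).
  by move=> kg; have [_ [D bD] _ _] := KerP kg; exact: (conv_itb _ hu (Ker_meas kg) bD).
have [kp _ _ _] := KerP kk.
have h0 := hi _ x (kp 0); have h1 := hi _ x (kp 1); have hx := hi _ x kk; have hy := hi _ y kk.
have h0' := itbZ (y.1 - x.1) h0; have h1' := itbZ (y.2 - x.2) h1.
have -> : conv u k y - conv u k x - (conv u (partial 0 k) x * (y.1 - x.1) + conv u (partial 1 k) x * (y.2 - x.2)) =
    itgp (fun z => u z * k (y.1 - z.1, y.2 - z.2) - u z * k (x.1 - z.1, x.2 - z.2) -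
    ((y.1 - x.1) * (u z * partial 0 k (x.1 - z.1, x.2 - z.2)) + (y.2 - x.2) * (u z * partial 1 k (x.1 - z.1, x.2 - z.2)))).
  rewrite (itgB (itbB hy hx) (itbD h0' h1')) (itgB hy hx) (itgD h0' h1') (itgZ _ h0) (itgZ _ h1).
  by rewrite /conv; congr (_ - (_ + _)); exact: mulrC.
apply: le_trans (itg_norm _) _; first by apply: itbB; [exact: itbB|exact: itbD].
rewrite -mulrA [_ * (_ + _)]mulrC mulrA -itgZ; last exact: itb_norm.
apply: itg_le.
- by apply: itb_norm; apply: itbB; [exact: itbB|exact: itbD].
- by apply: itbZ; exact: itb_norm.
move=> z; have := T (x.1 - z.1, x.2 - z.2) (y.1 - z.1, y.2 - z.2).
set Y := (_, _); set X := (_, _); rewrite /= => h.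
rewrite (_ : _ - _ = u z * (k Y - k X - (partial 0 k X * (y.1 - z.1 - (x.1 - z.1)) +
   partial 1 k X * (y.2 - z.2 - (x.2 - z.2))))); last by ring.
rewrite normrM mulrC ler_wpM2r//; apply: le_trans h _.
by apply: eqle; ring.
Qed.

Lemma Ker_conv u k : itbp u -> Ker k -> Ker (conv u k).
Proof.
move=> hu kk; exists [set f | exists2 k, Ker k & f = conv u k]; split; first by exists k.
move=> _ [{}k {}kk ->]; have [kp [C b] [D T] _] := KerP kk.
have C0 : 0 <= C by exact: le_trans (normr_ge0 _) (b 0).
have u0 : 0 <= itgp (fun y => `|u y|) by exact: itg_ge0.
exists (conv u (partial 0 k)), (conv u (partial 1 k)), ((C + `|D|) * itgp (fun y => `|u y|)); split.
- by exists (partial 0 k).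
- by exists (partial 1 k).
- move=> x; have hx := conv_itb x hu (Ker_meas kk) b.
  apply: le_trans (itg_norm hx) _.
  apply: (@le_trans _ _ (C * itgp (fun y => `|u y|))); last by rewrite ler_wpM2r// lerDl.
  rewrite -itgZ; last exact: itb_norm.
  apply: itg_le; [exact: itb_norm|by apply: itbZ; exact: itb_norm|].
  by move=> y; rewrite normrM mulrC ler_wpM2r.
move=> x y; apply: le_trans (conv_taylor hu kk T x y) _.
rewrite ler_wpM2r ?addr_ge0 ?sqr_ge0// ler_wpM2r//.
by apply: le_trans (ler_norm _) _; rewrite lerDr.
Qed.

End SmoothPlane.

(** * Test functions, integration by parts and the mollifier *)

Section TestFunctions.
Implicit Types (k : P -> R) (c : R) (i : 'I_2) (D : set P).

Lemma box_compact (x : P) r : compact (box x r).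
Proof. by rewrite boxE; apply: compact_setX; exact: segment_compact. Qed.

Lemma closed_compact D (x : P) r : closed D -> D `<=` box x r -> compact D.
Proof. by move=> cD DB; exact: subclosed_compact cD (@box_compact x r) DB. Qed.

Lemma compact_box D : compact D -> exists r, D `<=` box 0 r.
Proof.
move=> /compact_bounded[M [_ h]]; exists (M + 1) => x Dx.
have : Num.max `|x.1| `|x.2| <= M + 1 by exact: (h (M + 1) (ltr_pwDr ltr01 (lexx _)) x Dx).
rewrite ge_max => /andP[h1 h2].
by split; rewrite subr0.
Qed.

Lemma test_intro Om D phi r : Ker phi -> closed D -> D `<=` Om -> D `<=` box 0 r ->
  (forall x, ~ D x -> phi x = 0) -> test_function Om phi.
Proof.
move=> kp cD DO DB p0.
have sub : closure [set x | phi x != 0] `<=` D.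
  rewrite ((closure_id D).1 cD); apply: closure_subset => x /= px.
  by apply: contrapT => /p0 e; rewrite e eqxx in px.
split; [exact: Ker_smooth|apply: (@closed_compact _ 0 r); [exact: closed_closure|]|];
  exact: subset_trans sub _.
Qed.

Lemma partial_out D phi i : closed D -> (forall x, ~ D x -> phi x = 0) ->
  forall x, ~ D x -> partial i phi x = 0.
Proof.
move=> cD p0 x nD; rewrite /partial.
transitivity ('D_(basis_vec R i : R^o * R^o) (cst (0 : R^o)) (x : R^o * R^o)); last exact: derive_cst.
apply: near_eq_derive; apply: filterS (_ : \near x, ~ D x); first by move=> y /p0.
by apply: open_nbhs_nbhs; split=> //; exact: closed_openC.
Qed.

Lemma cont_bnd f D : compact D -> continuous (f : P -> R^o) -> (forall x, ~ D x -> f x = 0) ->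
  exists C, forall x, `|f x| <= C.
Proof.
move=> cD cf f0.
have /compact_bounded[M [_ h]] : compact ((f : P -> R^o) @` D).
  by apply: continuous_compact => //; exact: continuous_subspaceT.
exists (Num.max 0 (M + 1)) => x; have [Dx|nD] := pselect (D x).
  by rewrite le_max (h (M + 1)) ?orbT// ?ltrDl//; exists x.
by rewrite f0// normr0 le_max lexx.
Qed.

Lemma taylor_arith (C0 C1 C2 C3 a1 a2 a3 p q a d : R) : 0 <= C0 -> 0 <= p -> 0 <= q ->
  0 <= a -> 0 <= d -> a <= p -> d <= q -> 0 <= a1 -> 0 <= a2 -> 0 <= a3 -> a2 <= C2 -> a3 <= C3 -> a1 <= C1 ->
  a1 * a * p + (a3 * d * q + a2 * p * q) <= (C0 + (C1 + C2 + C3)) * (p ^+ 2 + q ^+ 2).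
Proof.
move=> c0 p0 q0 a0 d0 ap dq h1 h2 h3 l2 l3 l1.
have pq : p * q <= p ^+ 2 + q ^+ 2 by have := sqr_ge0 (p - q); have := mulr_ge0 p0 q0; nra.
have g1 : a1 * a * p <= C1 * p ^+ 2.
  by rewrite expr2 mulrA ler_pM// ?mulr_ge0// ler_pM.
have g3 : a3 * d * q <= C3 * q ^+ 2.
  by rewrite expr2 mulrA ler_pM// ?mulr_ge0// ler_pM.
have g2 : a2 * p * q <= C2 * (p ^+ 2 + q ^+ 2).
  by rewrite -mulrA ler_pM// mulr_ge0.
have := mulr_ge0 c0 (addr_ge0 (sqr_ge0 p) (sqr_ge0 q)).
have := mulr_ge0 (le_trans h1 l1) (sqr_ge0 q); have := mulr_ge0 (le_trans h3 l3) (sqr_ge0 p).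
lra.
Qed.

Lemma taylor_id (fy fm fx gc gx hd hm hx p q : R) : fm - fx = gc * p -> fy - fm = hd * q ->
  fy - fx - (gx * p + hx * q) = (gc - gx) * p + ((hd - hm) + (hm - hx)) * q.
Proof.
by move=> /eqP; rewrite subr_eq => /eqP -> /eqP; rewrite subr_eq => /eqP ->; ring.
Qed.

(** The class consists of all iterated partial derivatives. Each is continuous with compact support,
    hence bounded, and bounds on the second derivatives give the Taylor remainder through the mean
    value theorem on coordinate lines. *)
Lemma test_Ker Om phi : test_function Om phi -> Ker phi.
Proof.
move=> [sp cp _]; set D := closure _ in cp.
have cD : closed D by exact: closed_closure.
have out (w : seq 'I_2) : forall x, ~ D x -> foldr (@partial R) phi w x = 0.
  elim: w => [x nD|i w IH x nD] /=; last exact: partial_out IH x nD.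
  by apply: contrapT => /eqP p; apply: nD; exact: subset_closure.
exists [set g | exists w : seq 'I_2, g = foldr (@partial R) phi w]; split; first by exists [::].
move=> _ [w0 ->]; pose g w := foldr (@partial R) phi w.
have bd w : exists C, forall x, `|g w x| <= C.
  by apply: (cont_bnd cp) => //; [move=> x; exact: differentiable_continuous (sp w x)|exact: out].
have dg w i x : is_derive (x : R^o * R^o) (basis_vec R i : R^o * R^o) (g w : R^o * R^o -> R^o) (g (i :: w) x).
  by apply: derivableP; apply: diff_derivable; exact: sp.
have line0 w (c : R) (t : R) : is_derive t (1 : R) (fun t : R => g w (t, c)) (g (0 :: w) (t, c)).
  have h := dg w 0 (t, c).
  have E : (fun h : R => h^-1 *: (((fun t : R => g w (t, c)) \o shift t) (h *: (1 : R)) - g w (t, c))) =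
    (fun h : R => h^-1 *: (((g w : R^o * R^o -> R^o) \o shift (t, c)) (h *: (basis_vec R 0 : R^o * R^o)) - g w (t, c))).
    apply/funext => k /=; congr (_ *: (g w _ - _)).
    by congr (_, _); rewrite /= /GRing.scale/= ?mulr1 ?mulr0 ?add0r.
  by case: h => h1 h2; apply: DeriveDef; [rewrite /derivable E|rewrite /derive E].
have line1 w (c : R) (t : R) : is_derive t (1 : R) (fun t : R => g w (c, t)) (g (1 :: w) (c, t)).
  have h := dg w 1 (c, t).
  have E : (fun h : R => h^-1 *: (((fun t : R => g w (c, t)) \o shift t) (h *: (1 : R)) - g w (c, t))) =
    (fun h : R => h^-1 *: (((g w : R^o * R^o -> R^o) \o shift (c, t)) (h *: (basis_vec R 1 : R^o * R^o)) - g w (c, t))).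
    apply/funext => k /=; congr (_ *: (g w _ - _)).
    by congr (_, _); rewrite /= /GRing.scale/= ?mulr1 ?mulr0 ?add0r.
  by case: h => h1 h2; apply: DeriveDef; [rewrite /derivable E|rewrite /derive E].
have [C0 b0] := bd w0.
have [C1 b1] := bd [:: 0, 0 & w0]; have [C2 b2] := bd [:: 0, 1 & w0]; have [C3 b3] := bd [:: 1, 1 & w0].
have p0 (C : R) (w : seq 'I_2) : (forall x, `|g w x| <= C) -> 0 <= C by move=> /(_ 0); exact: le_trans.
have C10 := p0 _ _ b1; have C20 := p0 _ _ b2; have C30 := p0 _ _ b3; have C00 := p0 _ _ b0.
exists (g (0 :: w0)), (g (1 :: w0)), (C0 + (C1 + C2 + C3)); split.
- by exists (0 :: w0).
- by exists (1 :: w0).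
- by move=> x; apply: le_trans (b0 x) _; rewrite lerDl !addr_ge0.
move=> [x1 x2] [y1 y2] /=; rewrite -/(g w0 (y1, y2)) -/(g w0 (x1, x2)).
(* The path from x to y turns at the corner (y1, x2). The first two mean values treat its two legs;
   the other three compare the derivatives found there with those at x. *)
have [c hc e1] := MVT2 (line0 w0 x2) y1 x1.
have [d hd e2] := MVT2 (line1 w0 y1) y2 x2.
have [c' hc' e3] := MVT2 (line0 (0 :: w0) x2) c x1.
have [d' hd' e4] := MVT2 (line1 (1 :: w0) y1) d x2.
have [c'' hc'' e5] := MVT2 (line0 (1 :: w0) x2) y1 x1.
rewrite (_ : _ - _ = (g (0 :: w0) (c, x2) - g (0 :: w0) (x1, x2)) * (y1 - x1) +
  ((g (1 :: w0) (y1, d) - g (1 :: w0) (y1, x2)) + (g (1 :: w0) (y1, x2) - g (1 :: w0) (x1, x2))) * (y2 - x2)); last first.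
  exact: taylor_id e1 e2.
rewrite e3 e4 e5; apply: le_trans (ler_normD _ _) _.
rewrite !normrM; apply: le_trans (lerD (lexx _) (ler_wpM2r (normr_ge0 _) (ler_normD _ _))) _.
rewrite !normrM [(_ + _) * `|y2 - x2|]mulrDl -[(y1 - x1) ^+ 2]real_normK ?num_real// -[(y2 - x2) ^+ 2]real_normK ?num_real//.
have := b1 (c', x2); have := b3 (y1, d'); have := b2 (c'', x2).
exact: taylor_arith.
Qed.

Lemma itg_bnd f c (x : P) r : 0 <= r -> mfun f -> (forall y, `|f y| <= c) ->
  (forall y, ~ box x r y -> f y = 0) -> `|itgp f| <= c * (2 * r) ^+ 2.
Proof.
move=> r0 mf fc f0; have hf := itb_bnd mf fc f0.
have c0 : 0 <= c by exact: le_trans (normr_ge0 _) (fc 0).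
have mb : mfun (fun y : P => c * \1_(box x r) y : R).
  by apply: measurable_funM => //; apply: measurable_indic; exact: box_meas.
have hb : itbp (fun y => c * \1_(box x r) y).
  apply: (@itb_bnd _ c x r) => // y.
    by rewrite indicE normrM (ger0_norm c0); case: (_ \in _); rewrite ?normr1 ?mulr1// normr0 mulr0.
  by move=> h; rewrite indicE memNset ?mulr0.
apply: le_trans (itg_norm hf) _; apply: (@le_trans _ _ (itgp (fun y => c * \1_(box x r) y))).
  apply: itg_le => //; first exact: itb_norm.
  move=> y; rewrite indicE; have [h|h] := pselect (box x r y); first by rewrite mem_set// mulr1.
  by rewrite f0// normr0 mulr_ge0.
rewrite -lee_fin itgE//; under eq_integral do rewrite EFinM.
rewrite ge0_integralZl_EFin//; last by apply/measurable_EFinP; apply: measurable_indic; exact: box_meas.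
by rewrite integral_indic ?setIT//; [rewrite leb2_box// EFinM|exact: box_meas].
Qed.

Lemma test_out Om phi : test_function Om phi -> exists D r, [/\ closed D, D `<=` Om, 0 <= r, D `<=` box 0 r &
  forall x, ~ D x -> phi x = 0 /\ forall i, partial i phi x = 0].
Proof.
move=> [sp cp DO]; set D := closure _ in cp DO; have [r hr] := compact_box cp.
have p0 x : ~ D x -> phi x = 0.
  by move=> nD; apply: contrapT => /eqP p; apply: nD; exact: subset_closure.
exists D, `|r|; split=> //; first exact: closed_closure.
  by move=> x /hr[h1 h2]; split; [apply: le_trans h1 _|apply: le_trans h2 _]; exact: ler_norm.
by move=> x nD; split; [exact: p0|move=> i; apply: (@partial_out D) => //; exact: closed_closure].
Qed.

Lemma test_partial Om phi i : test_function Om phi -> test_function Om (partial i phi).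
Proof.
move=> h; have [D [r [cD DO r0 DB out]]] := test_out h; have [kp _ _ _] := KerP (test_Ker h).
by apply: (test_intro (kp i) cD DO DB) => x /out[_].
Qed.

Lemma test_sub Om Om' phi : Om `<=` Om' -> test_function Om phi -> test_function Om' phi.
Proof. by move=> s [h1 h2 h3]; split=> //; exact: subset_trans s. Qed.

Lemma test_itb Om phi : test_function Om phi -> itbp phi.
Proof.
move=> h; have kp := test_Ker h; have [D [r [_ _ _ DB out]]] := test_out h; have [_ [C b] _ _] := KerP kp.
apply: (itb_bnd (Ker_meas kp) b (x := 0) (r := r)) => y nB.
by have [] := out y (fun d => nB (DB _ d)).
Qed.

Lemma test_L2 Om phi : test_function Om phi -> L2p phi.
Proof.
move=> h; have kp := test_Ker h; have [D [r [_ _ _ DB out]]] := test_out h; have [_ [C b] _ _] := KerP kp.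
split; first exact: Ker_meas.
apply: (@itb_bnd _ (C ^+ 2) 0 r) => [|y|y nB]; first by apply: measurable_funX; exact: Ker_meas.
  by rewrite normrX lerXn2r ?nnegrE// (le_trans (normr_ge0 _) (b y)).
by have [-> _] := out y (fun d => nB (DB _ d)); rewrite expr0n.
Qed.

Lemma Ker_lin c f g : Ker f -> Ker g -> Ker (fun x => c * f x + g x) /\
  forall i, partial i (fun x => c * f x + g x) = fun x => c * partial i f x + partial i g x.
Proof.
have T c0 h k h0 h1 k0 k1 C (D : R) : taylor2 h h0 h1 C -> taylor2 k k0 k1 D ->
    taylor2 (fun x => c0 * h x + k x) (fun x => c0 * h0 x + k0 x) (fun x => c0 * h1 x + k1 x) (`|c0| * C + D).
  move=> T1 T2 x y; have e1 := ler_wpM2l (normr_ge0 c0) (T1 x y); have e2 := T2 x y.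
  rewrite (_ : _ - _ = c0 * (h y - h x - (h0 x * (y.1 - x.1) + h1 x * (y.2 - x.2))) +
    (k y - k x - (k0 x * (y.1 - x.1) + k1 x * (y.2 - x.2)))); last by ring.
  by apply: le_trans (ler_normD _ _) _; rewrite normrM mulrDl -mulrA; exact: lerD.
move=> kf kg; have [_ _ [C TC] _] := KerP kf; have [_ _ [D TD] _] := KerP kg.
split; last by move=> i; have [] := taylor2_partial (T c _ _ _ _ _ _ _ _ TC TD); case: (ord2P i) => ->.
case: kf => S [Sf hS]; case: kg => S' [Sg hS'].
exists [set k | exists h1 h2, [/\ S h1, S' h2 & k = fun x => c * h1 x + h2 x]]; split; first by exists f, g.
move=> _ [h1 [h2 [s1 s2 ->]]].
have [h10 [h11 [C1 [a1 a2 b1 T1]]]] := hS _ s1; have [h20 [h21 [C2 [a3 a4 b2 T2]]]] := hS' _ s2.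
exists (fun x => c * h10 x + h20 x), (fun x => c * h11 x + h21 x), (`|c| * C1 + C2); split.
- by exists h10, h20.
- by exists h11, h21.
- by move=> x; apply: le_trans (ler_normD _ _) _; rewrite normrM lerD// ler_wpM2l.
exact: T.
Qed.

Lemma test_lin Om c phi psi : test_function Om phi -> test_function Om psi ->
  test_function Om (fun x => c * phi x + psi x) /\
  forall i, partial i (fun x => c * phi x + psi x) = fun x => c * partial i phi x + partial i psi x.
Proof.
move=> h1 h2; have [k1 k2] := Ker_lin c (test_Ker h1) (test_Ker h2); split=> //.
have [D [r [cD DO r0 DB out]]] := test_out h1; have [E [s [cE EO s0 EB out']]] := test_out h2.
apply: (test_intro (D := D `|` E) (r := Num.max r s) k1); [exact: closedU|by rewrite subUset| |].
  move=> x [/DB[a b]|/EB[a b]]; split; by rewrite le_max ?a ?b ?orbT.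
move=> x nD; have [-> _] := out x (fun d => nD (or_introl d)).
by have [-> _] := out' x (fun d => nD (or_intror d)); rewrite mulr0 addr0.
Qed.

Lemma Ker_dir k i : Ker k -> exists2 C, 0 <= C & forall x h,
  `|k (aff (h * (basis_vec R i).1, h * (basis_vec R i).2) 1 x) - k x - h * partial i k x| <= C * h ^+ 2.
Proof.
move=> kk; have [_ _ [C T] _] := KerP kk; exists `|C| => // x h.
have := T x (aff (h * (basis_vec R i).1, h * (basis_vec R i).2) 1 x).
rewrite /aff/= !mul1r !addrK; case: (ord2P i) => -> /=;
  rewrite ?eqxx ?mulr1 ?mulr0 ?expr0n ?add0r ?addr0/= [_ * h]mulrC => /le_trans; apply;
  by rewrite ler_wpM2r ?sqr_ge0// ler_norm.
Qed.

Lemma small_eq0 (a K : R) : (forall h, 0 < h <= 1 -> `|a| <= K * h) -> a = 0.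
Proof.
move=> H; apply/eqP/negPn/negP => a0; have ap : 0 < `|a| by rewrite normr_gt0.
have K0 : 0 <= K.
  by have := H 1; rewrite ltr01 lexx mulr1 => /(_ isT); apply: le_trans.
have h0 : 0 < `|a| / (`|a| + K + K) by rewrite divr_gt0// -addrA ltr_pwDl// addr_ge0.
have h1 : `|a| / (`|a| + K + K) <= 1.
  by rewrite ler_pdivrMr ?mul1r -?addrA ?lerDl ?addr_ge0// ltr_pwDl// addr_ge0.
have := H (`|a| / (`|a| + K + K)); rewrite h0 h1 => /(_ isT).
by rewrite mulrA ler_pdivlMr -?addrA ?ltr_pwDl ?addr_ge0// [K * _]mulrC ler_pM2l//; lra.
Qed.

Lemma abs_add (a b r : R) : `|a + b| <= r -> `|a| <= 1 -> `|b| <= r + 1.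
Proof. by rewrite !ler_norml => /andP[? ?] /andP[? ?]; apply/andP; split; lra. Qed.

(** Translation invariance moves the shift by h from phi to k. Replacing both difference quotients
    by derivatives costs O(h^2), so h times the sum of the two integrals is O(h^2). The shift is at
    most 1, whence the box of radius r + 1. *)
Lemma ibp phi k i : test_function setT phi -> Ker k ->
  itgp (fun x => partial i phi x * k x) = - itgp (fun x => phi x * partial i k x).
Proof.
move=> hp kk; have kp := test_Ker hp.
have [D [r [_ _ r0 DB out]]] := test_out hp.
have [kpi [B bB] _ _] := KerP kp; have [kki [M bM] _ _] := KerP kk.
have [_ [M' bM'] _ _] := KerP (kki i); have [_ [B' bB'] _ _] := KerP (kpi i).
have [C C0 hC] := Ker_dir i kp; have [C' C'0 hC'] := Ker_dir i kk.
have nn (f : P -> R) (c : R) : (forall x, `|f x| <= c) -> 0 <= c by move=> /(_ 0); exact: le_trans.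
have B0 := nn _ _ bB; have M0 := nn _ _ bM.
pose e h : P := (h * (basis_vec R i).1, h * (basis_vec R i).2).
have mf := Ker_meas kp; have mk := Ker_meas kk; have mpi := Ker_meas (kpi i); have mki := Ker_meas (kki i).
have ml a t g : mfun g -> mfun (g \o aff a t : P -> R).
  by move=> mg; apply: measurableT_comp => //; exact: aff_m.
have ho x : ~ box 0 r x -> phi x = 0 /\ forall i, partial i phi x = 0.
  by move=> nB; apply: out => d; exact: nB (DB _ d).
have I (f g : P -> R) c d : mfun f -> mfun g -> (forall x, `|f x| <= c) ->
    (forall x, `|g x| <= d) -> (forall x, ~ box 0 (r + 1) x -> f x = 0) -> itbp (fun x => f x * g x) /\
    `|itgp (fun x => f x * g x)| <= c * d * (2 * (r + 1)) ^+ 2.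
  move=> mf' mg' bf bg f0; have b x : `|f x * g x| <= c * d by rewrite normrM ler_pM.
  have z x : ~ box 0 (r + 1) x -> f x * g x = 0 by move=> /f0 ->; rewrite mul0r.
  by split; [apply: itb_bnd z => //|apply: itg_bnd z => //; rewrite ?addr_ge0//]; exact: measurable_funM.
have sub x : ~ box 0 (r + 1) x -> ~ box 0 r x.
  by move=> h [h1 h2]; apply: h; split; [apply: le_trans h1 _|apply: le_trans h2 _]; rewrite lerDl.
apply/eqP; rewrite -addr_eq0; apply/eqP.
apply: (@small_eq0 _ (C * M * (2 * (r + 1)) ^+ 2 + B * C' * (2 * (r + 1)) ^+ 2)) => h /andP[h0 h1].
have sh x : ~ box 0 (r + 1) x -> phi (aff (e h) 1 x) = 0.
  move=> nB; suff nb : ~ box 0 r (aff (e h) 1 x) by case: (ho _ nb).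
  move=> [H1 H2]; apply: nB; move: H1 H2; rewrite /aff/= !subr0 !mul1r => H1 H2.
  have hb (b : bool) : `|h * b%:R| <= 1.
    by rewrite normrM (gtr0_norm h0); case: b; rewrite ?normr1 ?normr0 ?mulr1 ?mulr0.
  by split; rewrite subr0; [exact: abs_add H1 (hb _)|exact: abs_add H2 (hb _)].
have [i1 e1] := I _ _ _ _ (measurable_funB (measurable_funB (ml (e h) 1 _ mf) mf) (measurable_funM (measurable_cst h) mpi))
  mk (fun x => hC x h) bM (ltac:(by move=> x nB; rewrite /= sh// !(ho _ (sub _ nB)).1 (ho _ (sub _ nB)).2 mulr0 !subr0)).
have [i2 e2] := I _ _ _ _ mf (measurable_funB (measurable_funB (ml (e (- h)) 1 _ mk) mk) (measurable_funM (measurable_cst (- h)) mki))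
  bB (fun x => hC' x (- h)) (ltac:(by move=> x nB; rewrite (ho _ (sub _ nB)).1)).
have [i3 _] := I _ _ _ _ mf mk bB bM (ltac:(by move=> x nB; rewrite (ho _ (sub _ nB)).1)).
have [i4 _] := I _ _ _ _ mpi mk bB' bM (ltac:(by move=> x nB; rewrite (ho _ (sub _ nB)).2)).
have [i5 _] := I _ _ _ _ mf mki bB bM' (ltac:(by move=> x nB; rewrite (ho _ (sub _ nB)).1)).
have [i6 _] := I _ _ _ _ mf (ml (e (- h)) 1 _ mk) bB (fun x => bM _) (ltac:(by move=> x nB; rewrite (ho _ (sub _ nB)).1)).
have i7 := itb_aff (e h) ltr01 i6; have q := itg_aff (e h) ltr01 i6; rewrite expr1n invr1 mul1r in q.
have E7 : (fun x => phi x * (k \o aff (e (- h)) 1) x) \o aff (e h) 1 = fun x => phi (aff (e h) 1 x) * k x.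
  apply/funext => -[x1 x2] /=; congr (_ * k _); rewrite /aff/e/=; congr (_, _); ring.
rewrite E7 in i7 q.
move: e1 e2.
rewrite (_ : (fun x => _ * k x) = fun x => phi (aff (e h) 1 x) * k x - phi x * k x - h * (partial i phi x * k x)); last first.
  by apply/funext => x /=; ring.
rewrite (_ : (fun x => phi x * _) = fun x => phi x * (k \o aff (e (- h)) 1) x - phi x * k x + h * (phi x * partial i k x)); last first.
  by apply/funext => x /=; ring.
rewrite (itgB (itbB i7 i3) (itbZ h i4)) (itgB i7 i3) (itgZ h i4) (itgD (itbB i6 i3) (itbZ h i5)) (itgB i6 i3) (itgZ h i5) q.
clear -h0 h1 C0 C'0; rewrite sqrrN.
set a := itg _ _; set b := itg _ _; set c := itg _ _; set d := itg _ _.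
set X := (2 * _) ^+ 2; rewrite !ler_norml => /andP[a1 a2] /andP[b1 b2].
have e1 : (C * h ^+ 2 * M * X + B * (C' * h ^+ 2) * X) = h * ((C * M * X + B * C' * X) * h) by ring.
apply/andP; split; rewrite -(ler_pM2l h0) -?mulrN ?mulrN; lra.
Qed.

Definition bb (x : P) : R := bmp x.1 * bmp x.2.

Lemma bb_Ker : Ker bb.
Proof. by apply: Ker_tens; exact: bmp_sm. Qed.

Lemma bb_ge0 x : 0 <= bb x.
Proof. by rewrite mulr_ge0// bmp_ge0. Qed.

Lemma bb_out x : 1 <= `|x.1| \/ 1 <= `|x.2| -> bb x = 0.
Proof. by rewrite /bb => -[] /bmp_out ->; rewrite ?mul0r ?mulr0. Qed.

Lemma bb_itb : itbp bb.
Proof.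
have [_ [C b] _ _] := KerP bb_Ker; apply: (itb_bnd (Ker_meas bb_Ker) b (x := 0) (r := 1)) => y nB.
apply: bb_out; apply: contrapT => /not_orP[/negP h1 /negP h2]; apply: nB.
by rewrite -!ltNge in h1 h2; split; rewrite subr0 ltW.
Qed.

Lemma bb_int : 0 < itgp bb.
Proof.
pose c : R := expR (- 2) ^+ 2 * expR (- 2) ^+ 2.
have c0 : 0 < c by rewrite mulr_gt0// exprn_gt0// expR_gt0.
have mb : mfun (fun y : P => c * \1_(box 0 (1 / 2)) y : R).
  by apply: measurable_funM => //; apply: measurable_indic; exact: box_meas.
have hb : itbp (fun y => c * \1_(box 0 (1 / 2)) y).
  apply: (@itb_bnd _ c 0 (1 / 2)) => // y.
    by rewrite indicE normrM (gtr0_norm c0); case: (_ \in _); rewrite ?normr1 ?mulr1// normr0 mulr0 ltW.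
  by move=> h; rewrite indicE memNset ?mulr0.
apply: lt_le_trans (itg_le hb bb_itb _); last first.
  move=> x; rewrite indicE; have [h|h] := pselect (box 0 (1 / 2) x).
    rewrite mem_set// mulr1; case: h; rewrite !subr0 => h1 h2.
    by apply: ler_pM; rewrite ?exprn_ge0 ?expR_ge0 ?bmp_gt0.
  by rewrite memNset// mulr0 bb_ge0.
rewrite -lte_fin itgE//; under eq_integral do rewrite EFinM.
rewrite ge0_integralZl_EFin//; [|by apply/measurable_EFinP; apply: measurable_indic; exact: box_meas|exact: ltW].
rewrite integral_indic ?setIT//; last exact: box_meas.
by rewrite leb2_box// -EFinM lte_fin mulr_gt0// exprn_gt0//; lra.
Qed.

Definition kr r (x : P) : R := (itgp bb)^-1 * r ^- 2 * bb (aff 0 r^-1 x).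

Lemma kr_Ker r : Ker (kr r).
Proof. by have [] := Ker_aff ((itgp bb)^-1 * r ^- 2) (0 : P) r^-1 bb_Ker. Qed.

Lemma kr_ge0 r x : 0 <= kr r x.
Proof.
by rewrite /kr mulr_ge0 ?bb_ge0// mulr_ge0// invr_ge0 ?sqr_ge0// ltW// bb_int.
Qed.

Lemma kr_out r x : 0 < r -> r <= `|x.1| \/ r <= `|x.2| -> kr r x = 0.
Proof.
move=> r0 h; have ip : 0 < r^-1 by rewrite invr_gt0.
rewrite /kr bb_out ?mulr0// /aff/= !add0r !normrM !(gtr0_norm ip).
by rewrite ![r^-1 * _]mulrC !ler_pdivlMr// !mul1r.
Qed.

Lemma kr_even r (x : P) : kr r (- x.1, - x.2) = kr r x.
Proof. by rewrite /kr /bb /aff/= !mulrN !add0r !bmp_even. Qed.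

Lemma kr_itb r : 0 < r -> itbp (kr r).
Proof. by move=> r0; apply: itbZ; apply: (itb_aff (0 : P)) bb_itb; rewrite invr_gt0. Qed.

Lemma kr_int r : 0 < r -> itgp (kr r) = 1.
Proof.
move=> r0; have i0 : 0 < r^-1 by rewrite invr_gt0.
have := itg_aff (0 : P) i0 bb_itb; rewrite /kr itgZ; last exact: (itb_aff (0 : P)) bb_itb.
move=> ->; rewrite exprVn invrK; field; rewrite (gt_eqF r0) gt_eqF//; exact: bb_int.
Qed.

(** Two powers of 1 / r come from the normalisation and two from the second derivatives. This r^-4
    determines the exponent of the mesh size in [l2_rate]. *)
Lemma kr_taylor : exists2 C, 0 <= C & forall r, 0 < r ->
  taylor2 (kr r) (partial 0 (kr r)) (partial 1 (kr r)) (C * r ^- 4).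
Proof.
have [_ _ [C T] _] := KerP bb_Ker; exists ((itgp bb)^-1 * `|C|).
  by rewrite mulr_ge0// invr_ge0 (ltW bb_int).
move=> r r0; have T' := taylor2_aff ((itgp bb)^-1 * r ^- 2) (0 : P) r^-1 T.
rewrite -/(kr r) in T'; have [e0 e1] := taylor2_partial T'.
rewrite e0 e1 => x y; apply: le_trans (T' x y) _.
rewrite ler_wpM2r ?addr_ge0 ?sqr_ge0// ger0_norm ?mulr_ge0 ?invr_ge0 ?sqr_ge0 ?(ltW bb_int)//.
rewrite exprVn -!mulrA ler_wpM2l ?invr_ge0 ?(ltW bb_int)// mulrA -invfM -exprD mulrC.
by rewrite ler_wpM2r ?ler_norm// invr_ge0 exprn_ge0// ltW.
Qed.

End TestFunctions.

(** * Mollification and dilation in L^2, and the space W^{1,2}_0 *)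

Section Mollify.
Implicit Types (a p : P) (k v : P -> R) (c : R) (i : 'I_2) (D : set P).
Implicit Types H : 'I_2 -> P -> R.

Local Opaque itg n2 partial.

(** Minkowski's integral inequality for a probability density k. For fixed x the variance of F x
    under k is nonnegative, which bounds h x^2 by the mean of F x z^2; Tonelli then exchanges the
    integrals. Control of F is asked for only where k does not vanish. *)
Lemma mink (F : P -> P -> R) k (h : P -> R) (c : R) :
  mfun (fun w : P * P => F w.1 w.2) -> (forall z, 0 <= k z) -> itbp k ->
  itgp k = 1 -> mfun h ->
  (forall x, itbp (fun z => F x z * k z)) -> (forall x, itbp (fun z => F x z ^+ 2 * k z)) ->
  (forall x, h x = itgp (fun z => F x z * k z)) -> 0 <= c ->
  (forall z, k z != 0 -> L2p (F ^~ z) /\ n2p (F ^~ z) <= c) ->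
  L2p h /\ n2p h <= c.
Proof.
move=> mF k0 ik k1 mh i1 i2 hE c0 hz.
have jen x : h x ^+ 2 <= itgp (fun z => F x z ^+ 2 * k z).
  rewrite -subr_ge0; apply: le_trans (itg_ge0 leb2 (fun z => mulr_ge0 (sqr_ge0 (F x z - h x)) (k0 z))) _.
  rewrite (_ : (fun z => _) = fun z => F x z ^+ 2 * k z - (2 * h x * (F x z * k z) - h x ^+ 2 * k z)); last first.
    by apply/funext => z; ring.
  rewrite (itgB (i2 x) (itbB (itbZ _ (i1 x)) (itbZ _ ik))) (itgB (itbZ _ (i1 x)) (itbZ _ ik)).
  by rewrite (itgZ _ (i1 x)) (itgZ _ ik) k1 -hE; apply: eqle; ring.
have mk := itb_m ik.
pose g (w : P * P) := (F w.1 w.2 ^+ 2 * k w.2)%:E.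
have mg : mfun g.
  apply/measurable_EFinP; apply: measurable_funM; first exact: measurable_funX.
  by apply: measurableT_comp => //; exact: measurable_snd.
have g0 w : (0 <= g w)%E by rewrite lee_fin mulr_ge0 ?sqr_ge0.
have L : (\int[leb2]_x (h x ^+ 2)%:E <= (c ^+ 2)%:E)%E.
  apply: (@le_trans _ _ (\int[leb2]_x \int[leb2]_z (F x z ^+ 2 * k z)%:E)%E).
    apply: ge0_le_integral => //.
    - by move=> x _; rewrite lee_fin sqr_ge0.
    - by apply/measurable_EFinP; exact: measurable_funX.
    - have mF' := @measurable_fun_fubini_tonelli_F _ _ P P R sleb2 g mg g0; exact: mF'.
    - by move=> x _; rewrite -itgE ?lee_fin.
  rewrite (@tonelli22 g)//=.
  rewrite -[leRHS]mule1 -k1 itgE// -ge0_integralZl_EFin ?sqr_ge0//; last first.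
  - exact/measurable_EFinP.
  - by move=> z _; rewrite lee_fin.
  apply: ge0_le_integral => //.
  - by move=> z _; apply: integral_ge0 => x _; rewrite lee_fin mulr_ge0 ?sqr_ge0.
  - have mF' := @measurable_fun_fubini_tonelli_G _ _ _ _ R sleb2 g mg g0; exact: mF'.
  - apply/measurable_EFinP; exact: measurable_funM.
  move=> z _; have [kz|kz] := eqVneq (k z) 0.
    by under eq_integral do rewrite /g/= kz mulr0; rewrite integral0 kz mule0.
  have [[_ f2] fc] := hz z kz; under eq_integral do rewrite /g/= EFinM muleC.
  rewrite ge0_integralZl_EFin//; [|by move=> x _; rewrite lee_fin sqr_ge0|exact: (measurable_int leb2 f2)].
  by rewrite -itgE// -n2K muleC -!EFinM lee_fin ler_wpM2r// lerXn2r ?nnegrE ?n2_ge0.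
have i3 : itbp (fun x => h x ^+ 2).
  apply: itbP; first exact: measurable_funX.
  apply: le_lt_trans (ltry (c ^+ 2)); apply: le_trans L; apply: eqle.
  by apply: eq_integral => x _; rewrite ger0_norm// sqr_ge0.
by split; [split|apply: n2_le => //; rewrite -lee_fin itgE].
Qed.

(** Evenness of the kernel turns the convolution into a mean of translates of u, the form in which
    [mink] applies. *)
Lemma conv_alt u r (p : P) : 0 < r -> itbp (fun y => u y * kr r (p.1 - y.1, p.2 - y.2)) ->
  itbp (fun z => u (aff p 1 z) * kr r z) /\
  conv u (kr r) p = itgp (fun z => u (aff p 1 z) * kr r z).
Proof.
move=> r0 i0; have := itb_aff p ltr01 i0; have := itg_aff p ltr01 i0.
rewrite expr1n invr1 mul1r (_ : (fun y => _) \o aff p 1 = fun z => u (aff p 1 z) * kr r z).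
  by move=> e1 i1; split; [exact: i1|exact: esym e1].
apply/funext => z /=; congr (_ * _); rewrite -[RHS]kr_even; congr (kr r _).
by rewrite /aff/=; congr (_, _); ring.
Qed.

Lemma kr_b r : 0 < r -> exists C, forall x, `|kr r x| <= C.
Proof. by move=> r0; have [_ ? _ _] := KerP (kr_Ker r). Qed.

Lemma conv_out u r (p : P) : 0 < r ->
  (forall y, `|p.1 - y.1| < r -> `|p.2 - y.2| < r -> u y = 0) -> conv u (kr r) p = 0.
Proof.
move=> r0 h; rewrite -[RHS](itg0 leb2); congr itg; apply/funext => y.
have [h1|h1] := ltP `|p.1 - y.1| r; last by rewrite kr_out ?mulr0//; left.
have [h2|h2] := ltP `|p.2 - y.2| r; last by rewrite kr_out ?mulr0//; right.
by rewrite h ?mul0r.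
Qed.

Lemma L2_itb u r : L2p u -> (forall y, ~ box 0 r y -> u y = 0) -> itbp u.
Proof.
move=> hu u0; have m1 : mfun (\1_(box 0 r) : P -> R).
  by apply: measurable_indic; exact: box_meas.
have h1 : L2p (\1_(box 0 r) : P -> R).
  split=> //; apply: (@itb_bnd _ 1 0 r); first exact: measurable_funX.
    by move=> y; rewrite indicE; case: (_ \in _); rewrite ?expr1n ?expr0n ?normr1 ?normr0.
  by move=> y nB; rewrite indicE memNset// expr0n.
have := L2M hu h1; congr itb; apply/funext => y; rewrite indicE.
by have [b|b] := pselect (box 0 r y); [rewrite mem_set ?mulr1|rewrite u0 ?mul0r].
Qed.

Lemma aff2_m (a : P) s : mfun (fun w : P * P => aff (aff a s w.1) 1 w.2 : P).
Proof.
have m1 : mfun (fun w : P * P => aff a s w.1) by apply: measurableT_comp; [exact: aff_m|exact: measurable_fst].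
have mf : mfun (fst : P -> measurableTypeR R) by exact: measurable_fst.
have ms : mfun (snd : P -> measurableTypeR R) by exact: measurable_snd.
apply: measurable_fun_pair; apply: measurable_funD.
- exact: (measurableT_comp mf m1).
- by apply: measurable_funM => //; apply: (measurableT_comp mf); exact: measurable_snd.
- exact: (measurableT_comp ms m1).
- by apply: measurable_funM => //; apply: (measurableT_comp ms); exact: measurable_snd.
Qed.

Lemma aff_aff (a z x : P) s : aff (aff a s x) 1 z = aff (a.1 + z.1, a.2 + z.2) s x.
Proof. by rewrite /aff/=; congr (_, _); ring. Qed.

Lemma conv_meas u r : 0 < r -> itbp u -> mfun (conv u (kr r)).
Proof. by move=> r0 hu; apply: Ker_meas; apply: Ker_conv => //; exact: kr_Ker. Qed.

(** A mollified function is a mean of translates by vectors shorter than r, so its distance to v is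
    at most the largest distance of such a translate to v. *)
Lemma conv_n2 u v r (a : P) s (c : R) : 0 < r -> 0 < s -> 0 <= c -> L2p u -> itbp u -> L2p v ->
  (forall z, `|z.1| < r -> `|z.2| < r -> n2p (fun x => u (aff (a.1 + z.1, a.2 + z.2) s x) - v x) <= c) ->
  L2p (fun x => conv u (kr r) (aff a s x)) /\ n2p (fun x => conv u (kr r) (aff a s x) - v x) <= c.
Proof.
move=> r0 s0 c0 hu iu hv H; have [C bC] := kr_b r0; have mk := Ker_meas (kr_Ker r).
have i0 w p : itbp w -> itbp (fun y => w y * kr r (p.1 - y.1, p.2 - y.2)).
  by move=> hw; exact: (conv_itb p hw mk bC).
have i1 x := (conv_alt r0 (i0 u (aff a s x) iu)).1.
have e1 x := (conv_alt r0 (i0 u (aff a s x) iu)).2.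
have i2 x := (conv_alt r0 (i0 (fun y => u y ^+ 2) (aff a s x) hu.2)).1.
have ik := kr_itb r0.
have mh : mfun (fun x => conv u (kr r) (aff a s x)).
  by apply: measurableT_comp; [exact: conv_meas|exact: aff_m].
have mv : mfun v := hv.1.
have [] := @mink (fun x z => u (aff (aff a s x) 1 z) - v x) (kr r) (fun x => conv u (kr r) (aff a s x) - v x) c.
- apply: measurable_funB; first by apply: measurableT_comp; [exact: hu.1|exact: aff2_m].
  by apply: (measurableT_comp mv); exact: measurable_fst.
- exact: kr_ge0.
- exact: ik.
- exact: kr_int.
- by apply: measurable_funB.
- move=> x; rewrite (_ : (fun z => _) = fun z => u (aff (aff a s x) 1 z) * kr r z - v x * kr r z).
    by apply: itbB => //; exact: itbZ.
  by apply/funext => z; ring.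
- move=> x; rewrite (_ : (fun z => _) = fun z => u (aff (aff a s x) 1 z) ^+ 2 * kr r z -
     2 * v x * (u (aff (aff a s x) 1 z) * kr r z) + v x ^+ 2 * kr r z).
    by apply: itbD; [apply: itbB => //; exact: itbZ|exact: itbZ].
  by apply/funext => z; ring.
- move=> x; rewrite (_ : (fun z => _) = fun z => u (aff (aff a s x) 1 z) * kr r z - v x * kr r z).
    by rewrite (itgB (i1 x) (itbZ _ ik)) (itgZ _ ik) kr_int// e1 mulr1.
  by apply/funext => z; ring.
- exact: c0.
- move=> z kz; have z1 : `|z.1| < r by rewrite ltNge; apply: contra kz => h; rewrite kr_out//; left.
  have z2 : `|z.2| < r by rewrite ltNge; apply: contra kz => h; rewrite kr_out//; right.
  rewrite (_ : (fun x => _) = fun x => u (aff (a.1 + z.1, a.2 + z.2) s x) - v x); last first.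
    by apply/funext => x; rewrite aff_aff.
  by split; [apply: L2B => //; exact: L2_aff|exact: H].
move=> h1 h2; split=> //; have := L2D h1 hv; congr L2; apply/funext => x; exact: subrK.
Qed.

Lemma n2_bnd f (c : R) (x : P) r : 0 <= r -> 0 <= c -> mfun f -> (forall y, `|f y| <= c) ->
  (forall y, ~ box x r y -> f y = 0) -> L2p f /\ n2p f <= c * (2 * r).
Proof.
move=> r0 c0 mf fc f0.
have mf2 : mfun (fun y => f y ^+ 2) by exact: measurable_funX.
have b2 y : `|f y ^+ 2| <= c ^+ 2 by rewrite normrX lerXn2r ?nnegrE.
have z2 y : ~ box x r y -> f y ^+ 2 = 0 by move=> /f0 ->; rewrite expr0n.
split; first by split=> //; exact: itb_bnd mf2 b2 z2.
apply: n2_le; first by rewrite !mulr_ge0.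
by rewrite exprMn; apply: le_trans (ler_norm _) _; exact: itg_bnd mf2 b2 z2.
Qed.

Definition sup1 x (e : R) := `|x.1| <= e /\ `|x.2| <= e.

Lemma aff_back (p x : P) s B e t : 0 <= t <= 1 -> 0 <= s -> sup1 p e ->
  box 0 B (aff (t * p.1, t * p.2) (1 + t * s) x) -> box 0 (B + e) x.
Proof.
move=> /andP[t0 t1] s0 [p1 p2] [/=]; rewrite !subr0 => h1 h2.
have K (a b : R) : `|a| <= e -> `|t * a + (1 + t * s) * b| <= B -> `|b| <= B + e.
  move=> ha hb; have ts : 0 <= t * s by exact: mulr_ge0.
  apply: (@le_trans _ _ ((1 + t * s) * `|b|)); first by rewrite ler_peMl// lerDl.
  rewrite -[1 + _]ger0_norm ?addr_ge0// -normrM -[X in `|X|](addKr (t * a)).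
  apply: le_trans (ler_normD _ _) _; rewrite addrC lerD// normrN normrM (ger0_norm t0).
  by apply: le_trans ha; rewrite ler_piMl.
by split; rewrite /= subr0; [exact: K p1 h1|exact: K p2 h2].
Qed.

(* The map from x to [aff p (1 + s) x] is cut into m small steps; Taylor's formula
   controls each step up to O(m^-2). *)
Lemma dilation_n2 phi (p : P) s B e d : test_function setT phi -> 0 <= s -> 0 <= B -> sup1 p e ->
  (forall x, ~ box 0 B x -> phi x = 0 /\ forall i, partial i phi x = 0) ->
  (forall x, box 0 (B + e) x -> sup1 (p.1 + s * x.1, p.2 + s * x.2) d) ->
  n2p (fun x => phi (aff p (1 + s) x) - phi x) <=
    d * (n2p (partial 0 phi) + n2p (partial 1 phi)).
Proof.
move=> hp s0 B0 pe out hd; have kp := test_Ker hp; have [kpi [K bK] [C T] _] := KerP kp.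
have e0 : 0 <= e by case: pe => h _; exact: le_trans h.
have d0 : 0 <= d by have [|h _] := hd 0; [split; rewrite subrr normr0 addr_ge0|exact: le_trans h].
set N := n2p (partial 0 phi) + _; have N0 : 0 <= N by rewrite addr_ge0 ?n2_ge0.
pose Y (t : R) : P -> P := aff (t * p.1, t * p.2) (1 + t * s).
(* w is the constant velocity of the path t -> Y t x that joins x to [aff p (1 + s) x]; each step of
   length h is compared with h times the derivative along w. *)
pose w x : P := (p.1 + s * x.1, p.2 + s * x.2).
have L2Y t i : 0 <= t -> L2p (partial i phi \o Y t) /\ n2p (partial i phi \o Y t) <= n2p (partial i phi).
  move=> t0; have tp : 1 <= 1 + t * s by rewrite lerDl mulr_ge0.
  have l2 : L2p (partial i phi) by apply: (@test_L2 setT); exact: test_partial.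
  split; first by apply: L2_aff => //; exact: lt_le_trans tp.
  rewrite n2_aff ?(lt_le_trans _ tp)// ler_piMl ?n2_ge0// invf_le1 ?(lt_le_trans _ tp)//.
have L2phi t : 0 <= t -> L2p (phi \o Y t).
  move=> t0; apply: L2_aff; last exact: test_L2 hp.
  by rewrite ltr_wpDr ?mulr_ge0.
have mw i : mfun (fun x : P => if i == 0 :> 'I_2 then (w x).1 else (w x).2 : R).
  by rewrite /w/=; case: (i == 0); apply: measurable_funD => //; apply: measurable_funM.
pose wi i x : R := if i == 0 :> 'I_2 then (w x).1 else (w x).2.
have step t h : 0 <= t -> 0 < h -> t + h <= 1 ->
    n2p (fun x => phi (Y (t + h) x) - phi (Y t x)) <= h * d * N + `|C| * (2 * (h * d) ^+ 2) * (2 * (B + e)).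
  move=> t0 h0 th1.
  have tt : 0 <= t <= 1 by rewrite t0/=; lra.
  have th : 0 <= t + h <= 1 by rewrite th1 andbT addr_ge0// ltW.
  pose m i x := h * (wi i x * partial i phi (Y t x)).
  pose q x := phi (Y (t + h) x) - phi (Y t x) - (m 0 x + m 1 x).
  have o1 x : ~ box 0 (B + e) x -> phi (Y (t + h) x) = 0.
    by move=> nB; have [] := out (Y (t + h) x) (fun b => nB (aff_back th s0 pe b)).
  have o2 x : ~ box 0 (B + e) x -> phi (Y t x) = 0 /\ forall i, partial i phi (Y t x) = 0.
    by move=> nB; exact: out (fun b => nB (aff_back tt s0 pe b)).
  have mm i : L2p (m i) /\ n2p (m i) <= h * d * n2p (partial i phi).
    have [l2 n2i] := L2Y t i t0.
    have l3 := L2Z (h * d) l2.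
    have dom x : `|m i x| <= `|h * d * (partial i phi \o Y t) x|.
      have [b|nb] := pselect (box 0 (B + e) x); last by rewrite /m /= (o2 x nb).2 !mulr0.
      rewrite /m !normrM -mulrA ler_wpM2l// ler_wpM2r//.
      rewrite (ger0_norm d0); have [b1 b2] := hd x b.
      by rewrite /wi; case: ifP.
    have mi : mfun (m i).
      by apply: measurable_funM => //; apply: measurable_funM; [exact: mw|case: l2].
    split; first exact: L2_le dom.
    have hd0 : 0 <= h * d by rewrite mulr_ge0// ltW.
    apply: le_trans (n2_mono l3 mi dom) _; rewrite (n2Z _ l2) (ger0_norm hd0).
    exact: ler_wpM2l.
  have qz x : ~ box 0 (B + e) x -> q x = 0.
    by move=> nb; rewrite /q /m o1// !(o2 x nb).2 (o2 x nb).1 !mulr0 addr0 !subr0.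
  have qb x : `|q x| <= `|C| * (2 * (h * d) ^+ 2).
    have [b|nb] := pselect (box 0 (B + e) x); last first.
      by rewrite qz// normr0 mulr_ge0// mulr_ge0// sqr_ge0.
    have [b1 b2] := hd x b; have := T (Y t x) (Y (t + h) x).
    have w1 : (Y (t + h) x).1 - (Y t x).1 = h * (w x).1 by rewrite /Y /w /aff/=; ring.
    have w2 : (Y (t + h) x).2 - (Y t x).2 = h * (w x).2 by rewrite /Y /w /aff/=; ring.
    have w3 : partial 0 phi (Y t x) * (h * (w x).1) + partial 1 phi (Y t x) * (h * (w x).2) = m 0 x + m 1 x.
      by rewrite /m /wi eqxx/= [partial 0 phi _ * _]mulrC [partial 1 phi _ * _]mulrC -!mulrA.
    rewrite w1 w2 w3 -/(q x).
    move=> /le_trans; apply; apply: le_trans (ler_wpM2r _ (ler_norm C)) _; first by rewrite addr_ge0 ?sqr_ge0.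
    rewrite ler_wpM2l//.
    rewrite (_ : 2 * _ = (h * d) ^+ 2 + (h * d) ^+ 2); last by ring.
    by apply: lerD; rewrite -[leLHS]real_normK ?num_real// lerXn2r ?nnegrE ?mulr_ge0 ?(ltW h0)// normrM (gtr0_norm h0) ler_wpM2l// ltW.
  have [ml0 mn0] := mm 0; have [ml1 mn1] := mm 1.
  have lq : mfun q.
    by apply: measurable_funB; [apply: measurable_funB; [case: (L2phi (t + h)) => //; case/andP: th|case: (L2phi t)]|
      apply: measurable_funD; [case: ml0|case: ml1]].
  have [ql qn] := n2_bnd (addr_ge0 B0 e0) (mulr_ge0 (normr_ge0 C) (mulr_ge0 (ler0n _ 2) (sqr_ge0 _))) lq qb qz.
  have -> : (fun x => phi (Y (t + h) x) - phi (Y t x)) = fun x => m 0 x + m 1 x + q x.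
    by apply/funext => x; rewrite [RHS]addrC /q subrK.
  apply: le_trans (n2D (L2D ml0 ml1) ql) _; apply: lerD; last exact: qn.
  by rewrite /N mulrDr; exact: le_trans (n2D ml0 ml1) (lerD mn0 mn1).
have Q n : n2p (fun x => phi (aff p (1 + s) x) - phi x) <=
    d * N + `|C| * (2 * d ^+ 2) * (2 * (B + e)) / n.+1%:R.
  pose h : R := n.+1%:R^-1; have h0 : 0 < h by rewrite invr_gt0.
  have hn : n.+1%:R * h = 1 by rewrite mulfV.
  have ind j : (j <= n.+1)%N -> n2p (fun x => phi (Y (j%:R * h) x) - phi (Y 0 x)) <=
      j%:R * (h * d * N + `|C| * (2 * (h * d) ^+ 2) * (2 * (B + e))).
    elim: j => [_|j IH jn].
      by rewrite !mul0r (_ : (fun x => _) = fun=> 0) ?n20//; apply/funext => x; rewrite subrr.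
    have j0 : 0 <= j%:R * h by rewrite mulr_ge0 ?ler0n// ltW.
    have jh : (j.+1)%:R * h = j%:R * h + h by rewrite -natr1 mulrDl mul1r.
    have j1 : j%:R * h + h <= 1 by rewrite -jh -[leRHS]hn ler_pM2r ?ler_nat.
    have jh0 : 0 <= j%:R * h + h by rewrite addr_ge0// ltW.
    rewrite jh; apply: le_trans (n2_split (L2phi _ jh0) (L2phi _ j0) (L2phi _ (lexx 0))) _.
    by rewrite -natr1 [leRHS]mulrDl mul1r addrC; exact: lerD (IH (ltnW jn)) (step _ _ j0 h0 j1).
  have := ind n.+1 (leqnn _); rewrite hn.
  rewrite (_ : (fun x => _) = fun x => phi (aff p (1 + s) x) - phi x); last first.
    by apply/funext => x; rewrite /Y !mul1r !mul0r addr0; congr (phi _ - phi _); case: x => a b; rewrite /aff/=; congr (_, _); ring.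
  move=> /le_trans; apply; apply: eqle; rewrite /h; field; exact: lt0r_neq0.
apply/ler_addgt0Pr => e1 e10.
set K1 := `|C| * (2 * d ^+ 2) * (2 * (B + e)) in Q.
have K10 : 0 <= K1 by rewrite !mulr_ge0 ?sqr_ge0// addr_ge0.
have [n hn] : exists n : nat, K1 / e1 < n.+1%:R by exists (Num.truncn (K1 / e1)); exact: truncnS_gt.
apply: le_trans (Q n) _; rewrite lerD2l ler_pdivrMr// mulrC -ler_pdivrMr//; exact: ltW.
Qed.

(** W^{1,2}_0 with the gradient as explicit data and both functions extended by zero. The weak
    derivative chosen in the statement is determined only almost everywhere; keeping G separate
    postpones that choice to the end. *)
Definition H10 Om u G := [/\ L2p u, forall i, L2p (G i),
  forall x, ~ Om x -> u x = 0 /\ forall i, G i x = 0 &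
  forall e, 0 < e -> exists phi, [/\ test_function Om phi, n2p (fun x => phi x - u x) <= e &
    forall i, n2p (fun x => partial i phi x - G i x) <= e]].

Lemma H10_test Om phi : test_function Om phi -> H10 Om phi (fun i => partial i phi).
Proof.
move=> h; split; [exact: test_L2 h|by move=> i; exact: test_L2 (test_partial i h)| |].
  by move=> x nO; have [D [r [_ DO _ _ out]]] := test_out h; apply: out => /DO.
have z g : n2p (fun x => g x - g x) = 0.
  by rewrite (_ : (fun x => _) = fun=> 0) ?n20//; apply/funext => x; rewrite subrr.
by move=> e e0; exists phi; split=> // [|i]; rewrite z ltW.
Qed.

Lemma H10_lin Om c u G v H : H10 Om u G -> H10 Om v H ->
  H10 Om (fun x => c * u x + v x) (fun i x => c * G i x + H i x).
Proof.
move=> [u2 G2 uo ua] [v2 H2 vo va]; split.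
- by apply: L2D => //; exact: L2Z.
- by move=> i; apply: L2D => //; exact: L2Z.
- move=> x nO; have [-> g] := uo x nO; have [-> g'] := vo x nO.
  by rewrite mulr0 addr0; split=> // i; rewrite g g' mulr0 addr0.
move=> e e0; have e1 : 0 < e / (`|c| + 1) by rewrite divr_gt0// ltr_wpDl.
have e20 : 0 < e / (`|c| + 1) / 2 by rewrite divr_gt0.
have [phi [tp pu pG]] := ua _ e20; have [psi [tq qv qH]] := va (e / 2) (divr_gt0 e0 (ltr0n _ 2)).
have [tl pl] := test_lin c tp tq; exists (fun x => c * phi x + psi x).
have K (f g f' g' : P -> R) : L2p f -> L2p g -> L2p f' -> L2p g' ->
    n2p (fun x => f x - f' x) <= e / (`|c| + 1) / 2 -> n2p (fun x => g x - g' x) <= e / 2 ->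
    n2p (fun x => c * f x + g x - (c * f' x + g' x)) <= e.
  move=> lf lg lf' lg' h1 h2.
  rewrite (_ : (fun x => _) = fun x => c * (f x - f' x) + (g x - g' x)); last by apply/funext => x; ring.
  apply: le_trans (n2D (L2Z c (L2B lf lf')) (L2B lg lg')) _; rewrite (n2Z _ (L2B lf lf')).
  apply: (@le_trans _ _ (e / 2 + e / 2)); last by apply: eqle; field.
  apply: lerD => //; apply: le_trans (ler_wpM2l (normr_ge0 c) h1) _.
  rewrite mulrA ler_pM2r// mulrCA ler_piMr ?(ltW e0)// ler_pdivrMr ?ltr_wpDl// mul1r lerDl.
  by [].
have lp := test_L2 tp; have lq := test_L2 tq.
split=> // [|i]; first exact: K.
by rewrite pl; apply: K => //; [exact: test_L2 (test_partial i tp)|exact: test_L2 (test_partial i tq)].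
Qed.

Lemma H10_close Om u G : L2p u -> (forall i, L2p (G i)) ->
  (forall x, ~ Om x -> u x = 0 /\ forall i, G i x = 0) ->
  (forall e, 0 < e -> exists v H, [/\ H10 Om v H, n2p (fun x => v x - u x) <= e &
    forall i, n2p (fun x => H i x - G i x) <= e]) -> H10 Om u G.
Proof.
move=> u2 G2 uo h; split=> // e e0; have e20 : 0 < e / 2 by rewrite divr_gt0.
have [v [H [[v2 H2 vo va] h1 h2]]] := h _ e20; have [phi [tp pu pG]] := va _ e20.
have split2 f g k : L2p f -> L2p g -> L2p k -> n2p (fun x => f x - g x) <= e / 2 ->
    n2p (fun x => g x - k x) <= e / 2 -> n2p (fun x => f x - k x) <= e.
  move=> l1 l2 l3 h3 h4; apply: le_trans (n2_split l1 l2 l3) _.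
  by apply: le_trans (lerD h3 h4) _; apply: eqle; field.
exists phi; split=> // [|i]; first by apply: split2 pu h1 => //; exact: test_L2 tp.
by apply: split2 (pG i) (h2 i) => //; exact: test_L2 (test_partial i tp).
Qed.

End Mollify.

(** * Convex combinations in coordinates *)

Section Convexity.

Definition cmb x y t : P := (t * x.1 + (1 - t) * y.1, t * x.2 + (1 - t) * y.2).

Lemma i01P t : 0 <= t <= 1 -> exists k : {i01 R}, k%:num = t.
Proof.
move=> /andP[t0 t1]; have H : Itv.spec (@Itv.num_sem R) (Itv.Real `[0%Z, 1%Z]) t.
  by apply/and3P; split; rewrite ?num_real//= in_itv/= ?t0.
by exists (Itv.mk H).
Qed.

Lemma cvxP Om : is_convex Om <-> forall x y t, Om x -> Om y -> 0 <= t <= 1 -> Om (cmb x y t).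
Proof.
split=> [h x y t Ox Oy /i01P[k <-]|h x y k /set_mem Ox /set_mem Oy].
  by have := h x y k (mem_set Ox) (mem_set Oy); move=> /set_mem.
by apply/mem_set; apply: (h x y k%:num Ox Oy); rewrite ge0 le1.
Qed.

End Convexity.

(** * Approximation in W^{1,2}_0 by mollified dilations *)

Section MollifyH10.
Implicit Types (p : P) (v : P -> R) (c : R) (i : 'I_2) (D : set P).
Implicit Types H : 'I_2 -> P -> R.

Lemma box_closed (p : P) r : closed (box p r).
Proof. by apply: compact_closed; [exact: norm_hausdorff|exact: box_compact]. Qed.

Lemma test_kr r p : 0 < r -> test_function setT (fun y => 1 * kr r (aff p (-1) y)) /\
  forall i, partial i (fun y => 1 * kr r (aff p (-1) y)) = fun y => 1 * -1 * partial i (kr r) (aff p (-1) y).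
Proof.
move=> r0; have [k1 k2] := Ker_aff 1 p (-1) (kr_Ker r); split=> //.
apply: (test_intro (D := box p r) (r := Num.max `|p.1| `|p.2| + r) k1) => //; first exact: box_closed.
  move=> y [h1 h2]; split; rewrite subr0.
    by rewrite -[y.1](subrK p.1) (le_trans (ler_normD _ _))// addrC lerD// le_max lexx.
  by rewrite -[y.2](subrK p.2) (le_trans (ler_normD _ _))// addrC lerD// le_max lexx orbT.
move=> y nB; suff h : r <= `|(aff p (-1) y).1| \/ r <= `|(aff p (-1) y).2| by rewrite (kr_out r0 h) mulr0.
rewrite /aff/= !mulN1r; apply: contrapT => /not_orP[/negP a /negP b]; apply: nB.
by rewrite -ltNge distrC in a; rewrite -ltNge distrC in b; split; exact: ltW.
Qed.

Lemma sum2 (F : 'I_2 -> R) : \sum_i F i = F 0 + F 1.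
Proof. by rewrite !big_ord_recl big_ord0 addr0; congr (_ + F _); exact: val_inj. Qed.

Lemma H10_ibp Om u G psi i : H10 Om u G -> test_function setT psi ->
  itgp (fun x => G i x * psi x) = - itgp (fun x => u x * partial i psi x).
Proof.
move=> [u2 G2 _ ua] tp; have p2 := test_L2 tp; have pp2 := test_L2 (test_partial i tp).
apply/eqP; rewrite -addr_eq0 -normr_le0; apply: (@le_lim _ _ (n2p psi + n2p (partial i psi))) => e e0.
have [phi [tf pu pG]] := ua e e0; have tf' : test_function setT phi by exact: test_sub tf.
have f2 := test_L2 tf; have pf2 := test_L2 (test_partial i tf).
have h := ibp i tf' (test_Ker tp).
have -> : itgp (fun x => G i x * psi x) + itgp (fun x => u x * partial i psi x) =
   - itgp (fun x => (partial i phi x - G i x) * psi x) - itgp (fun x => (phi x - u x) * partial i psi x).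
  rewrite (_ : (fun x => (partial i phi x - G i x) * psi x) = fun x => partial i phi x * psi x - G i x * psi x); last first.
    by apply/funext => x; rewrite mulrBl.
  rewrite (_ : (fun x => (phi x - u x) * _) = fun x => phi x * partial i psi x - u x * partial i psi x); last first.
    by apply/funext => x; rewrite mulrBl.
  rewrite (itgB (L2M pf2 p2) (L2M (G2 i) p2)) (itgB (L2M f2 pp2) (L2M u2 pp2)) h.
  by move: (itg _ _) (itg _ _) (itg _ _) => a b d; ring.
apply: le_trans (ler_normB _ _) _; rewrite normrN [leRHS]mulrC mulrDr; apply: lerD.
  by apply: le_trans (CS (L2B pf2 (G2 i)) p2) _; apply: ler_wpM2r; rewrite ?n2_ge0//; exact: pG.
by apply: le_trans (CS (L2B f2 u2) pp2) _; apply: ler_wpM2r; rewrite ?n2_ge0.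
Qed.

(** The extension by zero has weak gradient G on the whole plane. Mollification uses just this, and
    a Lipschitz function vanishing off Om is shown to have it before it is known to lie in [H10]. *)
Definition wpair Om u G := [/\ L2p u, forall i, L2p (G i),
  forall x, ~ Om x -> u x = 0 /\ forall i, G i x = 0 &
  forall psi i, test_function setT psi ->
    itgp (fun x => G i x * psi x) = - itgp (fun x => u x * partial i psi x)].

Lemma H10_wpair Om u G : H10 Om u G -> wpair Om u G.
Proof. by move=> hu; have [u2 G2 uo _] := hu; split=> // psi i; exact: H10_ibp hu. Qed.

Lemma wpair_conv Om u G r p i : 0 < r -> wpair Om u G -> conv u (partial i (kr r)) p = conv (G i) (kr r) p.
Proof.
move=> r0 h; have [tk pk] := test_kr p r0; have [u2 _ _ /(_ _ i tk)] := h.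
have E w : (fun x => u x * (1 * -1 * w (aff p (-1) x))) = fun x => - (u x * w (p.1 - x.1, p.2 - x.2)).
  by apply/funext => x; rewrite /aff !mulN1r mul1r mulNr mul1r mulrN.
rewrite pk E /conv.
have -> : (fun x => G i x * (1 * kr r (aff p (-1) x))) = fun y => G i y * kr r (p.1 - y.1, p.2 - y.2).
  by apply/funext => x; rewrite /aff !mulN1r mul1r.
have [kp _ _ _] := KerP (kr_Ker r).
move=> ->; have := L2M u2 (test_L2 (test_partial i tk)); rewrite pk E => /itbN.
by rewrite (_ : (fun x => - - _) = fun y => u y * partial i (kr r) (p.1 - y.1, p.2 - y.2)) => [q|];
  [rewrite itgN// opprK|apply/funext => x; rewrite opprK].
Qed.

Lemma wpair_itb Om u G B : Om `<=` box 0 B -> wpair Om u G -> itbp u /\ forall i, itbp (G i).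
Proof.
move=> OB [u2 G2 uo _]; split=> [|i].
  by apply: (@L2_itb _ B u2) => y nB; have [] := uo y (fun o => nB (OB _ o)).
by apply: (@L2_itb _ B (G2 i)) => y nB; have [] := uo y (fun o => nB (OB _ o)).
Qed.

Lemma H10_dilation Om u G p s B e d : Om `<=` box 0 B -> H10 Om u G -> 0 <= s -> 0 <= B -> sup1 p e ->
  (forall x, box 0 (B + e) x -> sup1 (p.1 + s * x.1, p.2 + s * x.2) d) ->
  n2p (fun x => u (aff p (1 + s) x) - u x) <= d * (n2p (G 0) + n2p (G 1)).
Proof.
move=> OB [u2 G2 _ ua] s0 B0 pe hd.
have e0 : 0 <= e by case: pe => h _; exact: le_trans h.
have d0 : 0 <= d by have [|h _] := hd 0; [split; rewrite subrr normr0 addr_ge0|exact: le_trans h].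
rewrite -subr_le0; apply: (@le_lim _ _ (2 + 2 * d)) => e1 e10.
have [phi [tf pu pG]] := ua e1 e10; have f2 := test_L2 tf.
have [D [r [_ DO _ _ out]]] := test_out tf.
have s1 : 1 <= 1 + s by rewrite lerDl.
have sp : 0 < 1 + s by exact: lt_le_trans s1.
have := @dilation_n2 phi p s B e d (test_sub (fun _ _ => I) tf) s0 B0 pe
  (fun x nB => out x (fun d => nB (OB _ (DO _ d)))) hd.
have np i : n2p (partial i phi) <= n2p (G i) + e1.
  have pf2 := test_L2 (test_partial i tf).
  have := n2D (L2B pf2 (G2 i)) (G2 i); rewrite (_ : (fun x => _) = partial i phi); last first.
    by apply/funext => x; rewrite subrK.
  by move=> /le_trans; apply; rewrite addrC lerD2l; exact: pG.
move=> h.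
have fa := L2_aff p sp f2; have ua' := L2_aff p sp u2.
have t1 : n2p (fun x => u (aff p (1 + s) x) - phi (aff p (1 + s) x)) <= e1.
  rewrite n2BC; have := n2_aff p sp (L2B f2 u2) => ->.
  apply: le_trans pu; rewrite ler_piMl ?n2_ge0// invf_le1//.
have t2 := n2_split ua' fa u2; have t3 := n2_split fa f2 u2.
have t4 : d * (n2p (partial 0 phi) + n2p (partial 1 phi)) <= d * (n2p (G 0) + e1 + (n2p (G 1) + e1)).
  by apply: ler_wpM2l => //; apply: lerD; exact: np.
move: t1 t2 t3 t4 h pu; rewrite /comp.
set A1 := n2 _ (fun x => u _ - u x); set A2 := n2 _ (fun x => u _ - phi _).
set A4 := n2 _ (fun x => phi (aff _ _ x) - phi x); set A5 := n2 _ (fun x => phi (aff _ _ x) - u x).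
set A3 := n2 _ (fun x => phi x - u x).
move: (n2 _ (G 0)) (n2 _ (G 1)) (n2 _ (partial 0 phi)) (n2 _ (partial 1 phi)) => g0 g1 p0 p1; clear; lra.
Qed.

Lemma lap_arith (a0 a1 b0 b1 d0 d1 N e g0 g1 Y X : R) : a0 - b0 <= g0 * e -> a1 - b1 <= g1 * e ->
  (b0 - d0) + (b1 - d1) <= X -> X <= N * (e + Y) -> a0 + a1 - (d0 + d1) - N * Y <= (N + (g0 + g1)) * e.
Proof. rewrite !mulrDl mulrDr; lra. Qed.

Section Moll.
Variables (Om : set P) (x0 : P) (r0 B : R).
Hypotheses (cO : is_convex Om) (OB : Om `<=` box 0 B) (r00 : 0 < r0) (Bx : box x0 r0 `<=` Om).

(** u is evaluated at x + l (x - x0). Since Om is convex and contains a box around x0, this pulls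
    the support inside Om by a margin proportional to l, and mollification at radius l r0 / 2 stays
    within that margin. *)
Definition moll (l : R) u x : R := 1 * conv u (kr (l * r0 / 2)) (aff (- l * x0.1, - l * x0.2) (1 + l) x).

Lemma moll_out l u (x : P) e : 0 < l -> (forall y, ~ Om y -> u y = 0) -> 0 < e ->
  moll l u x != 0 -> exists y, [/\ Om y, `|(aff (- l * x0.1, - l * x0.2) (1 + l) x).1 - y.1| < l * r0 / 2 + e &
    `|(aff (- l * x0.1, - l * x0.2) (1 + l) x).2 - y.2| < l * r0 / 2 + e].
Proof.
move=> l0 uo e0; apply: contra_neqP => h; rewrite /moll conv_out ?mulr0 ?divr_gt0 ?mulr_gt0// => y h1 h2.
apply: contrapT => /eqP uy; apply: h; exists y; split.
- by apply: contrapT => /uo u0; rewrite u0 eqxx in uy.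
- by apply: lt_trans h1 _; rewrite ltrDl.
- by apply: lt_trans h2 _; rewrite ltrDl.
Qed.

(** x is the convex combination, with weights 1 / (1 + l) and l / (1 + l), of y and of a point w of
    the box around x0. *)
Lemma moll_Om l (x : P) y : 0 < l -> Om y ->
  `|(aff (- l * x0.1, - l * x0.2) (1 + l) x).1 - y.1| < l * r0 ->
  `|(aff (- l * x0.1, - l * x0.2) (1 + l) x).2 - y.2| < l * r0 -> Om x.
Proof.
move=> l0 Oy /= h1 h2.
have ln : l != 0 by rewrite gt_eqF.
have l1 : 0 < 1 + l by rewrite addr_gt0.
have l1n : 1 + l != 0 by rewrite gt_eqF.
pose w : P := (x0.1 + (- l * x0.1 + (1 + l) * x.1 - y.1) / l, x0.2 + (- l * x0.2 + (1 + l) * x.2 - y.2) / l).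
have Ow : Om w.
  have K (a q : R) : `|q| < l * r0 -> `|a + q / l - a| <= r0.
    by move=> h; rewrite addrAC subrr add0r normrM normfV (gtr0_norm l0) ler_pdivrMr// mulrC ltW.
  by apply: Bx; split; exact: K.
have -> : x = cmb y w (1 + l)^-1.
  by case: x {h1 h2 Ow} @w => a b w; rewrite /cmb/=; congr (_, _); field; rewrite l1n ln.
by apply: (cvxP Om).1 => //; rewrite invr_ge0 ltW//= invf_le1// lerDl ltW.
Qed.

Lemma moll_test l u G : 0 < l -> wpair Om u G -> test_function Om (moll l u) /\
  forall i, partial i (moll l u) = fun x => (1 + l) * conv (G i) (kr (l * r0 / 2)) (aff (- l * x0.1, - l * x0.2) (1 + l) x).
Proof.
move=> l0 hu; have [u2 G2 uo _] := hu; have [iu _] := wpair_itb OB hu.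
have rr : 0 < l * r0 / 2 by rewrite divr_gt0// mulr_gt0.
have kc := Ker_conv iu (kr_Ker (l * r0 / 2)).
have [km kp] := Ker_aff 1 (- l * x0.1, - l * x0.2) (1 + l) kc.
split; last first.
  move=> i; rewrite /moll kp; apply/funext => x; rewrite mul1r; congr (_ * _).
  rewrite -(wpair_conv _ _ rr hu); have [_ _ [C T] _] := KerP (kr_Ker (l * r0 / 2)).
  by have [e0 e1] := taylor2_partial (conv_taylor iu (kr_Ker _) T); case: (ord2P i) => ->; rewrite ?e0 ?e1.
pose D : set P := closure [set x | moll l u x != 0].
have DO : D `<=` Om.
  move=> x Dx; pose a : P := (- l * x0.1, - l * x0.2).
  (* Room for the closure of the support: 1/2 from the kernel and twice 1/8 from approximation stay
     below 1, in units of l r0. *)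
  pose e : R := l * r0 / 8; have e0 : 0 < e by rewrite divr_gt0// mulr_gt0.
  have l1 : 0 < 1 + l by rewrite addr_gt0.
  have d0 : 0 < e / (1 + l) by rewrite divr_gt0.
  have [x' [/= mx [h1 h2]]] : [set x | moll l u x != 0] `&` [set y : P | `|y.1 - x.1| < e / (1 + l) /\ `|y.2 - x.2| < e / (1 + l)] !=set0.
    by apply: Dx; apply/nbhs_boxP; exists (e / (1 + l)).
  have [y [Oy g1 g2]] := moll_out l0 (fun y n => (uo y n).1) e0 mx.
  have K (b c1 c2 d : R) : `|c2 - c1| < e / (1 + l) -> `|b + (1 + l) * c2 - d| < l * r0 / 2 + e -> `|b + (1 + l) * c1 - d| < l * r0.
    rewrite ltr_pdivlMr// -[X in _ * X](gtr0_norm l1) -normrM => q1 q2.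
    rewrite (_ : b + _ - d = (b + (1 + l) * c2 - d) - (c2 - c1) * (1 + l)); last by ring.
    apply: le_lt_trans (ler_normB _ _) _; apply: lt_trans (ltrD q2 q1) _.
    rewrite /e; have := mulr_gt0 l0 r00; move: (l * r0) => k; lra.
  by apply: (moll_Om l0 Oy); [exact: K h1 g1|exact: K h2 g2].
apply: (test_intro (D := D) (r := B) km) => //; first exact: closed_closure.
  by move=> x /DO/OB.
by move=> x nD; apply: contrapT => /eqP h; apply: nD; exact: subset_closure.
Qed.

(** In the plane the Dirichlet integral is invariant under dilations: the chain rule contributes 1 +
    l and the change of variables 1 / (1 + l). Averaging does not increase the norm. *)
Lemma moll_grad l u G i : 0 < l -> wpair Om u G -> n2p (partial i (moll l u)) <= n2p (G i).
Proof.
move=> l0 hu; have [_ G2 _ _] := hu; have [_ iG] := wpair_itb OB hu.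
have rr : 0 < l * r0 / 2 by rewrite divr_gt0// mulr_gt0.
have l1 : 0 < 1 + l by rewrite addr_gt0.
have c0 : 0 <= (1 + l)^-1 * n2p (G i) by rewrite mulr_ge0 ?n2_ge0// invr_ge0 ltW.
have [h1 h2] := @conv_n2 (G i) (fun=> 0) _ (- l * x0.1, - l * x0.2) (1 + l) _ rr l1 c0 (G2 i) (iG i) (L20 _)
  (ltac:(move=> z _ _; rewrite -(n2_aff (- l * x0.1 + z.1, - l * x0.2 + z.2) l1 (G2 i)); apply: eqle; congr n2; apply/funext => x; exact: subr0)).
have h3 : n2p (fun x => conv (G i) (kr (l * r0 / 2)) (aff (- l * x0.1, - l * x0.2) (1 + l) x)) <= (1 + l)^-1 * n2p (G i).
  by apply: le_trans h2; apply: eqle; congr n2; apply/funext => x; rewrite subr0.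
rewrite (moll_test l0 hu).2 (n2Z _ h1) (gtr0_norm l1); apply: le_trans (ler_wpM2l (ltW l1) h3) _.
by apply: eqle; rewrite mulrA mulfV ?mul1r// gt_eqF.
Qed.

Lemma moll_near l u G : 0 < l -> l <= 1 -> H10 Om u G ->
  n2p (fun x => moll l u x - u x) <= l * (3 * B + 2 * r0) * (n2p (G 0) + n2p (G 1)).
Proof.
move=> l0 l1 hu; have [u2 _ _ _] := hu; have [iu _] := wpair_itb OB (H10_wpair hu).
have rr : 0 < l * r0 / 2 by rewrite divr_gt0// mulr_gt0.
have sp : 0 < 1 + l by rewrite addr_gt0.
have [b1 b2] : box 0 B x0 by apply/OB/Bx; split; rewrite subrr normr0 ltW.
rewrite !subr0 in b1 b2; have B0 : 0 <= B by exact: le_trans b1.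
have lB : 0 <= l * (B + r0) by rewrite mulr_ge0 ?addr_ge0 ?(ltW l0)// ltW.
(* The displacement is at most l B from the centre, l r0 / 2 from the kernel and l (2 B + r0) from
   x, which ranges over an enlarged box. *)
pose d := l * (3 * B + 2 * r0); have d0 : 0 <= d.
  by rewrite /d mulr_ge0 ?(ltW l0)// addr_ge0// mulr_ge0// ltW.
have c0 : 0 <= d * (n2p (G 0) + n2p (G 1)) by rewrite mulr_ge0// addr_ge0 ?n2_ge0.
have [|_] := @conv_n2 u u _ (- l * x0.1, - l * x0.2) (1 + l) _ rr sp c0 u2 iu u2.
  move=> z z1 z2; apply: (H10_dilation OB hu (ltW l0) B0 (e := l * (B + r0))).
    have K (a b : R) : `|a| <= B -> `|b| < l * r0 / 2 -> `|- l * a + b| <= l * (B + r0).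
      move=> ha hb; apply: le_trans (ler_normD _ _) _; rewrite mulrDr; apply: lerD.
        by rewrite normrM normrN (gtr0_norm l0) ler_wpM2l// ltW.
      by apply: le_trans (ltW hb) _; have := mulr_gt0 l0 r00; lra.
    by split; exact: K.
  move=> x [x1 x2]; rewrite !subr0 in x1 x2.
  have K (a b c : R) : `|a| <= B -> `|b| < l * r0 / 2 -> `|c| <= B + l * (B + r0) -> `|- l * a + b + l * c| <= d.
    move=> ha hb hc; apply: le_trans (ler_normD _ _) _.
    have e1 : `|- l * a + b| <= l * B + l * r0 / 2.
      apply: le_trans (ler_normD _ _) _; apply: lerD; last exact: ltW.
      by rewrite normrM normrN (gtr0_norm l0) ler_wpM2l// ltW.
    have e2 : `|l * c| <= l * (2 * B + r0).
      rewrite normrM (gtr0_norm l0) ler_wpM2l ?(ltW l0)//; apply: le_trans hc _.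
      have : l * (B + r0) <= 1 * (B + r0) by rewrite ler_wpM2r// addr_ge0// ltW.
      lra.
    apply: le_trans (lerD e1 e2) _; by rewrite /d; have := mulr_gt0 l0 r00; lra.
  by split; exact: K.
by move=> h; apply: le_trans h; apply: eqle; congr n2; apply/funext => x; rewrite /moll mul1r.
Qed.

(* |grad m - G|^2 = |grad m|^2 - |G|^2 + 2 G . (G - grad m), where mollification after a dilation does
   not increase the Dirichlet integral and the last term is controlled by |m - u|. *)
Lemma moll_laplace u G N l : 0 < l -> l <= 1 -> H10 Om u G -> 0 <= N ->
  (forall phi, test_function Om phi -> \sum_i itgp (fun x => G i x * partial i phi x) <= N * n2p phi) ->
  \sum_i n2p (fun x => partial i (moll l u) x - G i x) ^+ 2 <=
    2 * (N * (l * (3 * B + 2 * r0) * (n2p (G 0) + n2p (G 1)))).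
Proof.
move=> l0 l1 hu N0 hN; have [u2 G2 _ ua] := hu; have [tm _] := moll_test l0 (H10_wpair hu).
have m2 := test_L2 tm; have pm2 i := test_L2 (test_partial i tm).
have near := moll_near l0 l1 hu.
(* The bound on the Laplacian admits test functions only, so it is applied to phi - moll with phi
   close to u. *)
have hgu : \sum_i itgp (fun x => G i x * G i x) - \sum_i itgp (fun x => G i x * partial i (moll l u) x) <=
    N * (l * (3 * B + 2 * r0) * (n2p (G 0) + n2p (G 1))).
  rewrite -subr_le0; apply: (@le_lim _ _ (N + (n2p (G 0) + n2p (G 1)))) => e e0.
  have [phi [tf pu pG]] := ua e e0; have f2 := test_L2 tf.
  have D i : itgp (fun x => G i x * G i x) - itgp (fun x => G i x * partial i phi x) <= n2p (G i) * e.
    have pf2 := test_L2 (test_partial i tf).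
    rewrite -(itgB (L2M (G2 i) (G2 i)) (L2M (G2 i) pf2)).
    rewrite (_ : (fun x => _) = fun x => G i x * (G i x - partial i phi x)); last by apply/funext => x; rewrite mulrBr.
    apply: le_trans (itg_mul_le (G2 i) (L2B (G2 i) pf2)) _; apply: ler_wpM2l; first exact: n2_ge0.
    by rewrite n2BC; exact: pG.
  have [td pd] := test_lin (-1) tm tf; have h := hN _ td.
  have E i : itgp (fun x => G i x * partial i (fun x => -1 * moll l u x + phi x) x) =
      itgp (fun x => G i x * partial i phi x) - itgp (fun x => G i x * partial i (moll l u) x).
    have pf2 := test_L2 (test_partial i tf); rewrite -(itgB (L2M (G2 i) pf2) (L2M (G2 i) (pm2 i))) pd.
    by congr itg; apply/funext => x; ring.
  have F : N * n2p (fun x => -1 * moll l u x + phi x) <= N * (e + n2p (fun x => moll l u x - u x)).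
    apply: ler_wpM2l => //; rewrite (_ : (fun x => _) = fun x => (phi x - u x) + (u x - moll l u x)); last first.
      by apply/funext => x; ring.
    by apply: le_trans (n2D (L2B f2 u2) (L2B u2 m2)) _; rewrite (n2BC _ u); exact: lerD.
  have {}F := le_trans F (ler_wpM2l N0 (lerD (lexx e) near)).
  by rewrite sum2 (E 0) (E 1) in h; rewrite 2!sum2; exact (lap_arith (D 0) (D 1) h F).
have K i : n2p (fun x => partial i (moll l u) x - G i x) ^+ 2 <=
    2 * (itgp (fun x => G i x * G i x) - itgp (fun x => G i x * partial i (moll l u) x)).
  have E : (fun x => (partial i (moll l u) x - G i x) ^+ 2) = fun x => partial i (moll l u) x ^+ 2 -
      (2 * (G i x * partial i (moll l u) x) - G i x ^+ 2).
    by apply/funext => x; move: (partial i _ x) (G i x) => a b; ring.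
  rewrite n2K E; have iGm := L2M (G2 i) (pm2 i).
  rewrite (itgB (pm2 i).2 (itbB (itbZ 2 iGm) (G2 i).2)) (itgB (itbZ 2 iGm) (G2 i).2) (itgZ 2 iGm) -!n2K.
  have := moll_grad i l0 (H10_wpair hu); rewrite -(@ler_pXn2r _ 2) ?nnegrE ?n2_ge0//.
  by move: (n2 _ _ ^+ 2) (n2 _ _ ^+ 2) (itg _ _) => a b q; lra.
apply: le_trans (ler_sum _ (fun i _ => K i)) _; rewrite -mulr_sumr ler_pM2l// sumrB; exact: hgu.
Qed.

(** The kernel of radius l r0 / 2 contributes l^-4; the factor 4 bounds (1 + l)^2, from the
    dilation. *)
Lemma moll_taylor : exists2 C, 0 <= C & forall l u G, 0 < l -> l <= 1 -> H10 Om u G ->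
  taylor2 (moll l u) (partial 0 (moll l u)) (partial 1 (moll l u)) (C * l ^- 4 * itgp (fun x => `|u x|)).
Proof.
have [C C0 hC] := kr_taylor; exists (4 * C * (r0 / 2) ^- 4).
  by rewrite mulr_ge0 ?mulr_ge0// invr_ge0 exprn_ge0// divr_ge0// ltW.
move=> l u G l0 l1 hu; have [iu _] := wpair_itb OB (H10_wpair hu).
have rr : 0 < l * r0 / 2 by rewrite divr_gt0// mulr_gt0.
have T := taylor2_aff 1 (- l * x0.1, - l * x0.2) (1 + l) (conv_taylor iu (kr_Ker _) (hC _ rr)).
have [e0 e1] := taylor2_partial T; rewrite -/(moll l u) in T e0 e1.
rewrite e0 e1 => x y; apply: le_trans (T x y) _; apply: ler_wpM2r; first by rewrite addr_ge0 ?sqr_ge0.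
rewrite normr1 mul1r mulrA; apply: ler_wpM2r; first exact: itg_ge0.
have -> : (l * r0 / 2) ^- 4 = (r0 / 2) ^- 4 * l ^- 4 by rewrite -mulrA exprMn invfM mulrC.
rewrite 2!mulrA; apply: ler_wpM2r; first by rewrite invr_ge0 exprn_ge0// ltW.
apply: ler_wpM2r; first by rewrite invr_ge0 exprn_ge0// divr_ge0// ltW.
apply: ler_wpM2r => //; rewrite (_ : 4 = 2 ^+ 2 :> R); last by ring.
by rewrite lerXn2r ?nnegrE//; lra.
Qed.

End Moll.

End MollifyH10.

(** * Integration along coordinate lines *)

Section Lines.
Implicit Types (p : P) (h v k : P -> R) (c M : R) (i : 'I_2) (D : set P).
Implicit Types (H : 'I_2 -> P -> R) (a b : measurableTypeR R -> R).

Lemma tens_int a b : mfun a -> mfun b -> (forall s, 0 <= a s) -> (forall s, 0 <= b s) ->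
  (\int[leb2]_x (a x.1 * b x.2)%:E = (\int[leb]_s (a s)%:E) * \int[leb]_s (b s)%:E)%E.
Proof.
move=> ma mb a0 b0.
have mab : mfun (fun x : P => (a x.1 * b x.2)%:E).
  apply/measurable_EFinP; apply: measurable_funM; first by apply: (measurableT_comp ma); exact: measurable_fst.
  by apply: (measurableT_comp mb); exact: measurable_snd.
rewrite tonelli12//=; last by move=> x; rewrite lee_fin mulr_ge0.
have B0 : (0 <= \int[leb]_s (b s)%:E)%E by apply: integral_ge0 => s _; rewrite lee_fin.
under eq_integral => s _.
  under eq_integral do rewrite EFinM.
  rewrite ge0_integralZl//; [|exact/measurable_EFinP|by move=> t _; rewrite lee_fin|by rewrite lee_fin].
  rewrite muleC; over.
rewrite ge0_integralZl//; [by rewrite muleC|exact/measurable_EFinP|by move=> t _; rewrite lee_fin].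
Qed.

Section Marginal.
Variables (h : P -> R) (M r : R).
Hypotheses (mh : mfun h) (h0 : forall x, 0 <= h x) (hM : forall x, h x <= M).
Hypotheses (hr : forall x, ~ box 0 r x -> h x = 0).

Definition marg0 (c : measurableTypeR R) : R := fine (\int[leb]_t (h (t, c))%:E)%E.
Definition marg1 (c : measurableTypeR R) : R := fine (\int[leb]_t (h (c, t))%:E)%E.

Let itv_bnd (w : measurableTypeR R -> R) : mfun w -> (forall t, 0 <= w t <= M) ->
  (forall t, r < `|t| -> w t = 0) -> (\int[leb]_t (w t)%:E < +oo)%E.
Proof.
move=> mw wM w0; have M0 : 0 <= M by exact: le_trans (h0 0) (hM 0).
pose I : set (measurableTypeR R) := `[- r, r]%classic.
have mI : measurable I by exact: measurable_itv.
apply: (@le_lt_trans _ _ (\int[leb]_t (M * \1_I t)%:E)%E).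
  apply: ge0_le_integral => //.
  - by move=> t _; rewrite lee_fin; case/andP: (wM t).
  - exact/measurable_EFinP.
  - by apply/measurable_EFinP/measurable_funM => //; exact: measurable_indic.
  move=> t _; rewrite lee_fin indicE; case: (ltP r `|t|) => [/w0->|tr].
    by rewrite mulr_ge0.
  have It : I t by rewrite /I/= in_itv/= -ler_norml.
  by rewrite mem_set// mulr1; case/andP: (wM t).
under eq_integral do rewrite EFinM.
rewrite ge0_integralZl_EFin//; last by apply/measurable_EFinP; exact: measurable_indic.
have -> : (\int[leb]_t (\1_I t)%:E = leb I)%E by rewrite integral_indic// setIT.
rewrite lebesgue_measure_itv/= -EFinD.
by case: ifP => _; rewrite -?EFinM ?mule0 ltry.
Qed.

Lemma marg0P : [/\ mfun marg0, forall c, 0 <= marg0 c,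
  forall c, (marg0 c)%:E = (\int[leb]_t (h (t, c))%:E)%E & (\int[leb]_c (marg0 c)%:E = (itgp h)%:E)%E].
Proof.
have mE : mfun (EFin \o h) by exact/measurable_EFinP.
have E c : (marg0 c)%:E = (\int[leb]_t (h (t, c))%:E)%E.
  rewrite /marg0 fineK// ge0_fin_numE; last by apply: integral_ge0 => t _; rewrite lee_fin.
  apply: itv_bnd => [|t|t tr]; [|by rewrite h0 hM|].
    by apply: (measurableT_comp mh); apply: measurable_fun_pair.
  by apply: hr => -[/=]; rewrite subr0 leNgt tr.
have h0' (x : P) : (0 <= (EFin \o h) x)%E by rewrite lee_fin.
have hm : itbp h by apply: (itb_bnd (c := M) mh _ hr) => x; rewrite ger0_norm.
split=> // [|c|].
- by apply: (measurableT_comp (fine_measurable measurableT)) (@measurable_fun_fubini_tonelli_G _ _ _ _ R leb (EFin \o h) mE h0').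
- by rewrite -lee_fin E; apply: integral_ge0 => t _; rewrite lee_fin.
by rewrite itgE// (tonelli21 mE h0'); apply: eq_integral => c _; rewrite E.
Qed.

Lemma marg1P : [/\ mfun marg1, forall c, 0 <= marg1 c,
  forall c, (marg1 c)%:E = (\int[leb]_t (h (c, t))%:E)%E & (\int[leb]_c (marg1 c)%:E = (itgp h)%:E)%E].
Proof.
have mE : mfun (EFin \o h) by exact/measurable_EFinP.
have E c : (marg1 c)%:E = (\int[leb]_t (h (c, t))%:E)%E.
  rewrite /marg1 fineK// ge0_fin_numE; last by apply: integral_ge0 => t _; rewrite lee_fin.
  apply: itv_bnd => [|t|t tr]; [|by rewrite h0 hM|].
    by apply: (measurableT_comp mh); apply: measurable_fun_pair.
  by apply: hr => -[_ /=]; rewrite subr0 leNgt tr.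
have h0' (x : P) : (0 <= (EFin \o h) x)%E by rewrite lee_fin.
have hm : itbp h by apply: (itb_bnd (c := M) mh _ hr) => x; rewrite ger0_norm.
split=> // [|c|].
- by apply: (measurableT_comp (fine_measurable measurableT)) (@measurable_fun_fubini_tonelli_F _ _ _ _ R leb (EFin \o h) mE h0').
- by rewrite -lee_fin E; apply: integral_ge0 => t _; rewrite lee_fin.
by rewrite itgE// (tonelli12 mE h0'); apply: eq_integral => c _; rewrite E.
Qed.

End Marginal.

Lemma ftc_le (w dw : R -> R) s t : (forall t, is_derive t (1 : R) w (dw t)) -> continuous dw -> s <= t ->
  (`|w t - w s|%:E <= \int[leb]_(x in `[s, t]) `|dw x|%:E)%E.
Proof.
move=> h cd; rewrite le_eqVlt => /predU1P[<-|st].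
  by rewrite subrr normr0; apply: integral_ge0 => x _; rewrite lee_fin.
have cw : continuous w by move=> x /=; apply: differentiable_continuous; apply/derivable1_diffP; case: (h x).
have dE (x : R) : w^`()%classic x = dw x by rewrite derive1E; case: (h x).
have := @continuous_FTC2 R dw w s t st (continuous_subspaceT cd).
move=> /(_ _ (fun w' _ => dE w')) E.
have {}E : (\int[leb]_(x in `[s, t]) (dw x)%:E = (w t)%:E - (w s)%:E)%E.
  apply: E; split; [by move=> x _; case: (h x)|exact: cvg_at_right_filter (cw s)|exact: cvg_at_left_filter (cw t)].
rewrite -[(`|_|%:E)%E]/(`|(w t)%:E - (w s)%:E|)%E -E; apply: le_abse_integral => //.
by apply/measurable_EFinP; apply: measurable_funTS; exact: continuous_measurable_fun.
Qed.

Lemma line_cont0 (g : P -> R^o) : continuous g -> forall c, continuous (fun t : R => g (t, c)).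
Proof.
move=> cg c t; apply: (@cvg_comp _ _ _ (fun t : R => (t, c) : P) g _ (nbhs ((t, c) : P))); last exact: cg.
move=> U /nbhs_boxP[r r0 h]; apply/nbhs_ballP; exists r => // s hs; apply: h => /=; last by rewrite subrr normr0.
by rewrite distrC.
Qed.

Lemma line_cont1 (g : P -> R^o) : continuous g -> forall c, continuous (fun t : R => g (c, t)).
Proof.
move=> cg c t; apply: (@cvg_comp _ _ _ (fun t : R => (c, t) : P) g _ (nbhs ((c, t) : P))); last exact: cg.
move=> U /nbhs_boxP[r r0 h]; apply/nbhs_ballP; exists r => // s hs; apply: h => /=; first by rewrite subrr normr0.
by rewrite distrC.
Qed.

(** C^1 functions supported in a box, with the gradient as data. Besides test functions the class
    contains their squares, through which [gagliardo] reaches L^4. *)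
Definition c1 f G r := [/\ 0 <= r, continuous (f : P -> R^o) /\ forall i, continuous (G i : P -> R^o),
  forall x, ~ box 0 r x -> f x = 0 /\ forall i, G i x = 0,
  forall s c, is_derive s (1 : R) (fun t : R => f (t, c)) (G 0 (s, c)) &
  forall s c, is_derive s (1 : R) (fun t : R => f (c, t)) (G 1 (c, s))].

Lemma c1_test Om phi : test_function Om phi -> exists r, c1 phi (fun i => partial i phi) r.
Proof.
move=> tp; have kp := test_Ker tp; have [kpi _ [C T] _] := KerP kp.
have [D [r [_ _ r0 DB out]]] := test_out tp; exists r; split; first exact: r0.
- by split=> [|i]; [exact: Ker_cont|exact: Ker_cont].
- by move=> x nB; apply: out => /DB.
- move=> s c; apply: (@quad_derive _ _ _ _ C) => h; have := T (s, c) (h + s, c).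
  by rewrite /= subrr addrK mulr0 addr0 expr0n addr0.
- move=> s c; apply: (@quad_derive _ _ _ _ C) => h; have := T (c, s) (c, h + s).
  by rewrite /= subrr addrK mulr0 add0r expr0n add0r.
Qed.

Lemma c1_sqr f G r : c1 f G r -> c1 (fun x => f x * f x) (fun i x => 2 * (f x * G i x)) r.
Proof.
move=> [r0 [cf cG] out d0 d1]; split=> //.
- split=> [x|i x]; first by apply: cvgM; exact: cf.
  by apply: cvgM; [exact: cvg_cst|apply: cvgM; [exact: cf|exact: cG]].
- by move=> x nB; have [-> _] := out x nB; split=> [|i]; rewrite mul0r ?mulr0.
- by move=> s c; apply: (derM (d0 s c) (d0 s c)); ring.
- by move=> s c; apply: (derM (d1 s c) (d1 s c)); ring.
Qed.

Lemma c1_bnd f G r i : c1 f G r -> exists2 M, 0 <= M & forall x, `|G i x| <= M.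
Proof.
move=> [r0 [_ cG] out _ _]; have [M hM] := cont_bnd (@box_compact 0 r) (cG i) (fun x nB => (out x nB).2 i).
by exists M => //; exact: le_trans (hM 0).
Qed.

(* Gagliardo-Nirenberg: f(x)^2 is at most the product of the integrals of |df| over the two lines through x. *)
Lemma gagliardo f G r : c1 f G r ->
  itgp (fun x => f x ^+ 2) <= itgp (fun x => `|G 0 x|) * itgp (fun x => `|G 1 x|).
Proof.
move=> hc; have [r0 [cf cG] out d0 d1] := hc.
have [M0 M00 b0] := c1_bnd 0 hc; have [M1 M10 b1] := c1_bnd 1 hc.
have mG i : mfun (fun x => `|G i x|) by apply: measurableT_comp => //; exact: cont_meas.
have z i x : ~ box 0 r x -> `|G i x| = 0 by move=> nB; rewrite (out x nB).2 normr0.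
have [ma a0 aE aI] := marg0P (mG 0) (fun x => normr_ge0 _) b0 (z 0).
have [mb c0 bE bI] := marg1P (mG 1) (fun x => normr_ge0 _) b1 (z 1).
set al := marg0 _ in ma a0 aE aI; set be := marg1 _ in mb c0 bE bI.
have cGt0 := line_cont0 (cG 0); have cGt1 := line_cont1 (cG 1).
(* A starting point outside the box, where f vanishes, so that the fundamental theorem bounds |f|
   itself. *)
have far t : exists2 s, s <= t & r < `|s|.
  exists (- (`|t| + r + 1)); first by have := ler_norm (- t); rewrite normrN; lra.
  by rewrite normrN ger0_norm ?addr_ge0//; have := normr_ge0 t; lra.
have A x : `|f x| <= al x.2.
  case: x => t c /=; have [s st rs] := far t; rewrite -lee_fin aE.
  have := ftc_le (fun t => d0 t c) (cGt0 c) st; rewrite (out (s, c) _).1 ?subr0 => [h|[/=]]; last first.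
    by rewrite subr0 leNgt rs.
  apply: le_trans h _; rewrite integral_mkcond; apply: ge0_le_integral => //.
  - by move=> w _; rewrite /patch; case: ifP.
  - apply/(measurable_restrictT _ _).1 => //; apply: measurable_funTS; apply/measurable_EFinP.
    by apply: (measurableT_comp (mG 0)); apply: measurable_fun_pair.
  - by apply/measurable_EFinP; apply: (measurableT_comp (mG 0)); apply: measurable_fun_pair.
  - by move=> w _; rewrite /patch; case: ifP => // _; rewrite lee_fin.
have B x : `|f x| <= be x.1.
  case: x => c t /=; have [s st rs] := far t; rewrite -lee_fin bE.
  have := ftc_le (fun t => d1 t c) (cGt1 c) st; rewrite (out (c, s) _).1 ?subr0 => [h|[_ /=]]; last first.
    by rewrite subr0 leNgt rs.
  apply: le_trans h _; rewrite integral_mkcond; apply: ge0_le_integral => //.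
  - by move=> w _; rewrite /patch; case: ifP.
  - apply/(measurable_restrictT _ _).1 => //; apply: measurable_funTS; apply/measurable_EFinP.
    by apply: (measurableT_comp (mG 1)); apply: measurable_fun_pair.
  - by apply/measurable_EFinP; apply: (measurableT_comp (mG 1)); apply: measurable_fun_pair.
  - by move=> w _; rewrite /patch; case: ifP => // _; rewrite lee_fin.
have [Mf bf] := cont_bnd (@box_compact 0 r) cf (fun x nB => (out x nB).1).
have mf := cont_meas cf.
have if2 : itbp (fun x => f x ^+ 2).
  apply: (itb_bnd (c := Mf ^+ 2) (x := 0) (r := r)) => [|x|x nB]; first exact: measurable_funX.
    by rewrite normrX lerXn2r ?nnegrE// (le_trans _ (bf 0)).
  by rewrite (out x nB).1 expr0n.
rewrite -lee_fin itgE// EFinM -aI -bI muleC -tens_int//; apply: ge0_le_integral => //.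
- by move=> x _; rewrite lee_fin sqr_ge0.
- by apply/measurable_EFinP; exact: measurable_funX.
- apply/measurable_EFinP; apply: measurable_funM; first by apply: (measurableT_comp mb); exact: measurable_fst.
  by apply: (measurableT_comp ma); exact: measurable_snd.
by move=> x _; rewrite lee_fin -real_normK ?num_real// expr2 mulrC; apply: ler_pM.
Qed.

End Lines.

(** * Poincaré inequalities and the L^4 bound in W^{1,2}_0 *)

Section H10Estimates.
Implicit Types (p : P) (h v k : P -> R) (c M : R) (i : 'I_2) (D : set P).
Implicit Types H : 'I_2 -> P -> R.

Definition ibox p r x : R := \1_(box p r) x.

Lemma ibox_L2 p r : L2p (ibox p r).
Proof.
have m1 : mfun (ibox p r) by apply: measurable_indic; exact: box_meas.
split=> //; apply: (@itb_bnd _ 1 p r); first exact: measurable_funX.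
  by move=> y; rewrite /ibox indicE; case: (_ \in _); rewrite ?expr1n ?expr0n ?normr1 ?normr0.
by move=> y nB; rewrite /ibox indicE memNset// expr0n.
Qed.

Lemma ibox1 p r x : box p r x -> ibox p r x = 1.
Proof. by move=> h; rewrite /ibox indicE mem_set. Qed.

Lemma ibox0 p r x : ~ box p r x -> ibox p r x = 0.
Proof. by move=> h; rewrite /ibox indicE memNset. Qed.

Lemma ibox_ge0 p r x : 0 <= ibox p r x <= 1.
Proof. by rewrite /ibox indicE; case: (_ \in _); rewrite ?lexx ler01. Qed.

Lemma n2_ibox p r : 0 <= r -> n2p (ibox p r) <= 2 * r.
Proof.
move=> r0; rewrite -[leRHS]mul1r; apply: (n2_bnd r0 ler01 _ _ _).2.
- by case: (ibox_L2 p r).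
- by move=> y; have /andP[h0 h1] := ibox_ge0 p r y; rewrite ger0_norm.
- by move=> y; exact: ibox0.
Qed.

Lemma itg_ibox_abs p r f : 0 <= r -> L2p f -> itgp (fun x => ibox p r x * `|f x|) <= 2 * r * n2p f.
Proof.
move=> r0 lf; apply: le_trans (itg_mul_le (ibox_L2 p r) (L2_norm lf)) _.
have -> : n2p (fun x => `|f x|) = n2p f.
  by apply: n2_abs.
by apply: ler_wpM2r (n2_ibox p r0); exact: n2_ge0.
Qed.

Definition weight p r M k := [/\ mfun k, (forall x, 0 <= k x <= M),
  (forall x, ~ box p r x -> k x = 0) & itgp k = 1].

Lemma weight_L2 p r M k : weight p r M k -> L2p k.
Proof.
move=> [mk kM k0 _]; split=> //; apply: (itb_bnd (c := M ^+ 2) (x := p) (r := r)); first exact: measurable_funX.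
  move=> x; have /andP[h0 h1] := kM x; rewrite ger0_norm ?sqr_ge0// lerXn2r ?nnegrE//; exact: le_trans h1.
by move=> x /k0 ->; rewrite expr0n.
Qed.

Lemma weight_itb p r M k : weight p r M k -> itbp k.
Proof.
by move=> [mk kM k0 _]; apply: (itb_bnd mk _ k0 (c := M)) => x; have /andP[h0 h1] := kM x; rewrite ger0_norm.
Qed.

(** From x to y through the corner (y.1, x.2): the oscillation is bounded by a line integral
    depending on x.2 alone plus one depending on y.1 alone. Such bounds can be averaged in x and y
    separately. *)
Lemma avg_line f G r0 p r : c1 f G r0 -> 0 <= r -> exists a b : measurableTypeR R -> R,
  [/\ mfun a, mfun b, (forall s, 0 <= a s) /\ (forall s, 0 <= b s),
   (\int[leb]_s (a s)%:E = (itgp (fun x => ibox p r x * `|G 0 x|))%:E)%E /\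
   (\int[leb]_s (b s)%:E = (itgp (fun x => ibox p r x * `|G 1 x|))%:E)%E &
   forall x y, box p r x -> box p r y -> f x - f y <= a x.2 + b y.1].
Proof.
move=> hc rr; have [r00 [cf cG] out d0 d1] := hc.
have mh i : mfun (fun x => ibox p r x * `|G i x|).
  by apply: measurable_funM; [case: (ibox_L2 p r)|apply: measurableT_comp => //; exact: cont_meas].
have h0 i x : 0 <= ibox p r x * `|G i x| by rewrite mulr_ge0//; case/andP: (ibox_ge0 p r x).
have [M hM] : exists M, forall i x, ibox p r x * `|G i x| <= M.
  have [M0 _ b0] := c1_bnd 0 hc; have [M1 _ b1] := c1_bnd 1 hc; exists (Num.max M0 M1) => i x.
  apply: (@le_trans _ _ `|G i x|); first by rewrite ler_piMl//; case/andP: (ibox_ge0 p r x).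
  by case: (ord2P i) => ->; rewrite le_max ?b0 ?b1 ?orbT.
have z i x : ~ box 0 r0 x -> ibox p r x * `|G i x| = 0 by move=> nB; rewrite (out x nB).2 normr0 mulr0.
have [ma a0 aE aI] := marg0P (mh 0) (h0 0) (hM 0) (z 0).
have [mb b0 bE bI] := marg1P (mh 1) (h0 1) (hM 1) (z 1).
exists (marg0 (fun x => ibox p r x * `|G 0 x|)), (marg1 (fun x => ibox p r x * `|G 1 x|)); split=> //.
have between (a b c : R) : `|b - a| <= r -> `|c - a| <= r -> forall s, b <= s <= c -> `|s - a| <= r.
  move=> h1 h2 s /andP[? ?]; move: h1 h2; rewrite !ler_distl => /andP[? ?] /andP[? ?]; apply/andP; split; lra.
have E0 (s t : R) c : s <= t -> box p r (s, c) -> box p r (t, c) ->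
    `|f (t, c) - f (s, c)| <= marg0 (fun x => ibox p r x * `|G 0 x|) c.
  move=> st [/= s1 s2] [/= t1 t2]; rewrite -lee_fin aE.
  apply: le_trans (ftc_le (fun t => d0 t c) (line_cont0 (cG 0) (c := c)) st) _.
  rewrite integral_mkcond; apply: ge0_le_integral => //.
  - by move=> w _; rewrite /patch; case: ifP.
  - apply/(measurable_restrictT _ _).1 => //; apply: measurable_funTS; apply/measurable_EFinP/measurableT_comp => //.
    by apply: (measurableT_comp (cont_meas (cG 0))); apply: measurable_fun_pair.
  - by apply/measurable_EFinP; apply: (measurableT_comp (mh 0)); apply: measurable_fun_pair.
  move=> w _; rewrite /patch; case: ifPn => [/set_mem/=|_]; last by rewrite lee_fin.
  by rewrite in_itv/= => h; rewrite lee_fin ibox1 ?mul1r//; split=> //=; exact: between h.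
have E1 (s t : R) c : s <= t -> box p r (c, s) -> box p r (c, t) ->
    `|f (c, t) - f (c, s)| <= marg1 (fun x => ibox p r x * `|G 1 x|) c.
  move=> st [/= s1 s2] [/= t1 t2]; rewrite -lee_fin bE.
  apply: le_trans (ftc_le (fun t => d1 t c) (line_cont1 (cG 1) (c := c)) st) _.
  rewrite integral_mkcond; apply: ge0_le_integral => //.
  - by move=> w _; rewrite /patch; case: ifP.
  - apply/(measurable_restrictT _ _).1 => //; apply: measurable_funTS; apply/measurable_EFinP/measurableT_comp => //.
    by apply: (measurableT_comp (cont_meas (cG 1))); apply: measurable_fun_pair.
  - by apply/measurable_EFinP; apply: (measurableT_comp (mh 1)); apply: measurable_fun_pair.
  move=> w _; rewrite /patch; case: ifPn => [/set_mem/=|_]; last by rewrite lee_fin.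
  by rewrite in_itv/= => h; rewrite lee_fin ibox1 ?mul1r//; split=> //=; exact: between h.
move=> [x1 x2] [y1 y2] bx by_ /=.
have bm : box p r (y1, x2) by case: bx by_ => _ ? [? _]; split.
rewrite (_ : f _ - f _ = (f (x1, x2) - f (y1, x2)) + (f (y1, x2) - f (y1, y2))); last by rewrite addrA subrK.
apply: lerD; apply: le_trans (ler_norm _) _.
  have [h|h] := leP x1 y1; first by rewrite distrC; exact: E0.
  by apply: E0 => //; exact: ltW.
have [h|h] := leP x2 y2; first by rewrite distrC; exact: E1.
by apply: E1 => //; exact: ltW.
Qed.

Lemma leb_itv_le (a r : R) : 0 <= r -> leb `[a - r, a + r]%classic = (2 * r)%:E.
Proof.
move=> r0; rewrite lebesgue_measure_itv/= lte_fin; case: ltP => h; rewrite -?EFinB.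
  by congr EFin; ring.
by congr EFin; lra.
Qed.

Lemma weight_marg p r M k (a : measurableTypeR R -> R) A : 0 <= r -> weight p r M k -> mfun a ->
  (forall s, 0 <= a s) -> (\int[leb]_s (a s)%:E = A%:E)%E ->
  [/\ itbp (fun x => k x * a x.1), itbp (fun x => k x * a x.2),
   itgp (fun x => k x * a x.1) <= M * (2 * r) * A & itgp (fun x => k x * a x.2) <= M * (2 * r) * A].
Proof.
move=> r0 [mk kM k0 _] ma a0 aA; have M0 : 0 <= M by have /andP[] := kM 0; exact: le_trans.
pose I j : set (measurableTypeR R) := `[j - r, j + r]%classic.
have mI j : measurable (I j) by exact: measurable_itv.
have m1 j : mfun (\1_(I j) : measurableTypeR R -> R) by exact: measurable_indic.
have q0 j s : 0 <= (\1_(I j) s : R) by rewrite indicE.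
have iI j : (\int[leb]_s ((\1_(I j) s)%:E) = (2 * r)%:E)%E.
  by rewrite integral_indic// setIT; exact: leb_itv_le.
have A0 : 0 <= A by rewrite -lee_fin -aA; apply: integral_ge0 => s _; rewrite lee_fin.
have dom x : k x <= M * (\1_(I p.1) x.1 * \1_(I p.2) x.2).
  have [h|h] := pselect (box p r x); last by rewrite k0// mulr_ge0// mulr_ge0.
  case: (h) => h1 h2; rewrite !indicE !mem_set ?mulr1//=; first by have /andP[] := kM x.
    by rewrite /I/= in_itv/= -ler_distl.
  by rewrite /I/= in_itv/= -ler_distl.
have q1 j s : (\1_(I j) s : R) <= 1 by rewrite indicE; case: (_ \in _).
have mf : mfun (fun x : P => a x.1) by apply: (measurableT_comp ma); exact: measurable_fst.
have ms : mfun (fun x : P => a x.2) by apply: (measurableT_comp ma); exact: measurable_snd.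
have mfa j : mfun (fun s : measurableTypeR R => \1_(I j) s * a s) by apply: measurable_funM => //; exact: m1.
have ia j : (\int[leb]_s (\1_(I j) s * a s)%:E <= A%:E)%E.
  rewrite -aA; apply: ge0_le_integral => //.
  - by move=> s _; rewrite lee_fin mulr_ge0.
  - exact/measurable_EFinP.
  - exact/measurable_EFinP.
  by move=> s _; rewrite lee_fin ler_piMl.
have key (F : P -> R) : mfun F -> (forall x, 0 <= F x) ->
   (\int[leb2]_x (F x)%:E <= (M * (2 * r) * A)%:E)%E -> itbp F /\ itgp F <= M * (2 * r) * A.
  move=> mF F0 le; have iF : itbp F.
    apply: itbP => //; apply: le_lt_trans (ltry (M * (2 * r) * A)); apply: le_trans le; apply: eqle.
    by apply: eq_integral => x _; rewrite ger0_norm.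
  by split=> //; rewrite -lee_fin itgE.
have k00 x : 0 <= k x by case/andP: (kM x).
have tens (a1 a2 : measurableTypeR R -> R) (F : P -> R) A1 A2 : mfun a1 -> mfun a2 ->
   (forall s, 0 <= a1 s) -> (forall s, 0 <= a2 s) -> (\int[leb]_s (a1 s)%:E <= A1%:E)%E -> (\int[leb]_s (a2 s)%:E <= A2%:E)%E ->
   mfun F -> (forall x, 0 <= F x) -> (forall x, F x <= M * (a1 x.1 * a2 x.2)) ->
   (\int[leb2]_x (F x)%:E <= (M * (A1 * A2))%:E)%E.
  move=> n1 n2 p1 p2 l1 l2 mF F0 FM.
  have mt : mfun (fun x : P => a1 x.1 * a2 x.2).
    apply: measurable_funM; first by apply: (measurableT_comp n1); exact: measurable_fst.
    by apply: (measurableT_comp n2); exact: measurable_snd.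
  apply: (@le_trans _ _ (\int[leb2]_x (M * (a1 x.1 * a2 x.2))%:E)%E).
    apply: ge0_le_integral => //.
    - by move=> x _; rewrite lee_fin.
    - exact/measurable_EFinP.
    - by apply/measurable_EFinP; exact: measurable_funM.
    - by move=> x _; rewrite lee_fin.
  under eq_integral do rewrite EFinM.
  rewrite ge0_integralZl//; [|exact/measurable_EFinP|by move=> x _; rewrite lee_fin mulr_ge0].
  rewrite tens_int// EFinM; apply: lee_wpmul2l; first by rewrite lee_fin.
  by rewrite EFinM; apply: lee_pmul => //; apply: integral_ge0 => s _; rewrite lee_fin.
have [h1 h2] : itbp (fun x => k x * a x.1) /\ itgp (fun x => k x * a x.1) <= M * (2 * r) * A.
  apply: key; [exact: measurable_funM|by move=> x; exact: mulr_ge0|].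
  rewrite (_ : M * (2 * r) * A = M * (A * (2 * r))); last by ring.
  apply: (tens (fun s => \1_(I p.1) s * a s) (\1_(I p.2))) => //.
  - by move=> s; exact: mulr_ge0.
  - by rewrite iI.
  - exact: measurable_funM.
  - by move=> x; exact: mulr_ge0.
  - by move=> x; rewrite mulrAC mulrA; apply: ler_wpM2r.
have [h3 h4] : itbp (fun x => k x * a x.2) /\ itgp (fun x => k x * a x.2) <= M * (2 * r) * A.
  apply: key; [exact: measurable_funM|by move=> x; exact: mulr_ge0|].
  rewrite -mulrA; apply: (tens (\1_(I p.1)) (fun s => \1_(I p.2) s * a s)) => //.
  - by move=> s; exact: mulr_ge0.
  - by rewrite iI.
  - exact: measurable_funM.
  - by move=> x; exact: mulr_ge0.
  - by move=> x; rewrite !mulrA; apply: ler_wpM2r => //; rewrite -mulrA.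
by split.
Qed.

(** An L^1 Poincaré inequality in the form of a comparison of two averages: [avg_line] is averaged
    against k in x and against k' in y. *)
Lemma avg_c1 f G r0 p r M k k' : c1 f G r0 -> 0 <= r -> weight p r M k -> weight p r M k' ->
  itgp (fun x => k x * f x) - itgp (fun x => k' x * f x) <=
  M * (2 * r) * (itgp (fun x => ibox p r x * `|G 0 x|) + itgp (fun x => ibox p r x * `|G 1 x|)).
Proof.
move=> hc rr wk wk'; have [a [b [ma mb [a0 b0] [aE bE] ab]]] := avg_line p hc rr.
have [_ ia _ la] := weight_marg rr wk ma a0 aE; have [ib _ lb _] := weight_marg rr wk' mb b0 bE.
have [r00 [cf _] out _ _] := hc; have mf := cont_meas cf.
have [Mf bf] := cont_bnd (@box_compact 0 r0) cf (fun x nB => (out x nB).1).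
have f2 : L2p f.
  split=> //; apply: (itb_bnd (c := Mf ^+ 2) (x := 0) (r := r0)); first exact: measurable_funX.
    by move=> x; rewrite normrX lerXn2r ?nnegrE// (le_trans _ (bf 0)).
  by move=> x nB; rewrite (out x nB).1 expr0n.
have i1 := L2M (weight_L2 wk) f2; have i2 := L2M (weight_L2 wk') f2.
have ik := weight_itb wk; have ik' := weight_itb wk'.
case: wk wk' => mk kM k0 k1 [mk' kM' k0' k1'].
set c := itgp (fun x => k x * f x) - itgp (fun x => k x * a x.2).
have cy y : box p r y -> c <= f y + b y.1.
  move=> By; rewrite /c -(itgB i1 ia) -[leRHS]mulr1 -k1 -(itgZ _ ik); apply: itg_le; [exact: itbB|exact: itbZ|].
  move=> x; have [Bx|nB] := pselect (box p r x); last by rewrite k0// !mul0r subrr mulr0.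
  rewrite -mulrBr mulrC; apply: ler_wpM2r; first by case/andP: (kM x).
  by have := ab x y Bx By; lra.
have : c <= itgp (fun x => k' x * f x) + itgp (fun x => k' x * b x.1).
  rewrite -(itgD i2 ib) -[c]mulr1 -k1' -(itgZ _ ik'); apply: itg_le; [exact: itbZ|exact: itbD|].
  move=> y; have [By|nB] := pselect (box p r y); last by rewrite k0'// !mul0r addr0 mulr0.
  by rewrite -mulrDr mulrC; apply: ler_wpM2l (cy y By); case/andP: (kM' y).
by move: la lb; rewrite /c mulrDr; move: (itg _ _) (itg _ _) (itg _ _) (itg _ _) => *; lra.
Qed.

Lemma pow4_small e : 0 < e -> exists n, (4^-1 : R) ^+ n <= e.
Proof.
move=> e0; have /cvgrPdist_le/(_ e e0)[n _ /(_ n (leqnn n))] := @cvg_expr R 4^-1 (ltac:(by rewrite ger0_norm//; lra)).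
by rewrite /= sub0r normrN ger0_norm ?exprn_ge0// => h; exists n.
Qed.

Lemma ae_seq (fn : nat -> P -> R) u : (forall n, L2p (fn n)) -> L2p u ->
  (forall n, n2p (fun x => fn n x - u x) <= (4^-1) ^+ n / 2) ->
  {ae leb2, forall x, fn n x @[n --> \oo] --> u x}.
Proof.
move=> hf hu h; have [n|f [f2 cf hn]] := L2_complete hf.
  apply: le_trans (n2_split (hf n.+1) hu (hf n)) _; rewrite (n2BC _ u (fn n)).
  move: (h n.+1) (h n); rewrite exprS; have : 0 <= (4^-1 : R) ^+ n by rewrite exprn_ge0.
  by move: (n2 _ _) (n2 _ _) (_ ^+ _) => a b d; lra.
have z : n2p (fun x => f x - u x) = 0.
  apply/eqP; rewrite eq_le n2_ge0 andbT; apply: (@le_lim _ _ 3) => e e0; have [n ne] := pow4_small e0.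
  apply: le_trans (n2_split f2 (hf n) hu) _; move: (h n) (hn n) ne.
  by move: (n2 _ _) (n2 _ _) (_ ^+ _) => a b d; lra.
have := n2_eq0 (L2B f2 hu) z; move: cf; apply: filterS2 => x cx /eqP; rewrite subr_eq0 => /eqP fu.
by rewrite -fu.
Qed.

(** The strict inequalities leave room for approximants that obey the same bound K. *)
Lemma H10_seq Om u G K : H10 Om u G -> (n2p u < K) -> (forall i, n2p (G i) < K) ->
  exists fn, [/\ forall n, test_function Om (fn n), {ae leb2, forall x, fn n x @[n --> \oo] --> u x},
    forall n, n2p (fn n) <= K & forall n i, n2p (partial i (fn n)) <= K].
Proof.
move=> [u2 G2 _ ua] h hi.
pose d := Num.min (K - n2p u) (Num.min (K - n2p (G 0)) (K - n2p (G 1))).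
have d0 : 0 < d by rewrite !lt_min !subr_gt0 h !hi.
have e0 n : 0 < Num.min d ((4^-1) ^+ n / 2) by rewrite lt_min d0/= divr_gt0// exprn_gt0//; lra.
have /choice[fn hn] n := ua _ (e0 n).
have tri (g k : P -> R) e : L2p g -> L2p k -> n2p (fun x => g x - k x) <= Num.min d e -> d <= K - n2p k ->
   n2p g <= K.
  move=> g2 k2; rewrite le_min => /andP[+ _] dk; rewrite (_ : g = fun x => (g x - k x) + k x); last first.
    by apply/funext => x; ring.
  move=> hd; apply: le_trans (n2D (L2B _ _) k2) _ => //; move: hd dk.
    by rewrite (_ : (fun x => _) = fun x => g x - k x); [move: (n2 _ _) (n2 _ _) => a b; lra|apply/funext => x; ring].
have f2 n : L2p (fn n) by have [/test_L2] := hn n.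
exists fn; split.
- by move=> n; have [] := hn n.
- apply: ae_seq => // n; have [_ + _] := hn n; move/le_trans; apply; by rewrite ge_min lexx orbT.
- move=> n; have [_ + _] := hn n => /tri; apply=> //; by rewrite ge_min lexx.
- move=> n i; have [tn _ /(_ i)/tri] := hn n; apply=> //; first exact: test_L2 (test_partial i tn).
  by case: (ord2P i) => ->; rewrite !ge_min lexx ?orbT.
Qed.

Lemma L4_arith (a b c K : R) : 0 <= a <= K -> 0 <= b <= K -> 0 <= c <= K ->
  (2 * (a * b)) * (2 * (a * c)) <= 4 * K ^+ 4.
Proof.
move=> /andP[a0 aK] /andP[b0 bK] /andP[c0 cK]; rewrite (_ : _ * _ = 4 * ((a * b) * (a * c))); last by ring.
rewrite (_ : K ^+ 4 = (K * K) * (K * K)); last by ring.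
by apply: ler_wpM2l => //; do 2? apply: ler_pM => //; apply: mulr_ge0.
Qed.

(** Ladyzhenskaya's inequality: [gagliardo] is applied to the squares of approximating test
    functions, whose derivatives are 2 f df, and Fatou's lemma passes to u. *)
Lemma H10_L4 Om u G K : H10 Om u G -> (n2p u < K) -> (forall i, n2p (G i) < K) ->
  itbp (fun x => u x ^+ 4) /\ itgp (fun x => u x ^+ 4) <= 4 * K ^+ 4.
Proof.
move=> hu h hi; have [fn [tn cn bn gn]] := H10_seq hu h hi; have [[mu _] _ _ _] := hu.
have c4 n : exists r, c1 (fun x => fn n x * fn n x) (fun i x => 2 * (fn n x * partial i (fn n) x)) r.
  by have [r /c1_sqr] := c1_test (tn n); exists r.
have sq n x : (fn n x * fn n x) ^+ 2 = fn n x ^+ 4 by ring.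
have i4 n : itbp (fun x => fn n x ^+ 4).
  have [D [r [_ _ r0 DB out]]] := test_out (tn n).
  have z x : ~ box 0 r x -> fn n x = 0 by move=> nB; apply: (out x _).1 => /DB.
  have [Mf bf] := cont_bnd (@box_compact 0 r) (Ker_cont (test_Ker (tn n))) z.
  apply: (itb_bnd (c := Mf ^+ 4) (x := 0) (r := r)) => [|x|x nB].
  - by apply: measurable_funX; exact: Ker_meas (test_Ker (tn n)).
  - by rewrite normrX lerXn2r ?nnegrE// (le_trans _ (bf 0)).
  - by rewrite z// expr0n.
apply: (fatouR i4) => //.
- exact: measurable_funX.
- by move=> n x; rewrite -sq sqr_ge0.
- by move: cn; apply: filterS => x cx; apply: (cvgM cx (cvgM cx (cvgM cx cx))).
move=> n; have [r /gagliardo] := c4 n; rewrite (_ : (fun x => _ ^+ 2) = fun x => fn n x ^+ 4); last by apply/funext => x; exact: sq.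
move/le_trans; apply.
have E i : itgp (fun x => `|2 * (fn n x * partial i (fn n) x)|) <= 2 * (n2p (fn n) * n2p (partial i (fn n))).
  have l1 := test_L2 (tn n); have l2 := test_L2 (test_partial i (tn n)).
  rewrite (_ : (fun x => _) = fun x => 2 * (`|fn n x| * `|partial i (fn n) x|)); last first.
    by apply/funext => x; rewrite !normrM ger0_norm.
  rewrite (itgZ _ (L2M (L2_norm l1) (L2_norm l2))); apply: ler_wpM2l => //.
  by apply: le_trans (itg_mul_le (L2_norm l1) (L2_norm l2)) _; rewrite !n2_abs.
have bd g : n2p g <= K -> 0 <= n2p g <= K by move=> ->; rewrite n2_ge0.
apply: le_trans (L4_arith (bd _ (bn n)) (bd _ (gn n 0)) (bd _ (gn n 1))).
by apply: ler_pM (E 0) (E 1); apply: itg_ge0 => x; exact: normr_ge0.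
Qed.

Lemma L1_near (f g : P -> R) p r : 0 <= r -> L2p f -> L2p g ->
  itgp (fun x => ibox p r x * `|f x|) <= itgp (fun x => ibox p r x * `|g x|) + 2 * r * n2p (fun x => f x - g x).
Proof.
move=> r0 lf lg; have lb := ibox_L2 p r.
apply: le_trans (_ : itgp (fun x => ibox p r x * `|g x| + ibox p r x * `|f x - g x|) <= _).
  apply: itg_le; [exact: L2M lb (L2_norm lf)|exact: itbD (L2M lb (L2_norm lg)) (L2M lb (L2_norm (L2B lf lg)))|].
  move=> x; rewrite -mulrDr; apply: ler_wpM2l; first by case/andP: (ibox_ge0 p r x).
  by rewrite -lerBlDl; exact: le_trans (lerB_dist _ _) _.
rewrite (itgD (L2M lb (L2_norm lg)) (L2M lb (L2_norm (L2B lf lg)))); apply: lerD => //.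
exact: itg_ibox_abs r0 (L2B lf lg).
Qed.

Lemma avg_arith (A A' B B' L0 L1 l0 l1 m rho k k' e : R) : 0 <= m -> 0 <= rho -> A - A' <= m * (L0 + L1) ->
  `|A - B| <= k * e -> `|A' - B'| <= k' * e -> L0 <= l0 + rho * e -> L1 <= l1 + rho * e ->
  B - B' - m * (l0 + l1) <= (k + k' + m * (rho + rho)) * e.
Proof.
move=> m0 r0 h; rewrite !ler_distl => /andP[h1 _] /andP[_ h2] h3 h4.
have h5 := ler_wpM2l m0 (lerD h3 h4).
have E : m * (l0 + rho * e + (l1 + rho * e)) = m * (l0 + l1) + m * (rho + rho) * e by ring.
by move: h h5; rewrite E !mulrDl; lra.
Qed.

Lemma H10_avg Om u G p r M k k' : H10 Om u G -> 0 <= r -> weight p r M k -> weight p r M k' ->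
  itgp (fun x => k x * u x) - itgp (fun x => k' x * u x) <=
  M * (2 * r) * itgp (fun x => ibox p r x * (`|G 0 x| + `|G 1 x|)).
Proof.
move=> [u2 G2 _ ua] r0 wk wk'; have k2 := weight_L2 wk; have k2' := weight_L2 wk'.
have M0 : 0 <= M by case: wk => _ /(_ 0)/andP[+ +] _ _; exact: le_trans.
have iG i := L2M (ibox_L2 p r) (L2_norm (G2 i)).
rewrite (_ : (fun x => ibox p r x * _) = fun x => ibox p r x * `|G 0 x| + ibox p r x * `|G 1 x|); last first.
  by apply/funext => x; rewrite mulrDr.
rewrite (itgD (iG 0) (iG 1)) -subr_le0.
apply: (@le_lim _ _ (n2p k + n2p k' + M * (2 * r) * (2 * r + 2 * r))) => e e0.
have [phi [tp pu pG]] := ua e e0; have [R0 hc] := c1_test tp.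
have p2 := test_L2 tp; have pp2 i := test_L2 (test_partial i tp).
have A (w : P -> R) : L2p w -> `|itgp (fun x => w x * phi x) - itgp (fun x => w x * u x)| <= n2p w * e.
  move=> w2; rewrite -(itgB (L2M w2 p2) (L2M w2 u2)) (_ : (fun x => _) = fun x => w x * (phi x - u x)); last first.
    by apply/funext => x; rewrite mulrBr.
  by apply: le_trans (CS w2 (L2B p2 u2)) _; apply: ler_wpM2l => //; exact: n2_ge0.
have R2 : 0 <= 2 * r by rewrite mulr_ge0.
apply: (avg_arith (mulr_ge0 M0 R2) R2 (avg_c1 hc r0 wk wk') (A _ k2) (A _ k2')).
  by apply: le_trans (L1_near p r0 (pp2 0) (G2 0)) _; rewrite lerD2l; apply: ler_wpM2l.
by apply: le_trans (L1_near p r0 (pp2 1) (G2 1)) _; rewrite lerD2l; apply: ler_wpM2l.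
Qed.

Lemma amgm (a b c : R) : 0 <= a -> 0 <= b -> 0 <= c -> c ^+ 2 <= a * b -> 2 * c <= a + b.
Proof.
move=> a0 b0 c0 h; rewrite -(@ler_pXn2r _ 2) ?nnegrE ?addr_ge0 ?mulr_ge0//.
rewrite (_ : (2 * c) ^+ 2 = 4 * c ^+ 2); last by ring.
by rewrite (_ : (a + b) ^+ 2 = (a - b) ^+ 2 + 4 * (a * b)); [have := sqr_ge0 (a - b); lra|ring].
Qed.

Lemma gag_arith (u phi a0 a1 b0 b1 e w : R) : 2 * phi <= a0 + a1 -> u <= phi + e -> a0 <= b0 + 2 * w * e ->
  a1 <= b1 + 2 * w * e -> 2 * u - (b0 + b1) <= (2 + 2 * w + 2 * w) * e.
Proof. by rewrite !mulrDl; move: (2 * w * e) => *; lra. Qed.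

(** The Gagliardo-Nirenberg inequality with the product replaced by a sum. Having only the L^1 norm
    of the gradient on the right matters in [meyers], where the adjoint solution is controlled in
    exponent 2 - d alone. *)
Lemma gag_L1 Om u G B : 0 <= B -> Om `<=` box 0 B -> H10 Om u G ->
  2 * n2p u <= itgp (fun x => `|G 0 x|) + itgp (fun x => `|G 1 x|).
Proof.
move=> B0 OB hu; have [u2 G2 uo ua] := hu; rewrite -subr_le0.
apply: (@le_lim _ _ (2 + 2 * B + 2 * B)) => e e0; have [phi [tp pu pG]] := ua e e0; have [R0 hc] := c1_test tp.
have [_ _ po _] := H10_test tp; have p2 := test_L2 tp.
have ib (g : P -> R) : (forall x, ~ Om x -> g x = 0) -> (fun x => ibox 0 B x * `|g x|) = fun x => `|g x|.
  move=> z; apply/funext => x; have [h|h] := pselect (Om x); first by rewrite ibox1 ?mul1r//; exact: OB.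
  by rewrite z// normr0 mulr0.
have D i : itgp (fun x => `|partial i phi x|) <= itgp (fun x => `|G i x|) + 2 * B * e.
  have := L1_near 0 B0 (test_L2 (test_partial i tp)) (G2 i).
  rewrite !ib => [|x /uo[]//|x /po[]//] => /le_trans; apply; rewrite lerD2l; apply: ler_wpM2l => //.
  by rewrite mulr_ge0.
have := gagliardo hc; rewrite -n2K => hg.
have a0 i : 0 <= itgp (fun x => `|partial i phi x|) by apply: itg_ge0 => x; exact: normr_ge0.
have h := amgm (a0 0) (a0 1) (n2_ge0 _ _) hg.
have h2 : n2p u <= n2p phi + e.
  rewrite (_ : u = fun x => phi x - (phi x - u x)); last by apply/funext => x; ring.
  apply: le_trans (n2B p2 (L2B p2 _)) _; rewrite -?(_ : u = fun x => phi x - (phi x - u x))//; try by apply/funext => x; ring.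
  by rewrite lerD2l.
exact: gag_arith h h2 (D 0) (D 1).
Qed.

Lemma poin_arith (u a0 a1 b0 b1 w : R) : 2 * u <= a0 + a1 -> a0 <= 2 * w * b0 -> a1 <= 2 * w * b1 -> u <= w * (b0 + b1).
Proof. by rewrite mulrDr -!mulrA; move: (w * b0) (w * b1) => *; lra. Qed.

Lemma poincare Om u G B : 0 <= B -> Om `<=` box 0 B -> H10 Om u G ->
  n2p u <= B * (n2p (G 0) + n2p (G 1)).
Proof.
move=> B0 OB hu; have [u2 G2 uo _] := hu.
have E i : itgp (fun x => `|G i x|) <= 2 * B * n2p (G i).
  apply: le_trans (itg_ibox_abs 0 B0 (G2 i)); apply: eqle; congr itg; apply/funext => x.
  have [h|h] := pselect (Om x); first by rewrite ibox1 ?mul1r//; exact: OB.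
  by rewrite (uo x h).2 normr0 mulr0.
exact: poin_arith (gag_L1 B0 OB hu) (E 0) (E 1).
Qed.

End H10Estimates.

(** * The fundamental lemma of the calculus of variations and uniqueness of weak derivatives *)

Section DuBoisReymond.
Implicit Types (p : P) (h v w : P -> R) (c M B : R) (i : 'I_2) (D U V K : set P).
Implicit Types H : 'I_2 -> P -> R.

Lemma open_gen : @measurable _ P = <<s (@open P) >>.
Proof.
apply/seteqP; split; last first.
  by apply: smallest_sub; [exact: sigma_algebra_measurable|move=> U; exact: open_meas].
have key (pr : P -> R) : continuous (pr : P -> R^o) -> forall A : set R, @measurable _ (measurableTypeR R) A -> <<s (@open P) >> (pr @^-1` A).
  move=> cpr A; rewrite -[@measurable _ _]/((@ocitv R).-sigma.-measurable) RGenOpens.measurableE => mA.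
  have h := sigma_algebra_image pr (smallest_sigma_algebra setT (@open P)).
  suff : image_set_system setT pr <<s (@open P) >> A by rewrite /image_set_system/= setTI.
  apply: mA; split=> // _ [a [b ->]]; rewrite /image_set_system/= setTI; apply: sub_sigma_algebra.
  by apply: open_comp => // x _; exact: cpr.
apply: smallest_sub; first exact: smallest_sigma_algebra.
rewrite subUset; split=> _ [A mA <-]; rewrite setTI; apply: key => // x.
  exact: (@cvg_fst _ _ (nbhs x.1) (nbhs x.2)).
exact: (@cvg_snd _ _ (nbhs x.1) (nbhs x.2)).
Qed.

(** The sets over which v integrates to 0 form a Dynkin class containing the open sets, which are
    stable under intersection and generate the sigma-algebra. *)
Lemma dbr0 v : itbp v -> (forall U, open U -> (\int[leb2]_(x in U) (v x)%:E = 0)%E) -> {ae leb2, forall x, v x = 0}.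
Proof.
move=> iv h.
have all S : measurable S -> (\int[leb2]_(x in S) (v x)%:E = 0)%E.
  move=> mS; have : <<s (@open P) >> S by rewrite -open_gen.
  have mE A : measurable A -> measurable_fun A (EFin \o v).
    by move=> mA; apply/measurable_funTS; apply: measurable_int iv.
  apply: (@dynkin_induction _ P (@open P) (fun S => (\int[leb2]_(x in S) (v x)%:E = 0)%E)).
  - exact: open_gen.
  - by move=> A C; exact: openI.
  - exact: h openT.
  - by move=> U; exact: h.
  - move=> A mA hA; have := h _ openT; rewrite -(setUv A) integral_setU//=; first by rewrite hA add0e.
    - exact: measurableC.
    - by apply: mE; apply: measurableU => //; exact: measurableC.
    - by apply/disj_setPS; rewrite setICr.
  - move=> F mF tF hF; rewrite integral_bigcup//; first by apply: eseries0 => k _ _; exact: hF.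
    by apply: integrableS iv => //; exact: bigcup_measurable.
have : ae_eq leb2 setT (EFin \o v) (EFin \o cst 0).
  apply: integral_ae_eq => // [|E _ mE]; first exact/measurable_EFinP.
  by rewrite all// integral0.
by apply: filterS => x /(_ I) [].
Qed.

(** The points deeper than 2 e in V form a closed set; mollifying its indicator at radius e keeps
    the support inside V and gives the value 1 at any fixed point of V once e is small. *)
Lemma test_approx V B : open V -> V `<=` box 0 B -> exists fn, [/\ forall n, test_function V (fn n),
  forall n x, 0 <= fn n x <= 1 & forall x, fn n x @[n --> \oo] --> (\1_V x : R)].
Proof.
move=> oV VB; pose e n : R := n.+1%:R^-1; have e0 n : 0 < e n by rewrite invr_gt0.
pose Vn n : set P := [set x | forall y, `|y.1 - x.1| < 2 * e n -> `|y.2 - x.2| < 2 * e n -> V y].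
have tri (a b c d1 d2 : R) : `|a - b| < d1 -> `|b - c| < d2 -> `|a - c| < d1 + d2.
  by move=> h1 h2; rewrite -(subrK b a) -addrA; apply: le_lt_trans (ler_normD _ _) _; exact: ltrD.
have cV n : closed (Vn n).
  rewrite -(setCK (Vn n)); apply: open_closedC; apply/open_boxP => x /existsNP[y] /not_implyP[h1] /not_implyP[h2 nV].
  exists (Num.min (2 * e n - `|y.1 - x.1|) (2 * e n - `|y.2 - x.2|)); first by rewrite lt_min !subr_gt0 h1.
  move=> z; rewrite !lt_min !ltrBrDr => /andP[z1 _] /andP[_ z2] Vz; apply: nV; apply: Vz.
    by apply: le_lt_trans (ler_distD x.1 _ _) _; rewrite addrC distrC.
  by apply: le_lt_trans (ler_distD x.2 _ _) _; rewrite addrC distrC.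
have VnV n : Vn n `<=` V by move=> x h; apply: h; rewrite subrr normr0 mulr_gt0.
have m1 n : mfun (\1_(Vn n) : P -> R) by apply: measurable_indic; exact: closed_meas.
have b1 n x : 0 <= (\1_(Vn n) x : R) <= 1 by rewrite indicE; case: (_ \in _); rewrite lexx ler01.
have i1 n : itbp (\1_(Vn n)).
  apply: (@itb_bnd _ 1 0 B) => // x; first by have /andP[h1 h2] := b1 n x; rewrite ger0_norm.
  by move=> nB; rewrite indicE memNset// => /VnV/VB.
pose fn n := conv (\1_(Vn n) : P -> R) (kr (e n)).
have ci n x := conv_itb x (i1 n) (Ker_meas (kr_Ker (e n))).
have ki n x : itbp (fun y => kr (e n) (x.1 - y.1, x.2 - y.2)) /\ itgp (fun y => kr (e n) (x.1 - y.1, x.2 - y.2)) = 1.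
  have E : (fun y => kr (e n) (x.1 - y.1, x.2 - y.2)) = kr (e n) \o aff (- x.1, - x.2) 1.
    by apply/funext => y; rewrite /= -kr_even; congr (kr _ (_, _)); rewrite /aff/=; ring.
  rewrite E; split; first exact: (itb_aff (- x.1, - x.2) ltr01 (kr_itb (e0 n))).
  by rewrite (itg_aff (- x.1, - x.2) ltr01 (kr_itb (e0 n))) kr_int// expr1n invr1 mulr1.
have near n x : fn n x != 0 -> exists y, [/\ Vn n y, `|x.1 - y.1| < e n & `|x.2 - y.2| < e n].
  move=> nz; apply: contrapT => no; move/eqP: nz; apply; apply: conv_out => // y h1 h2.
  by rewrite indicE memNset// => hy; apply: no; exists y.
exists fn; split.
- move=> n; pose D : set P := closure [set x | fn n x != 0].
  have DV : D `<=` V.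
    move=> x Dx; have [x' [/near[y [hy h1 h2]] [g1 g2]]] : [set x | fn n x != 0] `&` [set y : P | `|y.1 - x.1| < e n /\ `|y.2 - x.2| < e n] !=set0.
      by apply: Dx; apply/nbhs_boxP; exists (e n).
    by apply: hy; rewrite mulrDl mul1r; [apply: tri h1|apply: tri h2]; rewrite distrC.
  apply: (test_intro (D := D) (r := B)) => //; first by apply: Ker_conv => //; exact: kr_Ker.
  - exact: closed_closure.
  - by move=> x /DV/VB.
  - by move=> x nD; apply: contrapT => /eqP h; apply: nD; exact: subset_closure.
- move=> n x; have [C hC] := kr_b (e0 n); have [ki1 ki2] := ki n x.
  apply/andP; split; first by apply: itg_ge0 => y; rewrite mulr_ge0 ?kr_ge0//; case/andP: (b1 n y).
  rewrite -ki2; apply: itg_le => //; first exact: ci hC.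
  by move=> y; rewrite ler_piMl ?kr_ge0//; case/andP: (b1 n y).
move=> x; have [Vx|nV] := pselect (V x); last first.
  rewrite indicE memNset//; have E n : fn n x = 0.
    apply/eqP; apply: contrapT => /negP/near[y [hy h1 h2]]; apply: nV; apply: hy.
      by apply: lt_trans h1 _; rewrite ltr_pMl// ltr1n.
    by apply: lt_trans h2 _; rewrite ltr_pMl// ltr1n.
  by under eq_fun do rewrite E; exact: cvg_cst.
rewrite indicE mem_set//; have /open_boxP/(_ x Vx)[d d0 hd] := oV.
have d3 : 0 < d / 3 by rewrite divr_gt0.
have [N _ hN] := near_infty_natSinv_lt (PosNum d3).
apply: cvg_near_cst; exists N => // n /hN /=; rewrite -/(e n) => ed.
rewrite /fn /conv -(ki n x).2; congr itg; apply/funext => y.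
have [h1|h1] := ltP `|x.1 - y.1| (e n); last by rewrite kr_out ?mulr0//; left.
have [h2|h2] := ltP `|x.2 - y.2| (e n); last by rewrite kr_out ?mulr0//; right.
rewrite indicE mem_set ?mul1r// => z z1 z2; have e3 : 2 * e n + e n < d by move: ed; rewrite ltr_pdivlMr//; lra.
by apply: hd; [apply: lt_trans e3; apply: tri z1 _|apply: lt_trans e3; apply: tri z2 _]; rewrite distrC.
Qed.

Lemma itg_in Om f : measurable Om -> \int[leb2]_(x in Om) f x = itgp (f \_ Om).
Proof. by move=> mO; rewrite /itg /Rintegral integral_mkcond restrict_EFin. Qed.

Lemma loc_box Om w D : loc_integrable Om w -> compact D -> D `<=` Om -> measurable D -> itbp (w \_ D).
Proof.
move=> lw cD DO mD; have := lw _ cD DO; rewrite integrable_mkcond// /itb.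
by rewrite restrict_EFin.
Qed.

Lemma test_restrict Om w phi : measurable Om -> loc_integrable Om w -> test_function Om phi ->
  itbp (fun x => (w \_ Om) x * phi x) /\ \int[leb2]_(x in Om) (w x * phi x) = itgp (fun x => (w \_ Om) x * phi x).
Proof.
move=> mO lw tp; have [D [r [cD DO r0 DB out]]] := test_out tp; have [_ [C b] _ _] := KerP (test_Ker tp).
have E : (fun x => (w \_ Om) x * phi x) = fun x => phi x * (w \_ D) x.
  apply/funext => x; rewrite mulrC !patchE; case: ifPn => [/set_mem Ox|/negP nO].
    by case: ifPn => // /negP nD; rewrite (out x _).1 ?mul0r// => /mem_set.
  by case: (boolP (x \in D)) => // /set_mem/DO/mem_set h; case: (nO h).
split; last first.
  by rewrite itg_in//; congr itg; apply/funext => x; rewrite !patchE; case: ifP; rewrite ?mul0r.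
have iD := loc_box lw (closed_compact cD DB) DO (closed_meas cD).
rewrite E; apply: (@itb_le _ _ _ _ _ (fun x => C * `|(w \_ D) x|)).
- by apply: measurable_funM; [exact: Ker_meas (test_Ker tp)|exact: itb_m iD].
- by move=> x; rewrite normrM; apply: ler_wpM2r.
- by apply: itbZ; exact: itb_norm.
Qed.

(** As w is only locally integrable, the argument takes place in the rational boxes contained in Om;
    there are countably many, so the null sets may be united. *)
Lemma dbr Om w : open Om -> loc_integrable Om w ->
  (forall phi, test_function Om phi -> itgp (fun x => (w \_ Om) x * phi x) = 0) ->
  {ae leb2, forall x, Om x -> w x = 0}.
Proof.
move=> oO lw h; have mO := open_meas oO.
pose Bx (j : rat * rat * nat) := box (ratr j.1.1 : R, ratr j.1.2 : R) (j.2.+1%:R)^-1.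
pose Ob (j : rat * rat * nat) : set P := [set y | `|y.1 - ratr j.1.1| < (j.2.+1%:R)^-1 /\ `|y.2 - ratr j.1.2| < (j.2.+1%:R)^-1].
have loc j : Bx j `<=` Om -> {ae leb2, forall x, Ob j x -> w x = 0}.
  move=> BO; have oOb : open (Ob j).
    apply/open_boxP => x [h1 h2]; exists (Num.min (j.2.+1%:R^-1 - `|x.1 - ratr j.1.1|) (j.2.+1%:R^-1 - `|x.2 - ratr j.1.2|)).
      by rewrite lt_min !subr_gt0 h1.
    move=> y; rewrite !lt_min => /andP[y1 _] /andP[_ y2]; split.
      by rewrite -(subrK x.1 y.1) -addrA (le_lt_trans (ler_normD _ _))// -ltrBrDr.
    by rewrite -(subrK x.2 y.2) -addrA (le_lt_trans (ler_normD _ _))// -ltrBrDr.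
  have OB : Ob j `<=` Bx j by move=> x [h1 h2]; split; exact: ltW.
  have iB := loc_box lw (@box_compact _ _) BO (box_meas _ _).
  have iO : itbp (w \_ (Ob j)).
    apply: (@itb_le _ _ _ _ _ (fun x => `|(w \_ (Bx j)) x|)); last exact: itb_norm.
      have -> : w \_ (Ob j) = fun x => \1_(Ob j) x * (w \_ (Bx j)) x.
        apply/funext => x; rewrite indicE !patchE; case: ifPn => [/set_mem Ox|]; last by rewrite mul0r.
        by rewrite mem_set ?mul1r//; exact: OB.
      by apply: measurable_funM; [apply: measurable_indic; exact: open_meas|exact: itb_m iB].
    move=> x; rewrite !patchE; case: ifPn => [/set_mem Ox|]; last by rewrite normr0.
    by rewrite mem_set//; exact: OB.
  have : {ae leb2, forall x, (w \_ (Ob j)) x = 0}; last first.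
    by apply: filterS => x; rewrite patchE => + Ox; rewrite mem_set.
  apply: dbr0 => // U oU; have oV := openI oU oOb; have mV := open_meas oV.
  have [r hr] : exists r, Bx j `<=` box 0 r by apply: compact_box; exact: box_compact.
  have VB : U `&` Ob j `<=` box 0 r by move=> x [_ /OB/hr].
  have [fn [tn bn cn]] := test_approx oV VB.
  have -> : (\int[leb2]_(x in U) ((w \_ (Ob j)) x)%:E = (itgp (fun x => (w \_ (Ob j)) x * \1_(U `&` Ob j) x))%:E)%E.
    rewrite itgE; last first.
      apply: (@itb_le _ _ _ _ _ (fun x => `|(w \_ (Ob j)) x|)); last exact: itb_norm.
        by apply: measurable_funM; [exact: itb_m iO|exact: measurable_indic].
      by move=> x; rewrite normrM ler_piMr// indicE; case: (_ \in _); rewrite ?normr1 ?normr0.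
    rewrite [LHS]integral_mkcond; apply: eq_integral => x _; rewrite indicE in_setI !patchE.
    by case: (x \in U); case: (x \in Ob j); rewrite /= ?mulr1 ?mulr0.
  have [_ _ cv] := @dct _ _ _ leb2 (fun n x => (w \_ (Ob j)) x * fn n x) (fun x => (w \_ (Ob j)) x * \1_(U `&` Ob j) x) (fun x => `|(w \_ (Ob j)) x|)
    (fun n => measurable_funM (itb_m iO) (Ker_meas (test_Ker (tn n)))) (measurable_funM (itb_m iO) (measurable_indic mV)) (itb_norm iO)
    (aeW _ (fun x => cvgM (cvg_cst _) (cn x))) (fun n x => ltac:(have /andP[h1 h2] := bn n x; rewrite normrM ler_piMr// ger0_norm//)).
  congr EFin; apply/esym; apply: (cvg_unique _ _ cv) => //.
  have z n : itgp (fun x => (w \_ (Ob j)) x * fn n x) = 0.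
    rewrite -(h (fn n)); last by apply: test_sub (tn n) => x [_ /OB/BO].
    congr itg; apply/funext => x; rewrite !patchE; case: ifPn => [/set_mem/OB/BO Ox|nO]; first by rewrite mem_set.
    have [_ _ z _] := H10_test (tn n); rewrite (z x _).1 ?mulr0// => -[_ /mem_set Ox].
    by rewrite Ox in nO.
  by rewrite /= (funext z); exact: cvg_cst.
have : {ae leb2, forall x, forall n, if unpickle n is Some j then Bx j `<=` Om -> Ob j x -> w x = 0 else True}.
  apply/ae_foralln => n; case: unpickle => [j|]; last exact: aeW.
  have [/loc|nB] := pselect (Bx j `<=` Om); last by apply: aeW => x /nB.
  by apply: filterS => x hx _.
apply: filterS => x hx Ox; have /open_boxP/(_ x Ox)[r r0 h'] := oO.
have [j [h1 h2 jr]] := rat_box x r0; have := hx (pickle j); rewrite pickleK; apply; last by split.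
by move=> y [/= g1 g2]; apply: h'; [exact: dist3 g1 h1 jr|exact: dist3 g2 h2 jr].
Qed.

Lemma compact_meas K : compact K -> measurable K.
Proof. by move=> cK; apply: closed_meas; apply: compact_closed => //; exact: norm_hausdorff. Qed.

Lemma wp_unique Om i u w w' : open Om -> is_weak_partial Om i u w -> is_weak_partial Om i u w' ->
  {ae leb2, forall x, Om x -> w x = w' x}.
Proof.
move=> oO [lu lw hw] [_ lw' hw']; have mO := open_meas oO.
have : {ae leb2, forall x, Om x -> w x - w' x = 0}; last first.
  by apply: filterS => x + Ox => /(_ Ox)/eqP; rewrite subr_eq0 => /eqP.
apply: dbr => // [K cK KO|phi tp].
  by rewrite (_ : EFin \o _ = (EFin \o w) \- (EFin \o w'))%E//; apply: integrableB; [exact: compact_meas|exact: lw|exact: lw'].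
have := hw phi tp; rewrite (hw' phi tp) => /oppr_inj.
have [i1 ->] := test_restrict mO lw tp; have [i2 ->] := test_restrict mO lw' tp => e.
rewrite (_ : (fun x => _) = fun x => (w \_ Om) x * phi x - (w' \_ Om) x * phi x); last first.
  by apply/funext => x; rewrite !patchE; case: ifP => _; rewrite -mulrBl ?subrr.
by rewrite itgB// e subrr.
Qed.

Lemma L2_loc Om u : measurable Om -> L2p (u \_ Om) -> loc_integrable Om u.
Proof.
move=> mO lu K cK KO; have [r Kr] := compact_box cK; have mK := compact_meas cK.
apply/(integrable_mkcond _ mK); rewrite restrict_EFin.
apply: (@itb_le _ _ _ _ _ (fun x => ibox 0 r x * `|(u \_ Om) x|)).
- rewrite (_ : u \_ K = fun x => \1_K x * (u \_ Om) x); last first.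
    apply/funext => x; rewrite indicE !patchE; case: ifPn => [/set_mem Kx|]; last by rewrite mul0r.
    by rewrite mem_set ?mul1r//; exact: KO.
  by apply: measurable_funM; [exact: measurable_indic|case: lu].
- move=> x; rewrite !patchE; case: ifPn => [/set_mem Kx|_]; last by rewrite normr0 mulr_ge0//; case/andP: (ibox_ge0 0 r x).
  by rewrite ibox1 ?mul1r ?mem_set//; [exact: KO|exact: Kr].
- by apply: L2M (ibox_L2 _ _) (L2_norm lu).
Qed.

Lemma H10_wp Om u G i : open Om -> H10 Om (u \_ Om) G -> is_weak_partial Om i u (G i).
Proof.
move=> oO hu; have [u2 G2 uo _] := hu; have mO := open_meas oO.
have GE : G i \_ Om = G i.
  by apply/funext => x; rewrite patchE; case: ifPn => // /negP nO; rewrite (uo x _).2// => /mem_set.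
have lu := L2_loc mO u2; have lG : loc_integrable Om (G i) by apply: L2_loc => //; rewrite GE.
split=> // phi tp; have tp' := test_partial i tp.
have [_ ->] := test_restrict mO lu tp'; have [_ ->] := test_restrict mO lG tp.
by rewrite GE (H10_ibp i hu (test_sub _ tp))// opprK.
Qed.

Lemma wpP Om i u w : is_weak_partial Om i u w -> is_weak_partial Om i u (weak_partial Om i u).
Proof. by move=> h; apply: (@xgetPex _ (cst 0) [set w | is_weak_partial Om i u w]); exists w. Qed.

Lemma wp_ae Om u G i : open Om -> H10 Om (u \_ Om) G -> {ae leb2, forall x, Om x -> weak_partial Om i u x = G i x}.
Proof. by move=> oO hu; have h := H10_wp i oO hu; exact: wp_unique oO (wpP h) h. Qed.

End DuBoisReymond.

(** * Barycentric coordinates and conformity of triangles *)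

Section Triangles.
Implicit Types (a b c : P) (T S : set P) (v : 'I_3 -> P) (w : P -> R) (q : R * R * R).

(** Affine functions are coded by their coefficients, so that gradients can be read off the code. *)
Definition ev q x : R := q.1.1 + q.1.2 * x.1 + q.2 * x.2.

Lemma ev_cmb q x y t : ev q (cmb x y t) = t * ev q x + (1 - t) * ev q y.
Proof. by rewrite /ev /cmb/=; ring. Qed.

Definition o0 : 'I_3 := @Ordinal 3 0 isT.
Definition o1 : 'I_3 := @Ordinal 3 1 isT.
Definition o2 : 'I_3 := @Ordinal 3 2 isT.

Lemma ord3P (k : 'I_3) : [\/ k = o0, k = o1 | k = o2].
Proof. by case: k => -[|[|[|//]]] hk; [apply: Or31|apply: Or32|apply: Or33]; exact: val_inj. Qed.

Lemma sum3 (F : 'I_3 -> R) : \sum_k F k = F o0 + F o1 + F o2.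
Proof.
rewrite !big_ord_recl big_ord0 addr0 addrA; congr (_ + _ + _); congr F; exact: val_inj.
Qed.

Definition itp v (l : 'I_3 -> R * R * R) w x : R := \sum_k ev (l k) x * w (v k).

(** Barycentric coordinates as data of the triangle; all its convex geometry is derived from them
    instead of from the hull. *)
Record tri T v (l : 'I_3 -> R * R * R) : Prop := Tri {
  tri_v : forall k m, ev (l k) (v m) = (k == m)%:R;
  tri_T : forall x, T x <-> forall k, 0 <= ev (l k) x;
  tri_aff : forall q x, ev q x = \sum_k ev (l k) x * ev q (v k) }.

Definition pick3 {U : Type} (a b c : U) (k : 'I_3) : U := if k == o0 then a else if k == o1 then b else c.

(** Cramer's rule for the barycentric coordinate belonging to a. *)
Definition lam3 a b c : R * R * R :=
  let D := (b.1 - a.1) * (c.2 - a.2) - (b.2 - a.2) * (c.1 - a.1) in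
  ((b.1 * c.2 - b.2 * c.1) / D, (b.2 - c.2) / D, (c.1 - b.1) / D).

Lemma conv_hullP S : is_convex (conv_hull S) /\ S `<=` conv_hull S.
Proof.
split; last by move=> x Sx B [_]; apply.
apply/cvxP => x y t hx hy t01 B [cB SB]; move/cvxP: (cB); apply=> //; [exact: hx|exact: hy].
Qed.

Lemma conv_hull_sub S B : is_convex B -> S `<=` B -> conv_hull S `<=` B.
Proof. by move=> cB SB x; apply; split. Qed.

Lemma cvx3 B a b c (r s t : R) : is_convex B -> B a -> B b -> B c -> 0 <= r -> 0 <= s -> 0 <= t -> r + s + t = 1 ->
  B (r * a.1 + s * b.1 + t * c.1, r * a.2 + s * b.2 + t * c.2).
Proof.
move=> /cvxP cB Ba Bb Bc r0 s0 t0 e.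
have [st|st] := eqVneq (s + t) 0.
  have [s1 t1] : s = 0 /\ t = 0 by split; lra.
  have r1 : r = 1 by lra.
  by rewrite s1 t1 r1 !mul1r !mul0r !addr0; case: a Ba.
have st0 : 0 < s + t by rewrite lt_neqAle eq_sym st addr_ge0.
have Bd : B (cmb b c (s / (s + t))).
  by apply: cB => //; rewrite divr_ge0 ?(ltW st0)//= ler_pdivrMr// mul1r lerDl.
have := cB _ _ r Ba Bd; rewrite r0/= => /(_ ltac:(lra)).
have r1 : 1 - r = s + t by lra.
by congr B; rewrite /cmb/= r1; congr (_, _); field.
Qed.

Lemma tri_cvx T v l B x : tri T v l -> is_convex B -> (forall k, B (v k)) -> T x -> B x.
Proof.
move=> [lv lT la] cB hv /lT h.
have := la (1, 0, 0) x; have := la (0, 1, 0) x; have := la (0, 0, 1) x.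
rewrite !sum3 /ev/= !mul1r !mul0r !add0r !addr0 => e2 e1 e0.
have := cvx3 cB (hv o0) (hv o1) (hv o2) (h o0) (h o1) (h o2).
rewrite /ev; move: e0 e1 e2; rewrite !mulr1 => <- <- <-.
by case: x {h} => x1 x2; apply.
Qed.

Lemma tri_hull a b c : noncollinear a b c ->
  tri (conv_hull [set a; b; c]) (pick3 a b c) (pick3 (lam3 a b c) (lam3 b c a) (lam3 c a b)).
Proof.
case: a b c => [a1 a2] [b1 b2] [c1 c2]; rewrite /noncollinear/= => D0.
have D1 : (c1 - b1) * (a2 - b2) - (c2 - b2) * (a1 - b1) != 0 by move: D0; congr (_ != _); ring.
have D2 : (a1 - c1) * (b2 - c2) - (a2 - c2) * (b1 - c1) != 0 by move: D0; congr (_ != _); ring.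
set v := pick3 (a1, a2) _ _; set l := pick3 (lam3 _ _ _) _ _.
have lv k m : ev (l k) (v m) = (k == m)%:R.
  by case: (ord3P k) => ->; case: (ord3P m) => ->; rewrite /l /v /ev /lam3/=; field; rewrite ?D0 ?D1 ?D2.
have af q x : ev q x = \sum_k ev (l k) x * ev q (v k).
  case: q x => -[q0 q1 q2] [x1 x2]; rewrite sum3 /l /v /ev /lam3/=.
  by field; rewrite ?D0 ?D1 ?D2.
pose T' := [set x | forall k, 0 <= ev (l k) x].
have tT : tri T' v l by split.
split=> // x; split=> [|h].
  apply: (@conv_hull_sub _ T') => [|y [[->|->]|->] k].
  - by apply/cvxP => y z t hy hz /andP[t0 t1] k; rewrite ev_cmb addr_ge0// mulr_ge0 ?subr_ge0.
  - by rewrite (lv k o0).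
  - by rewrite (lv k o1).
  - by rewrite (lv k o2).
have [cH sH] := conv_hullP [set (a1, a2); (b1, b2); (c1, c2)].
apply: (tri_cvx tT cH) => // k; apply: sH.
by case: (ord3P k) => ->; [left; left|left; right|right].
Qed.

Lemma tri_ex T : is_triangle T -> exists v l, tri T v l.
Proof. by move=> [a [b [c [nc ->]]]]; eexists; eexists; exact: tri_hull nc. Qed.

Section OneTriangle.
Variables (T : set P) (v : 'I_3 -> P) (l : 'I_3 -> R * R * R).
Hypothesis tT : tri T v l.

Lemma tri_sum1 x : \sum_k ev (l k) x = 1.
Proof.
have := tri_aff tT (1, 0, 0) x; rewrite [LHS]/ev/= !mul0r !addr0 => ->.
by apply: eq_bigr => k _; rewrite [ev (1, 0, 0) _]/ev/= !mul0r !addr0 mulr1.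
Qed.

Lemma tri_eq x y : (forall k, ev (l k) x = ev (l k) y) -> x = y.
Proof.
move=> h; have e q : ev q x = ev q y by rewrite !(tri_aff tT q); apply: eq_bigr => k _; rewrite h.
have := e (0, 1, 0); have := e (0, 0, 1); rewrite /ev/= !mul0r !mul1r !add0r !addr0.
by case: x y {h e} => x1 x2 [y1 y2] /= -> ->.
Qed.

Lemma tri_vin k : T (v k).
Proof. by apply/(tri_T tT) => m; rewrite (tri_v tT). Qed.

Lemma tri_inj : injective v.
Proof.
move=> k m e; have := tri_v tT k k; rewrite eqxx e (tri_v tT); case: eqP => // _ /esym/eqP.
by rewrite oner_eq0.
Qed.

Lemma tri_le1 k x : T x -> ev (l k) x <= 1.
Proof.
move=> /(tri_T tT) h; rewrite -(tri_sum1 x) (bigD1 k)//= lerDl; apply: sumr_ge0 => m _; exact: h.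
Qed.

Lemma tri_1 k x : T x -> ev (l k) x = 1 -> x = v k.
Proof.
move=> /(tri_T tT) h e; apply: tri_eq => m; rewrite (tri_v tT); case: eqVneq => [->//|mk].
apply/eqP; rewrite eq_le h andbT -(@lerD2l _ (ev (l k) x)) addr0 [leRHS]e -(tri_sum1 x).
by rewrite (bigD1 k)//= (bigD1 m)//= addrA lerDl; apply: sumr_ge0 => j _; exact: h.
Qed.

Lemma itp_v w k : itp v l w (v k) = w (v k).
Proof.
rewrite /itp (bigD1 k)//= (tri_v tT) eqxx mul1r big1 ?addr0// => m mk.
by rewrite (tri_v tT) (negPf mk) mul0r.
Qed.

Lemma tri_closed_convex : is_convex T.
Proof.
apply/cvxP => x y t /(tri_T tT) hx /(tri_T tT) hy /andP[t0 t1]; apply/(tri_T tT) => k.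
by rewrite ev_cmb addr_ge0// mulr_ge0 ?subr_ge0.
Qed.

End OneTriangle.

Lemma itp_cmb v l w x y t : itp v l w (cmb x y t) = t * itp v l w x + (1 - t) * itp v l w y.
Proof. by rewrite /itp !mulr_sumr -big_split/=; apply: eq_bigr => k _; rewrite ev_cmb; ring. Qed.

(** Vertices are extreme points. If [v' k] were none of the [v m], its own coordinate would be less
    than 1 at each of them, hence also at [v' k], which is a convex combination of them. *)
Lemma tri_vertex T v l a b c : tri T v l -> has_vertices T a b c -> [/\ exists k, a = v k, exists k, b = v k & exists k, c = v k].
Proof.
move=> tT [nc TE].
have : tri T (pick3 a b c) (pick3 (lam3 a b c) (lam3 b c a) (lam3 c a b)) by rewrite TE; exact: tri_hull.
move: (pick3 (lam3 _ _ _) _ _) => l' tT'.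
suff H k : exists m, pick3 a b c k = v m by split; [exact: (H o0)|exact: (H o1)|exact: (H o2)].
set v' := pick3 a b c in tT' *.
apply: contrapT => nk.
have lt m : ev (l' k) (v m) < 1.
  rewrite lt_neqAle (tri_le1 tT' _ (tri_vin tT m)) andbT; apply/eqP => e; apply: nk; exists m.
  by rewrite (tri_1 tT' (tri_vin tT m) e).
have : ev (l' k) (v' k) = 1 by rewrite (tri_v tT') eqxx.
rewrite (tri_aff tT) -(tri_sum1 tT (v' k)) => /esym/eqP; rewrite -subr_eq0 -sumrB.
have h := (tri_T tT _).1 (tri_vin tT' k).
rewrite psumr_eq0 => [/allP z|m _]; last first.
  by rewrite -[X in X - _]mulr1 -mulrBr mulr_ge0// subr_ge0 ltW.
have : (1 : R) <= 0; last by rewrite ler10.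
rewrite -(tri_sum1 tT (v' k)) big1// => m _; have := z m (mem_index_enum _).
by rewrite /= -[X in X - _]mulr1 -mulrBr mulf_eq0 subr_eq0 [1 == _]eq_sym (lt_eqF (lt m)) orbF => /eqP.
Qed.

Lemma segP a b x : conv_hull [set a; b] x -> exists2 t, 0 <= t <= 1 & x = cmb a b t.
Proof.
pose B : set P := [set x | exists2 t, 0 <= t <= 1 & x = cmb a b t].
apply: (@conv_hull_sub _ B) => [|y [->|->]].
- apply/cvxP => _ _ t [s /andP[s0 s1] ->] [r /andP[r0 r1] ->] /andP[t0 t1]; exists (t * s + (1 - t) * r).
    by apply/andP; split; [rewrite addr_ge0// mulr_ge0 ?subr_ge0|nra].
  by rewrite /cmb/=; congr (_, _); ring.
- by exists 1; rewrite ?ler01 ?lexx// /cmb !mul1r subrr !mul0r !addr0; case: (a).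
- by exists 0; rewrite ?ler01 ?lexx// /cmb !mul0r subr0 !mul1r !add0r; case: (b).
Qed.

Lemma side_arith (s r r' : R) : 0 <= s <= 1 -> 0 <= r <= 1 -> 0 <= r' <= 1 -> s * r + (1 - s) * r' = 1 -> r = 1 \/ r' = 1.
Proof.
move=> /andP[s0 s1] /andP[r0 r1] /andP[p0 p1] e.
have [->|rn] := eqVneq r 1; [by left|right].
have [s2|s2] := eqVneq s 0; first by move: e; rewrite s2 mul0r subr0 mul1r add0r.
have rl : r < 1 by rewrite lt_neqAle rn.
have sl : 0 < s by rewrite lt_neqAle eq_sym s2.
have h1 : 0 < s * (1 - r) by rewrite mulr_gt0// subr_gt0.
have h2 : 0 <= (1 - s) * (1 - r') by rewrite mulr_ge0// subr_ge0.
lra.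
Qed.

Lemma cmb_eq a b s t : a != b -> cmb a b s = cmb a b t -> s = t.
Proof.
move=> ab [e1 e2]; apply/eqP/negPn/negP => st; move/negP: ab; apply.
have E (p q : R) : s * p + (1 - s) * q = t * p + (1 - t) * q -> p = q.
  move=> e; have : (s - t) * (p - q) = 0 by transitivity ((s * p + (1 - s) * q) - (t * p + (1 - t) * q)); [ring|rewrite e subrr].
  by move=> /eqP; rewrite mulf_eq0 !subr_eq0 (negPf st) => /eqP.
by case: a b e1 e2 => a1 a2 [b1 b2] /= /E -> /E ->.
Qed.

Lemma side_ends a b a' b' : a != b -> a' != b' -> conv_hull [set a; b] = conv_hull [set a'; b'] ->
  (a = a' /\ b = b') \/ (a = b' /\ b = a').
Proof.
move=> ab ab' e.
have i (c d x : P) : x = c \/ x = d -> conv_hull [set c; d] x by move=> h; exact: (conv_hullP [set c; d]).2.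
have [s s01 es] : exists2 s, 0 <= s <= 1 & a = cmb a' b' s by apply: segP; rewrite -e; apply: i; left.
have [u u01 eu] : exists2 s, 0 <= s <= 1 & b = cmb a' b' s by apply: segP; rewrite -e; apply: i; right.
have [r r01 er] : exists2 s, 0 <= s <= 1 & a' = cmb a b s by apply: segP; rewrite e; apply: i; left.
have [r' r'01 er'] : exists2 s, 0 <= s <= 1 & b' = cmb a b s by apply: segP; rewrite e; apply: i; right.
have c1 : cmb a b 1 = a by rewrite /cmb !mul1r subrr !mul0r !addr0; case: (a).
have c0 : cmb a b 0 = b by rewrite /cmb !mul0r subr0 !mul1r !add0r; case: (b).
have cc t : cmb (cmb a b r) (cmb a b r') t = cmb a b (t * r + (1 - t) * r').
  by rewrite /cmb/=; congr (_, _); ring.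
have es' := es; have eu' := eu.
rewrite er er' cc -{1}c1 in es'; rewrite er er' cc -{1}c0 in eu'.
have h1 := cmb_eq ab es'; have h2 := cmb_eq ab eu'.
have c01 (p : R) : 0 <= p <= 1 -> 0 <= 1 - p <= 1 by move=> /andP[? ?]; apply/andP; split; lra.
have := side_arith s01 r01 r'01 (esym h1).
have : u * (1 - r) + (1 - u) * (1 - r') = 1 by rewrite -[RHS]subr0 h2; ring.
move=> /(side_arith u01 (c01 _ r01) (c01 _ r'01)) h4 h3.
have [r1|r1] := h3; [left|right].
  have : r' = 0.
    case: h4 => h4; last by lra.
    by exfalso; move: r1 h4; lra.
  by move=> r0; rewrite er er' r1 r0 c1 c0.
have : r = 0.
  by case: h4 => h4; [lra|exfalso; move: r1 h4; lra].
by move=> r0; rewrite er er' r1 r0 c1 c0.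
Qed.

Lemma nc_neq a b c : noncollinear a b c -> a != b.
Proof. by apply: contra_neq => ->; rewrite !subrr !mul0r subrr. Qed.

(** Along a common side both interpolants are affine and agree at the two ends. Admissibility enters
    the proof only through this agreement. *)
Lemma conforming T T' v v' l l' w x : tri T v l -> tri T' v' l' ->
  [\/ T `&` T' = set0, exists a, [/\ is_vertex a T, is_vertex a T' & T `&` T' = [set a]] |
        is_side (T `&` T') T /\ is_side (T `&` T') T'] -> T x -> T' x -> itp v l w x = itp v' l' w x.
Proof.
move=> tT tT' h Tx Tx'; have TT : (T `&` T') x by [].
case: h => [e|[a [[b [c hv]] [b' [c' hv']] e]]|[[a [b [c [hv e]]]] [a' [b' [c' [hv' e']]]]]].
- by rewrite e in TT.
- move: TT; rewrite e => ->; have [[k ek] _ _] := tri_vertex tT hv.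
  by have [[k' ek'] _ _] := tri_vertex tT' hv'; rewrite {1}ek (itp_v tT) -ek ek' (itp_v tT').
move: TT; rewrite e => /segP[t t01 xt].
have [[k ak] [m bm] _] := tri_vertex tT hv; have [[k' ak'] [m' bm'] _] := tri_vertex tT' hv'.
have := side_ends (nc_neq hv.1) (nc_neq hv'.1) (etrans (esym e) e').
rewrite xt !itp_cmb => -[[ea eb]|[ea eb]].
  by rewrite {1}ak {1}bm !(itp_v tT) -ak -bm ea eb ak' bm' !(itp_v tT').
by rewrite {1}ak {1}bm !(itp_v tT) -ak -bm ea eb ak' bm' !(itp_v tT').
Qed.

End Triangles.

(** * From regular admissible triangulations to meshes with a shape constant *)

Section Mesh.
Implicit Types (a b c : P) (T S : set P) (v : 'I_3 -> P) (w : P -> R) (q : R * R * R).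

Lemma enorm_le x : enorm x <= `|x.1| + `|x.2|.
Proof.
rewrite -[leRHS]ger0_norm ?addr_ge0// -sqrtr_sqr ler_wsqrtr// sqrrD !real_normK ?num_real//.
by rewrite lerD2r lerDl mulrn_wge0// mulr_ge0.
Qed.

Lemma enorm_ge x : `|x.1| <= enorm x /\ `|x.2| <= enorm x.
Proof. by rewrite -!sqrtr_sqr !ler_wsqrtr// ?lerDl ?lerDr sqr_ge0. Qed.

Lemma tri_box T v l : tri T v l -> exists2 r, 0 < r & forall x y, T x -> T y -> enorm (x - y) <= r.
Proof.
move=> tT; pose r1 := \sum_k `|(v k).1|; pose r2 := \sum_k `|(v k).2|.
have B x : T x -> `|x.1| <= r1 /\ `|x.2| <= r2.
  move=> Tx; have h := (tri_T tT x).1 Tx.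
  have K q : `|ev q x| <= \sum_k `|ev q (v k)|.
    rewrite (tri_aff tT) (le_trans (ler_norm_sum _ _ _))//; apply: ler_sum => k _.
    by rewrite normrM ger0_norm// ler_piMl// (tri_le1 tT).
  have := K (0, 1, 0); have := K (0, 0, 1); rewrite /ev/= !mul0r !mul1r !add0r !addr0 => h2 h1.
  by split; [apply: le_trans h1 _|apply: le_trans h2 _]; apply: ler_sum => k _;
    rewrite ?mul0r ?mul1r ?add0r ?addr0.
have r10 : 0 <= r1 by exact: sumr_ge0.
have r20 : 0 <= r2 by exact: sumr_ge0.
exists ((r1 + r1) + (r2 + r2) + 1); first by rewrite ltr_wpDl ?addr_ge0.
move=> x y /B[x1 x2] /B[y1 y2]; apply: le_trans (enorm_le _) _; rewrite /=.
have := ler_normB x.1 y.1; have := ler_normB x.2 y.2; move: x1 x2 y1 y2.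
move: (`|x.1|) (`|x.2|) (`|y.1|) (`|y.2|) (`|x.1 - y.1|) (`|x.2 - y.2|) => *; lra.
Qed.

Lemma ediam_ge T v l x y : tri T v l -> T x -> T y -> enorm (x - y) <= ediam T.
Proof.
move=> /tri_box[r _ h] Tx Ty; apply: ub_le_sup; last by exists x, y.
by exists r => _ [a [b [Ta Tb ->]]]; exact: h.
Qed.

Lemma tri_disc T v l : tri T v l -> exists x, exists2 r, 0 < r & [set y | enorm (y - x) <= r] `<=` T.
Proof.
move=> tT; pose g : P := (\sum_k 3^-1 * (v k).1, \sum_k 3^-1 * (v k).2).
have evg k : ev (l k) g = 3^-1.
  have -> : ev (l k) g = \sum_m 3^-1 * ev (l k) (v m).
    by rewrite !sum3 /ev/= !sum3; field.
  rewrite (bigD1 k)//= (tri_v tT) eqxx big1 ?addr0 ?mulr1// => m /negPf mk.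
  by rewrite (tri_v tT) eq_sym mk mulr0.
pose M := \sum_k (`|(l k).1.2| + `|(l k).2|) + 1.
have M0 : 0 < M by rewrite ltr_wpDl// sumr_ge0// => k _; rewrite addr_ge0.
exists g, (3^-1 / M); first by rewrite divr_gt0.
move=> y /= hy; apply/(tri_T tT) => k; have [h1 h2] := enorm_ge (y - g).
have {h1}h1 := le_trans h1 hy; have {h2}h2 := le_trans h2 hy.
have E : ev (l k) y = 3^-1 + ((l k).1.2 * (y.1 - g.1) + (l k).2 * (y.2 - g.2)).
  by rewrite -(evg k) /ev; ring.
rewrite E -lerBlDl sub0r lerNl; apply: le_trans (ler_norm _) _; rewrite normrN.
apply: le_trans (ler_normD _ _) _; rewrite !normrM.
apply: le_trans (lerD (ler_wpM2l (normr_ge0 _) h1) (ler_wpM2l (normr_ge0 _) h2)) _.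
rewrite -mulrDl mulrCA ler_piMr// ler_pdivrMr// mul1r /M (bigD1 k)//= -addrA lerDl.
by rewrite addr_ge0// sumr_ge0// => m _; rewrite addr_ge0.
Qed.

Lemma disc_diam T v l x r : tri T v l -> 0 <= r -> [set y | enorm (y - x) <= r] `<=` T -> 2 * r <= ediam T.
Proof.
move=> tT r0 h; have e (s : R) : 0 <= s -> enorm ((s, 0) : P) = s.
  by move=> s0; rewrite /enorm/= expr0n addr0 sqrtr_sqr ger0_norm.
have := @ediam_ge T v l (x + (r, 0)) (x - (r, 0)) tT.
rewrite opprB addrA addrAC (addrC x) addrK => H.
have -> : 2 * r = enorm ((r, 0) + (r, 0) : P).
  rewrite -(e (2 * r)) ?mulr_ge0// (_ : ((2 * r, 0) : P) = ((r, 0) : P) + ((r, 0) : P))//.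
  by rewrite mulrDl mul1r -[in LHS](addr0 0).
apply: H; apply: h => /=.
  by rewrite addrK e.
by rewrite addrAC subrr add0r /enorm/= oppr0 expr0n addr0 sqrtr_sqr normrN ger0_norm.
Qed.

(** The 8 collects three factors 2: a disc within half of the supremum, its radius instead of its
    diameter, and the comparison of a box with a Euclidean disc. *)
Lemma tri_reg T v l sg : tri T v l -> 0 < sg -> ediam T / inball_diam T <= sg ->
  0 < ediam T /\ exists z, box z ((8 * sg)^-1 * ediam T) `<=` T.
Proof.
move=> tT sg0 hs; set H := ediam T; set D := inball_diam T.
set E := [set 2 * r | r in [set r | 0 <= r /\ exists x, [set y | enorm (y - x) <= r] `<=` T]].
have ub : has_ubound E.
  by exists H => _ [r [r0 [x h]] <-]; exact: disc_diam tT r0 h.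
have [x [r r0 hr]] := tri_disc tT.
have rE : E (2 * r) by exists r => //; split; [exact: ltW|exists x].
have D0 : 0 < D.
  by apply: lt_le_trans (ub_le_sup ub rE); rewrite mulr_gt0.
have H0 : 0 < H by apply: lt_le_trans (disc_diam tT (ltW r0) hr); rewrite mulr_gt0.
split=> //.
have hE : has_sup E by split=> //; exists (2 * r).
have [|_ [r' [r'0 [z hz]] <-]] := @sup_adherent _ E (D / 2) _ hE; first by rewrite divr_gt0.
rewrite -[sup E]/D => h.
exists z => y [h1 h2]; apply: hz => /=; apply: le_trans (enorm_le _) _.
apply: le_trans (lerD h1 h2) _; rewrite -mulrDl.
have : H <= sg * D by move: hs; rewrite ler_pdivrMr.
have -> : ((8 * sg)^-1 + (8 * sg)^-1) * H = (4 * sg)^-1 * H by field; rewrite gt_eqF.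
rewrite ler_pdivrMl ?mulr_gt0// => /le_trans; apply.
by rewrite -mulrA mulrCA ler_pM2l//; lra.
Qed.

(** All that is used of a triangulation, in terms of boxes: H is the local size and k the shape
    constant, the only quantity on which later mesh constants depend besides the problem. Conformity
    is expressed by the equality of interpolants at common points. *)
Record mesh Om n (T : 'I_n -> set P) (v : 'I_n -> 'I_3 -> P) (l : 'I_n -> 'I_3 -> R * R * R) (H : 'I_n -> R) (k h : R) : Prop :=
  Mesh {
  m_tri : forall i, tri (T i) (v i) (l i);
  m_inj : injective T;
  m_cov : forall x, closure Om x <-> exists i, T i x;
  m_cf : forall i j x w, T i x -> T j x -> itp (v i) (l i) w x = itp (v j) (l j) w x;
  m_H : forall i, 0 < H i <= h;
  m_in : forall i, exists z, box z (k * H i) `<=` T i;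
  m_out : forall i x y, T i x -> T i y -> box x (H i) y }.

Lemma family_mesh Om h0 (Th : R -> set (set P)) : triangulation_family Om h0 Th -> regular_family h0 Th ->
  exists2 k, 0 < k & forall h, 0 < h <= h0 -> exists n (T : 'I_n -> set P) (v : 'I_n -> 'I_3 -> P) l H,
    mesh Om T v l H k h /\ forall S, Th h S <-> exists i, S = T i.
Proof.
move=> hT [sg sg0 hr]; exists (8 * sg)^-1; first by rewrite invr_gt0 mulr_gt0.
move=> h hh; have [[/finite_seqP[s es] ht cov] adm ms] := hT h hh.
(* Duplicates are removed so that the indexing of triangles is injective. *)
pose s' := undup s; pose n := size s'; pose T (i : 'I_n) := nth set0 s' i.
have TP S : Th h S <-> exists i, S = T i.
  rewrite es /=; rewrite -mem_undup; split=> [hS|[i ->]]; last by rewrite mem_nth.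
  have lt : (index S s' < n)%N by rewrite index_mem.
  by exists (Ordinal lt); rewrite /T/= nth_index.
have TT i : Th h (T i) by apply/TP; exists i.
have /choice[v /choice[l tT]] i := tri_ex (ht _ (TT i)).
exists n, T, v, l, (fun i => ediam (T i)); split=> //.
have reg i := tri_reg (tT i) sg0 (hr h hh _ (TT i)).
have e0 i : 0 <= ediam (T i) by rewrite ltW//; case: (reg i).
split=> //.
- by move=> i j /eqP; rewrite (nth_uniq _ _ _ (undup_uniq _))// => /eqP/val_inj.
- move=> x; rewrite cov; split=> [[S /TP[i ->] hx]|[i hx]]; [by exists i|by exists (T i)].
- move=> i j x w xi xj; have [->//|ij] := eqVneq i j.
  apply: (conforming w (tT i) (tT j)) => //; apply: adm => // /eqP; rewrite (nth_uniq _ _ _ (undup_uniq _))// => /eqP/val_inj/eqP.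
  by rewrite (negPf ij).
- move=> i; have [-> _] := reg i; rewrite /= -ms; apply: ub_le_sup; last by exists (T i).
  exists (\sum_j ediam (T j)) => _ [S /TP[j ->] <-].
  by rewrite (bigD1 j)//= lerDl sumr_ge0.
- by move=> i; case: (reg i).
- move=> i x y xi yi; have [h1 h2] := enorm_ge (y - x).
  by split; [apply: le_trans h1 _|apply: le_trans h2 _]; exact: ediam_ge (tT i) yi xi.
Qed.

End Mesh.

(** * Vertex stars, comparison of neighbouring sizes and separation of vertices *)

Section MeshGeometry.
Implicit Types (p : P) (D : R) (w : P -> R) (q : R * R * R) (A B : set R).

(** Connectedness of the unit interval, realised by the last point of A, so that the path does not
    return to A afterwards. *)
Lemma conn01 A B : closed A -> closed B -> (forall t, 0 <= t <= 1 -> A t \/ B t) -> A 0 -> B 1 ->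
  exists t, [/\ 0 <= t <= 1, A t, B t & forall s, t < s <= 1 -> ~ A s].
Proof.
move=> cA cB AB A0 B1; pose E : set R := A `&` `[0, 1]%classic.
have E0 : E 0 by split=> //=; rewrite in_itv/= lexx ler01.
have uE : has_ubound E by exists 1 => t [_] /=; rewrite in_itv/= => /andP[].
have cE : closed E by apply: closedI => //; exact: interval_closed.
have [As] : E (sup E) by rewrite [X in X _](closure_id E).1//; apply: closure_sup => //; exists 0.
set t := sup E; rewrite /= in_itv/= => t01.
have last s : t < s <= 1 -> ~ A s.
  move=> /andP[ts s1] As'; have s01 : 0 <= s <= 1 by rewrite s1 andbT (le_trans _ (ltW ts))//; case/andP: t01.
  by have := ub_le_sup uE (conj As' s01 : E s); rewrite leNgt ts.
exists t; split=> //; apply: contrapT => nB.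
have t1 : t < 1.
  by case/andP: t01 => _; rewrite le_eqVlt => /predU1P[e|//]; rewrite e in nB.
have : nbhs t (~` B) by apply: open_nbhs_nbhs; split=> //; exact: closed_openC.
move=> /nbhs_ballP[d /= d0 hd].
pose s := Num.min (t + d / 2) 1.
have ts : t < s by rewrite lt_min t1 ltrDl divr_gt0.
have s1 : s <= 1 by rewrite ge_min lexx orbT.
have s01 : 0 <= s <= 1 by rewrite s1 andbT (le_trans _ (ltW ts))//; case/andP: t01.
case: (AB s s01) => [As'|Bs]; first by apply: (last s) As'; rewrite ts.
apply: (hd s) => //; rewrite /ball/= distrC ger0_norm ?subr_ge0 ?(ltW ts)//.
rewrite ltrBlDl; apply: le_lt_trans (_ : t + d / 2 < _); first by rewrite ge_min lexx.
by rewrite ltrD2l ltr_pdivrMr// ltr_pMr// ltr1n.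
Qed.

Lemma fin_eps n (Q : 'I_n -> R -> Prop) : (forall j, exists2 e, 0 < e & forall r, 0 < r <= e -> Q j r) ->
  exists2 e, 0 < e & forall j r, 0 < r <= e -> Q j r.
Proof.
move=> /(_ _)/cid2-/all_sig2[e e0 h]; exists (\big[Num.min/1]_j e j).
  by elim/big_rec: _ => // j x _ x0; rewrite lt_min e0.
move=> j r /andP[r0 re]; apply: h; rewrite r0/=; apply: le_trans re _.
by rewrite (bigD1 j)//= ge_min lexx.
Qed.

Lemma itg_ibox p r : 0 <= r -> itbp (ibox p r) /\ itgp (ibox p r) = (2 * r) ^+ 2.
Proof.
move=> r0; have m1 : mfun (ibox p r) by apply: measurable_indic; exact: box_meas.
have i1 : itbp (ibox p r).
  apply: (@itb_bnd _ 1 p r) => // y; last exact: ibox0.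
  by have /andP[h1 h2] := ibox_ge0 p r y; rewrite ger0_norm.
split=> //; apply: EFin_inj; rewrite itgE// -(leb2_box p r0) /ibox.
by rewrite integral_indic ?setIT//; exact: box_meas.
Qed.

Section OneMesh.
Variables (Om : set P) (n : nat) (T : 'I_n -> set P) (v : 'I_n -> 'I_3 -> P) (l : 'I_n -> 'I_3 -> R * R * R).
Variables (H : 'I_n -> R) (k h : R).
Hypotheses (M : mesh Om T v l H k h) (k0 : 0 < k).
Implicit Types (i j : 'I_n) (m : 'I_3).

Let tT i := m_tri M i.

Lemma H_gt0 i : 0 < H i. Proof. by case/andP: (m_H M i). Qed.

Lemma kH_gt0 i : 0 < k * H i. Proof. by rewrite mulr_gt0// H_gt0. Qed.

(** A box of side 2 k H fits into a triangle whose extent is at most H. The index serves as the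
    witness that there is a triangle. *)
Lemma k_le : 'I_n -> k <= 1 / 2.
Proof.
move=> i; have [z hz] := m_in M i; have kH := kH_gt0 i.
have h1 : T i (z.1 + k * H i, z.2).
  by apply: hz; split; rewrite /= ?subrr ?normr0 ?(ltW kH)// addrAC subrr add0r gtr0_norm.
have h2 : T i (z.1 - k * H i, z.2).
  by apply: hz; split; rewrite /= ?subrr ?normr0 ?(ltW kH)// addrAC subrr add0r normrN gtr0_norm.
have [+ _] := m_out M h2 h1; rewrite /= (_ : _ - _ = (2 * k) * H i); last by ring.
rewrite gtr0_norm ?mulr_gt0 ?H_gt0// -ler_pdivlMr ?H_gt0// divff ?gt_eqF ?H_gt0//; lra.
Qed.

(** On the triangle the function is a convex combination of its vertex values, hence bounded by D;
    the values at opposite points of the inscribed box give the slopes. *)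
Lemma grad_bd i q D : (forall m, `|ev q (v i m)| <= D) -> `|q.1.2| <= D / (k * H i) /\ `|q.2| <= D / (k * H i).
Proof.
move=> hD; have B x : T i x -> `|ev q x| <= D.
  move=> Tx; rewrite (tri_aff (tT i)) (le_trans (ler_norm_sum _ _ _))//.
  rewrite -[leRHS]mul1r -(tri_sum1 (tT i) x) mulr_suml; apply: ler_sum => m _.
  by rewrite normrM ger0_norm ?(tri_T (tT i) x).1// ler_wpM2l// (tri_T (tT i) x).1.
have [z hz] := m_in M i; have kH := kH_gt0 i.
have z1 e : `|e| <= k * H i -> T i (z.1 + e, z.2).
  by move=> he; apply: hz; split; rewrite /= ?subrr ?normr0 ?(ltW kH)// addrAC subrr add0r.
have z2 e : `|e| <= k * H i -> T i (z.1, z.2 + e).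
  by move=> he; apply: hz; split; rewrite /= ?subrr ?normr0 ?(ltW kH)// addrAC subrr add0r.
have e1 : `|k * H i| <= k * H i by rewrite gtr0_norm.
have e2 : `|- (k * H i)| <= k * H i by rewrite normrN.
have G (u u' g : R) : `|u| <= D -> `|u'| <= D -> u - u' = 2 * (g * (k * H i)) -> `|g| <= D / (k * H i).
  move=> h1 h2 e; rewrite ler_pdivlMr// -[X in _ * X]gtr0_norm// -normrM.
  move: h1 h2; rewrite !ler_norml => /andP[? ?] /andP[? ?]; apply/andP; split; lra.
split; [apply: (G _ _ _ (B _ (z1 _ e1)) (B _ (z1 _ e2)))|apply: (G _ _ _ (B _ (z2 _ e1)) (B _ (z2 _ e2)))];
  rewrite /ev/=; ring.
Qed.

(** Subtracting 1/2 centres the values 0 and 1 of the coordinate and improves the bound by a factor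
    2. *)
Lemma lam_slope i m : `|(l i m).1.2| <= (2 * (k * H i))^-1 /\ `|(l i m).2| <= (2 * (k * H i))^-1.
Proof.
have [m'|h1 h2] := @grad_bd i ((l i m).1.1 - 1 / 2, (l i m).1.2, (l i m).2) (1 / 2).
  rewrite (_ : ev _ _ = ev (l i m) (v i m') - 1 / 2); last by rewrite /ev/=; ring.
  rewrite (tri_v (tT i)); case: (_ == _) => /=; rewrite ler_norml; apply/andP; split; lra.
by rewrite invfM -div1r.
Qed.

Lemma lam_lip i m x y r : box x r y -> `|ev (l i m) y - ev (l i m) x| <= r / (k * H i).
Proof.
move=> [h1 h2]; have [g1 g2] := lam_slope i m.
rewrite (_ : _ - _ = (l i m).1.2 * (y.1 - x.1) + (l i m).2 * (y.2 - x.2)); last by rewrite /ev; ring.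
apply: le_trans (ler_normD _ _) _; rewrite !normrM.
apply: le_trans (lerD (ler_pM (normr_ge0 _) (normr_ge0 _) g1 h1) (ler_pM (normr_ge0 _) (normr_ge0 _) g2 h2)) _.
by apply: eqle; field; rewrite (gt_eqF k0) gt_eqF// H_gt0.
Qed.

Lemma vert_dist i m m' r : m != m' -> box (v i m) r (v i m') -> k * H i <= r.
Proof.
move=> mm /(lam_lip i m); rewrite !(tri_v (tT i)) eqxx (negPf mm) sub0r normrN normr1.
by rewrite ler_pdivlMr ?kH_gt0// mul1r.
Qed.

(** Conformity is tested with the nodal value 1 at [v i m] and 0 elsewhere: seen from T i the
    interpolant is positive at x, seen from T j it vanishes unless that vertex belongs to T j. *)
Lemma share i j x m : T i x -> T j x -> 0 < ev (l i m) x -> exists m', v i m = v j m'.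
Proof.
move=> xi xj pos; pose w (y : P) : R := (`[< y = v i m >])%:R.
have := m_cf M w xi xj; rewrite [LHS](_ : _ = ev (l i m) x).
  move=> e; apply: contrapT => nm; have : 0 < itp (v j) (l j) w x by rewrite -e.
  rewrite /itp big1 ?ltxx// => m' _; rewrite /w asboolF ?mulr0// => e'; apply: nm; exists m'.
  by rewrite e'.
rewrite /itp (bigD1 m)//= /w asboolT// mulr1 big1 ?addr0// => m' mm.
by rewrite asboolF ?mulr0// => /(tri_inj (tT i)) e; rewrite e eqxx in mm.
Qed.

Lemma node_vertex i j m : T i (v j m) -> exists m', v j m = v i m'.
Proof. by move=> hv; apply: (share (tri_vin (tT j) m) hv); rewrite (tri_v (tT j)) eqxx. Qed.

(** Two common points force two common vertices. They are at distance at least k H i, seen from T i,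
    and at most H j, seen from T j. *)
Lemma edge_cmp i j x y : x != y -> T i x -> T i y -> T j x -> T j y -> k * H i <= H j.
Proof.
move=> xy xi yi xj yj; have lx := (tri_T (tT i) x).1 xi; have ly := (tri_T (tT i) y).1 yi.
have pos z : (exists m, 0 < ev (l i m) z).
  apply: contrapT => /forallNP no; have : (1 : R) <= 0; last by rewrite ler10.
  rewrite -(tri_sum1 (tT i) z); apply: sumr_le0 => m _; rewrite leNgt; apply/negP; exact: no.
have [m pm] := pos x.
have [m' mm pm'] : exists2 m', m != m' & (0 < ev (l i m') x) || (0 < ev (l i m') y).
  apply: contrapT => no; have z m' : m != m' -> ev (l i m') x = 0 /\ ev (l i m') y = 0.
    move=> mm; split; apply/eqP; rewrite eq_le ?lx ?ly andbT leNgt; apply/negP => p; apply: no; exists m' => //;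
      by rewrite p ?orbT.
  have one p : (forall m', m != m' -> ev (l i m') p = 0) -> ev (l i m) p = 1.
    move=> h'; rewrite -(tri_sum1 (tT i) p) (bigD1 m)//= big1 ?addr0// => m' mm; apply: h'.
    by rewrite eq_sym.
  move/eqP: xy; apply; rewrite (tri_1 (tT i) xi (one x (fun m' mm => (z m' mm).1))).
  by rewrite (tri_1 (tT i) yi (one y (fun m' mm => (z m' mm).2))).
have [a ea] := share xi xj pm.
have [b eb] : exists b : 'I_3, v i m' = v j b by case/orP: pm' => p; [exact: share xi xj p|exact: share yi yj p].
apply: (vert_dist mm); rewrite ea eb; apply: (m_out M (i := j)); exact: (tri_vin (tT j)).
Qed.

Lemma T_away j x : ~ T j x -> exists2 e, 0 < e & forall r, 0 < r <= e -> forall y, box x r y -> ~ T j y.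
Proof.
move=> nT; have [m hm] : exists m, ev (l j m) x < 0.
  apply: contrapT => /forallNP no; apply: nT; apply/(tri_T (tT j)) => m; rewrite leNgt; apply/negP; exact: no.
exists (- ev (l j m) x / 2 * (k * H j)).
  by rewrite mulr_gt0 ?kH_gt0// divr_gt0// oppr_gt0.
move=> r /andP[r0 hr] y /(lam_lip j m) hy /(tri_T (tT j))/(_ m) py; move: hy.
rewrite ger0_norm; last by rewrite subr_ge0 (le_trans (ltW hm)).
have : r / (k * H j) <= - ev (l j m) x / 2 by rewrite ler_pdivrMr ?kH_gt0.
move: (r / _) => r'; lra.
Qed.

Lemma local_cover x : exists2 e, 0 < e & forall y, closure Om y -> box x e y -> exists j, T j y /\ T j x.
Proof.
have [j|e e0 he] := @fin_eps n (fun j r => ~ T j x -> forall y, box x r y -> ~ T j y).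
  have [Tx|/T_away[e e0 he]] := pselect (T j x); first by exists 1.
  by exists e => // r hr _; exact: he.
exists e => // y /(m_cov M)[j yj] yx; exists j; split=> //; apply: contrapT => nT.
by apply: (he j e) nT y yx yj; rewrite e0 lexx.
Qed.

Lemma inner_pos i r y : 0 < r -> box y r `<=` T i -> forall m, 0 < ev (l i m) y.
Proof.
move=> r0 hb m; rewrite lt_neqAle eq_sym (tri_T (tT i) y).1 ?andbT; last first.
  by apply: hb; split; rewrite subrr normr0 ltW.
apply/eqP => z; have b1 e : `|e| <= r -> 0 <= ev (l i m) (y.1 + e, y.2).
  move=> he; apply: (tri_T (tT i) _).1; apply: hb; split; rewrite /= ?subrr ?normr0 ?(ltW r0)//.
  by rewrite addrAC subrr add0r.
have b2 e : `|e| <= r -> 0 <= ev (l i m) (y.1, y.2 + e).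
  move=> he; apply: (tri_T (tT i) _).1; apply: hb; split; rewrite /= ?subrr ?normr0 ?(ltW r0)//.
  by rewrite addrAC subrr add0r.
have r1 : `|r| <= r by rewrite gtr0_norm.
have r2 : `|- r| <= r by rewrite normrN.
have K (g : R) : 0 <= g * r -> 0 <= g * - r -> g = 0.
  by rewrite mulrN oppr_ge0 pmulr_lge0// pmulr_lle0// => g0 g1; apply/eqP; rewrite eq_le g0 g1.
have e1 : (l i m).1.2 = 0.
  by apply: K; [have := b1 r r1|have := b1 (- r) r2]; move: z; rewrite /ev/=; lra.
have e2 : (l i m).2 = 0.
  by apply: K; [have := b2 r r1|have := b2 (- r) r2]; move: z; rewrite /ev/=; lra.
have := tri_v (tT i) m m; rewrite eqxx => e3; move: z; rewrite -(_ : ev (l i m) (v i m) = ev (l i m) y).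
  by rewrite e3 => /eqP; rewrite oner_eq0.
by rewrite /ev e1 e2 !mul0r.
Qed.

(** By [share] every vertex of T i is a vertex of T j; both have three, so the triangles
    coincide. *)
Lemma open_disj i j x : T j x -> (forall m, 0 < ev (l i m) x) -> i = j.
Proof.
move=> xj pos; apply: (m_inj M); have xi : T i x by apply/(tri_T (tT i)) => m; exact: ltW.
have sub : forall m, exists m', v i m = v j m' by move=> m; exact: share xi xj (pos m).
have /choice[f hf] := sub; have injf : injective f.
  by move=> m m' e; apply: (tri_inj (tT i)); rewrite !hf e.
have sub' m : exists m', v j m = v i m'.
  by have := injF_onto injf m; move=> /codomP[m' ->]; exists m'; rewrite hf.
apply/seteqP; split=> y.
  apply: (tri_cvx (tT i)); first exact: tri_closed_convex (tT j).
  by move=> m; have [m' ->] := sub m; exact: tri_vin (tT j) m'.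
apply: (tri_cvx (tT j)); first exact: tri_closed_convex (tT i).
by move=> m; have [m' ->] := sub' m; exact: tri_vin (tT i) m'.
Qed.

(** Shrunk towards x to the common size e, the least of all sizes, the triangles contain disjoint
    boxes of side k e inside a box of side 2 e; compare areas. The inscribed boxes are halved to lie
    in the open triangles, which are disjoint. *)
Lemma node_count x (J : {set 'I_n}) : (forall j, j \in J -> T j x) -> #|J|%:R * k ^+ 2 <= 4.
Proof.
move=> hJ; have [j|e e0 he] := @fin_eps n (fun j r => r <= H j).
  by exists (H j); [exact: H_gt0|move=> r /andP[]].
have {}he j : e <= H j by apply: he; rewrite e0 lexx.
have bx j : exists z, j \in J -> box x e z /\ box z (k * e) `<=` [set y | T j y /\ box x e y].
  have [jJ|nJ] := boolP (j \in J); last by exists x.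
  have [z0 hz] := m_in M j; have xj := hJ j jJ; pose t := e / H j.
  have t0 : 0 < t by rewrite divr_gt0 ?H_gt0.
  have t1 : t <= 1 by rewrite ler_pdivrMr ?H_gt0// mul1r.
  have tH : t * H j = e by rewrite divfK// gt_eqF// H_gt0.
  have S y : T j y -> T j (cmb y x t) /\ box x e (cmb y x t).
    move=> yj; split; first by apply: ((cvxP (T j)).1 (tri_closed_convex (tT j))) => //; rewrite (ltW t0).
    have [d1 d2] := m_out M xj yj; rewrite -tH /box /cmb/=.
    rewrite (_ : t * y.1 + _ - _ = t * (y.1 - x.1)); last by ring.
    rewrite (_ : t * y.2 + _ - _ = t * (y.2 - x.2)); last by ring.
    have K (u : R) : `|u| <= H j -> `|t * u| <= t * H j by move=> hu; rewrite normrM (gtr0_norm t0) ler_pM2l.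
    by split; exact: K.
  have z0j : T j z0 by apply: hz; split; rewrite subrr normr0 ltW// kH_gt0.
  exists (cmb z0 x t) => _; split; first by case: (S _ z0j).
  move=> y [y1 y2]; pose y' : P := (z0.1 + (y.1 - (cmb z0 x t).1) / t, z0.2 + (y.2 - (cmb z0 x t).2) / t).
  have y'j : T j y'.
    have K (u a : R) : `|u| <= k * e -> `|a + u / t - a| <= k * H j.
      by move=> hu; rewrite addrAC subrr add0r normrM normfV (gtr0_norm t0) ler_pdivrMr// -mulrA (mulrC (H j)) tH.
    by apply: hz; split; exact: K.
  have -> : y = cmb y' x t.
    by case: y {y1 y2 y'j} @y' => a b; rewrite /cmb/=; congr (_, _); field; rewrite gt_eqF.
  exact: S.
have /choice[z hz] := bx.
have ke : 0 < k * e by rewrite mulr_gt0.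
have r2 : 0 <= k * e / 2 by rewrite divr_ge0// ltW.
have F y : \sum_(j <- enum J) ibox (z j) (k * e / 2) y <= ibox x e y.
  have sub j : j \in J -> box (z j) (k * e / 2) y -> box x e y /\ forall m, 0 < ev (l j m) y.
    move=> jJ [y1 y2]; have [_ hj] := hz j jJ; split.
      by have [] : T j y /\ box x e y by apply: hj; split; [apply: le_trans y1 _|apply: le_trans y2 _];
        rewrite ler_pdivrMr// ler_peMr ?(ltW ke)// ler1n.
    apply: (@inner_pos j (k * e / 2)); first by rewrite divr_gt0.
    move=> u [u1 u2]; have [] : T j u /\ box x e u; last by [].
    apply: hj; have K (c d f : R) : `|c - d| <= k * e / 2 -> `|d - f| <= k * e / 2 -> `|c - f| <= k * e.
      by rewrite !ler_norml => /andP[? ?] /andP[? ?]; apply/andP; split; lra.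
    by split; [exact: K u1 y1|exact: K u2 y2].
  have [[j jJ jy]|no] := pselect (exists2 j, j \in J & box (z j) (k * e / 2) y); last first.
    rewrite big_seq big1 => [|j]; first by case/andP: (ibox_ge0 x e y).
    by rewrite mem_enum => jJ; rewrite ibox0// => b; apply: no; exists j.
  have [bxy pos] := sub j jJ jy; rewrite ibox1// (bigD1_seq j) ?mem_enum ?enum_uniq//= ibox1//.
  rewrite big_seq_cond big1 ?addr0// => j' /andP[]; rewrite mem_enum => j'J jj.
  rewrite ibox0// => b; have [_ pos'] := sub j' j'J b; move/eqP: jj; apply; apply: open_disj pos'.
  by apply/(tri_T (tT j)) => m; exact: ltW.
have I j := itg_ibox (z j) r2; have [ix ex] := itg_ibox x (ltW e0).
have := itg_le (itb_sum _ (fun j => (I j).1)) ix F.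
rewrite (itg_sum _ (fun j => (I j).1)) ex (eq_bigr _ (fun j _ => (I j).2)).
rewrite big_const_seq count_predT -cardE iter_addr addr0.
rewrite (_ : 2 * (k * e / 2) = k * e); last by field.
rewrite !exprMn -[X in X <= _ -> _]mulr_natl mulrA ler_pM2r ?exprn_gt0// => /le_trans; apply.
by apply: eqle; ring.
Qed.

Lemma T_closed_line j x y : closed [set t : R | T j (cmb x y t)].
Proof.
rewrite (_ : [set t | _] = \bigcap_(m in [set: 'I_3]) [set t | 0 <= t * ev (l j m) x + (1 - t) * ev (l j m) y]).
  apply: closed_bigI => m _.
  rewrite (_ : [set t | _] = (fun t : R => t * ev (l j m) x + (1 - t) * ev (l j m) y) @^-1` [set u | 0 <= u])//.
  apply: closed_comp (@closed_ge R 0) => t _ /=.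
  apply: cvgD; apply: cvgM; try exact: cvg_cst; first exact: cvg_id.
  by apply: cvgB; [exact: cvg_cst|exact: cvg_id].
apply/seteqP; split=> t /=; first by move=> /(tri_T (tT j)) h' m _; rewrite /= -ev_cmb.
by move=> h'; apply/(tri_T (tT j)) => m; rewrite ev_cmb; exact: h'.
Qed.

Lemma T_closed_lines (J : pred 'I_n) x y : closed [set t : R | exists2 j, J j & T j (cmb x y t)].
Proof.
rewrite (_ : [set t | _] = \bigcup_(j in [set j | J j]) [set t : R | T j (cmb x y t)]).
  by apply: closed_bigcup => [|j _]; [exact: finite_finset || exact: finite_finpred|exact: T_closed_line].
by apply/seteqP; split=> t [j h1 h2]; exists j.
Qed.

Hypothesis cO : is_convex (closure Om).

(* Two triangles at x, one with property J and one without, are joined by a segment close to x that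
   avoids x; by connectedness some point of it lies in triangles of both kinds. *)
Lemma node_link (J : pred 'I_n) i j x : T i x -> T j x -> J i -> ~~ J j ->
  exists a b y, [/\ J a, ~~ J b, x != y & [/\ T a x, T a y, T b x & T b y]].
Proof.
move=> xi xj Ji Jj; have [e e0 he] := local_cover x.
(* This determinant vanishes exactly when x, p and q are collinear; for a pair with nonzero value
   the joining segment avoids x. *)
pose X (p q : P) : R := (p.1 - x.1) * (q.2 - x.2) - (p.2 - x.2) * (q.1 - x.1).
have [p' pj' px'] : exists2 p', T j p' & p' != x.
  have [eq|ne] := eqVneq (v j o0) x; last by exists (v j o0) => //; exact: tri_vin (tT j) o0.
  by exists (v j o1); [exact: tri_vin (tT j) o1|rewrite -eq; apply/eqP => /(tri_inj (tT j))].
have [p pi pX] : exists2 p, T i p & X p p' != 0.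
  have [z hz] := m_in M i; have kH := kH_gt0 i.
  have zi : T i z by apply: hz; split; rewrite subrr normr0 ltW.
  have z1 : T i (z.1 + k * H i, z.2).
    by apply: hz; split; rewrite /= ?subrr ?normr0 ?(ltW kH)// addrAC subrr add0r gtr0_norm.
  have z2 : T i (z.1, z.2 + k * H i).
    by apply: hz; split; rewrite /= ?subrr ?normr0 ?(ltW kH)// addrAC subrr add0r gtr0_norm.
  apply: contrapT => no; have X0 p : T i p -> X p p' = 0.
    by move=> ip; apply: contrapT => /eqP Xn; apply: no; exists p.
  move: (X0 _ zi) (X0 _ z1) (X0 _ z2); rewrite /X/= => e1 e2 e3.
  have d2 : k * H i * (p'.2 - x.2) = 0 by move: e1 e2; lra.
  have d1 : k * H i * (p'.1 - x.1) = 0 by move: e1 e3; lra.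
  have K (u u' : R) : k * H i * (u - u') = 0 -> u = u'.
    by move=> /eqP; rewrite mulf_eq0 (gt_eqF kH)/= subr_eq0 => /eqP.
  move/K: d1 => d1; move/K: d2 => d2.
  by move/eqP: px'; apply; case: (p') (x) d1 d2 => ? ? [? ?] /= -> ->.
have [r [r0 r1 hr]] : exists r, [/\ 0 < r, r <= 1 & forall q : P, (q = p \/ q = p') -> box x e (cmb q x r)].
  pose D := `|p.1 - x.1| + `|p.2 - x.2| + (`|p'.1 - x.1| + `|p'.2 - x.2|) + 1.
  have D0 : 0 < D by rewrite ltr_wpDl// !addr_ge0.
  have K (c d : R) : `|c - d| <= D -> `|Num.min 1 (e / D) * c + (1 - Num.min 1 (e / D)) * d - d| <= e.
    have m0 : 0 <= Num.min 1 (e / D) by rewrite le_min ler01 divr_ge0// ltW.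
    move=> hc; rewrite (_ : _ - d = Num.min 1 (e / D) * (c - d)); last by ring.
    rewrite normrM (ger0_norm m0); apply: (@le_trans _ _ (e / D * D)); last by rewrite divfK// gt_eqF.
    by apply: ler_pM => //; rewrite ge_min lexx orbT.
  exists (Num.min 1 (e / D)); split; [by rewrite lt_min ltr01 divr_gt0|by rewrite ge_min lexx|].
  have n1 := normr_ge0 (p.1 - x.1); have n2 := normr_ge0 (p.2 - x.2).
  have n3 := normr_ge0 (p'.1 - x.1); have n4 := normr_ge0 (p'.2 - x.2).
  by move=> q [->|->]; split; apply: K; rewrite /D; lra.
have r01 : 0 <= r <= 1 by rewrite r1 ltW.
have ca (q q' : P) a : T a q -> T a q' -> T a (cmb q q' r).
  by move=> h1 h2; apply: ((cvxP (T a)).1 (tri_closed_convex (tT a))).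
pose q := cmb p x r; pose q' := cmb p' x r.
have qi : T i q by exact: ca.
have qj : T j q' by exact: ca.
have ne t : cmb q q' t != x.
  apply: contra_neq pX => e'.
  have e1 : t * (p.1 - x.1) + (1 - t) * (p'.1 - x.1) = 0.
    apply: (mulfI (lt0r_neq0 r0)); move: (congr1 fst e'); rewrite /q /q' /cmb/= mulr0; lra.
  have e2 : t * (p.2 - x.2) + (1 - t) * (p'.2 - x.2) = 0.
    apply: (mulfI (lt0r_neq0 r0)); move: (congr1 snd e'); rewrite /q /q' /cmb/= mulr0; lra.
  have tX : t * X p p' = 0.
    transitivity ((t * (p.1 - x.1) + (1 - t) * (p'.1 - x.1)) * (p'.2 - x.2) -
      (t * (p.2 - x.2) + (1 - t) * (p'.2 - x.2)) * (p'.1 - x.1)); first by rewrite /X; ring.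
    by rewrite e1 e2 !mul0r subrr.
  have [t0|t0] := eqVneq t 0; last by move/eqP: tX; rewrite mulf_eq0 (negPf t0) => /eqP.
  exfalso; move/eqP: px'; apply; move: e1 e2; rewrite t0 !mul0r !add0r subr0 !mul1r => /eqP + /eqP.
  by rewrite !subr_eq0 => /eqP + /eqP; case: (p') (x) => ? ? [? ?] /= -> ->.
have bq t : 0 <= t <= 1 -> closure Om (cmb q q' t) /\ box x e (cmb q q' t).
  move=> t01; split.
    by apply: ((cvxP (closure Om)).1 cO) => //; apply/(m_cov M); [exists i|exists j].
  have [a1 a2] := hr p (or_introl erefl); have [b1 b2] := hr p' (or_intror erefl).
  have K (c d f : R) : `|c - f| <= e -> `|d - f| <= e -> `|t * c + (1 - t) * d - f| <= e.
    case/andP: t01 => t0 t1 h1 h2; have t1' : 0 <= 1 - t by rewrite subr_ge0.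
    rewrite (_ : _ - f = t * (c - f) + (1 - t) * (d - f)); last by ring.
    apply: le_trans (ler_normD _ _) _; rewrite !normrM (ger0_norm t0) (ger0_norm t1').
    apply: (@le_trans _ _ (t * e + (1 - t) * e)); last by apply: eqle; ring.
    by apply: lerD; exact: ler_wpM2l.
  by split; exact: K.
pose J1 a := (J a) && `[< T a x >]; pose J2 a := (~~ J a) && `[< T a x >].
have [] := @conn01 [set t | exists2 a, J2 a & T a (cmb q q' t)] [set t | exists2 a, J1 a & T a (cmb q q' t)].
- exact: T_closed_lines.
- exact: T_closed_lines.
- move=> t /bq[c b]; have [a [h1 h2]] := he _ c b.
  by have [Ja|nJ] := boolP (J a); [right|left]; exists a => //; rewrite /J1 /J2 ?Ja ?nJ/=; apply/asboolP.
- exists j; first by rewrite /J2 Jj; apply/asboolP.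
  by rewrite (_ : cmb _ _ _ = q')// /cmb !mul0r !add0r subr0 !mul1r; case: (q').
- exists i; first by rewrite /J1 Ji; apply/asboolP.
  by rewrite (_ : cmb _ _ _ = q)// /cmb !mul1r subrr !mul0r !addr0; case: (q).
move=> t [_ + + _] => [[b /andP[nJ /asboolP bx] tb] [a /andP[Ja /asboolP ax] ta]].
by exists a, b, (cmb q q' t); split=> //; rewrite eq_sym.
Qed.

Definition cnt := (Num.truncn (4 / k ^+ 2)).+1.

(** Otherwise the sizes at x would range over more than the [cnt] intervals from k^-m H j to
    k^-(m+1) H j. Since at most 4 / k^2 triangles meet at x, one interval contains no size. By
    [node_link] two triangles on the two sides of this gap share a second point, and [edge_cmp]
    forbids a ratio above 1 / k. *)
Lemma star_cmp i j x : T i x -> T j x -> k ^+ cnt * H i <= H j.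
Proof.
move=> xi xj; rewrite leNgt; apply/negP => lt.
pose tau (m : nat) : R := k^-1 ^+ m * H j.
have k1 : k < 1 by have := k_le i; lra.
have kV : 1 < k^-1 by rewrite invf_gt1.
have tauS (m : nat) : tau m.+1 = k^-1 * tau m by rewrite /tau exprS mulrA.
have tau_mono (m m' : nat) : (m <= m')%N -> tau m <= tau m'.
  by move=> mm; rewrite ler_pM2r ?H_gt0// ler_weXn2l// ltW.
have [full|] := pselect (forall m : 'I_cnt, exists a, T a x /\ tau m < H a <= tau m.+1).
  have /choice[f hf] := full.
  have fi : injective f.
    move=> m m' e; apply: val_inj; have [_ /andP[a1 a2]] := hf m; have [_ /andP[b1 b2]] := hf m'.
    rewrite e in a1 a2; apply/eqP; rewrite eqn_leq; apply/andP; split; rewrite leqNgt; apply/negP => l'.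
      by have := lt_le_trans a1 (le_trans b2 (@tau_mono (val m').+1 (val m) l')); rewrite ltxx.
    by have := lt_le_trans b1 (le_trans a2 (@tau_mono (val m).+1 (val m') l')); rewrite ltxx.
  have := @node_count x (finset (mem (codom f))); rewrite cardsE card_codom// card_ord => cnt_le.
  have {cnt_le} := cnt_le (ltac:(by move=> a; rewrite inE => /codomP[m ->]; have [] := hf m)).
  rewrite -ler_pdivlMr ?exprn_gt0// leNgt => /negP; apply; exact: truncnS_gt.
move=> /existsNP[m gap].
have [||a [b [y [Ja Jb xy [ax ay bx by_]]]]] := @node_link (fun a => H a <= tau m) j i x xj xi.
- rewrite -[H j]mul1r ler_pM2r ?H_gt0//; rewrite exprn_ege1// ltW//.
- rewrite -ltNge; apply: le_lt_trans (tau_mono _ cnt (ltnW (ltn_ord m))) _.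
  by rewrite /tau exprVn ltr_pdivrMl ?exprn_gt0// .
have := edge_cmp xy bx by_ ax ay; apply/negP; rewrite -ltNge.
apply: le_lt_trans Ja _; have : tau m.+1 < H b.
  by rewrite ltNge; apply/negP => le; apply: gap; exists b; rewrite le andbT ltNge.
by rewrite tauS ltr_pdivrMl.
Qed.

Lemma separation i m j m' r : v i m != v j m' -> box (v i m) r (v j m') -> k * k ^+ cnt * H i <= r.
Proof.
set x := v i m; set y := v j m' => xy bxy; have [e e0 he] := local_cover x.
have r0 : 0 <= r by case: bxy => h1 _; exact: le_trans (normr_ge0 _) h1.
pose s := Num.min 1 (e / (r + 1)).
have r1 : 0 < r + 1 by rewrite ltr_wpDl.
have s0 : 0 < s by rewrite lt_min ltr01 divr_gt0.
have s1 : s <= 1 by rewrite ge_min lexx.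
have xi : T i x := tri_vin (tT i) m.
have [a [wa xa]] : exists a, T a (cmb y x s) /\ T a x.
  apply: he.
    apply: ((cvxP (closure Om)).1 cO); [apply/(m_cov M)..|]; [exists j; exact: tri_vin (tT j) m'|by exists i|].
    by rewrite ltW.
  have K (c d : R) : `|c - d| <= r -> `|s * c + (1 - s) * d - d| <= e.
    move=> hc; rewrite (_ : _ - d = s * (c - d)); last by ring.
    rewrite normrM (gtr0_norm s0); apply: (@le_trans _ _ (e / (r + 1) * (r + 1))).
      by apply: ler_pM => //; [exact: ltW|rewrite ge_min lexx orbT|apply: le_trans hc _; rewrite lerDl].
    by rewrite divfK// gt_eqF.
  by case: bxy => h1 h2; split; exact: K.
have ka := star_cmp xi xa.
have suff' : k * H a <= r -> k * k ^+ cnt * H i <= r.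
  by apply: le_trans; rewrite -mulrA ler_pM2l.
have [lt|/suff'//] := ltP r (k * H a).
have [b xb'] := node_vertex xa; have xb : x = v a b := xb'.
have ya : T a y.
  apply/(tri_T (tT a)) => c; have := (tri_T (tT a) _).1 wa c; rewrite ev_cmb.
  have [<-|bc] := eqVneq b c.
    move=> _; have := lam_lip a b bxy; rewrite xb (tri_v (tT a)) eqxx ler_distl => /andP[+ _].
    apply: le_trans; rewrite subr_ge0 ler_pdivrMr ?kH_gt0// mul1r; exact: ltW.
  by rewrite xb (tri_v (tT a)) eq_sym (negPf bc) mulr0 addr0 pmulr_rge0.
have [b' yb] := node_vertex ya.
apply: suff'; apply: (@vert_dist a b b'); last by rewrite -xb -yb.
by apply: contra_neq xy => e'; rewrite xb /y yb e'.
Qed.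

End OneMesh.

End MeshGeometry.

(** * Lipschitz functions vanishing outside a convex domain *)

Section LipschitzH10.
Implicit Types (p : P) (c L B : R) (i : 'I_2).

Lemma conv_near u r p c e : 0 < r -> itbp u ->
  (forall y, `|p.1 - y.1| < r -> `|p.2 - y.2| < r -> `|u y - c| <= e) -> `|conv u (kr r) p - c| <= e.
Proof.
move=> r0 iu hu; have [C bC] := kr_b r0.
have [i1 ->] := conv_alt r0 (conv_itb p iu (Ker_meas (kr_Ker r)) bC).
have ik := kr_itb r0; have k1 := kr_int r0.
have e0 : 0 <= e by apply: le_trans (normr_ge0 _) (hu p _ _); rewrite subrr normr0.
have -> : itgp (fun z => u (aff p 1 z) * kr r z) - c = itgp (fun z => u (aff p 1 z) * kr r z - c * kr r z).
  by rewrite (itgB i1 (itbZ _ ik)) (itgZ _ ik) k1 mulr1.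
apply: le_trans (itg_norm (itbB i1 (itbZ _ ik))) _.
apply: (@le_trans _ _ (itgp (fun z => e * kr r z))); last by rewrite (itgZ _ ik) k1 mulr1.
apply: (itg_le (itb_norm (itbB i1 (itbZ _ ik))) (itbZ _ ik)).
move=> z; rewrite -mulrBl normrM (ger0_norm (kr_ge0 _ _)).
have [kz|kz] := eqVneq (kr r z) 0; first by rewrite kz !mulr0.
apply: ler_wpM2r; first exact: kr_ge0.
by apply: hu; rewrite /aff/= mul1r opprD addNKr normrN ltNge; apply: contra_neqN kz => h; apply: kr_out => //; [left|right].
Qed.

Lemma L2_cvg0 (fn : nat -> P -> R) f C B : 0 <= B -> (forall n, mfun (fn n)) -> mfun f ->
  (forall n x, `|fn n x| <= C) -> (forall x, `|f x| <= C) ->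
  (forall n x, ~ box 0 B x -> fn n x = 0) -> (forall x, ~ box 0 B x -> f x = 0) ->
  {ae leb2, forall x, fn n x @[n --> \oo] --> f x} ->
  forall e, 0 < e -> exists N, forall n, (N <= n)%N -> n2p (fun x => fn n x - f x) <= e.
Proof.
move=> B0 mfn mf bn b zn z cv e e0.
have C0 : 0 <= C by exact: le_trans (normr_ge0 _) (b 0).
have cv2 : {ae leb2, forall x, (fn n x - f x) ^+ 2 @[n --> \oo] --> 0}.
  apply: filterS cv => x h; have h2 : (fun n => fn n x - f x) @ \oo --> f x - f x by apply: cvgB => //; exact: cvg_cst.
  rewrite (subrr (f x)) in h2; have h3 := cvgM h2 h2; rewrite (mulr0 (0 : R)) in h3.
  by under eq_fun do rewrite expr2; exact: h3.
have [|_ _] := @dct _ _ _ leb2 (fun n x => (fn n x - f x) ^+ 2) (fun=> 0) (fun x => (C + C) ^+ 2 * ibox 0 B x)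
  (fun n => measurable_funX _ (measurable_funB (mfn n) mf)) (measurable_cst _) (itbZ _ (itg_ibox 0 B0).1) cv2.
  move=> n x; have [h|h] := pselect (box 0 B x); last by rewrite zn// z// subrr expr0n normr0 mulr_ge0 ?sqr_ge0//; case/andP: (ibox_ge0 0 B x).
  rewrite ibox1// mulr1 normrX lerXn2r ?nnegrE ?addr_ge0//; apply: le_trans (ler_normB _ _) _; exact: lerD.
rewrite itg0 => /cvgrPdist_le/(_ (e ^+ 2) (exprn_gt0 _ e0))[N _ hN]; exists N => n /hN /=.
rewrite sub0r normrN => h; apply: n2_le; first exact: ltW.
exact: le_trans (ler_norm _) h.
Qed.

Lemma lip_cont u L : (forall x y, `|u x - u y| <= L * (`|x.1 - y.1| + `|x.2 - y.2|)) -> continuous (u : P -> R^o).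
Proof.
move=> hu x; apply/cvgrPdist_le => e e0; have L1 : 0 < `|L| + 1 by rewrite ltr_wpDl.
apply/nbhs_boxP; exists (e / (`|L| + 1) / 2); first by rewrite !divr_gt0.
move=> y h1 h2; apply: le_trans (hu x y) _; rewrite distrC [`|x.2 - y.2|]distrC.
apply: (@le_trans _ _ ((`|L| + 1) * (e / (`|L| + 1) / 2 + e / (`|L| + 1) / 2))); last first.
  by apply: eqle; field; rewrite gt_eqF.
apply: (@le_trans _ _ ((`|L| + 1) * (`|y.1 - x.1| + `|y.2 - x.2|))).
  by apply: ler_wpM2r; rewrite ?addr_ge0// (le_trans (ler_norm L))// lerDl.
by apply: ler_wpM2l; [exact: ltW|apply: lerD; exact: ltW].
Qed.

Section Lip.
Variables (Om : set P) (x0 : P) (r0 B L : R) (u : P -> R) (G : 'I_2 -> P -> R).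
Hypotheses (cO : is_convex Om) (OB : Om `<=` box 0 B) (r00 : 0 < r0) (Bx : box x0 r0 `<=` Om).
Hypotheses (hu : forall x y, `|u x - u y| <= L * (`|x.1 - y.1| + `|x.2 - y.2|)).
Hypotheses (uo : forall x, ~ Om x -> u x = 0 /\ forall i, G i x = 0).
Hypotheses (Gm : forall i, mfun (G i)) (GL : forall i x, `|G i x| <= L).
Hypothesis hG : {ae leb2, forall x, exists2 r, 0 < r & forall y, box x r y ->
  u y = u x + (G 0 x * (y.1 - x.1) + G 1 x * (y.2 - x.2)) /\ forall i, G i y = G i x}.

Let B0 : 0 <= B.
Proof.
have [h _] : box 0 B x0 by apply: OB; apply: Bx; split; rewrite subrr normr0 ltW.
exact: le_trans (normr_ge0 _) h.
Qed.

Let L0 : 0 <= L. Proof. exact: le_trans (normr_ge0 _) (GL 0 0). Qed.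

Let cu := lip_cont hu.

Let ub : exists C, forall x, `|u x| <= C.
Proof. by apply: (cont_bnd (@box_compact 0 B) cu) => x nB; apply: (uo _).1 => /OB. Qed.

Let zu x : ~ box 0 B x -> u x = 0 /\ forall i, G i x = 0. Proof. by move=> nB; apply: uo => /OB. Qed.

(** By [hG] the difference quotient of u at almost every point equals the derivative once the step
    is small, and it is bounded by L, so dominated convergence applies. *)
Lemma lip_wpair : wpair Om u G.
Proof.
have [M hM] := ub; have mu := cont_meas cu.
have u2 : L2p u.
  by apply: (n2_bnd (x := 0) (r := B) (c := M) B0 _ mu hM _).1 => [|y /zu[]//]; exact: le_trans (normr_ge0 _) (hM 0).
have G2 i : L2p (G i).
  by apply: (n2_bnd (x := 0) (r := B) B0 L0 (Gm i) (GL i) _).1 => y /zu[_].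
split=> // psi i tp; have kp := test_Ker tp; have [kpi _ _ _] := KerP kp.
have [_ [M' bM'] _ _] := KerP (kpi i); have [C C0 hC] := Ker_dir i kp.
have p2 := test_L2 tp; have pp2 := test_L2 (test_partial i tp).
pose h n : R := n.+1%:R^-1; have h0 n : 0 < h n by rewrite invr_gt0.
have h1 n : h n <= 1 by rewrite invf_le1// ler1n.
have hcv : h n @[n --> \oo] --> 0 by exact: cvg_harmonic.
pose e (s : R) : P := (s * (basis_vec R i).1, s * (basis_vec R i).2).
have sh (f : P -> R) s : L2p f -> L2p (f \o aff (e s) 1) by exact: L2_aff.
(* A n has the difference quotient on u and D n on psi; a translation shows that their integrals
   agree. *)
pose A n x := (h n)^-1 * (u (aff (e (h n)) 1 x) * psi x - u x * psi x).
pose D n x := (h n)^-1 * (u x * psi (aff (e (- h n)) 1 x) - u x * psi x).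
have AD n : itgp (A n) = itgp (D n).
  have i1 := L2M (sh _ (h n) u2) p2; have i2 := L2M u2 (sh _ (- h n) p2); have i3 := L2M u2 p2.
  rewrite /A /D (itgZ _ (itbB i1 i3)) (itgZ _ (itbB i2 i3)) (itgB i1 i3) (itgB i2 i3).
  congr (_ * (_ - _)); have := itg_aff (e (h n)) ltr01 i2; rewrite expr1n invr1 mul1r => <-; congr itg.
  apply/funext => -[a b] /=; congr (_ * psi _); rewrite /aff /e/=; congr (_, _); ring.
have lim1 : itgp (A n) @[n --> \oo] --> itgp (fun x => G i x * psi x).
  have [|||||_ _] := @dct _ _ _ leb2 A (fun x => G i x * psi x) (fun x => L * `|psi x|) => //.
  - move=> n; apply: measurable_funM => //; have [m1 _] := sh _ (h n) u2; have [m2 _] := p2.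
    by apply: measurable_funB; apply: measurable_funM.
  - by apply: measurable_funM; [exact: Gm|case: p2].
  - by apply: itbZ; apply: itb_norm; exact: test_itb tp.
  - apply: filterS hG => x [r rr hr]; apply: cvg_near_cst.
    have : \forall n \near \oo, h n <= r.
      by move/cvgrPdist_le : hcv => /(_ r rr); apply: filterS => n; rewrite sub0r normrN ger0_norm// ltW.
    move=> H; apply: filterS H => n hn; have [|uE _] := hr (aff (e (h n)) 1 x).
      rewrite /aff/e; split; rewrite /= mul1r addrK normrM (gtr0_norm (h0 n)).
        by apply: le_trans hn; rewrite ler_piMr ?(ltW (h0 n))//; case: (ord2P i) => ->; rewrite /= ?normr1 ?normr0.
      by apply: le_trans hn; rewrite ler_piMr ?(ltW (h0 n))//; case: (ord2P i) => ->; rewrite /= ?normr1 ?normr0.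
    rewrite /A uE /aff/e/= !mul1r !addrK.
    by case: (ord2P i) => -> /=; field; rewrite gt_eqF// ltr_wpDl.
  - move=> n x; rewrite /A -mulrBl mulrA normrM; apply: ler_wpM2r => //.
    rewrite normrM gtr0_norm ?invr_gt0// ler_pdivrMl//; apply: le_trans (hu _ _) _.
    rewrite /aff/e/= !mul1r !addrK mulrC; apply: ler_wpM2r => //.
    rewrite !normrM (gtr0_norm (h0 n)); case: (ord2P i) => ->; rewrite /= ?eqxx /= ?normr1 ?normr0 ?mulr1 ?mulr0 ?addr0 ?add0r//.
have lim2 : itgp (D n) @[n --> \oo] --> itgp (fun x => - (u x * partial i psi x)).
  have [|||||_ _] := @dct _ _ _ leb2 D (fun x => - (u x * partial i psi x)) (fun x => (C + M') * `|u x|) => //.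
  - move=> n; apply: measurable_funM => //; have [m1 _] := sh _ (- h n) p2; have [m2 _] := p2.
    by apply: measurable_funB; apply: measurable_funM.
  - by apply: measurableT_comp => //; apply: measurable_funM; [exact: mu|case: pp2].
  - by apply: itbZ; apply: itb_norm; apply: (itb_bnd mu hM (x := 0) (r := B)) => y /zu[].
  - apply: aeW => x; apply/cvgrPdist_le => d d0.
    have c0 : 0 < `|u x| * C + 1 by rewrite ltr_wpDl// mulr_ge0.
    move/cvgrPdist_le : hcv => /(_ _ (divr_gt0 d0 c0)); apply: filterS => n; rewrite sub0r normrN gtr0_norm// => hn.
    have := hC x (- h n); rewrite -/(e (- h n)) sqrrN => q.
    rewrite distrC (_ : D n x - _ = (h n)^-1 * (u x * (psi (aff (e (- h n)) 1 x) - psi x - - h n * partial i psi x))); last first.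
      by rewrite /D; field; rewrite gt_eqF// ltr_wpDl.
    rewrite normrM gtr0_norm ?invr_gt0// ler_pdivrMl// normrM; apply: le_trans (ler_wpM2l (normr_ge0 _) q) _.
    rewrite mulrA expr2 mulrA mulrC; apply: ler_wpM2l; first exact: ltW.
    move: hn; rewrite ler_pdivlMr//; apply: le_trans; rewrite mulrC; apply: ler_wpM2l; first exact: ltW.
    by rewrite lerDl.
  - move=> n x; rewrite /D -mulrBr mulrCA normrM mulrC; apply: ler_wpM2r => //.
    have := hC x (- h n); rewrite -/(e (- h n)) sqrrN => q.
    rewrite normrM gtr0_norm ?invr_gt0// ler_pdivrMl//.
    rewrite -[X in `|X|](subrK (- h n * partial i psi x)); apply: le_trans (ler_normD _ _) _.
    rewrite [leRHS]mulrDr; apply: lerD; last first.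
      by rewrite normrM normrN (gtr0_norm (h0 n)); apply: ler_wpM2l => //; exact: ltW.
    by apply: le_trans q _; rewrite mulrC; apply: ler_wpM2r => //; rewrite expr2 ler_piMr// ltW.
have E : (fun n => itgp (A n)) = (fun n => itgp (D n)) by apply/funext.
rewrite E in lim1; rewrite (cvg_unique (@Rhausdorff R) lim1 lim2) itgN//.
exact: L2M u2 pp2.
Qed.

(** Mollified dilations of u are test functions. Near almost every point G is constant, so their
    gradient is eventually (1 + l) G there; with the bound 2 L this converges in L^2. *)
Lemma lip_H10 : H10 Om u G.
Proof.
have wp := lip_wpair; have [u2 G2 _ _] := wp; have [iu iG] := wpair_itb OB wp; have [M hM] := ub.
split=> // e e0.
pose h n : R := n.+1%:R^-1; have h0 n : 0 < h n by rewrite invr_gt0.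
have h1 n : h n <= 1 by rewrite invf_le1// ler1n.
have hcv : h n @[n --> \oo] --> 0 by exact: cvg_harmonic.
have tm n := moll_test cO OB r00 Bx (h0 n) wp.
pose a l : P := (- l * x0.1, - l * x0.2).
have rr n : 0 < h n * r0 / 2 by rewrite divr_gt0// mulr_gt0.
pose D x := r0 + (`|x.1 - x0.1| + `|x.2 - x0.2|); have D0 x : 0 < D x by rewrite ltr_pwDl// addr_ge0.
have near x y n : `|(aff (a (h n)) (1 + h n) x).1 - y.1| < h n * r0 / 2 ->
    `|(aff (a (h n)) (1 + h n) x).2 - y.2| < h n * r0 / 2 -> box x (h n * D x) y.
  have K (b c d q : R) : 0 <= q -> `|- h n * b + (1 + h n) * c - d| < h n * r0 / 2 ->
     `|d - c| <= h n * (r0 + (`|c - b| + q)).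
    move=> q0 hh; rewrite (_ : d - c = h n * (c - b) - (- h n * b + (1 + h n) * c - d)); last by ring.
    apply: le_trans (ler_normB _ _) _; rewrite normrM (gtr0_norm (h0 n)) !mulrDr.
    have := mulr_ge0 (ltW (h0 n)) q0; have := mulr_gt0 (h0 n) r00; move: hh.
    by move: (`|_|) (h n * `|_|) (h n * q) (h n * r0) => *; lra.
  move=> h2 h3; split; first exact: K h2.
  by rewrite /D [`|x.1 - _| + _]addrC; exact: K h3.
have zt n x : ~ box 0 B x -> moll x0 r0 (h n) u x = 0 /\ forall i, partial i (moll x0 r0 (h n) u) x = 0.
  by move=> nB; have [_ _ z _] := H10_test (tm n).1; apply: z => /OB.
have C1 := @L2_cvg0 (fun n => moll x0 r0 (h n) u) u (Num.max M 0) B B0 _ (cont_meas cu) _ _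
  (fun n x nB => (zt n x nB).1) (fun x nB => (zu nB).1).
have [N1 hN1] : exists N, forall n, (N <= n)%N -> n2p (fun x => moll x0 r0 (h n) u x - u x) <= e.
  apply: C1 e0.
  - by move=> n; case: (test_L2 (tm n).1).
  - move=> n x; rewrite le_max; apply/orP; left; rewrite /moll mul1r -[X in `|X|]subr0.
    by apply: conv_near => // y _ _; rewrite subr0.
  - by move=> x; rewrite le_max hM.
  apply: aeW => x; apply/cvgrPdist_le => d d0.
  have c0 : 0 < L * (D x + D x) + 1 by rewrite ltr_wpDl// mulr_ge0// addr_ge0// ltW.
  move/cvgrPdist_le : hcv => /(_ _ (divr_gt0 d0 c0)); apply: filterS => n; rewrite sub0r normrN gtr0_norm// => hn.
  rewrite distrC /moll mul1r; apply: conv_near => // y y1 y2; have [b1 b2] := near x y n y1 y2.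
  apply: le_trans (hu y x) _; apply: le_trans (ler_wpM2l L0 (lerD b1 b2)) _.
  rewrite -mulrDr mulrCA; move: hn; rewrite ler_pdivlMr//; apply: le_trans; apply: ler_wpM2l; first exact: ltW.
  by rewrite lerDl.
have C2 i : exists N, forall n, (N <= n)%N -> n2p (fun x => partial i (moll x0 r0 (h n) u) x - G i x) <= e.
  apply: (@L2_cvg0 (fun n => partial i (moll x0 r0 (h n) u)) (G i) (2 * L) B B0) e0 => //.
  - by move=> n; case: (test_L2 (test_partial i (tm n).1)).
  - move=> n x; rewrite (tm n).2 normrM; apply: ler_pM => //.
      by rewrite ger0_norm ?addr_ge0 ?(ltW (h0 n))//; have := h1 n; lra.
    by rewrite -[X in `|X|]subr0; apply: conv_near => // y _ _; rewrite subr0.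
  - by move=> x; apply: le_trans (GL i x) _; rewrite ler_peMl// ler1n.
  - by move=> n x nB; have [] := zt n x nB.
  - by move=> x nB; have [] := zu nB.
  apply: filterS hG => x [r rp hr]; apply/cvgrPdist_le => d d0.
  have c0 : 0 < L + 1 by rewrite ltr_wpDl.
  move/cvgrPdist_le : hcv => hcv'; have F1 := hcv' _ (divr_gt0 d0 c0); have F2 := hcv' _ (divr_gt0 rp (D0 x)).
  apply: filterS2 F1 F2 => n; rewrite sub0r normrN gtr0_norm// => hn; rewrite ler_pdivlMr// => hd.
  rewrite distrC (tm n).2.
  have : `|conv (G i) (kr (h n * r0 / 2)) (aff (a (h n)) (1 + h n) x) - G i x| <= 0.
    apply: conv_near => // y y1 y2; have [b1 b2] := near x y n y1 y2.
    by have [|_ ->] := hr y; [split; [exact: le_trans b1 hd|exact: le_trans b2 hd]|rewrite subrr normr0].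
  rewrite normr_le0 subr_eq0 => /eqP E; rewrite [conv _ _ _]E mulrDl mul1r addrAC subrr add0r normrM gtr0_norm//.
  move: hn; rewrite ler_pdivlMr//; apply: le_trans; apply: ler_wpM2l; first exact: ltW.
  by apply: le_trans (GL i x) _; rewrite lerDl.
have [N2 hN2] := C2 0; have [N3 hN3] := C2 1.
pose n := (N1 + N2 + N3)%N; exists (moll x0 r0 (h n) u); split.
- by case: (tm n).
- by apply: hN1; rewrite /n -addnA leq_addr.
- by move=> i; case: (ord2P i) => ->; [apply: hN2; rewrite /n addnAC leq_addl|apply: hN3; rewrite /n leq_addl].
Qed.

End Lip.

End LipschitzH10.

(** * Open convex sets, their closures, and null lines *)

Section OpenConvex.
Implicit Types (p : P) (q : R * R * R).

Lemma cmb0 x y : cmb y x 0 = x.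
Proof. by rewrite /cmb !mul0r !add0r subr0 !mul1r; case: (x). Qed.

Lemma cmb1 x y : cmb y x 1 = y.
Proof. by rewrite /cmb !mul1r subrr !mul0r !addr0; case: (y). Qed.

Lemma clos_box Om x e : closure Om x -> 0 < e -> exists2 y, Om y & box x e y.
Proof.
move=> cx e0; have [y [Oy [h1 h2]]] : Om `&` [set y : P | `|y.1 - x.1| < e /\ `|y.2 - x.2| < e] !=set0.
  by apply: cx; apply/nbhs_boxP; exists e.
by exists y => //; split; exact: ltW.
Qed.

(** z is replaced by a nearby point of Om, and y is moved so that the combination stays the same; as
    y is an interior point, the moved point remains in Om. *)
Lemma cvx_in Om y z t : open Om -> is_convex Om -> Om y -> closure Om z -> 0 < t <= 1 -> Om (cmb y z t).
Proof.
move=> /open_boxP oO /cvxP cO Oy cz /andP[t0 t1]; have [r r0 hr] := oO y Oy.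
have [|z' Oz' [h1 h2]] := clos_box (e := r * t / 2) cz; first by rewrite divr_gt0// mulr_gt0.
pose y' : P := (y.1 + (1 - t) / t * (z.1 - z'.1), y.2 + (1 - t) / t * (z.2 - z'.2)).
have K (a b c : R) : `|b - c| <= r * t / 2 -> `|a + (1 - t) / t * (c - b) - a| < r.
  move=> h; rewrite addrAC subrr add0r normrM distrC (ger0_norm (divr_ge0 _ (ltW t0))) ?subr_ge0//.
  have : (1 - t) / t * `|b - c| <= 1 / t * (r * t / 2).
    by apply: ler_pM => //; [rewrite divr_ge0 ?subr_ge0// ltW|rewrite ler_pM2r ?invr_gt0//; lra].
  move/le_lt_trans; apply; rewrite (_ : 1 / t * _ = r / 2); last by field; rewrite gt_eqF.
  by rewrite ltr_pdivrMr// ltr_pMr// ltr1n.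
have Oy' : Om y' by apply: hr; exact: K.
rewrite (_ : cmb y z t = cmb y' z' t); first by apply: cO; rewrite ?(ltW t0).
by rewrite /cmb/=; congr (_, _); field; rewrite gt_eqF.
Qed.

Lemma clos_cvx Om : is_convex Om -> is_convex (closure Om).
Proof.
move=> /cvxP cO; apply/cvxP => x y t cx cy t01 U /nbhs_boxP[r r0 hr].
have r2 : 0 < r / 2 by rewrite divr_gt0.
have [x' Ox' [x1 x2]] := clos_box cx r2; have [y' Oy' [y1 y2]] := clos_box cy r2.
exists (cmb x' y' t); split; first exact: cO.
case/andP: t01 => t0 t1; have t1' : 0 <= 1 - t by rewrite subr_ge0.
have K (a b c d : R) : `|b - a| <= r / 2 -> `|d - c| <= r / 2 -> `|t * b + (1 - t) * d - (t * a + (1 - t) * c)| < r.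
  move=> h1 h2; rewrite (_ : _ - _ = t * (b - a) + (1 - t) * (d - c)); last by ring.
  apply: le_lt_trans (ler_normD _ _) _; rewrite !normrM (ger0_norm t0) (ger0_norm t1').
  apply: (@le_lt_trans _ _ (r / 2)); last by rewrite ltr_pdivrMr// ltr_pMr// ltr1n.
  have := ler_wpM2l t0 h1; have := ler_wpM2l t1' h2; lra.
by apply: hr; exact: K.
Qed.

(** The segment from a point p of Om is prolonged beyond y inside the closure; y then lies strictly
    between p and a point of the closure. *)
Lemma int_clos Om y r : open Om -> is_convex Om -> Om !=set0 -> 0 < r -> box y r `<=` closure Om -> Om y.
Proof.
move=> oO cO [p Op] r0 hr; pose D := `|y.1 - p.1| + `|y.2 - p.2| + 1; pose e := r / D.
have D0 : 0 < D by rewrite ltr_wpDl// addr_ge0.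
have e0 : 0 < e by rewrite divr_gt0.
pose y' : P := (y.1 + e * (y.1 - p.1), y.2 + e * (y.2 - p.2)).
have K (a b : R) : `|b| <= D -> `|a + e * b - a| <= r.
  move=> h; rewrite addrAC subrr add0r normrM (gtr0_norm e0); apply: le_trans (ler_wpM2l (ltW e0) h) _.
  by rewrite /e divfK// gt_eqF.
have cy' : closure Om y'.
  by apply: hr; split; apply: K; rewrite /D -addrA ?lerDl ?addr_ge0// addrCA lerDl addr_ge0.
have e1 : 0 < 1 + e by rewrite addr_gt0.
rewrite (_ : y = cmb p y' (e / (1 + e))).
  by apply: cvx_in => //; rewrite divr_gt0//= ler_pdivrMr// mul1r lerDr.
by case: (y) @y' {cy' hr} D0 e0 e1 K => a b /= *; rewrite /cmb/=; congr (_, _); field; rewrite gt_eqF.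
Qed.

(** Every parallel to a suitable axis meets the line in one point; integrate over the parallels. *)
Lemma null_line q : (q.1.2 != 0) || (q.2 != 0) -> {ae leb2, forall x, ev q x != 0}.
Proof.
move=> hq; pose N : set P := [set x | ev q x = 0].
have mN : measurable N.
  have mf : mfun (ev q).
    have m1 : mfun (fst : P -> measurableTypeR R) by exact: measurable_fst.
    have m2 : mfun (snd : P -> measurableTypeR R) by exact: measurable_snd.
    by apply: measurable_funD; [apply: measurable_funD => //|]; apply: measurable_funM.
  by rewrite (_ : N = ev q @^-1` [set 0])// -[X in measurable X]setTI; apply: mf.
exists N; split=> //; last by move=> x /= /negP; rewrite negbK => /eqP.
have mi : mfun (fun x : P => (\1_N x)%:E : \bar R).
  by apply/measurable_EFinP; exact: measurable_indic.
have i0 (x : P) : (0 <= (\1_N x)%:E :> \bar R)%E by rewrite lee_fin.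
have z (S : set (measurableTypeR R)) (a : R) : (forall t, S t <-> t = a) -> (\int[leb]_t (\1_S t)%:E = 0)%E.
  move=> h; have -> : S = [set a] by apply/seteqP; split=> t /h.
  by rewrite integral_indic// setIT; exact: lebesgue_measure_set1.
have -> : leb2 N = (\int[leb2]_x (\1_N x)%:E)%E by rewrite integral_indic// setIT.
have E (S : set (measurableTypeR R)) (f : measurableTypeR R -> P) : S = f @^-1` N ->
   (fun t => (\1_N (f t))%:E : \bar R) = (fun t => (\1_S t)%:E).
  by move=> ->; apply/funext => t; rewrite !indicE; congr ((_ : bool)%:R%:E); apply/idP/idP => /set_mem h; apply/mem_set.
case/orP: hq => hq.
  rewrite (tonelli21 mi i0); apply: integral0_eq => t _.
  rewrite (E [set s : measurableTypeR R | ev q (s, t) = 0])//.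
  apply: (z _ (- (q.1.1 + q.2 * t) / q.1.2)) => s; rewrite /ev/=; split=> [h|->]; last by field.
  by apply: (mulfI hq); rewrite mulrCA mulfV// mulr1; move: h; lra.
rewrite (tonelli12 mi i0); apply: integral0_eq => s _.
rewrite (E [set t : measurableTypeR R | ev q (s, t) = 0])//.
apply: (z _ (- (q.1.1 + q.1.2 * s) / q.2)) => t; rewrite /ev/=; split=> [h|->]; last by field.
by apply: (mulfI hq); rewrite mulrCA mulfV// mulr1; move: h; lra.
Qed.

End OpenConvex.

(** * Lipschitz extension and a covering lemma *)

Section McShane.
Implicit Types (p : P) (w : P -> R).

Definition D1 x y : R := `|x.1 - y.1| + `|x.2 - y.2|.

Lemma D1_cmb x y t : 0 <= t <= 1 -> D1 x (cmb y x t) = t * D1 x y /\ D1 (cmb y x t) y = (1 - t) * D1 x y.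
Proof.
move=> /andP[t0 t1]; have t1' : 0 <= 1 - t by rewrite subr_ge0.
have K1 (a b : R) : `|a - (t * b + (1 - t) * a)| = t * `|a - b|.
  by rewrite -[in RHS](ger0_norm t0) -normrM; congr `|_|; ring.
have K2 (a b : R) : `|t * b + (1 - t) * a - b| = (1 - t) * `|a - b|.
  by rewrite -[in RHS](ger0_norm t1') -normrM; congr `|_|; ring.
by rewrite /D1 /cmb/=; split; [rewrite !K1 mulrDr|rewrite !K2 mulrDr].
Qed.

Lemma D1_ge0 x y : 0 <= D1 x y. Proof. by rewrite addr_ge0. Qed.

Lemma D1_tri x y z : D1 x z <= D1 x y + D1 y z.
Proof.
rewrite /D1 addrACA; apply: lerD; first by rewrite -(subrKA (y.1)) ler_normD.
by rewrite -(subrKA (y.2)) ler_normD.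
Qed.

Lemma D1C x y : D1 x y = D1 y x.
Proof. by rewrite /D1 ![`|x.1 - _|]distrC ![`|x.2 - _|]distrC. Qed.

Lemma D1_xx x : D1 x x = 0.
Proof. by rewrite /D1 !subrr normr0 addr0. Qed.

(** McShane's extension, the minimum over y of the cones w y + L D1 x y, built by recursion on the
    finite list. *)
Lemma mcshane_seq (s : seq P) w L : 0 <= L -> s != [::] -> exists f, [/\ forall x y, f x <= f y + L * D1 x y,
  forall x y, y \in s -> f x <= w y + L * D1 x y & forall x, exists2 y, y \in s & f x = w y + L * D1 x y].
Proof.
move=> L0; have lip a x y : w a + L * D1 x a <= w a + L * D1 y a + L * D1 x y.
  by rewrite -addrA lerD2l -mulrDr; apply: ler_wpM2l => //; rewrite addrC D1_tri.
elim: s => // a s IH _; have [->|sn] := eqVneq s [::].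
  exists (fun x => w a + L * D1 x a); split=> [x y|x y|x]; first exact: lip.
    by rewrite inE => /eqP ->.
  by exists a; rewrite ?mem_head.
have [f [h1 h2 h3]] := IH sn; exists (fun x => Num.min (f x) (w a + L * D1 x a)); split=> [x y|x y|x].
- by rewrite addr_minl le_min !ge_min h1 lip !orbT.
- by rewrite inE => /predU1P[->|/h2 h]; rewrite ge_min ?lexx ?orbT ?h.
- have [_|_] := leP (f x) (w a + L * D1 x a); last by exists a; rewrite ?mem_head.
  by have [y ys ->] := h3 x; exists y; rewrite ?inE ?ys ?orbT.
Qed.

Lemma mcshane (s : seq P) w L : 0 <= L ->
  (forall x y, x \in s -> y \in s -> w x <= w y + L * D1 x y) ->
  exists f, (forall x, x \in s -> f x = w x) /\ forall x y, `|f x - f y| <= L * D1 x y.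
Proof.
move=> L0 hw; have [->|sn] := eqVneq s [::].
  by exists (fun=> 0); split=> // x y; rewrite subrr normr0 mulr_ge0 ?D1_ge0.
have [f [h1 h2 h3]] := mcshane_seq w L0 sn; exists f; split=> [x xs|x y].
  apply/eqP; rewrite eq_le; apply/andP; split; first by have := h2 x x xs; rewrite D1_xx mulr0 addr0.
  by have [y ys ->] := h3 x; exact: hw.
by rewrite ler_norml lerBlDr lerBrDr [_ + f y]addrC [_ * _ + f y]addrC lerBlDr h1/= D1C h1.
Qed.

Lemma box_mono p r s : r <= s -> box p r `<=` box p s.
Proof. by move=> rs x [a b]; split; exact: le_trans rs. Qed.

Lemma box_sym p r x : box p r x -> box x r p.
Proof. by move=> [a b]; split; rewrite distrC. Qed.

Lemma box_add p r s x y : box p r x -> box x s y -> box p (r + s) y.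
Proof.
move=> [a b] [c d]; split.
  by rewrite -(subrKA x.1) addrC; apply: le_trans (ler_normD _ _) (lerD a c).
by rewrite -(subrKA x.2) addrC; apply: le_trans (ler_normD _ _) (lerD b d).
Qed.

(** Greedy choice of the largest radius, by induction on the cardinality. A discarded box meets a
    selected one of at least its radius, hence lies in the threefold enlargement of that one. *)
Lemma vitali n (c : 'I_n -> P) (r : 'I_n -> R) (J : {set 'I_n}) : (forall i, 0 <= r i) ->
  exists J' : {set 'I_n}, [/\ J' \subset J,
  (forall i j x, i \in J' -> j \in J' -> box (c i) (r i) x -> box (c j) (r j) x -> i = j) &
  forall i, i \in J -> exists j, [/\ j \in J', r i <= r j & exists x, box (c i) (r i) x /\ box (c j) (r j) x]].
Proof.
move=> r0; move: {2}#|J|.+1 (ltnSn #|J|) => m; elim: m J => // m IH J; rewrite ltnS => hJ.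
have [->|[i0 i0J]] := set_0Vmem J.
  by exists finset.set0; split=> [|i j x|i]; rewrite ?sub0set ?inE.
have [j jJ jmax] : exists2 j, j \in J & forall i, i \in J -> r i <= r j.
  by case: (Order.TotalTheory.arg_maxP r i0J) => j jJ h; exists j.
pose J1 := [set i in J | ~~ `[< exists x, box (c i) (r i) x /\ box (c j) (r j) x >]]%SET.
have cx i : box (c i) (r i) (c i) by split; rewrite subrr normr0.
have J1P i : (i \in J1) = (i \in J) && ~~ `[< exists x, box (c i) (r i) x /\ box (c j) (r j) x >] by rewrite inE.
have jJ1 : j \notin J1 by rewrite J1P negb_and negbK; apply/orP; right; apply/asboolP; exists (c j).
have sJ1 : J1 \subset J by apply/fintype.subsetP => i; rewrite J1P => /andP[].
have [|J' [s1 s2 s3]] := IH J1.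
  by apply: leq_trans hJ; apply: proper_card; apply/properP; split=> //; exists j.
exists (j |: J')%SET; split.
- by apply/fintype.subsetP => i; rewrite !inE => /predU1P[->//|/(fintype.subsetP s1)/(fintype.subsetP sJ1)].
- have N i x : i \in J' -> box (c i) (r i) x -> box (c j) (r j) x -> False.
    by move=> /(fintype.subsetP s1); rewrite J1P => /andP[_ /asboolP ni] b1 b2; apply: ni; exists x.
  move=> i i' x; rewrite !inE => /predU1P[->|h] /predU1P[->|h'] b1 b2 //; last exact: s2 b1 b2.
    by case: (N _ _ h' b2 b1).
  by case: (N _ _ h b1 b2).
- move=> i iJ; have [iJ1|] := boolP (i \in J1).
    by have [i' [h1 h2 h3]] := s3 _ iJ1; exists i'; split=> //; rewrite !inE h1 orbT.
  rewrite J1P iJ/= negbK => /asboolP h; exists j; split=> //; first by rewrite !inE eqxx.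
  exact: jmax.
Qed.

End McShane.

(** * Averages over boxes, and boxes outside a convex set *)

Section Truncation.
Implicit Types p : P.

Definition wbox p r x : R := (2 * r) ^- 2 * ibox p r x.

Lemma weight_box p p' r r' N : 0 < r -> box p r `<=` box p' r' -> (2 * r) ^- 2 <= N -> weight p' r' N (wbox p r).
Proof.
move=> r0 sub hN; have w0 : 0 <= (2 * r) ^- 2 by rewrite invr_ge0 sqr_ge0.
have [ib ibE] := itg_ibox p (ltW r0); split.
- by apply: measurable_funM => //; exact: itb_m ib.
- move=> x; rewrite /wbox; have /andP[b0 b1] := ibox_ge0 p r x; rewrite mulr_ge0//=.
  by apply: le_trans hN; rewrite ler_piMr.
- by move=> x nx; rewrite /wbox ibox0 ?mulr0// => /sub.
- by rewrite itgZ// ibE mulVf// gt_eqF// exprn_gt0// mulr_gt0.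
Qed.

Definition avgb (u : P -> R) p r : R := itgp (fun x => wbox p r x * u x).

Lemma avgb_cmp Om u (G : 'I_2 -> P -> R) p p1 p2 r r1 r2 N : H10 Om u G -> 0 <= r -> 0 < r1 -> 0 < r2 ->
  box p1 r1 `<=` box p r -> box p2 r2 `<=` box p r -> (2 * r1) ^- 2 <= N -> (2 * r2) ^- 2 <= N ->
  `|avgb u p1 r1 - avgb u p2 r2| <= N * (2 * r) * itgp (fun x => ibox p r x * (`|G 0 x| + `|G 1 x|)).
Proof.
move=> hu r0 r10 r20 s1 s2 h1 h2; have w1 := weight_box r10 s1 h1; have w2 := weight_box r20 s2 h2.
by rewrite ler_norml lerNl opprB; apply/andP; split; apply: H10_avg hu r0 _ _.
Qed.

Lemma avgb_cst (u : P -> R) p r a e : 0 < r -> L2p u -> (forall x, box p r x -> `|a - u x| <= e) -> `|a - avgb u p r| <= e.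
Proof.
move=> r0 hu hb; have W := weight_box (p := p) (p' := p) (r' := r) r0 (fun _ => id) (lexx _).
have iw := weight_itb W; have i2 : itbp (fun x => wbox p r x * u x) by apply: L2M => //; exact: weight_L2 W.
have [_ w0 _ w1] := W.
have aE : a = itgp (fun x => a * wbox p r x) by rewrite itgZ// w1 mulr1.
have eE : e = itgp (fun x => e * wbox p r x) by rewrite itgZ// w1 mulr1.
have i3 : itbp (fun x => a * wbox p r x - wbox p r x * u x) by apply: itbB => //; exact: itbZ.
rewrite {1}aE /avgb -itgB//; last exact: itbZ.
apply: le_trans (itg_norm i3) _; rewrite [leRHS]eE; apply: itg_le; [exact: itb_norm|exact: itbZ|] => x.
have /andP[b0 _] := w0 x; rewrite [a * _]mulrC -mulrBr normrM ger0_norm// mulrC.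
have [xb|nb] := pselect (box p r x); first by apply: ler_wpM2r => //; exact: hb.
by rewrite /wbox ibox0// !mulr0.
Qed.

(* A convex set missing y misses one of the four boxes around the corners of a box centred at y. *)
Lemma corner_box Om y r : is_convex Om -> ~ Om y -> 0 < r ->
  exists2 q, box q (r / 4) `<=` box y r & forall x, box q (r / 4) x -> ~ Om x.
Proof.
move=> /cvxP cO ny r0; apply: contrapT => no.
have bet (a b c : R) : a < c -> c < b -> exists2 t, 0 <= t <= 1 & t * b + (1 - t) * a = c.
  move=> ac cb; have ab : 0 < b - a by rewrite subr_gt0 (lt_trans ac).
  exists ((c - a) / (b - a)); last by field; rewrite gt_eqF.
  by rewrite divr_ge0 ?(ltW ab) ?subr_ge0 ?(ltW ac)//= ler_pdivrMr// mul1r lerD2r ltW.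
have pick s1 s2 : `|s1| = 1 -> `|s2| = 1 -> exists p, [/\ Om p, 0 < s1 * (p.1 - y.1) & 0 < s2 * (p.2 - y.2)].
  move=> e1 e2; pose q : P := (y.1 + s1 * (3 / 4 * r), y.2 + s2 * (3 / 4 * r)).
  have bq s (a b : R) : `|s| = 1 -> `|a - (b + s * (3 / 4 * r))| <= r / 4 -> `|a - b| <= r /\ 0 < s * (a - b).
    move=> es; rewrite ler_distlC => /andP[]; have : s = 1 \/ s = -1.
      by case: (ger0P s) es => _ <-; [left|right; rewrite opprK].
    by case=> ->; rewrite ?mulN1r ?mul1r ler_distlC => h1 h2; split; try lra; apply/andP; split; lra.
  apply: contrapT => nO; apply: no; exists q => [x [/(bq _ _ _ e1)[+ _] /(bq _ _ _ e2)[+ _]]|x [b1 b2] Ox]; first by split.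
  by apply: nO; exists x; split=> //; [have [] := bq _ _ _ e1 b1|have [] := bq _ _ _ e2 b2].
have n1 : `|1 : R| = 1 by rewrite normr1.
have nN : `|-1 : R| = 1 by rewrite normrN1.
(* Points of Om in the left and the right corner of the same height give by convexity a point
   straight above or below y, according to s. *)
have half s : `|s| = 1 -> exists2 b, Om (y.1, b) & 0 < s * (b - y.2).
  move=> es; have [p [Op p1 p2]] := pick 1 s n1 es; have [q [Oq q1 q2]] := pick (-1) s nN es.
  move: p1 q1; rewrite mul1r mulN1r opprB !subr_gt0 => p1 q1; have [t t01 et] := bet _ _ _ q1 p1.
  exists (t * p.2 + (1 - t) * q.2); first by have := cO p q t Op Oq t01; rewrite /cmb et.
  have -> : s * (t * p.2 + (1 - t) * q.2 - y.2) = t * (s * (p.2 - y.2)) + (1 - t) * (s * (q.2 - y.2)) by ring.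
  case/andP: t01 => t0 t1; have [->|tn] := eqVneq t 0; first by rewrite mul0r add0r subr0 mul1r.
  rewrite ltr_pwDl//; first by rewrite mulr_gt0// lt_neqAle eq_sym tn.
  by rewrite mulr_ge0 ?subr_ge0// ltW.
have [a Oa] := half _ nN; have [b Ob] := half _ n1; rewrite mul1r mulN1r opprB !subr_gt0 => yb ay.
have [t t01 et] := bet _ _ _ ay yb; apply: ny; have := cO _ _ t Ob Oa t01.
by rewrite /cmb/= et (_ : t * y.1 + (1 - t) * y.1 = y.1) -?surjective_pairing//; ring.
Qed.

End Truncation.

(** * The Sobolev notions of the statement in terms of integrals *)

Section SobolevNorms.
Implicit Types (v w : P -> R) (p : R) (i : 'I_2).

Lemma loc_meas Om w : open Om -> loc_integrable Om w -> mfun (w \_ Om).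
Proof.
move=> oO lw; have mO := open_meas oO; apply/(measurable_restrict _ mO measurableT); rewrite setTI.
pose Bx (j : rat * rat * nat) := box (ratr j.1.1 : R, ratr j.1.2 : R) (j.2.+1%:R)^-1.
pose E n := if unpickle n is Some j then (if pselect (Bx j `<=` Om) then Bx j else set0) else set0.
have EP n : E n = set0 \/ exists j, E n = Bx j /\ Bx j `<=` Om.
  by rewrite /E; case: unpickle => [j|]; [case: pselect => h; [right; exists j|left]|left].
have -> : Om = \bigcup_n E n.
  rewrite eqEsubset; split=> [x Ox|x [n _]]; last by have [->|[j [-> h /h]]] := EP n.
  have /open_boxP/(_ x Ox)[r r0 h] := oO; have [j [h1 h2 jr]] := rat_box x r0.
  have Ej : E (pickle j) = Bx j.
    rewrite /E pickleK; case: pselect => // -[]; move=> y [/= g1 g2].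
    by apply: h; [exact: dist3 g1 h1 jr|exact: dist3 g2 h2 jr].
  by exists (pickle j); [exact: I|rewrite Ej; split; exact: ltW].
apply/measurable_fun_bigcup => n; have [->|[j [-> h]]] := EP n; rewrite ?measurable0//.
- exact: box_meas.
- exact: measurable_fun_set0.
have := itb_m (loc_box lw (@box_compact _ _) h (box_meas _ _)).
by move/(measurable_restrict _ (box_meas _ _) measurableT); rewrite setTI.
Qed.

Lemma itb_abs_eq (u : P -> R) p : mfun u -> mfun (fun x => `|u x| `^ p).
Proof.
move=> mu; apply: (measurableT_comp (f := fun t : measurableTypeR R => (t `^ p : R))); first exact: measurable_powR.
exact: measurableT_comp.
Qed.

Lemma Lp_pow Om p u : 1 <= p -> itbp (fun x => `|(u \_ Om) x| `^ p) ->
  (Lp_norm Om p%:E u `^ p = (itgp (fun x => `|(u \_ Om) x| `^ p))%:E)%E.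
Proof.
move=> p1 hu; rewrite /Lp_norm poweR_Lnorm ?gt_eqF ?(lt_le_trans ltr01)// itgE//.
Qed.

Lemma Lp_in Om p u : 1 <= p -> in_Lp Om p%:E u <->
  mfun (u \_ Om) /\ itbp (fun x => `|(u \_ Om) x| `^ p).
Proof.
move=> p1; have p0 : p != 0 by rewrite gt_eqF// (lt_le_trans ltr01).
have E : (\int[leb2]_x `| `|(u \_ Om) x| `^ p |%:E = Lnorm leb2 p%:E (EFin \o (u \_ Om)) `^ p)%E.
  by rewrite poweR_Lnorm//; apply: eq_integral => x _; rewrite ger0_norm ?powR_ge0// poweR_EFin.
rewrite /in_Lp inE/= /finite_norm; split.
  move=> /andP[]; rewrite !inE/= => mu fu; split=> //; apply: itbP; first exact: itb_abs_eq.
  by rewrite E; exact: poweR_lty.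
move=> [mu /integrableP[_ fu]]; apply/andP; split; rewrite inE//=.
rewrite /finite_norm unlock; apply: poweR_lty; move: fu.
by rewrite /= E poweR_Lnorm.
Qed.

Lemma abs_pow2 (a : R) : `|a| `^ 2 = a ^+ 2.
Proof. by rewrite powR_mulrn// real_normK ?num_real. Qed.

Lemma in_Lp2 Om u : in_Lp Om 2%:E u <-> L2p (u \_ Om).
Proof.
rewrite Lp_in ?ler1n// /L2 (_ : (fun x => `|(u \_ Om) x| `^ 2) = (fun x => (u \_ Om) x ^+ 2))//.
by apply: funext => x; rewrite abs_pow2.
Qed.

Lemma Lp_norm2 Om u : in_Lp Om 2%:E u -> Lp_norm Om 2%:E u = (n2p (u \_ Om))%:E.
Proof.
move=> /(Lp_in Om u (ler1n _ 2))[mu iu]; have := Lp_pow (ler1n _ 2) iu.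
move=> /(congr1 (fun t : \bar R => (t `^ 2^-1)%E)); rewrite -poweRrM mulfV ?pnatr_eq0// poweRe1 ?Lnorm_ge0// => ->.
rewrite poweR_EFin powR12_sqrt; last by apply: itg_ge0 => x; exact: powR_ge0.
by congr (Num.sqrt (itg _ _))%:E; apply: funext => x; rewrite abs_pow2.
Qed.

Lemma wp_pow Om p i u w : open Om -> is_weak_partial Om i u w -> itbp (fun x => `|(w \_ Om) x| `^ p) ->
  itbp (fun x => `|(weak_partial Om i u \_ Om) x| `^ p) /\
  itgp (fun x => `|(weak_partial Om i u \_ Om) x| `^ p) = itgp (fun x => `|(w \_ Om) x| `^ p).
Proof.
move=> oO hw iw; have hw' := wpP hw; have [_ lw' _] := hw'; have [_ lw _] := hw.
have m1 := itb_abs_eq p (loc_meas oO lw'); have m2 := itb_abs_eq p (loc_meas oO lw).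
have ae : {ae leb2, forall x, `|(weak_partial Om i u \_ Om) x| `^ p = `|(w \_ Om) x| `^ p}.
  have := wp_unique oO hw' hw; apply: filterS => x hx; rewrite !patchE; case: ifPn => // /set_mem Ox.
  by rewrite hx.
split; last exact: itg_ae.
by apply: (itb_ae m2 m1) => //; apply: filterS ae => x ->.
Qed.

(** The norm of the statement uses one chosen weak derivative; by uniqueness almost everywhere any
    other version G gives the same value. *)
Lemma W1p_eval Om p u G : open Om -> 1 <= p -> (forall i, is_weak_partial Om i u (G i)) ->
  mfun (u \_ Om) -> itbp (fun x => `|(u \_ Om) x| `^ p) ->
  (forall i, itbp (fun x => `|(G i \_ Om) x| `^ p)) -> in_Sobolev Om 1 p%:E u /\
  W1p_norm Om p u = ((itgp (fun x => `|(u \_ Om) x| `^ p) +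
    \sum_i itgp (fun x => `|(G i \_ Om) x| `^ p)) `^ p^-1)%:E.
Proof.
move=> oO p1 hw mu iu iw; split.
  split; first by apply/Lp_in.
  move=> i; exists (G i); split=> //; apply/Lp_in => //; split=> //.
  by have [_ lw _] := hw i; exact: loc_meas.
rewrite /W1p_norm Lp_pow// (eq_bigr (fun i => (itgp (fun x => `|(G i \_ Om) x| `^ p))%:E)).
  by rewrite sumEFin -EFinD poweR_EFin.
by move=> i _; have [i1 i2] := wp_pow oO (hw i) (iw i); rewrite (Lp_pow p1 i1) i2.
Qed.

Lemma patchB Om u v : (u \- v)%R \_ Om = (fun x => (u \_ Om) x - (v \_ Om) x).
Proof. by apply: funext => x; rewrite !patchE; case: ifPn; rewrite ?subr0. Qed.

Lemma wp_test Om i u w phi : open Om -> is_weak_partial Om i u w -> test_function Om phi ->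
  is_weak_partial Om i (u \- phi)%R (w \- partial i phi)%R.
Proof.
move=> oO [lu lw hw] tp; have mO := open_meas oO.
have HP := H10_test tp; have rE : phi \_ Om = phi.
  by have [_ _ h _] := HP; apply/funext => x; rewrite patchE; case: ifPn => // /negP nO; rewrite (h x _).1// => /mem_set.
have HP' : H10 Om (phi \_ Om) (fun i => partial i phi) by rewrite rE.
have [lp lpi hp] := H10_wp i oO HP'.
have lB f g : loc_integrable Om f -> loc_integrable Om g -> loc_integrable Om (f \- g)%R.
  by move=> hf hg K cK KO; have := integrableB (compact_meas cK) (hf K cK KO) (hg K cK KO).
have LB f g psi : loc_integrable Om f -> loc_integrable Om g -> test_function Om psi ->
    \int[leb2]_(x in Om) ((f \- g)%R x * psi x) = \int[leb2]_(x in Om) (f x * psi x) - \int[leb2]_(x in Om) (g x * psi x).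
  move=> hf hg ts; have [i1 ->] := test_restrict mO hf ts; have [i2 ->] := test_restrict mO hg ts.
  have [_ ->] := test_restrict mO (lB _ _ hf hg) ts; rewrite -itgB//; congr itg; apply: funext => x.
  by rewrite patchB mulrBl.
split=> [||psi ts]; [exact: lB|exact: lB|].
by rewrite (LB _ _ _ lu lp (test_partial i ts)) (LB _ _ _ lw lpi ts) hw// hp// opprD.
Qed.

Lemma n2_pow Om u : itgp (fun x => `|(u \_ Om) x| `^ 2) = n2p (u \_ Om) ^+ 2.
Proof. by rewrite n2K; congr itg; apply: funext => x; rewrite abs_pow2. Qed.

Lemma W12_eval Om u G : open Om -> (forall i, is_weak_partial Om i u (G i)) -> L2p (u \_ Om) ->
  (forall i, L2p (G i \_ Om)) -> in_Sobolev Om 1 2%:E u /\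
  W1p_norm Om 2 u = (Num.sqrt (n2p (u \_ Om) ^+ 2 + \sum_i n2p (G i \_ Om) ^+ 2))%:E.
Proof.
move=> oO hw u2 w2.
have iu : itbp (fun x => `|(u \_ Om) x| `^ 2) by have /in_Lp2/(Lp_in _ _ (ler1n _ 2))[] := u2.
have iw i : itbp (fun x => `|(G i \_ Om) x| `^ 2) by have /in_Lp2/(Lp_in _ _ (ler1n _ 2))[] := w2 i.
have [s ->] := W1p_eval oO (ler1n _ 2) hw u2.1 iu iw; split=> //.
rewrite powR12_sqrt; last by rewrite addr_ge0 ?sumr_ge0// => *; rewrite ?itg_ge0// => x; exact: powR_ge0.
by rewrite n2_pow; under eq_bigr do rewrite n2_pow.
Qed.

Lemma test_patch Om phi : test_function Om phi -> phi \_ Om = phi /\ forall i, partial i phi \_ Om = partial i phi.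
Proof.
move=> /H10_test[_ _ h _]; split=> [|i]; apply/funext => x; rewrite patchE; case: ifPn => // /negP nO.
  by rewrite (h x _).1// => /mem_set.
by rewrite (h x _).2// => /mem_set.
Qed.

Lemma W012_H10 Om u : open Om -> in_W012 Om u -> H10 Om (u \_ Om) (fun i => weak_partial Om i u \_ Om).
Proof.
move=> oO [[/in_Lp2 u2 hs] happ].
have wp i : is_weak_partial Om i u (weak_partial Om i u) by have [w [/wpP]] := hs i.
have w2 i : L2p (weak_partial Om i u \_ Om).
  have [w [hw /in_Lp2/in_Lp2/(Lp_in _ _ (ler1n _ 2))[_ iw]]] := hs i.
  by apply/in_Lp2/(Lp_in _ _ (ler1n _ 2)); have [i1 _] := wp_pow oO hw iw; split=> //; have [_ /(loc_meas oO)] := wp i.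
split=> //; first by move=> x nO; split=> [|i]; rewrite patchE memNset.
move=> e e0; have [phi tp lt] := happ e e0; exists phi.
have [pE ppE] := test_patch tp; have t2 := test_L2 tp; have tp2 i := test_L2 (test_partial i tp).
have [||_] := @W12_eval Om (u \- phi)%R (fun i => weak_partial Om i u \- partial i phi)%R oO (fun i => wp_test oO (wp i) tp).
- by rewrite patchB pE; exact: L2B.
- by move=> i; rewrite patchB ppE; exact: L2B.
move=> E; rewrite E lte_fin patchB pE in lt.
have s0 (a b : R) : 0 <= a -> 0 <= b -> a <= Num.sqrt (a ^+ 2 + b).
  by move=> a0 b0; rewrite -[leLHS]ger0_norm// -sqrtr_sqr ler_sqrt ?lerDl ?addr_ge0 ?sqr_ge0.
have sg (F : 'I_2 -> R) : 0 <= \sum_i F i ^+ 2 by apply: sumr_ge0 => i _; exact: sqr_ge0.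
split=> // [|i].
  rewrite n2BC; apply: le_trans (ltW lt); apply: s0; [exact: n2_ge0|exact: sg].
rewrite n2BC -(ppE i) -patchB; apply: le_trans (ltW lt); rewrite addrC (bigD1 i)//= -addrA; apply: s0; first exact: n2_ge0.
by rewrite addr_ge0 ?sqr_ge0// sumr_ge0// => j _; exact: sqr_ge0.
Qed.

Lemma H10_W012 Om u G : open Om -> H10 Om (u \_ Om) G -> in_W012 Om u.
Proof.
move=> oO hu; have wp i := H10_wp i oO hu; have [u2 G2 z happ] := hu.
have GE i : G i \_ Om = G i.
  by apply/funext => x; rewrite patchE; case: ifPn => // /negP nO; rewrite (z x _).2// => /mem_set.
have w2 i : L2p (G i \_ Om) by rewrite GE.
have [s _] := W12_eval oO wp u2 w2; split=> // e e0.
have e3 : 0 < e / 3 by rewrite divr_gt0.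
have [phi [tp h1 h2]] := happ (e / 3) e3; exists phi => //.
have [pE ppE] := test_patch tp; have t2 := test_L2 tp; have tp2 i := test_L2 (test_partial i tp).
have [||_ ->] := @W12_eval Om (u \- phi)%R (fun i => G i \- partial i phi)%R oO (fun i => wp_test oO (wp i) tp).
- by rewrite patchB pE; exact: L2B.
- by move=> i; rewrite patchB ppE GE; exact: L2B.
rewrite lte_fin patchB pE; under eq_bigr do rewrite patchB ppE GE n2BC.
rewrite n2BC sum2; have := h2 0; have := h2 1; move: h1.
move: (n2_ge0 leb2 (fun x => phi x - (u \_ Om) x)) (n2_ge0 leb2 (fun x => partial 0 phi x - G 0 x)) (n2_ge0 leb2 (fun x => partial 1 phi x - G 1 x)).
move: (n2 _ _) (n2 _ _) (n2 _ _) => a b c a0 b0 c0 ha hb hc.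
rewrite -(ltr_pXn2r (n := 2))// ?nnegrE ?sqrtr_ge0 ?(ltW e0)// sqr_sqrtr ?addr_ge0 ?sqr_ge0//.
have sq (t : R) : 0 <= t -> t <= e / 3 -> t ^+ 2 <= e ^+ 2 / 9.
  move=> t0 te; rewrite (_ : e ^+ 2 / 9 = (e / 3) ^+ 2); last by field.
  by apply: lerXn2r; rewrite ?nnegrE ?(ltW e3).
have := sq _ a0 ha; have := sq _ b0 hc; have := sq _ c0 hb; have : 0 < e ^+ 2 by rewrite exprn_gt0.
by move: (a ^+ 2) (b ^+ 2) (c ^+ 2) (e ^+ 2) => *; lra.
Qed.

End SobolevNorms.

(** * The bilinear form and weak solutions *)

Section Coefficients.
Implicit Types (v : P -> R) (c K : R) (i j : 'I_2) (H : 'I_2 -> P -> R).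
Implicit Types a : 'I_2 -> 'I_2 -> P -> R.

(** Boundedness and ellipticity at every point. [bilin_coef] provides such a representative of the
    matrix, so that later estimates hold pointwise and not only almost everywhere. *)
Record coef a c K : Prop := Coef {
  cf_m : forall i j, mfun (a i j);
  cf_b : forall i j x, `|a i j x| <= K;
  cf_e : forall x (t : 'I_2 -> R), c * \sum_i t i ^+ 2 <= \sum_i \sum_j a i j x * t j * t i }.

Definition bil a G H : R := \sum_i \sum_j itgp (fun x => a i j x * G j x * H i x).

Definition L2g G := forall i, L2p (G i).

(** Ellipticity sees only the symmetric part, so the adjoint problem has the same constants. *)
Lemma coef_tr a c K : coef a c K -> coef (fun i j => a j i) c K.
Proof.
move=> [h1 h2 h3]; split=> // x t; apply: le_trans (h3 x t) _; rewrite exchange_big/=.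
by apply: eqle; apply: eq_bigr => i _; apply: eq_bigr => j _; rewrite mulrAC.
Qed.

Lemma bil_tr a G H : bil (fun i j => a j i) G H = bil a H G.
Proof.
rewrite /bil exchange_big/=; apply: eq_bigr => i _; apply: eq_bigr => j _; congr itg.
by apply: funext => x; rewrite mulrAC.
Qed.

Lemma coef_ge0 a c K : coef a c K -> 0 <= K.
Proof. by move=> /cf_b/(_ 0 0 0); exact: le_trans. Qed.

Lemma coef_L2 a c K i j f : coef a c K -> L2p f -> L2p (fun x => a i j x * f x) /\ n2p (fun x => a i j x * f x) <= K * n2p f.
Proof.
move=> ca hf; have K0 := coef_ge0 ca; have ma : mfun (fun x => a i j x * f x).
  by apply: measurable_funM; [exact: (cf_m ca)|exact: hf.1].
have hK := L2Z K hf; have le x : `|a i j x * f x| <= `|K * f x|.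
  by rewrite !normrM (ger0_norm K0); apply: ler_wpM2r => //; exact: (cf_b ca).
split; first exact: L2_le le.
by rewrite -[K in leRHS]ger0_norm// -n2Z//; exact: n2_mono.
Qed.

Lemma coef_itb a c K i j f g : coef a c K -> L2p f -> L2p g -> itbp (fun x => a i j x * f x * g x).
Proof. by move=> ca hf hg; apply: L2M => //; have [] := coef_L2 i j ca hf. Qed.

Lemma bil_lin1 a c K s G G' H : coef a c K -> L2g G -> L2g G' -> L2g H ->
  bil a (fun i x => s * G i x + G' i x) H = s * bil a G H + bil a G' H.
Proof.
move=> ca hG hG' hH; rewrite /bil mulr_sumr -big_split/=; apply: eq_bigr => i _.
rewrite mulr_sumr -big_split/=; apply: eq_bigr => j _.
have i1 := coef_itb i j ca (hG j) (hH i); have i2 := coef_itb i j ca (hG' j) (hH i).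
rewrite -itgZ// -itgD//; last exact: itbZ.
by congr itg; apply: funext => x; ring.
Qed.

Lemma bil_lin2 a c K s G H H' : coef a c K -> L2g G -> L2g H -> L2g H' ->
  bil a G (fun i x => s * H i x + H' i x) = s * bil a G H + bil a G H'.
Proof. by move=> ca hG hH hH'; rewrite -!(bil_tr a); exact: bil_lin1 (coef_tr ca) hH hH' hG. Qed.

Lemma bil_bd a c K G H : coef a c K -> L2g G -> L2g H ->
  `|bil a G H| <= K * (n2p (G 0) + n2p (G 1)) * (n2p (H 0) + n2p (H 1)).
Proof.
move=> ca hG hH; have b i j : `|itgp (fun x => a i j x * G j x * H i x)| <= K * n2p (G j) * n2p (H i).
  have [h1 h2] := coef_L2 i j ca (hG j).
  by apply: le_trans (CS h1 (hH i)) _; apply: ler_wpM2r => //; exact: n2_ge0.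
have S (F : 'I_2 -> 'I_2 -> R) (F' : 'I_2 -> 'I_2 -> R) : (forall i j, `|F i j| <= F' i j) ->
    `|\sum_i \sum_j F i j| <= \sum_i \sum_j F' i j.
  move=> h; apply: le_trans (ler_norm_sum _ _ _) _; apply: ler_sum => i _.
  by apply: le_trans (ler_norm_sum _ _ _) _; apply: ler_sum.
by apply: le_trans (S _ _ b) _; rewrite !sum2; apply: eqle; ring.
Qed.

Lemma bil_coer a c K G : coef a c K -> L2g G -> c * \sum_i n2p (G i) ^+ 2 <= bil a G G.
Proof.
move=> ca hG; have i1 i j := coef_itb i j ca (hG j) (hG i).
have iS i : itbp (fun x => \sum_j a i j x * G j x * G i x) by apply: itb_sum.
have -> : bil a G G = itgp (fun x => \sum_i \sum_j a i j x * G j x * G i x).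
  by rewrite itg_sum//; apply: eq_bigr => i _; rewrite itg_sum.
have sq i : itbp (fun x => G i x ^+ 2) by case: (hG i).
have -> : c * \sum_i n2p (G i) ^+ 2 = itgp (fun x => c * \sum_i G i x ^+ 2).
  by rewrite itgZ ?itg_sum//; [under eq_bigr do rewrite n2K|exact: itb_sum].
apply: itg_le; [by apply: itbZ; exact: itb_sum|exact: itb_sum|] => x.
exact: (cf_e ca x (fun i => G i x)).
Qed.

Lemma weq_H10 Om a c K f G : coef a c K -> L2p f -> L2g G ->
  (forall phi, test_function Om phi -> bil a G (fun i => partial i phi) = - itgp (fun x => f x * phi x)) ->
  forall v H, H10 Om v H -> bil a G H = - itgp (fun x => f x * v x).
Proof.
move=> ca hf hG hw v H [v2 H2 _ happ]; apply/eqP; rewrite -subr_eq0 -normr_le0.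
apply: (@le_lim _ _ (K * (n2p (G 0) + n2p (G 1)) * 2 + n2p f)) => e e0.
have [phi [tp h1 h2]] := happ e e0; have t2 := test_L2 tp; have tp2 i := test_L2 (test_partial i tp).
pose D i x := -1 * partial i phi x + H i x.
have hD : L2g D by move=> i; apply: L2D => //; exact: L2Z.
have nD i : n2p (D i) <= e.
  by apply: le_trans (h2 i); rewrite n2BC; apply: eqle; congr (n2 _ _); apply: funext => x; rewrite /D mulN1r addrC.
have E1 : bil a G H = bil a G (fun i => partial i phi) + bil a G D.
  by rewrite (bil_lin2 (-1) ca hG tp2 H2) mulN1r addrA subrr add0r.
have i1 := L2M hf t2; have i2 := L2M hf v2; have dv := L2B v2 t2; have i3 := L2M hf dv.
have E2 : itgp (fun x => f x * v x) = itgp (fun x => f x * phi x) + itgp (fun x => f x * (v x - phi x)).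
  by rewrite -itgD//; congr itg; apply: funext => x; ring.
rewrite E1 E2 (hw _ tp) (_ : - _ + _ - _ = bil a G D + itgp (fun x => f x * (v x - phi x))); last by ring.
apply: le_trans (ler_normD _ _) _; rewrite mulrDl; apply: lerD.
  have K0 := coef_ge0 ca; apply: le_trans (bil_bd ca hG hD) _; rewrite -[leRHS]mulrA.
  apply: ler_wpM2l; first by rewrite mulr_ge0// addr_ge0 ?n2_ge0.
  by rewrite mulr_natl mulr2n; exact: lerD.
apply: le_trans (CS hf dv) _; apply: ler_wpM2l; first exact: n2_ge0.
by rewrite n2BC.
Qed.

Lemma bilin_coef Om (A : P -> 'M[R]_2) : open Om -> in_Linfty_mx Om A -> uniformly_elliptic Om A ->
  exists a c K, [/\ 0 < c, coef a c K & forall u v G H, H10 Om (u \_ Om) G -> H10 Om (v \_ Om) H ->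
    bilin_form Om A u v = bil a G H].
Proof.
move=> oO hA [c c0 hc]; have mO := open_meas oO.
have mA i j : mfun ((fun x => A x i j) \_ Om).
  by have := hA i j; rewrite /in_Lp inE => /andP[]; rewrite inE.
have bA i j : exists b : R, {ae leb2, forall x, `|((fun x => A x i j) \_ Om) x| <= b}.
  have := hA i j; rewrite /in_Lp inE => /andP[_]; rewrite inE/= /finite_norm unlock.
  case: ifPn => [_|/negP[]]; last first.
    (* The norm of order infinity is an essential supremum only over a space of positive measure; a
       box shows that the plane is one. *)
    have p1 : (0 < leb2 (box (0 : P)%R 1%R))%E by rewrite leb2_box// lte_fin exprn_gt0// mulr1.
    apply: (lt_le_trans p1).
    by apply: le_measure; rewrite ?inE//; exact: box_meas.
  move=> lt; have [b hb] : exists b : R, (ess_sup_inf.ess_sup leb2 (abse \o (EFin \o ((fun x => A x i j) \_ Om))) <= b%:E)%E.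
    move: lt; case: (ess_sup_inf.ess_sup _ _) => [b _|//|_]; first by exists b.
    by exists 0; rewrite leNye.
  by exists b; move/ess_sup_inf.ess_supP: hb; apply: filterS => x /=; rewrite lee_fin.
have [b1 hb1] := choice (fun o : 'I_2 * 'I_2 => bA o.1 o.2); pose b0 i j := b1 (i, j).
have hb0 i j : {ae leb2, forall x, `|((fun x => A x i j) \_ Om) x| <= b0 i j} := hb1 (i, j).
pose M := \sum_i \sum_j `|b0 i j|.
have bM i j : b0 i j <= M.
  apply: le_trans (ler_norm _) _; rewrite /M (bigD1 i)//= (bigD1 j)//= -addrA lerDl addr_ge0 ?sumr_ge0// => k _.
  by rewrite sumr_ge0.
have M0 : 0 <= M by apply: sumr_ge0 => i _; exact: sumr_ge0.
have [N [mN N0 hN]] : {ae leb2, forall x, (forall i j, `|((fun x => A x i j) \_ Om) x| <= M) /\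
    (Om x -> forall xi : 'cV[R]_2, dot (A x *m xi) xi >= c * dot xi xi)}.
  apply: filterS2 hc _ => [x h1 h2|]; first by split; [exact: h2|exact: h1].
  have : forall i, {ae leb2, forall x, forall j, `|((fun x => A x i j) \_ Om) x| <= M}.
    move=> i; have := hb0 i 0; have := hb0 i 1; apply: filterS2 => x h1 h2 j.
    by case: (ord2P j) => ->; [apply: le_trans h2 _|apply: le_trans h1 _]; exact: bM.
  move=> h; have := h 0; have := h 1; apply: filterS2 => x h1 h2 i.
  by case: (ord2P i) => ->.
pose D := Om `\` N; have mD : measurable D by exact: measurableD.
have DP x : D x -> (forall i j, `|A x i j| <= M) /\ forall xi : 'cV[R]_2, dot (A x *m xi) xi >= c * dot xi xi.
  move=> [Ox nN]; have [h1 h2] : (forall i j, `|((fun x => A x i j) \_ Om) x| <= M) /\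
    (Om x -> forall xi : 'cV[R]_2, dot (A x *m xi) xi >= c * dot xi xi) by apply: contrapT => h; apply: nN; exact: hN.
  by split=> [i j|]; [have := h1 i j; rewrite patchE mem_set|exact: h2].
(* Off the set D of good points of Om the matrix is replaced by c times the identity. *)
pose a i j x := ((fun x => A x i j) \_ Om) x * \1_D x + c * (i == j)%:R * (1 - \1_D x).
have aD i j x : D x -> a i j x = A x i j.
  by move=> [Ox nN]; rewrite /a patchE indicE !mem_set//= mulr1 subrr mulr0 addr0.
have aN i j x : ~ D x -> a i j x = c * (i == j)%:R.
  by move=> nD; rewrite /a indicE memNset// mulr0 add0r subr0 mulr1.
have m1 : mfun (\1_D : P -> R) by exact: measurable_indic.
have ca : coef a c (M + c).
  split.
  - move=> i j; apply: measurable_funD; apply: measurable_funM => //.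
    by apply: measurable_funB.
  - move=> i j x; have [Dx|nD] := pselect (D x).
      by rewrite aD//; have [+ _] := DP x Dx => /(_ i j) h; apply: le_trans h _; rewrite lerDl ltW.
    rewrite aN// normrM ger0_norm ?(ltW c0)//; case: (i == j); rewrite ?normr1 ?normr0 ?mulr1 ?mulr0 ?lerDr//.
    by rewrite addr_ge0// ltW.
  - move=> x t; have [Dx|nD] := pselect (D x); last first.
      rewrite mulr_sumr; apply: ler_sum => i _; rewrite (bigD1 i)//= big1 ?addr0.
        by rewrite aN// eqxx mulr1 expr2 mulrA.
      by move=> j ji; rewrite aN// eq_sym (negbTE ji) mulr0 !mul0r.
    have [_ /(_ (\col_i t i))] := DP x Dx; rewrite /dot !sum2 !mxE !sum2 !mxE !aD// => h.
    apply: le_trans (_ : _ <= c * (t 0 * t 0 + t 1 * t 1)) _; first by rewrite !expr2.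
    by apply: le_trans h _; apply: eqle; ring.
exists a, c, (M + c); split=> // u v G H hu hv.
have [_ G2 G0 _] := hu; have [_ H2 H0 _] := hv.
have wm i w G' : H10 Om (w \_ Om) G' -> mfun (weak_partial Om i w \_ Om).
  by move=> /(H10_wp i oO)/wpP[_ lw _]; exact: loc_meas.
rewrite /bilin_form itg_in//.
have E1 : (fun x => dot (A x *m weak_grad Om u x) (weak_grad Om v x)) \_ Om =
    (fun x => \sum_i \sum_j ((fun x => A x i j) \_ Om) x * (weak_partial Om j u \_ Om) x * (weak_partial Om i v \_ Om) x).
  apply: funext => x; rewrite patchE; case: ifPn => xO.
    have pin (f : P -> R) : (f \_ Om) x = f x by rewrite patchE xO.
    rewrite /dot; apply: eq_bigr => i _; rewrite [weak_grad Om v x i 0]mxE mxE mulr_suml.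
    apply: eq_bigr => j _; rewrite [weak_grad Om u x j 0]mxE.
    by congr (_ * _ * _); apply/esym; [exact: (pin (fun x => A x i j))|exact: pin|exact: pin].
  have pout (f : P -> R) : (f \_ Om) x = 0 by rewrite patchE (negbTE xO).
  transitivity (0 : R) => //; apply/esym; apply: big1 => i _; apply: big1 => j _.
  by apply: etrans (congr1 _ (pout (weak_partial Om i v))) _; exact: mulr0.
have -> : bil a G H = itgp (fun x => \sum_i \sum_j a i j x * G j x * H i x).
  have i1 i j := coef_itb i j ca (G2 j) (H2 i); rewrite itg_sum => [|i]; last exact: itb_sum.
  by apply: eq_bigr => i _; rewrite itg_sum.
rewrite E1; apply: itg_ae.
- apply: measurable_sum => i; apply: measurable_sum => j.
  by apply: measurable_funM; [apply: measurable_funM => //; exact: wm hu|exact: wm hv].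
- apply: measurable_sum => i; apply: measurable_sum => j.
  apply: measurable_funM; last by case: (H2 i).
  by apply: measurable_funM; [exact: (cf_m ca)|case: (G2 j)].
have aw w G' i : H10 Om (w \_ Om) G' -> {ae leb2, forall x, Om x -> weak_partial Om i w x = G' i x} by exact: wp_ae.
have nN : {ae leb2, forall x, ~ N x} by exists N; split=> // x /= h; exact: contrapT.
have au : {ae leb2, forall x, forall i, Om x -> weak_partial Om i u x = G i x}.
  by have := aw _ _ 0 hu; have := aw _ _ 1 hu; apply: filterS2 => x h1 h2 i; case: (ord2P i) => ->.
have av : {ae leb2, forall x, forall i, Om x -> weak_partial Om i v x = H i x}.
  by have := aw _ _ 0 hv; have := aw _ _ 1 hv; apply: filterS2 => x h1 h2 i; case: (ord2P i) => ->.
apply: filterS3 nN au av => x nNx ux vx; apply: eq_bigr => i _; apply: eq_bigr => j _.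
have [Ox|nO] := pselect (Om x).
  have pin (f : P -> R) : (f \_ Om) x = f x by rewrite patchE mem_set.
  have -> : a i j x = A x i j by exact: aD.
  rewrite -(ux j Ox) -(vx i Ox); congr (_ * _ * _); [exact: (pin (fun x => A x i j))|exact: pin|exact: pin].
have pout (f : P -> R) : (f \_ Om) x = 0 by rewrite patchE memNset.
rewrite (H0 x nO).2 mulr0; apply: etrans (congr1 _ (pout (weak_partial Om i v))) _; exact: mulr0.
Qed.

Lemma patch_out Om u : (forall x, ~ Om x -> u x = 0) -> u \_ Om = u.
Proof. by move=> h; apply/funext => x; rewrite patchE; case: ifPn => // /negP nO; rewrite h// => /mem_set. Qed.

Lemma itg_rhs Om f phi : open Om -> \int[leb2]_(x in Om) (f x * phi x) = itgp (fun x => (f \_ Om) x * phi x).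
Proof.
move=> /open_meas mO; rewrite itg_in//; congr itg; apply: funext => x.
by rewrite !patchE; case: ifPn; rewrite ?mul0r.
Qed.

Definition ltr (f : (P -> R) -> R) := forall s w w', f (fun x => s * w x + w' x) = s * f w + f w'.

Lemma ltr_sum (f : (P -> R) -> R) (I : Type) (q : seq I) (d : I -> R) (w : I -> P -> R) : ltr f ->
  f (fun x => \sum_(j <- q) d j * w j x) = \sum_(j <- q) d j * f (w j).
Proof.
move=> lf; elim: q => [|j q IH].
  rewrite big_nil; have := lf 1 (fun=> 0) (fun=> 0); under [X in f X = _]eq_fun do rewrite mul1r addr0.
  rewrite mul1r => /eqP; rewrite -subr_eq0 opprD addNKr oppr_eq0 => /eqP e.
  by rewrite -[RHS]e; congr f; apply: funext => x; rewrite big_nil.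
by rewrite big_cons -IH -lf; congr f; apply: funext => x; rewrite big_cons.
Qed.

Section Solutions.
Variables (Om : set P) (A : P -> 'M[R]_2) (a : 'I_2 -> 'I_2 -> P -> R) (c K : R).
Hypotheses (oO : open Om) (ca : coef a c K).
Hypothesis hb : forall u v G H, H10 Om (u \_ Om) G -> H10 Om (v \_ Om) H -> bilin_form Om A u v = bil a G H.

Lemma weak_weq f u : in_Lp Om 2%:E f -> weak_solution Om A f u -> exists2 G, H10 Om (u \_ Om) G &
  forall v H, H10 Om v H -> bil a G H = - itgp (fun x => (f \_ Om) x * v x).
Proof.
move=> /in_Lp2 f2 [/(W012_H10 oO) hu hw]; exists (fun i => weak_partial Om i u \_ Om) => //.
have [_ G2 _ _] := hu; apply: (weq_H10 ca f2 G2) => phi tp; rewrite -itg_rhs// -hw//.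
by apply/esym/hb => //; have [-> _] := test_patch tp; exact: H10_test.
Qed.

Lemma weq_weak f u G : H10 Om u G ->
  (forall phi, test_function Om phi -> bil a G (fun i => partial i phi) = - itgp (fun x => (f \_ Om) x * phi x)) ->
  weak_solution Om A f u.
Proof.
move=> hu hw; have uE : u \_ Om = u by apply: patch_out; case: hu => _ _ h _ x /h[].
have hu' : H10 Om (u \_ Om) G by rewrite uE.
split=> [|phi tp]; first exact: H10_W012 hu'.
rewrite itg_rhs// -hw//; apply: hb => //; have [-> _] := test_patch tp; exact: H10_test.
Qed.

(** Of the second derivatives only the two pure ones are used. The constant N depends on u;
    [lap_bound] replaces it by a multiple of the norm of the data. *)
Lemma W22_lap u G : H10 Om (u \_ Om) G -> in_Sobolev Om 2 2%:E u -> exists2 N, 0 <= N &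
  forall phi, test_function Om phi -> \sum_i itgp (fun x => G i x * partial i phi x) <= N * n2p phi.
Proof.
move=> hu [_ hs]; have mO := open_meas oO.
have /choice[w hw] i := hs i; have /choice[w2 hw2] i : exists w2, is_weak_partial Om i (w i) w2 /\ L2p (w2 \_ Om).
  by have [_ [_ /(_ i)[w' [h1 /in_Lp2 h2]]]] := hw i; exists w'.
exists (\sum_i n2p (w2 i \_ Om)); first by apply: sumr_ge0 => i _; exact: n2_ge0.
move=> phi tp; rewrite mulr_suml; apply: ler_sum => i _; have [wi _] := hw i; have [wpi L2w] := hw2 i.
have hG := H10_wp i oO hu; have [_ lG _] := hG; have [lw lw2 ibp2] := wpi.
have ti := test_partial i tp; have [i1 E1] := test_restrict mO lw ti; have [i2 E2] := test_restrict mO lw2 tp.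
have := ibp2 _ tp; rewrite E1 E2 => E.
have -> : itgp (fun x => G i x * partial i phi x) = itgp (fun x => (w i \_ Om) x * partial i phi x).
  have [_ G2 G0 _] := hu; apply: itg_ae.
  - by apply: measurable_funM; [case: (G2 i)|case: (test_L2 ti)].
  - by case/integrableP: i1 => /measurable_EFinP.
  have := wp_unique oO hG wi; apply: filterS => x hx; rewrite patchE; case: ifPn => [/set_mem/hx -> //|/negP nO].
  by rewrite (G0 x _).2// => /mem_set.
rewrite E; apply: le_trans (ler_norm _) _; rewrite normrN; exact: CS (test_L2 tp).
Qed.

End Solutions.

End Coefficients.

(** * The space of solutions and the uniform bound on the Laplacian *)

Section SolutionSpace.
Implicit Types (v : P -> R) (i j : 'I_2).
Variables (Om : set P) (B : R) (a : 'I_2 -> 'I_2 -> P -> R) (c K : R).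
Hypotheses (B0 : 0 <= B) (OB : Om `<=` box 0 B) (c0 : 0 < c) (ca : coef a c K).

Definition weq f G := forall phi, test_function Om phi ->
  bil a G (fun i => partial i phi) = - itgp (fun x => f x * phi x).

Lemma energy_arith (p q r : R) : c * (p ^+ 2 + q ^+ 2) <= r * (B * (p + q)) -> 0 <= p -> 0 <= q -> 0 <= r -> p + q <= 2 * B / c * r.
Proof.
move=> h2 p0 q0 r0; have [pq|pq] := leP (p + q) 0.
  by apply: le_trans pq _; rewrite !mulr_ge0 ?invr_ge0 ?(ltW c0).
rewrite -(ler_pM2r pq) -(ler_pM2l c0).
have -> : c * (2 * B / c * r * (p + q)) = 2 * (r * (B * (p + q))) by field; rewrite gt_eqF.
have h3 : 0 <= c * (p - q) ^+ 2 by rewrite mulr_ge0 ?sqr_ge0// ltW.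
have e2 : c * ((p + q) * (p + q)) = 2 * (c * (p ^+ 2 + q ^+ 2)) - c * (p - q) ^+ 2 by ring.
by rewrite e2 lerBlDr -[leLHS]addr0 lerD// ler_pM2l.
Qed.

Lemma ge_sum3 (p q : R) : 0 <= p -> 0 <= q -> [/\ 0 < 1 + p + q, p <= 1 + p + q & q <= 1 + p + q].
Proof. by move=> p0 q0; split; lra. Qed.

Lemma L2_lim_out (g : nat -> P -> R) : measurable Om -> (forall n, L2p (g n)) -> (forall n x, ~ Om x -> g n x = 0) ->
  (forall n, n2p (fun x => g n.+1 x - g n x) <= 4^-1 ^+ n) -> exists g', [/\ L2p g',
  forall x, ~ Om x -> g' x = 0 & forall n, n2p (fun x => g' x - g n x) <= 2 * 4^-1 ^+ n].
Proof.
move=> mO g2 gz hd; have [g' [g2' _ hg]] := L2_complete g2 hd.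
have mp : mfun (g' \_ Om).
  by apply/(measurable_restrict _ mO measurableT); rewrite setTI; apply: measurable_funTS; case: g2'.
have le f (z : forall x, ~ Om x -> f x = 0) x : `|(g' \_ Om) x - f x| <= `|g' x - f x|.
  by rewrite patchE; case: ifPn => // /negP nO; rewrite (z x) ?subrr ?normr0// => /mem_set.
exists (g' \_ Om); split=> [|x nO|n]; last 1 first.
- apply: le_trans (hg n); apply: n2_mono; [exact: L2B| |exact: le (gz n)].
  by apply: measurable_funB => //; case: (g2 n).
- apply: L2_le mp g2' _ => x; have := le (fun=> 0) (fun _ _ => erefl) x; by rewrite !subr0.
- by rewrite patchE memNset.
Qed.

Lemma energy f u G : L2p f -> H10 Om u G -> weq f G -> n2p (G 0) + n2p (G 1) <= 2 * B / c * n2p f.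
Proof.
move=> f2 hu hw; have [u2 G2 _ _] := hu; have := weq_H10 ca f2 G2 hw hu.
have := bil_coer ca G2; rewrite sum2 => + e; rewrite e => h1.
have h2 : c * (n2p (G 0) ^+ 2 + n2p (G 1) ^+ 2) <= n2p f * (B * (n2p (G 0) + n2p (G 1))).
  apply: le_trans h1 _; apply: le_trans (ler_norm _) _; rewrite normrN; apply: le_trans (CS f2 u2) _.
  by apply: ler_wpM2l; [exact: n2_ge0|exact: poincare hu].
exact: energy_arith h2 (n2_ge0 _ _) (n2_ge0 _ _) (n2_ge0 _ _).
Qed.

Let trip := ((P -> R) * (P -> R) * ('I_2 -> P -> R))%type.
Implicit Types X Y : trip.

(** The graph of the solution operator: data, solution and gradient. Being closed, it is complete,
    which is what the hump argument asks for; existence of solutions for all data plays no part in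
    this. *)
Definition sol X := [/\ L2p X.1.1, H10 Om X.1.2 X.2 & weq X.1.1 X.2].
Definition axt s X Y : trip := (fun x => s * X.1.1 x + Y.1.1 x, fun x => s * X.1.2 x + Y.1.2 x, fun i x => s * X.2 i x + Y.2 i x).
(** With this factor, [solK] times the norm of the data dominates the norms of the solution and of
    each derivative; the summand 1 keeps it positive. *)
Definition solK : R := 1 + 2 * B / c + B * (2 * B / c).
Definition lap phi X : R := \sum_i itgp (fun x => X.2 i x * partial i phi x).

Let q0 : 0 <= 2 * B / c. Proof. by rewrite !mulr_ge0 ?invr_ge0 ?(ltW c0). Qed.

Lemma solK_ge : [/\ 0 < solK, 2 * B / c <= solK & B * (2 * B / c) <= solK].
Proof.
by apply: ge_sum3 => //; exact: mulr_ge0.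
Qed.

Lemma sol_n2 X : sol X -> (forall i, n2p (X.2 i) <= solK * n2p X.1.1) /\ n2p X.1.2 <= solK * n2p X.1.1.
Proof.
move=> [f2 hu hw]; have E := energy f2 hu hw; have [K0 K1 K2] := solK_ge; have n0 := n2_ge0 leb2 X.1.1; split.
  move=> i; apply: le_trans (ler_wpM2r n0 K1); apply: le_trans E.
  by case: (ord2P i) => ->; rewrite ?lerDl ?lerDr n2_ge0.
apply: le_trans (ler_wpM2r n0 K2); apply: le_trans (poincare B0 OB hu) _.
by rewrite -[leRHS]mulrA; exact: ler_wpM2l.
Qed.

Lemma sol_ax s X Y : sol X -> sol Y -> sol (axt s X Y).
Proof.
move=> [f2 hu hw] [f2' hu' hw']; split.
- by apply: L2D => //; exact: L2Z.
- exact: H10_lin.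
- have [_ G2 _ _] := hu; have [_ G2' _ _] := hu'; move=> phi tp.
  have t2 := test_L2 tp; have tp2 i := test_L2 (test_partial i tp).
  rewrite /axt/= (bil_lin1 s ca G2 G2' tp2) hw// hw'//.
  have i1 := L2M f2 t2; have i2 := L2M f2' t2.
  under [in RHS]eq_fun do rewrite mulrDl -mulrA.
  by rewrite itgD ?itgZ//; [ring|exact: itbZ].
Qed.

Lemma lap_ax phi s X Y : test_function Om phi -> sol X -> sol Y -> lap phi (axt s X Y) = s * lap phi X + lap phi Y.
Proof.
move=> tp [_ [_ G2 _ _] _] [_ [_ G2' _ _] _]; rewrite /lap mulr_sumr -big_split/=; apply: eq_bigr => i _.
have tp2 := test_L2 (test_partial i tp); have i1 := L2M (G2 i) tp2; have i2 := L2M (G2' i) tp2.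
under [in LHS]eq_fun do rewrite mulrDl -mulrA.
by rewrite itgD ?itgZ//; exact: itbZ.
Qed.

(** The energy estimate makes solutions and gradients converge at the same geometric rate as the
    data, and the equation passes to the limit. *)
Lemma sol_lim (X : nat -> trip) : measurable Om -> (forall n, sol (X n)) ->
  (forall n, solK * n2p (axt (-1) (X n) (X n.+1)).1.1 <= 4^-1 ^+ n) ->
  exists2 Y, sol Y & forall n, solK * n2p (axt (-1) (X n) Y).1.1 <= 2 * 4^-1 ^+ n.
Proof.
move=> mO hX hd; have [K0 _ _] := solK_ge; have sd n := sol_n2 (sol_ax (-1) (hX n) (hX n.+1)).
have nE (f g : P -> R) : n2p (fun x => -1 * f x + g x) = n2p (fun x => g x - f x).
  by congr n2; apply: funext => x; ring.
have f2 n : L2p (X n).1.1 by have [] := hX n.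
have u2 n : L2p (X n).1.2 by have [_ []] := hX n.
have G2 n i : L2p ((X n).2 i) by have [_ []] := hX n.
have uz n x : ~ Om x -> (X n).1.2 x = 0 by have [_ [_ _ h _] _] := hX n => /h[].
have Gz i n x : ~ Om x -> (X n).2 i x = 0 by have [_ [_ _ h _] _] := hX n => /h[].
have [|F [F2 _ hF]] := @L2_complete _ _ _ leb2 (fun n x => solK * (X n).1.1 x) (fun n => L2Z solK (f2 n)).
  move=> n; under eq_fun do rewrite -mulrBr.
  by rewrite n2Z ?(ger0_norm (ltW K0)) -?nE; [exact: hd|exact: L2B].
have [|U [U2 Uz hU]] := L2_lim_out mO u2 uz.
  by move=> n; rewrite -nE; have [_ h] := sd n; apply: le_trans h (hd n).
have /choice[g hg] i : exists g', [/\ L2p g', forall x, ~ Om x -> g' x = 0 &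
    forall n, n2p (fun x => g' x - (X n).2 i x) <= 2 * 4^-1 ^+ n].
  apply: L2_lim_out => // [n|n]; first exact: Gz.
  by rewrite -nE; have [h _] := sd n; apply: le_trans (h i) (hd n).
have small e : 0 < e -> exists n : nat, 2 * 4^-1 ^+ n <= e :> R.
  move=> e0; have [n hn] := pow4_small (e := e / 2) (ltac:(by rewrite divr_gt0)).
  by exists n; rewrite mulrC -ler_pdivlMr.
pose Y : trip := (fun x => solK^-1 * F x, U, g).
have fY n : solK * n2p (fun x => Y.1.1 x - (X n).1.1 x) <= 2 * 4^-1 ^+ n.
  rewrite -[solK]ger0_norm ?(ltW K0)// -n2Z; last by apply: L2B => //; exact: L2Z.
  apply: le_trans (hF n); apply: eqle; congr n2; apply: funext => x /=; field.
  by rewrite gt_eqF.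
have g2 i : L2p (g i) by have [] := hg i.
have hY : H10 Om U g.
  apply: H10_close => // [x nO|e e0]; first by split=> [|i]; [exact: Uz|have [_ /(_ x nO)] := hg i].
  have [n hn] := small e e0; exists (X n).1.2, (X n).2; split; first by have [] := hX n.
    by rewrite n2BC; apply: le_trans (hU n) hn.
  by move=> i; rewrite n2BC; have [_ _ h] := hg i; apply: le_trans (h n) hn.
exists Y => [|n]; last by rewrite /axt/= nE; exact: fY.
split=> //=; first exact: L2Z.
move=> phi tp; have t2 := test_L2 tp; have tp2 i := test_L2 (test_partial i tp).
have Y2 : L2p Y.1.1 by exact: L2Z.
apply/eqP; rewrite -subr_eq0 opprK -normr_le0.
apply: (@le_lim _ _ (K * 2 * (n2p (partial 0 phi) + n2p (partial 1 phi)) + solK^-1 * n2p phi)) => e e0.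
have [n hn] := small e e0; have [_ [_ Gn2 _ _] /(_ phi tp) En] := hX n.
pose D i x := -1 * (X n).2 i x + g i x.
have D2 : L2g D by move=> i; apply: L2D => //; exact: L2Z.
have Dn i : n2p (D i) <= e by rewrite nE; have [_ _ h] := hg i; apply: le_trans (h n) hn.
have E1 : bil a g (fun i => partial i phi) = bil a D (fun i => partial i phi) + bil a (X n).2 (fun i => partial i phi).
  by rewrite (bil_lin1 (-1) ca Gn2 g2 tp2); ring.
have df : L2p (fun x => Y.1.1 x - (X n).1.1 x) by exact: L2B.
have i1 := L2M df t2; have i2 := L2M (f2 n) t2.
have E2 : itgp (fun x => Y.1.1 x * phi x) = itgp (fun x => (Y.1.1 x - (X n).1.1 x) * phi x) + itgp (fun x => (X n).1.1 x * phi x).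
  by rewrite -itgD//; congr itg; apply: funext => x; ring.
rewrite E1 E2 En (_ : _ + - _ + (_ + _) = bil a D (fun i => partial i phi) + itgp (fun x => (Y.1.1 x - (X n).1.1 x) * phi x)); last by ring.
apply: le_trans (ler_normD _ _) _; rewrite mulrDl; apply: lerD.
  apply: le_trans (bil_bd ca D2 tp2) _; rewrite [K * 2 * _ * e]mulrAC -[K * 2 * e]mulrA.
  apply: ler_wpM2r; first by rewrite addr_ge0 ?n2_ge0.
  by apply: ler_wpM2l; [exact: (coef_ge0 ca)|rewrite mulr_natl mulr2n; exact: lerD].
apply: le_trans (CS df t2) _; rewrite [leRHS]mulrAC; apply: ler_wpM2r; first exact: n2_ge0.
rewrite mulrC ler_pdivlMr// mulrC; exact: le_trans (fY n) hn.
Qed.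

Hypothesis hN : forall X, sol X -> exists2 N, 0 <= N & forall phi, test_function Om phi -> lap phi X <= N * n2p phi.

(** Uniform boundedness for the functionals [lap phi] with |phi|_2 <= 1 on the solution space. Each
    is bounded by the energy estimate, with a constant depending on grad phi; for a fixed solution
    they are bounded together by [hN]. *)
Lemma lap_bound : measurable Om -> exists2 C, 0 <= C & forall f u G, L2p f -> H10 Om u G -> weq f G ->
  forall phi, test_function Om phi -> \sum_i itgp (fun x => G i x * partial i phi x) <= C * n2p f * n2p phi.
Proof.
move=> mO; have [K0 _ _] := solK_ge.
have scale s phi : test_function Om phi -> test_function Om (fun x => s * phi x) /\
    forall X, sol X -> lap (fun x => s * phi x) X = s * lap phi X.
  move=> tp; have [t1 t2] := test_lin (s - 1) tp tp.
  have e1 : (fun x => s * phi x) = (fun x => (s - 1) * phi x + phi x) by apply: funext => x; ring.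
  rewrite e1; split=> // X [_ [_ G2 _ _] _]; rewrite /lap mulr_sumr; apply: eq_bigr => i _.
  have i1 := L2M (G2 i) (test_L2 (test_partial i tp)); rewrite t2 -itgZ//; congr itg.
  by apply: funext => x; ring.
have [[X0 hX0]|no] := pselect (exists X, sol X); last first.
  by exists 0 => // f u G f2 hu hw; case: no; exists (f, u, G).
have L2X X : sol X -> L2p X.1.1 by case.
pose J phi := test_function Om phi /\ n2p phi <= 1; pose N X := solK * n2p X.1.1.
have N0 X : 0 <= N X by rewrite mulr_ge0 ?n2_ge0// ltW.
have Nax s X Y : sol X -> sol Y -> N (axt (-1) Y (axt s X Y)) = `|s| * N X.
  move=> sX sY; rewrite /N mulrCA -n2Z; last exact: L2X.
  by congr (_ * n2 _ _); apply: funext => x /=; ring.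
have Lb phi : J phi -> exists M, forall X, sol X -> `|lap phi X| <= M * N X.
  move=> [tp _]; exists (n2p (partial 0 phi) + n2p (partial 1 phi)) => X sX.
  have [h _] := sol_n2 sX; have [_ [_ G2 _ _] _] := sX; rewrite /lap sum2 mulrDl.
  have b i : `|itgp (fun x => X.2 i x * partial i phi x)| <= n2p (partial i phi) * N X.
    apply: le_trans (CS (G2 i) (test_L2 (test_partial i tp))) _; rewrite mulrC.
    by apply: ler_wpM2l (h i); exact: n2_ge0.
  by apply: le_trans (ler_normD _ _) _; exact: lerD.
have pw X : sol X -> exists M, forall phi, J phi -> `|lap phi X| <= M.
  move=> sX; have [M M0 hX] := hN sX; exists M => phi [tp p1]; have [tp' e] := scale (-1) phi tp.
  rewrite ler_norml; apply/andP; split.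
    rewrite lerNl -mulN1r -e//; apply: le_trans (hX _ tp') _.
    by rewrite n2Z ?normrN1 ?mul1r ?ler_piMr//; exact: test_L2 tp.
  by apply: le_trans (hX _ tp) _; rewrite ler_piMr.
have Lax phi s X Y : J phi -> sol X -> sol Y -> lap phi (axt s X Y) = s * lap phi X + lap phi Y.
  by move=> [tp _]; exact: lap_ax.
have [C hC] := unif_bound (sol_ax (-1) hX0 hX0) sol_ax Lax N0 Nax Lb (fun x0 : nat -> trip => @sol_lim x0 mO) pw.
exists (`|C| * solK); first by rewrite mulr_ge0// ltW.
move=> f u G f2 hu hw phi tp; have sX : sol (f, u, G) by [].
have n0 := n2_ge0 leb2 phi; pose W := `|C| * N (f, u, G); have W0 : 0 <= W by rewrite mulr_ge0.
rewrite -[\sum_i _]/(lap phi (f, u, G)) -[_ * solK * _]mulrA -/W -subr_le0.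
(* The norm of phi may vanish, so phi is divided by its norm plus e. *)
apply: (@le_lim _ _ W) => e e0; have s0 : 0 < n2p phi + e by rewrite ltr_wpDl.
have [tp' es] := scale (n2p phi + e)^-1 phi tp.
have Jp : J (fun x => (n2p phi + e)^-1 * phi x).
  split=> //; rewrite n2Z; last exact: test_L2 tp.
  by rewrite ger0_norm ?invr_ge0 ?(ltW s0)// mulrC ler_pdivrMr// mul1r lerDl ltW.
have := hC _ _ Jp sX; rewrite es// => h1.
have h2 : (n2p phi + e)^-1 * lap phi (f, u, G) <= W.
  apply: le_trans (ler_norm _) _; apply: le_trans h1 _; apply: ler_wpM2r => //; exact: ler_norm.
by rewrite mulrC ler_pdivrMr// mulrDr in h2; rewrite lerBlDr addrC.
Qed.

End SolutionSpace.

(** * Piecewise constant and piecewise affine functions on a mesh *)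

Section MeshFunctions.
Variables (Om : set P) (n : nat) (T : 'I_n -> set P) (v : 'I_n -> 'I_3 -> P) (l : 'I_n -> 'I_3 -> R * R * R).
Variables (H : 'I_n -> R) (k h B : R).
Hypotheses (M : mesh Om T v l H k h) (k0 : 0 < k).
Hypotheses (oO : open Om) (cO : is_convex Om) (nO : Om !=set0) (OB : Om `<=` box 0 B).
Implicit Types (i j : 'I_n) (m : 'I_3) (w : P -> R).

Section FiniteElements.
Implicit Types (q : R * R * R) (c d : 'I_n -> R).

Let tT i := m_tri M i.

Definition Op i : set P := [set x | forall m, 0 < ev (l i m) x].

Lemma Op_T i : Op i `<=` T i.
Proof. by move=> x hx; apply/(tri_T (tT i)) => m; exact: ltW. Qed.

Lemma Op_box i x : Op i x -> exists2 r, 0 < r & box x r `<=` Op i.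
Proof.
move=> hx; have [m|r r0 hr] := @fin_eps 3 (fun m r => forall y, box x r y -> 0 < ev (l i m) y).
  exists (ev (l i m) x / 2 * (k * H i)); first by rewrite mulr_gt0 ?(kH_gt0 M)// divr_gt0.
  move=> r /andP[r0 rl] y /(lam_lip M k0 i m); rewrite ler_distl => /andP[+ _]; apply: lt_le_trans.
  have : r / (k * H i) <= ev (l i m) x / 2 by rewrite ler_pdivrMr ?(kH_gt0 M).
  by have := hx m; move: (r / _) (ev _ _) => *; lra.
by exists r => // y hy m; apply: hr hy; rewrite r0 lexx.
Qed.

Lemma Op_open i : open (Op i).
Proof.
apply/open_boxP => x /Op_box[r r0 hr]; exists r => // y h1 h2; apply: hr.
by split; exact: ltW.
Qed.

Lemma Op_Om i : Op i `<=` Om.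
Proof.
move=> x /Op_box[r r0 hr]; apply: (int_clos oO cO nO r0) => y /hr/Op_T hy.
by apply/(m_cov M); exists i.
Qed.

Lemma Op_meas i : measurable (Op i). Proof. by apply: open_meas; exact: Op_open. Qed.

Lemma Op_inj i j x : Op i x -> Op j x -> i = j.
Proof. by move=> hi hj; apply: (open_disj M (Op_T hj)). Qed.

(** The triangles cover the closure, and each lies in its open part up to three lines, which are
    null. *)
Lemma ae_mesh : {ae leb2, forall x, (exists i, Op i x) \/ ~ closure Om x}.
Proof.
have h1 i m : {ae leb2, forall x, ev (l i m) x != 0}.
  apply: null_line; rewrite -negb_and; apply/negP => /andP[/eqP e1 /eqP e2].
  have [m' mm] : exists m', m != m'.
    by case: (ord3P m) => ->; [exists o1|exists o0|exists o0].
  have := tri_v (tT i) m m; have := tri_v (tT i) m m'; rewrite eqxx (negPf mm) /ev e1 e2 !mul0r !addr0 => ->.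
  by move=> /esym/eqP; rewrite oner_eq0.
have : {ae leb2, forall x, forall i m, ev (l i m) x != 0}.
  by apply: filter_forall => i; apply: filter_forall => m; exact: h1.
apply: filterS => x hx; have [cx|] := pselect (closure Om x); [left|by right].
have [i ix] := (m_cov M x).1 cx; exists i => m; rewrite lt_neqAle eq_sym hx/=.
exact: (tri_T (tT i) x).1.
Qed.

(** The value on the sides is 0, so that composition with any F such that F 0 0 = 0 is exact at
    every point. *)
Definition pc c x : R := \sum_i c i * \1_(Op i) x.

Lemma pcE c i x : Op i x -> pc c x = c i.
Proof.
move=> hx; rewrite /pc (bigD1 i)//= indicE mem_set// mulr1 big1 ?addr0// => j ji.
by rewrite indicE memNset ?mulr0// => hj; move/eqP: ji; apply; exact: Op_inj hj hx.
Qed.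

Lemma pc0 c x : (forall i, ~ Op i x) -> pc c x = 0.
Proof. by move=> no; rewrite /pc big1// => i _; rewrite indicE memNset ?mulr0. Qed.

Lemma pcP c x : pc c x = 0 \/ exists2 i, Op i x & pc c x = c i.
Proof.
have [[i hi]|no] := pselect (exists i, Op i x); first by right; exists i => //; exact: pcE.
by left; apply: pc0 => i hi; apply: no; exists i.
Qed.

Lemma pc_out c x : ~ Om x -> pc c x = 0.
Proof. by move=> nx; apply: pc0 => i /Op_Om. Qed.

Lemma pc_map2 (F : R -> R -> R) c d x : F 0 0 = 0 -> F (pc c x) (pc d x) = pc (fun i => F (c i) (d i)) x.
Proof.
move=> F0; have [[i hi]|no] := pselect (exists i, Op i x); first by rewrite !(pcE _ hi).
by rewrite !pc0// => i hi; apply: no; exists i.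
Qed.

Lemma pc_map (F : R -> R) c x : F 0 = 0 -> F (pc c x) = pc (fun i => F (c i)) x.
Proof. by move=> F0; rewrite (pc_map2 (F := fun a _ => F a) c c). Qed.

Lemma Op_itb i : itbp (\1_(Op i)).
Proof.
apply: (@itb_bnd _ 1 0 B).
- by apply: measurable_indic; exact: Op_meas.
- by move=> y; rewrite indicE; case: (_ \in _); rewrite ?normr1 ?normr0.
- by move=> y nB; rewrite indicE memNset// => /Op_Om/OB.
Qed.

Definition mu i : R := itgp (\1_(Op i)).

Lemma pc_itg c : itbp (pc c) /\ itgp (pc c) = \sum_i c i * mu i.
Proof.
have ic i := itbZ (c i) (Op_itb i).
by split; [exact: itb_sum|rewrite /pc itg_sum//; apply: eq_bigr => i _; rewrite itgZ//; exact: Op_itb].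
Qed.

Lemma pc_m c : mfun (pc c). Proof. by have [/itb_m] := pc_itg c. Qed.

Lemma pc_L2 c : L2p (pc c).
Proof.
split; first exact: pc_m.
rewrite (_ : (fun x => _) = pc (fun i => c i ^+ 2)); first by case: (pc_itg (fun i => c i ^+ 2)).
by apply/funext => x; rewrite (pc_map (F := fun a => a ^+ 2)) ?expr0n.
Qed.

Lemma pc_n2 c : n2p (pc c) ^+ 2 = \sum_i c i ^+ 2 * mu i.
Proof.
rewrite n2K -(pc_itg _).2; congr itg.
by apply/funext => x; rewrite (pc_map (F := fun a => a ^+ 2)) ?expr0n.
Qed.

Lemma mu_bd i : (k * H i) ^+ 2 <= mu i <= (2 * H i) ^+ 2.
Proof.
have kH := kH_gt0 M k0 i; have H0 := H_gt0 M i; have [z hz] := m_in M i.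
have kH2 : 0 < k * H i / 2 by rewrite divr_gt0.
have [ib eb] := itg_ibox z (ltW kH2).
have [ib' eb'] := itg_ibox (v i o0) (ltW H0).
rewrite -eb' (_ : (k * H i) ^+ 2 = (2 * (k * H i / 2)) ^+ 2); last by congr (_ ^+ 2); field.
rewrite -eb; apply/andP; split; apply: itg_le => //; try exact: Op_itb; move=> x; last first.
  rewrite indicE; have [hx|hx] := pselect (Op i x); last by rewrite memNset//; case/andP: (ibox_ge0 (v i o0) (H i) x).
  by rewrite mem_set// ibox1//; apply: (m_out M (tri_vin (tT i) o0)); exact: Op_T.
have [hx|hx] := pselect (box z (k * H i / 2) x); last by rewrite ibox0// indicE.
rewrite ibox1// indicE mem_set//; apply: (inner_pos M kH2) => y hy; apply: hz.
have K (a b c : R) : `|b - a| <= k * H i / 2 -> `|c - b| <= k * H i / 2 -> `|c - a| <= k * H i.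
  by rewrite !ler_norml => /andP[? ?] /andP[? ?]; apply/andP; split; lra.
by case: hx hy => h1 h2 [h3 h4]; split; [exact: K h1 h3|exact: K h2 h4].
Qed.

Lemma mu_gt0 i : 0 < mu i.
Proof. by have /andP[+ _] := mu_bd i; apply: lt_le_trans; rewrite exprn_gt0// (kH_gt0 M). Qed.

Definition slo (a : 'I_2) q : R := if a == 0 then q.1.2 else q.2.

Definition itq w i : R * R * R :=
  (\sum_m w (v i m) * (l i m).1.1, \sum_m w (v i m) * (l i m).1.2, \sum_m w (v i m) * (l i m).2).

Lemma itq_ev w i x : ev (itq w i) x = itp (v i) (l i) w x.
Proof. by rewrite /itp !sum3 /ev/= !sum3; ring. Qed.

(** Nodal data are given by a function w on the whole plane of which only the values at the vertices
    matter. The triangle is chosen arbitrarily; conformity makes the choice irrelevant. *)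
Definition fe w x : R :=
  if pselect (exists i, T i x) is left e then itp (v (sval (cid e))) (l (sval (cid e))) w x else 0.

Lemma feE w i x : T i x -> fe w x = ev (itq w i) x.
Proof.
move=> ix; rewrite /fe itq_ev; case: pselect => [e|no]; last by case: no; exists i.
by apply: (m_cf M) => //; case: cid.
Qed.

Lemma fe_out w x : ~ closure Om x -> fe w x = 0.
Proof. by move=> nx; rewrite /fe; case: pselect => // e; case: nx; apply/(m_cov M). Qed.

Lemma fe_v w i m : fe w (v i m) = w (v i m).
Proof. by rewrite (feE w (tri_vin (tT i) m)) itq_ev (itp_v (tT i)). Qed.

Definition Gr w (a : 'I_2) : P -> R := pc (fun i => slo a (itq w i)).

Definition adm w := forall i m, ~ Om (v i m) -> w (v i m) = 0.

(** If a vertex inside Om had positive weight at x, then x would lie on a segment from a point of Om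
    to a point of the closure, hence in Om. *)
Lemma fe_bd w x : adm w -> ~ Om x -> fe w x = 0.
Proof.
move=> aw nx; have [cx|/fe_out->//] := pselect (closure Om x).
have [i ix] := (m_cov M x).1 cx; rewrite (feE w ix) itq_ev /itp big1// => m _.
have lx := (tri_T (tT i) x).1 ix; have [->|lm] := eqVneq (ev (l i m) x) 0; first by rewrite mul0r.
have lm0 : 0 < ev (l i m) x by rewrite lt_neqAle eq_sym lm lx.
rewrite aw ?mulr0// => Ov; apply: nx.
have [e1|e1] := eqVneq (ev (l i m) x) 1; first by rewrite (tri_1 (tT i) ix e1).
have t1 : 0 < 1 - ev (l i m) x by rewrite subr_gt0 lt_neqAle e1 (tri_le1 (tT i)).
set t := ev (l i m) x in t1 lm0 e1 *.
pose z : P := ((x.1 - t * (v i m).1) / (1 - t), (x.2 - t * (v i m).2) / (1 - t)).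
have xE : x = cmb (v i m) z t.
  rewrite /cmb/= ![(1 - t) * _]mulrC !divfK ?gt_eqF//.
  by rewrite ![t * _ + _]addrC !subrK; case: (x).
rewrite xE; apply: cvx_in => //; last by rewrite lm0 /= (tri_le1 (tT i)).
apply/(m_cov M); exists i; apply/(tri_T (tT i)) => m'.
have : ev (l i m') x = t * (m' == m)%:R + (1 - t) * ev (l i m') z by rewrite {1}xE ev_cmb (tri_v (tT i)).
have [->|mm] := eqVneq m' m; last by rewrite mulr0 add0r => e'; rewrite -(pmulr_rge0 _ t1) -e' lx.
rewrite mulr1 -/t -{1}[t]addr0 => /addrI/esym/eqP; rewrite mulf_eq0 gt_eqF//= => /eqP ->.
exact: lexx.
Qed.

(** The segment is followed triangle by triangle. The current one is left at its last point, which
    belongs to another triangle, and is never met again, so the list of triangles shrinks. *)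
Lemma chain (S : seq 'I_n) (f : P -> R) (L : R) x y : (forall i (a b : P), T i a -> T i b -> `|f a - f b| <= L * D1 a b) ->
  (forall t, 0 <= t <= 1 -> exists2 i, i \in S & T i (cmb y x t)) -> `|f x - f y| <= L * D1 x y.
Proof.
move=> hf; have e0 := @cmb0; have e1 := @cmb1.
have [N] := ubnP (size S); elim: N S x => // N IH S x sN hS.
have [i iS ix] := hS 0 (ltac:(by rewrite lexx ler01)); rewrite e0 in ix.
have [iy|niy] := pselect (T i y); first exact: hf ix iy.
pose A : set R := [set t | T i (cmb y x t)].
pose B' : set R := [set t | exists2 j, j \in rem i S & T j (cmb y x t)].
have AB t : 0 <= t <= 1 -> A t \/ B' t.
  move=> /hS[j jS jt]; have [ji|ji] := eqVneq j i; first by left; rewrite /A /= -ji.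
  right; exists j => //; move: jS; rewrite (perm_mem (perm_to_rem iS)) inE (negPf ji).
  by [].
have cA : closed A by exact: (T_closed_line M).
have cB : closed B' := T_closed_lines M (J := fun j => j \in rem i S) (x := y) (y := x).
have A0 : A 0 by rewrite /A/= e0.
have B1 : B' 1 by case: (AB 1 (ltac:(by rewrite lexx ler01))) => //; rewrite /A /= e1.
have [t [t01 At Bt last]] := conn01 cA cB AB A0 B1.
set z := cmb y x t; have iz : T i z := At.
have cc s : cmb y z s = cmb y x (s + (1 - s) * t) by rewrite /z /cmb/=; congr (_, _); ring.
have IHz : `|f z - f y| <= L * D1 z y.
  apply: (IH (rem i S)) => [|s /andP[s0 s1]].
    by rewrite size_rem// -ltnS prednK//; case: (S) iS.
  have [s00|sn] := eqVneq s 0; first by rewrite s00 e0; case: Bt => j; exists j.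
  have sp : 0 < s by rewrite lt_neqAle eq_sym sn.
  have u01 : t < s + (1 - s) * t <= 1.
    case/andP: t01 => t0 t1; have t1' : t < 1.
      by rewrite lt_neqAle t1 andbT; apply/eqP => te; apply: niy; rewrite -[y](e1 x) -te.
    have : 0 < s * (1 - t) by rewrite mulr_gt0// subr_gt0.
    have : 0 <= (1 - s) * (1 - t) by rewrite mulr_ge0// subr_ge0.
    by move=> *; apply/andP; split; lra.
  have [/last//|[j js jt]] := AB (s + (1 - s) * t) (ltac:(case/andP: u01 => u1 ->; rewrite andbT (le_trans _ (ltW u1))//; by case/andP: t01)).
  by exists j => //; rewrite cc.
have h1 := hf _ _ _ ix iz; have [d1 d2] := D1_cmb x y t01; move: IHz h1; rewrite d1 d2.
move=> h2 h1; rewrite -(subrK (f z) (f x)) -addrA; apply: le_trans (ler_normD _ _) _.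
by apply: le_trans (lerD h1 h2) _; apply: eqle; ring.
Qed.

Definition wlip w : R := \sum_i (`|slo 0 (itq w i)| + `|slo 1 (itq w i)|).

Lemma wlip_ge w i (a : 'I_2) : `|slo a (itq w i)| <= wlip w.
Proof.
rewrite /wlip (bigD1 i)//=; apply: (@le_trans _ _ (`|slo 0 (itq w i)| + `|slo 1 (itq w i)|)).
  by case: (ord2P a) => ->; rewrite ?lerDl ?lerDr.
by rewrite lerDl sumr_ge0// => j _; rewrite addr_ge0.
Qed.

Lemma wlip_ge0 w : 0 <= wlip w.
Proof. by apply: sumr_ge0 => j _; rewrite addr_ge0. Qed.

Lemma fe_lip w x y : adm w -> `|fe w x - fe w y| <= wlip w * D1 x y.
Proof.
move=> aw; have hf i (a b : P) : T i a -> T i b -> `|fe w a - fe w b| <= wlip w * D1 a b.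
  move=> ia ib; rewrite (feE w ia) (feE w ib).
  rewrite (_ : _ - _ = slo 0 (itq w i) * (a.1 - b.1) + slo 1 (itq w i) * (a.2 - b.2)); last by rewrite /ev /slo/=; ring.
  apply: le_trans (ler_normD _ _) _; rewrite !normrM /D1 mulrDr.
  by apply: lerD; apply: ler_wpM2r => //; exact: wlip_ge.
have cc := (cvxP (closure Om)).1 (clos_cvx cO).
have inn x' y' : closure Om x' -> closure Om y' -> `|fe w x' - fe w y'| <= wlip w * D1 x' y'.
  move=> cx cy; apply: (chain (S := enum 'I_n) hf) => t t01.
  by have [i it] := (m_cov M _).1 (cc _ _ _ cy cx t01); exists i => //; rewrite mem_enum.
have outn x' y' : closure Om x' -> ~ closure Om y' -> `|fe w x' - fe w y'| <= wlip w * D1 x' y'.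
  move=> cx ny; rewrite (fe_out _ ny).
  have e0 := cmb0 x' y'; have e1 := cmb1 x' y'.
  have [|||||t [t01 [j _ At] _ last]] := @conn01 [set t | exists2 j, xpredT j & T j (cmb y' x' t)] setT.
  - exact: (T_closed_lines M).
  - exact: closedT.
  - by move=> t _; right.
  - by have [j jx] := (m_cov M _).1 cx; exists j => //; rewrite e0.
  - by [].
  (* The last point of the segment in the closure cannot lie in the open set Om, so the function
     vanishes there. *)
  set z := cmb y' x' t in At; have cz : closure Om z by apply/(m_cov M); exists j.
  have nz : ~ Om z.
    move=> Oz; have t1 : t < 1.
      rewrite lt_neqAle; case/andP: t01 => _ ->; rewrite andbT; apply/eqP => te; apply: ny.
      by rewrite -e1 -te.
    have [r r0 hr] := (open_boxP _).1 oO z Oz.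
    pose D := D1 x' y' + 1; have D0 : 0 < D by rewrite ltr_wpDl// D1_ge0.
    pose s := Num.min 1 (t + r / D / 2).
    have ts : t < s by rewrite lt_min t1 ltrDl !divr_gt0.
    have s1 : s <= 1 by rewrite ge_min lexx.
    apply: (last s); first by rewrite ts.
    have st : (s - t) * D < r.
      rewrite -ltr_pdivlMr// ltrBlDl; apply: (@le_lt_trans _ _ (t + r / D / 2)); first by rewrite ge_min lexx orbT.
      by rewrite ltrD2l ltr_pdivrMr// ltr_pMr ?divr_gt0// ltr1n.
    have K (a b d : R) : `|a - b| <= D -> `|s * b + (1 - s) * a - (t * b + (1 - t) * a)| < r.
      move=> hab; rewrite (_ : _ - _ = (s - t) * (b - a)); last by ring.
      rewrite normrM gtr0_norm ?subr_gt0// distrC; apply: le_lt_trans st; apply: ler_wpM2l => //.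
      by rewrite subr_ge0 ltW.
    have [|i ii] := (m_cov M (cmb y' x' s)).1; last by exists i.
    apply: subset_closure; apply: hr; apply: (K _ _ 0); rewrite /D /D1 -addrA ?lerDl ?addr_ge0//.
    by rewrite addrCA lerDl addr_ge0.
  have [d1 _] := D1_cmb x' y' t01; have := inn x' z cx cz; rewrite (fe_bd aw nz) /z d1 => /le_trans; apply.
  by apply: ler_wpM2l; [exact: wlip_ge0|rewrite ler_piMl ?D1_ge0//; case/andP: t01].
have Dc x' y' : D1 x' y' = D1 y' x' by rewrite /D1 distrC [X in _ + X]distrC.
have [cx|nx] := pselect (closure Om x); have [cy|ny] := pselect (closure Om y).
- exact: inn.
- exact: outn.
- by rewrite distrC Dc; exact: outn.
- by rewrite !fe_out// subrr normr0 mulr_ge0 ?D1_ge0// wlip_ge0.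
Qed.

Lemma inner_box : exists x0, exists2 r0, 0 < r0 & box x0 r0 `<=` Om.
Proof.
have [x0 Ox] := nO; have [r r0 hr] := (open_boxP _).1 oO x0 Ox.
exists x0, (r / 2); first by rewrite divr_gt0.
have r2 : r / 2 < r by rewrite ltr_pdivrMr// ltr_pMr// ltr1n.
by move=> y [h1 h2]; apply: hr; [exact: le_lt_trans h1 r2|exact: le_lt_trans h2 r2].
Qed.

Lemma fe_H10 w : adm w -> H10 Om (fe w) (Gr w).
Proof.
move=> aw; have [x0 [r0 r00 Bx]] := inner_box.
apply: (@lip_H10 Om x0 r0 B (wlip w)) => //.
- by move=> x y; exact: fe_lip.
- by move=> x nx; split=> [|a]; [exact: fe_bd|exact: pc_out].
- by move=> a; exact: pc_m.
- move=> a x; rewrite /Gr; have [->|[i _ ->]] := pcP (fun i => slo a (itq w i)) x; first by rewrite normr0 wlip_ge0.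
  exact: wlip_ge.
apply: filterS ae_mesh => x [[i ix]|nc].
  have [r rp hr] := Op_box ix; exists r => // y /hr iy; split; last by move=> a; rewrite /Gr !(pcE _ ix) (pcE _ iy).
  by rewrite (feE w (Op_T ix)) (feE w (Op_T iy)) /Gr !(pcE _ ix) /ev /slo/=; ring.
have : open (~` closure Om) by apply: closed_openC; exact: closed_closure.
move=> /open_boxP/(_ x nc)[r rp hr]; exists (r / 2); first by rewrite divr_gt0.
have r2 : r / 2 < r by rewrite ltr_pdivrMr// ltr_pMr// ltr1n.
have g y a : ~ closure Om y -> Gr w a y = 0 by move=> ny; apply: pc_out => /subset_closure.
move=> y [h1 h2]; have ny : ~ closure Om y by apply: hr; [exact: le_lt_trans h1 r2|exact: le_lt_trans h2 r2].
by rewrite !fe_out// !g// !mul0r !addr0; split=> // a; rewrite !g.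
Qed.

Variables (TT : set (set P)).
Hypothesis hTT : forall S, TT S <-> exists i, S = T i.

Lemma fe_V10 w : adm w -> in_V10 Om TT (fe w).
Proof.
move=> aw; split; last by move=> x [_]; rewrite ((interior_id _).1 oO); exact: fe_bd.
split; first by apply: continuous_subspaceT; apply: lip_cont => x y; exact: fe_lip.
move=> S /hTT[i ->]; exists (itq w i).1.1, (itq w i).1.2, (itq w i).2 => x ix.
by rewrite (feE w ix).
Qed.

Lemma V10_fe u : in_V10 Om TT u -> adm u /\ forall x, closure Om x -> u x = fe u x.
Proof.
move=> [[_ hu] h0]; split.
  move=> i m nv; apply: h0; split; first by apply/(m_cov M); exists i; exact: tri_vin (tT i) m.
  by rewrite ((interior_id _).1 oO).
move=> x /(m_cov M)[i ix]; have [a [b [c hx]]] := hu _ ((hTT _).2 (ex_intro _ i erefl)).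
rewrite (feE u ix) itq_ev /itp hx// -[LHS]/(ev (a, b, c) x) (tri_aff (tT i)).
by apply: eq_bigr => m _; rewrite hx//; exact: tri_vin (tT i) m.
Qed.

Lemma V10_H10 u : in_V10 Om TT u -> H10 Om (u \_ Om) (Gr u).
Proof.
move=> /V10_fe[aw hu]; rewrite (_ : u \_ Om = fe u); first exact: fe_H10.
apply/funext => x; rewrite patchE; case: ifPn => [/set_mem Ox|/negP nx]; first by apply: hu; exact: subset_closure.
by rewrite fe_bd// => /mem_set.
Qed.

End FiniteElements.

(** * The maximal function of a mesh *)

Section MaximalFunction.
Variable g : 'I_n -> R.
Hypothesis g0 : forall i, 0 <= g i.

Let itbg (c : 'I_n -> R) := (pc_itg c).1.
Let itgg (c : 'I_n -> R) := (pc_itg c).2.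
Local Notation F := (pc g).

Lemma pc_ge0 (c : 'I_n -> R) x : (forall i, 0 <= c i) -> 0 <= pc c x.
Proof. by move=> c0; have [->|[i _ ->]] := pcP c x. Qed.

Lemma pc_ibox (c : 'I_n -> R) p r : itbp (fun x => ibox p r x * pc c x).
Proof. by apply: L2M; [exact: ibox_L2|exact: pc_L2]. Qed.

Definition bxi i r : R := itgp (fun x => ibox (v i 0) r x * F x).

Lemma bxi_le i r : bxi i r <= itgp F.
Proof.
apply: itg_le; [exact: pc_ibox|exact: itbg|] => x; have /andP[a0 a1] := ibox_ge0 (v i 0) r x.
by rewrite ler_piMl// pc_ge0.
Qed.

(** One value per triangle: the boxes are centred at a vertex and not smaller than the local size,
    so that level sets are unions of triangles. *)
Definition mx i : R := sup [set bxi i r / (2 * r) ^+ 2 | r in [set r | H i <= r]].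

Lemma mx_sup i : has_sup [set bxi i r / (2 * r) ^+ 2 | r in [set r | H i <= r]].
Proof.
split; first by exists (bxi i (H i) / (2 * H i) ^+ 2), (H i) => /=.
exists (itgp F / (2 * H i) ^+ 2) => _ [r /= hr <-]; have Hi := H_gt0 M i.
have r0 : 0 < r by exact: lt_le_trans hr.
have F0 : 0 <= itgp F by apply: itg_ge0 => x; exact: pc_ge0.
apply: (@le_trans _ _ (itgp F / (2 * r) ^+ 2)).
  by apply: ler_wpM2r; [rewrite invr_ge0 sqr_ge0|exact: bxi_le].
apply: ler_wpM2l => //; rewrite lef_pV2 ?posrE ?exprn_gt0 ?mulr_gt0//.
by apply: lerXn2r; rewrite ?nnegrE ?mulr_ge0 ?(ltW Hi) ?(ltW r0)//; apply: ler_wpM2l.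
Qed.

Lemma mx_le i r : H i <= r -> bxi i r <= (2 * r) ^+ 2 * mx i.
Proof.
move=> hr; have r0 : 0 < r by apply: lt_le_trans hr; exact: (H_gt0 M).
rewrite mulrC -ler_pdivrMr ?exprn_gt0 ?mulr_gt0//; apply: sup_upper_bound; first exact: mx_sup.
by exists r.
Qed.

Lemma mx_gt i t : t < mx i -> exists2 r, H i <= r & t * (2 * r) ^+ 2 < bxi i r.
Proof.
rewrite -subr_gt0 => /(sup_adherent)/(_ (mx_sup i))[_ [r /= hr <-]].
have r0 : 0 < r by apply: lt_le_trans hr; exact: (H_gt0 M).
by rewrite subKr ltr_pdivlMr ?exprn_gt0 ?mulr_gt0// => ht; exists r.
Qed.

Lemma T_box i x : T i x -> box (v i 0) (H i) x.
Proof. exact: (m_out M (tri_vin (m_tri M i) 0)). Qed.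

Lemma mx_ge i : g i <= 4 / k ^+ 2 * mx i.
Proof.
have Hi := H_gt0 M i; have := mx_le (lexx (H i)).
have : g i * (k * H i) ^+ 2 <= bxi i (H i).
  have /andP[a _] := mu_bd i; apply: le_trans (ler_wpM2l (g0 i) a) _.
  rewrite -itgZ; last exact: Op_itb.
  apply: itg_le; [by apply: itbZ; exact: Op_itb|exact: pc_ibox|] => x.
  have /andP[b0 _] := ibox_ge0 (v i 0) (H i) x.
  rewrite indicE; have [/set_mem xi|_] := boolP (x \in _); last by rewrite mulr0 mulr_ge0 ?pc_ge0.
  by rewrite mulr1 (pcE g xi) ibox1 ?mul1r//; apply: T_box; exact: (Op_T xi).
move=> /le_trans h1 /h1; rewrite !exprMn [2 ^+ 2 * _]mulrC mulrA -mulrA [_ * mx i]mulrC.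
rewrite [X in _ <= X](_ : _ = (2 ^+ 2 * mx i) * H i ^+ 2); last by ring.
rewrite mulrA ler_pM2r ?exprn_gt0// -ler_pdivlMr ?exprn_gt0// => /le_trans; apply.
by rewrite expr2 -natrM mulrAC.
Qed.

(** The part of g below t / 2 is discarded and Vitali's covering applied to the rest. A tripled box
    contains the whole triangle because its radius is at least the local size. The constant is 9,
    for the area of tripled boxes, times 2, for the discarded half. *)
Lemma mx_weak t : 0 < t -> t * \sum_i mu i * (t < mx i)%R%:R <= 18 * \sum_i mu i * g i * (t < 2 * g i)%R%:R.
Proof.
move=> t0; pose J := [set i | t < mx i]%SET.
have rP i : exists r, [/\ H i <= r & t < mx i -> t * (2 * r) ^+ 2 < bxi i r].
  by have [/mx_gt[r h1 h2]|h1] := ltP t (mx i); [exists r|exists (H i)]; split.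
have {rP}/choice[r rP] := rP; have r0 i : 0 < r i by have [+ _] := rP i; apply: lt_le_trans; exact: (H_gt0 M).
have [J' [s1 s2 s3]] := vitali (fun i => v i 0) J (fun i => ltW (r0 i)).
pose g' i := g i * (t < 2 * g i)%R%:R.
have g'0 i : 0 <= g' i by rewrite mulr_ge0.
have Fle x : F x <= pc g' x + t / 2.
  have [e|[i xi _]] := pcP g x; first by rewrite e addr_ge0 ?pc_ge0// divr_ge0// ltW.
  rewrite !(pcE _ xi) /g'; have [lt|le] := ltP t (2 * g i); first by rewrite mulr1 lerDl divr_ge0// ltW.
  by rewrite mulr0 add0r ler_pdivlMr// mulrC.
have avg j : j \in J' -> t / 2 * (2 * r j) ^+ 2 <= itgp (fun x => ibox (v j 0) (r j) x * pc g' x).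
  move=> /(fintype.subsetP s1); rewrite inE => jt; have [_ /(_ jt) lt] := rP j.
  have [ib ibE] := itg_ibox (v j 0) (ltW (r0 j)).
  have : bxi j (r j) <= itgp (fun x => ibox (v j 0) (r j) x * pc g' x) + t / 2 * (2 * r j) ^+ 2.
    rewrite -ibE -itgZ// -itgD; [|exact: pc_ibox|exact: itbZ].
    apply: itg_le; [exact: pc_ibox|by apply: itbD; [exact: pc_ibox|exact: itbZ]|] => x.
    have /andP[b0 _] := ibox_ge0 (v j 0) (r j) x.
    by rewrite [t / 2 * _]mulrC -mulrDr; exact: ler_wpM2l.
  move/(lt_le_trans lt); move: (itg _ _) ((2 * _) ^+ 2) => a b; lra.
have cov : \sum_i mu i * (t < mx i)%R%:R <= \sum_(j in J') 9 * (2 * r j) ^+ 2.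
  have -> : \sum_i mu i * (t < mx i)%R%:R = itgp (pc (fun i => (t < mx i)%R%:R)).
    by rewrite itgg; apply: eq_bigr => i _; rewrite mulrC.
  have ib j := itg_ibox (v j 0) (mulr_ge0 (ler0n R 3) (ltW (r0 j))).
  have -> : \sum_(j in J') 9 * (2 * r j) ^+ 2 = itgp (fun x => \sum_(j <- enum J') ibox (v j 0) (3 * r j) x).
    rewrite itg_sum; last by move=> j; have [] := ib j.
    by rewrite big_enum; apply: eq_bigr => j _; have [_ ->] := ib j; ring.
  apply: itg_le; [exact: itbg|by apply: itb_sum => j; have [] := ib j|] => x.
  have s0 : 0 <= \sum_(j <- enum J') ibox (v j 0) (3 * r j) x.
    by apply: sumr_ge0 => j _; have /andP[] := ibox_ge0 (v j 0) (3 * r j) x.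
  have [->//|[i xi ->]] := pcP (fun i => (t < mx i)%R%:R) x.
  have [lt|//] := ltP t (mx i); have iJ : i \in J by rewrite inE.
  have [j [jJ rij [y [b1 bj]]]] := s3 _ iJ.
  have bx : box (v j 0) (3 * r j) x.
    have bi : box (v i 0) (r j) x by have := T_box (Op_T xi); have [Hr _] := rP i; exact: (box_mono (le_trans Hr rij)).
    have bi' : box (v i 0) (r j) y by exact: box_mono b1.
    have := box_add bj (box_add (box_sym bi') bi); by rewrite (_ : r j + (r j + r j) = 3 * r j); last by ring.
  rewrite big_enum (bigD1 j)//= ibox1// lerDl; apply: sumr_ge0 => j' _.
  by have /andP[] := ibox_ge0 (v j' 0) (3 * r j') x.
have dis : \sum_(j in J') itgp (fun x => ibox (v j 0) (r j) x * pc g' x) <= itgp (pc g').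
  rewrite -big_enum -itg_sum; last by move=> j; exact: pc_ibox.
  apply: itg_le; [by apply: itb_sum => j; exact: pc_ibox|exact: itbg|] => x; rewrite -mulr_suml ler_piMl ?pc_ge0//.
  rewrite big_enum; have [[j [jJ' bj]]|no] := pselect (exists j, j \in J' /\ box (v j 0) (r j) x).
    rewrite (bigD1 j)//= ibox1// big1 ?addr0// => i /andP[iJ' ne]; rewrite ibox0// => bi.
    by move: ne; rewrite (s2 _ _ _ iJ' jJ' bi bj) eqxx.
  by rewrite big1// => j jJ'; rewrite ibox0// => bj; apply: no; exists j.
apply: le_trans (ler_wpM2l (ltW t0) cov) _.
have -> : \sum_i mu i * g i * (t < 2 * g i)%R%:R = itgp (pc g').
  by rewrite itgg; apply: eq_bigr => i _; rewrite /g'; ring.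
apply: le_trans (ler_wpM2l (ler0n R 18) dis); rewrite !mulr_sumr; apply: ler_sum => j jJ'.
by have := ler_wpM2l (ler0n R 18) (avg _ jJ'); apply: le_trans; apply: eqle; field.
Qed.

End MaximalFunction.

(** * Lipschitz truncation of nodal values *)

Section MeshTruncation.
Variable w : P -> R.
Hypothesis aw : adm w.
Implicit Types p : P.

Definition gsl i : R := `|slo 0 (itq w i)| + `|slo 1 (itq w i)|.

Lemma gsl_ge0 i : 0 <= gsl i. Proof. by rewrite addr_ge0. Qed.

Local Notation z := (fe w).
Local Notation G := (Gr w).
Local Notation mm := (mx gsl).
Let hz : H10 Om z G := fe_H10 aw.

Lemma gslE x : `|G 0 x| + `|G 1 x| = pc gsl x.
Proof. by rewrite (pc_map2 (F := fun a b => `|a| + `|b|)) ?normr0 ?addr0. Qed.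

Lemma ibx_le i m r t : H i <= r -> mm i <= t ->
  itgp (fun x => ibox (v i m) r x * (`|G 0 x| + `|G 1 x|)) <= 16 * r ^+ 2 * t.
Proof.
move=> hr ht; have H0 := H_gt0 M i.
have h2 : H i <= 2 * r by rewrite mulr_natl mulr2n (le_trans hr)// lerDl (le_trans (ltW H0)).
have := mx_le gsl_ge0 h2.
have ib p s : itbp (fun x => ibox p s x * pc gsl x) by exact: pc_ibox.
have sub : box (v i m) r `<=` box (v i 0) (2 * r).
  move=> x hx; rewrite mulr_natl mulr2n; apply: box_add hx; apply: box_mono hr _ _.
  exact: (T_box (tri_vin (m_tri M i) m)).
have -> : (fun x => ibox (v i m) r x * (`|G 0 x| + `|G 1 x|)) = (fun x => ibox (v i m) r x * pc gsl x).
  by apply: funext => x; rewrite gslE.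
have le : itgp (fun x => ibox (v i m) r x * pc gsl x) <= bxi gsl i (2 * r).
  apply: itg_le => // x; apply: ler_wpM2r; first by apply: pc_ge0; exact: gsl_ge0.
  by have [xb|nb] := pselect (box (v i m) r x); [rewrite !ibox1//; exact: sub|rewrite ibox0//; have /andP[] := ibox_ge0 (v i 0) (2 * r) x].
move=> /(le_trans le) h1; apply: le_trans h1 _; apply: le_trans (ler_wpM2l (sqr_ge0 _) ht) _.
by apply: eqle; ring.
Qed.

Lemma tri_osc i m x : T i x -> `|w (v i m) - z x| <= gsl i * H i.
Proof.
move=> xi; rewrite (feE w xi) -(fe_v w i m) (feE w (tri_vin (m_tri M i) m)).
have [a b] := m_out M (tri_vin (m_tri M i) m) xi; rewrite /gsl; move: (itq w i) => q; rewrite /slo/= /ev; set y := v i m in a b *.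
rewrite (_ : _ - _ = q.1.2 * (y.1 - x.1) + q.2 * (y.2 - x.2)); last by ring.
apply: le_trans (ler_normD _ _) _; rewrite !normrM mulrDl [`|y.1 - _|]distrC [`|y.2 - _|]distrC.
by apply: lerD; apply: ler_wpM2l.
Qed.

Lemma base_arith (a b c K1 g' Hi r t mi : R) : 0 < K1 -> K1 <= 1 / 2 -> 0 < Hi -> Hi <= r -> 0 <= g' -> mi <= t ->
  g' <= 4 / K1 ^+ 2 * mi ->
  `|a - b| <= g' * Hi -> `|b - c| <= (K1 * r) ^- 2 * (2 * r) * (16 * r ^+ 2 * t) -> `|a - c| <= 36 / K1 ^+ 2 * (r * t).
Proof.
move=> K0 Kh H0 Hr g0 mt gm h1 h2; have r0 : 0 < r by exact: lt_le_trans Hr.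
rewrite -(subrKA b); apply: le_trans (ler_normD _ _) _; apply: le_trans (lerD h1 h2) _.
have u0 : 0 <= 4 / K1 ^+ 2 by rewrite divr_ge0// sqr_ge0.
have : g' * Hi <= 4 / K1 ^+ 2 * t * r.
  by apply: ler_pM; rewrite ?(ltW H0)//; apply: le_trans gm _; apply: ler_wpM2l.
have -> : (K1 * r) ^- 2 * (2 * r) * (16 * r ^+ 2 * t) = 32 / K1 ^+ 2 * (r * t) by field; rewrite !gt_eqF.
move/(lerD (lexx (32 / K1 ^+ 2 * (r * t)))); rewrite addrC => /le_trans; apply.
by apply: eqle; field; rewrite gt_eqF.
Qed.

Lemma step_arith (a b c K1 r t : R) : 0 < K1 -> K1 <= 1 / 2 -> 0 < r -> 0 <= t ->
  `|a - b| <= 64 / K1 ^+ 2 * (r / 2 * t) -> `|b - c| <= r ^- 2 * (2 * r) * (16 * r ^+ 2 * t) -> `|a - c| <= 64 / K1 ^+ 2 * (r * t).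
Proof.
move=> K0 Kh r0 t0 h1 h2; have u0 : 0 <= r * t by rewrite mulr_ge0// ltW.
rewrite -(subrKA b); apply: le_trans (ler_normD _ _) _; apply: le_trans (lerD h1 h2) _.
have -> : r ^- 2 * (2 * r) * (16 * r ^+ 2 * t) = 32 * (r * t) by field; rewrite gt_eqF.
have -> : 64 / K1 ^+ 2 * (r * t) = 64 / K1 ^+ 2 * (r / 2 * t) + 32 * (K1 ^- 2 * (r * t)) by field; rewrite gt_eqF.
rewrite lerD2l ler_pM2l//; rewrite ler_peMl// invf_ge1 ?exprn_gt0//.
by rewrite expr_le1 ?(ltW K0)//; lra.
Qed.

(** Where the maximal function is at most t, halving the radius changes the average by at most 32 r
    t, and the dyadic radii sum to the factor 64. Near the local size the comparison passes through
    the inscribed box: 36 is 4 for the oscillation on the triangle plus 32 for the change of box,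
    each divided by k^2. *)
Lemma node_avg i m r t : H i <= r -> mm i <= t -> `|w (v i m) - avgb z (v i m) r| <= 64 / k ^+ 2 * (r * t).
Proof.
move=> hr ht; have H0 := H_gt0 M i; have kh := k_le M k0 i.
have L2z : L2p z by case: hz.
have mi0 : 0 <= mm i.
  have := mx_ge gsl_ge0 i; have q0 : 0 < 4 / k ^+ 2 by rewrite divr_gt0// exprn_gt0.
  by move/(le_trans (gsl_ge0 i)); rewrite pmulr_rge0.
have t0 : 0 <= t by exact: le_trans ht.
have base s : H i <= s -> s <= 2 * H i -> `|w (v i m) - avgb z (v i m) s| <= 36 / k ^+ 2 * (s * t).
  move=> hs s2; have [c hc] := m_in M i; have s0 : 0 < s by exact: lt_le_trans hs.
  have ks : 0 < k * H i by rewrite mulr_gt0.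
  apply: (base_arith (b := avgb z c (k * H i)) k0 kh H0 hs (gsl_ge0 i) ht (mx_ge gsl_ge0 i)).
    by apply: avgb_cst => // x /hc; exact: tri_osc.
  have inc (a b : R) : 0 < a -> a <= b -> b ^- 2 <= a ^- 2.
    move=> a0 ab; have b0 : 0 < b by exact: lt_le_trans ab.
    by rewrite lef_pV2 ?posrE ?exprn_gt0//; apply: lerXn2r; rewrite ?nnegrE ?(ltW a0) ?(ltW b0).
  have kH2 : k * s <= 2 * (k * H i) by rewrite mulrCA ler_pM2l.
  apply: le_trans (avgb_cmp (r := s) (N := (k * s) ^- 2) hz (ltW s0) ks s0 _ (fun _ => id) _ _) _.
  - by move=> x /hc xi; apply: box_mono hs _ _; exact: (m_out M (tri_vin (m_tri M i) m)).
  - by apply: inc => //; rewrite mulr_gt0.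
  - by apply: inc; [rewrite mulr_gt0|apply: ler_wpM2r; [exact: ltW|lra]].
  - apply: ler_wpM2l; last exact: ibx_le.
    by rewrite mulr_ge0 ?invr_ge0 ?sqr_ge0// mulr_ge0// ltW.
have [N hN] : exists N : nat, r <= 2 ^+ N * (2 * H i).
  exists (Num.truncn (r / (2 * H i))).+1; rewrite -ler_pdivrMr ?mulr_gt0//.
  by apply: ltW; apply: lt_trans (truncnS_gt _) _; rewrite -natrX ltr_nat ltn_expl.
elim: N r hr hN => [|N IH] r hr hN; have r0 : 0 < r by exact: lt_le_trans hr.
  apply: le_trans (base _ hr _) _; first by rewrite mul1r in hN.
  have u0 : 0 <= r * t by rewrite mulr_ge0// ltW.
  by apply: ler_wpM2r => //; apply: ler_wpM2r; [rewrite invr_ge0 sqr_ge0|rewrite ler_nat].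
have [r2|r2] := leP r (2 * H i).
  apply: le_trans (base _ hr r2) _.
  have u0 : 0 <= r * t by rewrite mulr_ge0// ltW.
  by apply: ler_wpM2r => //; apply: ler_wpM2r; [rewrite invr_ge0 sqr_ge0|rewrite ler_nat].
have hr2 : H i <= r / 2 by rewrite ler_pdivlMr// mulrC ltW.
have r20 : 0 < r / 2 by rewrite divr_gt0.
apply: (step_arith k0 kh r0 t0 (IH (r / 2) hr2 _)); first by rewrite ler_pdivrMr// mulrAC -exprSr.
apply: le_trans (avgb_cmp (r := r) (N := r ^- 2) hz (ltW r0) r20 r0 _ (fun _ => id) _ _) _.
- by apply: box_mono; rewrite ler_pdivrMr// ler_peMr ?(ltW r0)// ler1n.
- by rewrite mulrC divfK.
- by rewrite lef_pV2 ?posrE ?exprn_gt0 ?mulr_gt0//; apply: lerXn2r; rewrite ?nnegrE ?mulr_ge0 ?(ltW r0)//; rewrite ler_peMl ?(ltW r0)// ler1n.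
- apply: ler_wpM2l; last exact: ibx_le.
  by rewrite mulr_ge0 ?invr_ge0 ?sqr_ge0// mulr_ge0// ltW.
Qed.

Lemma chain3 (a b c d e1 e2 e3 : R) : `|a - b| <= e1 -> `|b - c| <= e2 -> `|c - d| <= e3 -> `|a - d| <= e1 + e2 + e3.
Proof.
move=> h1 h2 h3; have -> : a - d = (a - b) + (b - c) + (c - d) by ring.
by apply: le_trans (ler_normD _ _) (lerD _ h3); apply: le_trans (ler_normD _ _) (lerD h1 h2).
Qed.

Lemma good_good i m j m' r t : H i <= r -> H j <= r -> mm i <= t -> mm j <= t -> box (v i m) r (v j m') ->
  `|w (v i m) - w (v j m')| <= (3 * 64) / k ^+ 2 * (r * t).
Proof.
move=> hi hj ti tj hb; have r0 : 0 < r by apply: lt_le_trans hi; exact: (H_gt0 M).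
have r2 : H i <= 2 * r by rewrite mulr_natl mulr2n (le_trans hi)// lerDl ltW.
have := avgb_cmp (p1 := v i m) (p2 := v j m') (p := v i m) (r := 2 * r) (N := (2 * r) ^- 2) hz
  (mulr_ge0 (ler0n _ 2) (ltW r0)) r0 r0 _ _ (lexx _) (lexx _).
have s1 : box (v i m) r `<=` box (v i m) (2 * r) by apply: box_mono; rewrite mulr_natl mulr2n lerDl ltW.
have s2 : box (v j m') r `<=` box (v i m) (2 * r) by move=> x hx; rewrite mulr_natl mulr2n; exact: box_add hb hx.
move=> /(_ s1 s2) h2; have q0 : 0 <= (2 * r) ^- 2 * (2 * (2 * r)) by rewrite !mulr_ge0 ?invr_ge0 ?sqr_ge0 ?(ltW r0).
have := le_trans h2 (ler_wpM2l q0 (ibx_le m r2 ti)).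
have -> : (2 * r) ^- 2 * (2 * (2 * r)) * (16 * (2 * r) ^+ 2 * t) = 64 * (r * t) by field; rewrite gt_eqF.
have h1 := node_avg m hi ti; have h3 := node_avg m' hj tj; rewrite distrC in h3.
have rt : 0 <= r * t.
  rewrite mulr_ge0 ?(ltW r0)//; have : 0 <= 64 / k ^+ 2 * (r * t) by exact: le_trans h1.
  by rewrite pmulr_rge0 ?divr_gt0 ?exprn_gt0// pmulr_rge0.
have k1 : 64 * (r * t) <= 64 / k ^+ 2 * (r * t).
  apply: ler_wpM2r => //; rewrite ler_peMr// invf_ge1 ?exprn_gt0//.
  by rewrite expr_le1 ?(ltW k0)//; apply: le_trans (k_le M k0 i) _; rewrite ler_pdivrMr// mul1r ler1n.
move=> /le_trans/(_ k1) h4; apply: le_trans (chain3 h1 h4 h3) _.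
by apply: eqle; ring.
Qed.

(** A quarter box outside Om, where the function vanishes, replaces the second vertex; 17 is 1 for
    [node_avg] plus 16 for the smaller box. *)
Lemma good_bd i m y r t : H i <= r -> mm i <= t -> ~ Om y -> box (v i m) r y ->
  `|w (v i m)| <= (17 * 64) / k ^+ 2 * (r * t).
Proof.
move=> hi ti ny hb; have r0 : 0 < r by apply: lt_le_trans hi; exact: (H_gt0 M).
have r2 : H i <= 2 * r by rewrite mulr_natl mulr2n (le_trans hi)// lerDl ltW.
have [q qs qO] := corner_box cO ny r0; have r4 : 0 < r / 4 by rewrite divr_gt0.
have s1 : box (v i m) r `<=` box (v i m) (2 * r) by apply: box_mono; rewrite mulr_natl mulr2n lerDl ltW.
have s2 : box q (r / 4) `<=` box (v i m) (2 * r) by move=> x /qs hx; rewrite mulr_natl mulr2n; exact: box_add hb hx.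
have e4 : 2 * (r / 4) = r / 2 by field.
have le4 : (2 * r) ^- 2 <= (r / 2) ^- 2.
  rewrite lef_pV2 ?posrE ?exprn_gt0 ?mulr_gt0 ?invr_gt0//; apply: lerXn2r; rewrite ?nnegrE ?mulr_ge0 ?invr_ge0 ?(ltW r0)//.
  lra.
have := avgb_cmp (p := v i m) (r := 2 * r) (N := (r / 2) ^- 2) hz (mulr_ge0 (ler0n _ 2) (ltW r0)) r0 r4 s1 s2 le4.
rewrite e4 => /(_ (lexx _)).
have -> : avgb z q (r / 4) = 0.
  rewrite /avgb (_ : (fun x => _) = (fun=> 0)) ?itg0//; apply: funext => x.
  have [xb|nb] := pselect (box q (r / 4) x); last by rewrite /wbox ibox0// mulr0 mul0r.
  by have [_ _ /(_ _ (qO _ xb))[-> _] _] := hz; rewrite mulr0.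
rewrite subr0 => h2; have q0 : 0 <= (r / 2) ^- 2 * (2 * (2 * r)) by rewrite !mulr_ge0 ?invr_ge0 ?sqr_ge0 ?(ltW r0).
have := le_trans h2 (ler_wpM2l q0 (ibx_le m r2 ti)).
have -> : (r / 2) ^- 2 * (2 * (2 * r)) * (16 * (2 * r) ^+ 2 * t) = (16 * 64) * (r * t) by field; rewrite gt_eqF.
have h1 := node_avg m hi ti.
have rt : 0 <= r * t.
  rewrite mulr_ge0 ?(ltW r0)//; have : 0 <= 64 / k ^+ 2 * (r * t) by exact: le_trans h1.
  by rewrite pmulr_rge0 ?divr_gt0 ?exprn_gt0// pmulr_rge0.
have k1 : (16 * 64) * (r * t) <= (16 * 64) / k ^+ 2 * (r * t).
  apply: ler_wpM2r => //; rewrite ler_peMr// invf_ge1 ?exprn_gt0//.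
  by rewrite expr_le1 ?(ltW k0)//; apply: le_trans (k_le M k0 i) _; rewrite ler_pdivrMr// mul1r ler1n.
move=> /le_trans/(_ k1) h4; rewrite -(subrK (avgb z (v i m) r) (w _)).
apply: le_trans (ler_normD _ _) _; apply: le_trans (lerD h1 h4) _.
by apply: eqle; ring.
Qed.

Definition sepc : R := k * k ^+ cnt k.
Definition lipc : R := (17 * 64) / k ^+ 2 / sepc.

Lemma sepc_gt0 : 0 < sepc. Proof. by rewrite mulr_gt0// exprn_gt0. Qed.
Lemma lipc_gt0 : 0 < lipc. Proof. by rewrite divr_gt0 ?sepc_gt0// divr_gt0 ?exprn_gt0// mulr_gt0. Qed.

Lemma node_lip i m j m' t : mm i <= t -> mm j <= t \/ ~ Om (v j m') ->
  `|w (v i m) - w (v j m')| <= lipc * t * D1 (v i m) (v j m').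
Proof.
move=> ti tj; have [->|ne] := eqVneq (v i m) (v j m'); first by rewrite subrr normr0 D1_xx mulr0.
pose d := Num.max `|(v i m).1 - (v j m').1| `|(v i m).2 - (v j m').2|; pose r := d / sepc.
have d0 : 0 <= d by rewrite le_max normr_ge0.
have c0 := sepc_gt0; have r0 : 0 <= r by rewrite divr_ge0// ltW.
have bx : box (v i m) d (v j m') by split; rewrite distrC le_max lexx ?orbT.
have c1 : sepc <= 1.
  have k1 : k <= 1 by apply: le_trans (k_le M k0 i) _; rewrite ler_pdivrMr// mul1r ler1n.
  by rewrite /sepc -exprS exprn_ile1// ltW.
have bxr : box (v i m) r (v j m') by apply: box_mono bx; rewrite ler_pdivlMr// ler_piMr.
have hi : H i <= r by rewrite ler_pdivlMr// mulrC; exact: (separation M k0 (clos_cvx cO) ne bx).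
have ij : H j <= r.
  rewrite ler_pdivlMr// mulrC; apply: (separation M k0 (clos_cvx cO) (m := m') (m' := m) (j := i)); first by rewrite eq_sym.
  exact: box_sym.
have dD : d <= D1 (v i m) (v j m') by rewrite /D1 ge_max lerDl lerDr !normr_ge0.
have fin : `|w (v i m) - w (v j m')| <= (17 * 64) / k ^+ 2 * (r * t).
  case: tj => [tj|nO']; last by rewrite (aw nO') subr0; exact: good_bd bxr.
  have h1 := good_good hi ij ti tj bxr; apply: (le_trans h1).
  have rt : 0 <= r * t.
    have : 0 <= (3 * 64) / k ^+ 2 * (r * t) by exact: le_trans h1.
    by rewrite pmulr_rge0// divr_gt0 ?exprn_gt0// mulr_gt0.
  by apply: ler_wpM2r => //; apply: ler_wpM2r; [rewrite invr_ge0 sqr_ge0|apply: ler_wpM2r => //; rewrite ler_nat].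
have t0 : 0 <= t.
  apply: le_trans ti; have := mx_ge gsl_ge0 i.
  by move/(le_trans (gsl_ge0 i)); rewrite pmulr_rge0// divr_gt0// exprn_gt0.
apply: le_trans fin _; rewrite (_ : _ * (r * t) = lipc * t * d); last by rewrite /lipc /r; ring.
by apply: ler_wpM2l => //; rewrite mulr_ge0// ltW// lipc_gt0.
Qed.

Definition trK : R := 18 + 4 / k ^+ 2 + 2 * lipc / k.

Lemma trK_ge : [/\ 18 <= trK, 4 / k ^+ 2 <= trK & 2 * lipc / k <= trK].
Proof.
have a : 0 <= 4 / k ^+ 2 by rewrite divr_ge0// sqr_ge0.
have b : 0 <= 2 * lipc / k by apply: divr_ge0; [apply: mulr_ge0 => //; exact: ltW lipc_gt0|exact: ltW].
by rewrite /trK; move: (4 / _) (2 * _ / _) a b => p q a b; split; lra.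
Qed.

(** The nodal values are kept on triangles with [mm i <= t] and at vertices outside Om, where they
    vanish, and extended by [mcshane]. The truncation is the finite element function of the
    extension: conformity and the boundary condition persist, and regularity of the triangles bounds
    its slopes. *)
Lemma truncation : [/\ forall i, gsl i <= trK * mm i,
  forall t, 0 < t -> t * \sum_i mu i * (t < mm i)%R%:R <= trK * \sum_i mu i * gsl i * (t < 2 * gsl i)%R%:R &
  forall t, 0 < t -> exists2 f, adm f & forall i (a : 'I_2),
    (mm i <= t -> slo a (itq f i) = slo a (itq w i)) /\ `|slo a (itq f i)| <= trK * t].
Proof.
have [K1 K2 K3] := trK_ge; split=> [i|t t0|t t0].
- apply: le_trans (mx_ge gsl_ge0 i) _; apply: ler_wpM2r => //.
  have := mx_ge gsl_ge0 i.
  by move/(le_trans (gsl_ge0 i)); rewrite pmulr_rge0// divr_gt0// exprn_gt0.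
- apply: le_trans (mx_weak gsl_ge0 t0) _; apply: ler_wpM2r => //.
  apply: sumr_ge0 => i _; rewrite mulr_ge0// mulr_ge0 ?gsl_ge0// ltW//.
  exact: mu_gt0.
pose S := [seq v o.1 o.2 | o <- enum {: 'I_n * 'I_3} & (mm o.1 <= t) || ~~ `[< Om (v o.1 o.2) >]].
have SP x : x \in S -> exists i m, x = v i m /\ (mm i <= t \/ ~ Om (v i m)).
  move=> /mapP[[i m]]; rewrite mem_filter => /andP[/orP[a|/asboolP a] _] ->; exists i, m; split=> //; [left|right] => //.
have inS i m : mm i <= t \/ ~ Om (v i m) -> v i m \in S.
  move=> a; apply/mapP; exists (i, m) => //; rewrite mem_filter mem_enum andbT.
  by apply/orP; case: a => [->|a]; [left|right; apply/asboolP].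
have L0 : 0 <= lipc * t by rewrite mulr_ge0 ?(ltW t0)// ltW// lipc_gt0.
have [x y|f [fS flip]] := @mcshane S w (lipc * t) L0.
  move=> /SP[i [m [-> a]]] /SP[j [m' [-> b]]]; rewrite -lerBlDl; apply: le_trans (ler_norm _) _.
  case: a => [a|a]; first exact: node_lip.
  case: b => [b|b]; first by rewrite distrC D1C; apply: node_lip => //; right.
  by rewrite (aw a) (aw b) subrr normr0 mulr_ge0// D1_ge0.
exists f => [i m nO'|i a]; first by rewrite fS ?(aw nO')//; apply: inS; right.
split=> [ti|].
  have e m : f (v i m) = w (v i m) by rewrite fS//; apply: inS; left.
  by rewrite /slo /itq; case: (a == 0) => /=; apply: eq_bigr => m _; rewrite e.
have H0 := H_gt0 M i; pose q := itq f i.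
have [|s1 s2] := grad_bd M k0 (i := i) (q := (q.1.1 - f (v i 0), q.1.2, q.2)) (D := 2 * (lipc * t) * H i).
  move=> m; have -> : ev (q.1.1 - f (v i 0), q.1.2, q.2) (v i m) = f (v i m) - f (v i 0).
    rewrite -[f (v i m)](itp_v (m_tri M i)) -itq_ev /ev/=; ring.
  rewrite (_ : 2 * (lipc * t) * H i = lipc * t * (2 * H i)); last by ring.
  apply: (le_trans (flip _ _)); apply: ler_wpM2l => //.
  have [d1 d2] := m_out M (tri_vin (m_tri M i) 0) (tri_vin (m_tri M i) m).
  by rewrite mulr_natl mulr2n; exact: lerD.
have -> : trK * t = t * trK by rewrite mulrC.
have E : 2 * (lipc * t) * H i / (k * H i) = t * (2 * lipc / k) by field; rewrite !gt_eqF.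
rewrite E in s1 s2; rewrite /slo; apply: le_trans (_ : _ <= t * (2 * lipc / k)) _; last by apply: ler_wpM2l => //; exact: ltW.
by case: (a == 0).
Qed.

End MeshTruncation.

(** * Galerkin problems, duality and Cea's lemma *)

Section DiscreteProblem.

Variables (a : 'I_2 -> 'I_2 -> P -> R) (c K : R).
Hypotheses (c0 : 0 < c) (ca : coef a c K).
Implicit Types b : 'I_2.

Lemma itq_lin s w w' i : itq (fun x => s * w x + w' x) i =
  (s * (itq w i).1.1 + (itq w' i).1.1, s * (itq w i).1.2 + (itq w' i).1.2, s * (itq w i).2 + (itq w' i).2).
Proof. by rewrite /itq/= !sum3; congr (_, _, _); ring. Qed.

Lemma Gr_lin s w w' b x : Gr (fun y => s * w y + w' y) b x = s * Gr w b x + Gr w' b x.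
Proof.
rewrite /Gr (pc_map2 (F := fun p q => s * p + q)) ?mulr0 ?addr0//; congr pc; apply: funext => i.
by rewrite itq_lin /slo; case: (b == 0).
Qed.

Lemma fe_lin s w w' x : fe (fun y => s * w y + w' y) x = s * fe w x + fe w' x.
Proof.
have [[i xi]|no] := pselect (exists i, T i x).
  by rewrite !(feE _ xi) itq_lin /ev/=; ring.
have no' : ~ closure Om x by move=> /(m_cov M).
by rewrite !(fe_out)// mulr0 addr0.
Qed.

Definition nodal w w' := forall i m, w (v i m) = w' (v i m).

Lemma itq_nodal w w' i : nodal w w' -> itq w i = itq w' i.
Proof. by move=> e; rewrite /itq; congr (_, _, _); apply: eq_bigr => m _; rewrite e. Qed.

Lemma Gr_nodal w w' : nodal w w' -> Gr w = Gr w'.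
Proof.
by move=> e; apply: funext => b; congr pc; apply: funext => i; rewrite (itq_nodal _ e).
Qed.

Lemma fe_nodal w w' : nodal w w' -> fe w = fe w'.
Proof.
move=> e; apply: funext => x; have [[i xi]|no] := pselect (exists i, T i x).
  by rewrite !(feE _ xi) (itq_nodal _ e).
by rewrite !(fe_out)// => /(m_cov M).
Qed.

Lemma Gr_L2 w : L2g (Gr w).
Proof. by move=> b; exact: pc_L2. Qed.

Lemma adm_lin s w w' : adm w -> adm w' -> adm (fun x => s * w x + w' x).
Proof. by move=> h1 h2 i m nO'; rewrite h1// h2// mulr0 addr0. Qed.

(** Ellipticity makes all slopes vanish, so the function is Lipschitz with constant 0, and it
    vanishes at a point outside the bounding box. *)
Lemma adm_zero w : adm w -> bil a (Gr w) (Gr w) <= 0 -> forall x, fe w x = 0.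
Proof.
move=> aw hb; have := le_trans (bil_coer ca (Gr_L2 w)) hb; rewrite pmulr_rle0// sum2.
have S b : n2p (Gr w b) ^+ 2 = \sum_i slo b (itq w i) ^+ 2 * mu i by exact: pc_n2.
have sl0 b : n2p (Gr w b) ^+ 2 <= 0 -> forall i, slo b (itq w i) = 0.
  rewrite S => le i; have t0 j : 0 <= slo b (itq w j) ^+ 2 * mu j.
    by rewrite mulr_ge0 ?sqr_ge0// ltW// (mu_gt0).
  have : slo b (itq w i) ^+ 2 * mu i <= 0.
    by apply: le_trans le; rewrite (bigD1 i)//= lerDl sumr_ge0.
  rewrite pmulr_lle0 ?mu_gt0// => le0.
  by apply/eqP; rewrite -sqrf_eq0 eq_le le0 sqr_ge0.
move=> le; have z b i : slo b (itq w i) = 0.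
  apply: sl0; apply: le_trans le; case: (ord2P b) => ->; [rewrite lerDl|rewrite lerDr]; exact: sqr_ge0.
have wl : wlip w = 0 by apply: big1 => i _; rewrite !z normr0 addr0.
have nOp : ~ Om ((`|B| + 1)%R, 0) by move=> /OB[/= + _]; rewrite subr0 => /(le_trans (ler_norm _)); have := ler_norm B; lra.
move=> x; have := fe_lip x ((`|B| + 1)%R, 0) aw.
by rewrite wl mul0r (fe_bd aw nOp) subr0 normr_le0 => /eqP.
Qed.

(** The right-hand side is any linear functional of the nodal values, which covers the given data as
    well as the dual problem driven by slopes. *)
Lemma discrete_solve (F : (P -> R) -> R) : ltr F -> (forall w w', nodal w w' -> F w = F w') ->
  exists2 w, adm w & forall w', adm w' -> bil a (Gr w) (Gr w') = F w'.
Proof.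
move=> lF nF; pose S := undup [seq v o.1 o.2 | o <- enum {: 'I_n * 'I_3} & `[< Om (v o.1 o.2) >]].
have SP x : x \in S -> Om x /\ exists i m, x = v i m.
  rewrite mem_undup => /mapP[[i m]]; rewrite mem_filter => /andP[/asboolP/= Ov _] ->.
  by split=> //; exists i, m.
have inS i m : Om (v i m) -> v i m \in S.
  move=> Ov; rewrite mem_undup; apply/mapP; exists (i, m) => //.
  by rewrite mem_filter mem_enum andbT; apply/asboolP.
pose N := size S; pose nd (s : 'I_N) : P := nth 0 S s.
have ndS (s : 'I_N) : nd s \in S by exact: mem_nth.
(* Only nodal values count, so the indicator of a node stands for its hat function. *)
pose hat (s : 'I_N) : P -> R := fun x => (x == nd s)%:R.
have hat_adm (s : 'I_N) : adm (hat s).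
  by move=> i m nO'; rewrite /hat; case: eqP => // e; case: nO'; rewrite e; have [] := SP _ (ndS s).
pose comb (d : 'I_N -> R) : P -> R := fun x => \sum_s d s * hat s x.
have comb_nd d (s : 'I_N) : comb d (nd s) = d s.
  rewrite /comb (bigD1 s)//= big1 ?addr0 => [|s' ne]; first by rewrite /hat eqxx mulr1.
  rewrite /hat; case: eqP => [/eqP e|_]; last by rewrite mulr0.
  by move: e ne; rewrite /nd (nth_uniq 0 (ltn_ord s) (ltn_ord s') (undup_uniq _)) eq_sym val_eqE => ->.
have comb_adm d : adm (comb d).
  by move=> i m nO'; apply: big1 => s _; rewrite hat_adm// mulr0.
have comb_all w : adm w -> nodal w (comb (w \o nd)).
  move=> aw i m; have [/inS vS|nO'] := pselect (Om (v i m)); last by rewrite aw// comb_adm.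
  have lt : (index (v i m) S < N)%N by rewrite index_mem.
  by have := comb_nd (w \o nd) (Ordinal lt); rewrite /nd/= nth_index.
have l1 G : L2g G -> ltr (fun w => bil a (Gr w) G).
  move=> hG s w w'; rewrite -(bil_lin1 s ca (Gr_L2 w) (Gr_L2 w') hG); congr (bil _ _ _).
  by apply: funext => b; apply: funext => x; exact: Gr_lin.
have l2 G : L2g G -> ltr (fun w => bil a G (Gr w)).
  move=> hG s w w'; rewrite -(bil_lin2 s ca hG (Gr_L2 w) (Gr_L2 w')); congr (bil _ _ _).
  by apply: funext => b; apply: funext => x; exact: Gr_lin.
have [d0|d hd] := @fin_solve _ N (fun s t : 'I_N => bil a (Gr (hat s)) (Gr (hat t))) (fun t : 'I_N => F (hat t)).
  move=> hd s; have e (t : 'I_N) : bil a (Gr (comb d0)) (Gr (hat t)) = 0.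
    by rewrite (ltr_sum _ d0 hat (l1 _ (Gr_L2 (hat t)))); exact: hd.
  have z := @adm_zero (comb d0) (comb_adm d0); rewrite -(comb_nd d0).
  have [_ [i [m ->]]] := SP _ (ndS s); rewrite -(fe_v (comb d0)); apply: z.
  by rewrite (ltr_sum _ d0 hat (l2 _ (Gr_L2 (comb d0)))) big1// => t _; rewrite e mulr0.
exists (comb d) => // w' aw'; rewrite (nF _ _ (comb_all _ aw')) (Gr_nodal (comb_all _ aw')).
rewrite (ltr_sum _ _ hat lF) (ltr_sum _ _ hat (l2 _ (Gr_L2 (comb d)))); apply: eq_bigr => t _.
by rewrite -hd (ltr_sum _ d hat (l1 _ (Gr_L2 (hat t)))).
Qed.

Let K0 : 0 <= K := coef_ge0 ca.
Let mu0 i : 0 <= mu i. Proof. by apply: ltW; exact: mu_gt0. Qed.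

Lemma gsl_sqr w i : gsl w i ^+ 2 <= 2 * \sum_b slo b (itq w i) ^+ 2.
Proof.
rewrite sum2 /gsl -[slo 0 _ ^+ 2]real_normK ?num_real// -[slo 1 _ ^+ 2]real_normK ?num_real//.
set p := `|slo 0 _|; set q := `|slo 1 _|; rewrite -subr_ge0 (_ : _ - _ = (p - q) ^+ 2) ?sqr_ge0//; ring.
Qed.

Lemma bil_pc (e : 'I_n -> R) w w' :
  (forall i x, Op i x -> e i <= \sum_b \sum_b' a b b' x * slo b' (itq w i) * slo b (itq w' i)) ->
  \sum_i e i * mu i <= bil a (Gr w) (Gr w').
Proof.
move=> he; have [ie <-] := pc_itg e.
have L2w w1 b : L2p (Gr w1 b) by exact: pc_L2.
have i1 b b' := coef_itb b b' ca (L2w w b') (L2w w' b).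
have iS b : itbp (fun x => \sum_b' a b b' x * Gr w b' x * Gr w' b x) by exact: itb_sum.
have -> : bil a (Gr w) (Gr w') = itgp (fun x => \sum_b \sum_b' a b b' x * Gr w b' x * Gr w' b x).
  by rewrite itg_sum//; apply: eq_bigr => b _; rewrite itg_sum.
apply: itg_le => //; first exact: itb_sum.
move=> x; have [[i xi]|no] := pselect (exists i, Op i x); last first.
  rewrite pc0; last by move=> i xi; apply: no; exists i.
  have z0 w1 b : Gr w1 b x = 0 by rewrite /Gr pc0// => i xi; apply: no; exists i.
  by rewrite big1// => b _; rewrite big1// => b' _; rewrite (z0 w') mulr0.
rewrite (pcE _ xi); apply: le_trans (he i x xi) _; apply: eqle.
by apply: eq_bigr => b _; apply: eq_bigr => b' _; rewrite /Gr !(pcE _ xi).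
Qed.

Section Dual.
Variables (Psi : 'I_2 -> 'I_n -> R) (psi : 'I_n -> R).
Hypothesis hPsi : forall b i, `|Psi b i| <= psi i.
Let psi0 i : 0 <= psi i. Proof. exact: le_trans (hPsi 0 i). Qed.
Definition pairg w : R := \sum_i mu i * \sum_b Psi b i * slo b (itq w i).

Definition lewK : R := 2 * trK * (K + 1).

Lemma trK_ge18 : 18 <= trK.
Proof. by have [] := trK_ge. Qed.

Lemma lewK_ge : [/\ 1 <= lewK, trK <= lewK, 2 * trK <= lewK & K * (2 * trK) <= lewK].
Proof.
have t1 := trK_ge18; have : 0 <= trK * K by rewrite mulr_ge0//; apply: le_trans t1.
by rewrite /lewK mulrDr mulr1; move: (trK) t1 => t t1; split; lra.
Qed.

(** The adjoint problem is tested with the truncation of its own solution z. Where the maximal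
    function is at most t the slopes are those of z and give the energy; elsewhere they are at most
    [trK * t]. The constant is c / 2 because [gsl] is the sum of two absolute slopes. *)
Lemma dual_truncation (z : P -> R) : adm z -> (forall w, adm w -> bil a (Gr w) (Gr z) = pairg w) ->
  forall t, 0 < t -> c / 2 * \sum_i mu i * gsl z i ^+ 2 * (mx (gsl z) i <= t)%R%:R <=
    \sum_i mu i * (psi i * gsl z i) * (mx (gsl z) i <= t)%R%:R +
    lewK * (t * \sum_i mu i * (gsl z i + psi i) * (t < mx (gsl z) i)%R%:R).
Proof.
move=> az hz t t0; have [_ _ /(_ t t0)[f af hf]] := truncation az.
set mm := mx (gsl z) in hf *; have g0 i : 0 <= gsl z i by exact: gsl_ge0.
have [l1 l2 l3 l4] := lewK_ge; have tK : 0 <= trK by apply: le_trans trK_ge18.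
pose e i : R := c / 2 * gsl z i ^+ 2 * (mm i <= t)%R%:R - lewK * t * gsl z i * (t < mm i)%R%:R.
have lo : \sum_i e i * mu i <= bil a (Gr f) (Gr z).
  apply: bil_pc => i x xi; rewrite /e; have [mt|mt] := leP (mm i) t.
    rewrite mulr1 mulr0 subr0; have s b : slo b (itq f i) = slo b (itq z i) by have [->] := hf i b.
    under eq_bigr do under eq_bigr do rewrite s.
    apply: le_trans (cf_e ca x (fun b => slo b (itq z i))).
    by rewrite -mulrA ler_pM2l// mulrC ler_pdivrMr// mulrC; exact: gsl_sqr.
  rewrite mulr0 mulr1 sub0r lerNl -sumrN; under eq_bigr do rewrite -sumrN.
  apply: (@le_trans _ _ (\sum_b \sum_(b' < 2) K * (trK * t) * `|slo b (itq z i)|)).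
    apply: ler_sum => b _; apply: ler_sum => b' _; apply: le_trans (ler_norm _) _; rewrite normrN !normrM.
    apply: ler_wpM2r => //; apply: ler_pM => //; first exact: (cf_b ca).
    by have [] := hf i b'.
  rewrite !sum2 (_ : _ + _ = K * (2 * trK) * (t * gsl z i)); last by rewrite /gsl; ring.
  by rewrite -[leRHS]mulrA; apply: ler_wpM2r => //; rewrite mulr_ge0// ltW.
have up : pairg f <= \sum_i mu i * (psi i * gsl z i) * (mm i <= t)%R%:R + lewK * t * \sum_i mu i * psi i * (t < mm i)%R%:R.
  rewrite mulr_sumr -big_split/=; apply: ler_sum => i _; have [mt|mt] := leP (mm i) t.
    rewrite mulr1 !mulr0 addr0; apply: ler_wpM2l => //.
    have bb b : Psi b i * slo b (itq f i) <= psi i * `|slo b (itq z i)|.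
      by have [-> // _] := hf i b; apply: le_trans (ler_norm _) _; rewrite normrM; exact: ler_wpM2r.
    by rewrite sum2 /gsl mulrDr; exact: lerD.
  rewrite mulr0 add0r mulr1 mulrCA; apply: ler_wpM2l => //.
  apply: le_trans (_ : _ <= 2 * trK * (t * psi i)) _; last by rewrite -[leRHS]mulrA; apply: ler_wpM2r => //; rewrite mulr_ge0// ltW.
  rewrite sum2 (_ : 2 * _ * _ = psi i * (trK * t) + psi i * (trK * t)); last by ring.
  have bb b : Psi b i * slo b (itq f i) <= psi i * (trK * t).
    by apply: le_trans (ler_norm _) _; rewrite normrM; apply: ler_pM => //; have [] := hf i b.
  exact: lerD.
rewrite (hz _ af) in lo; have := le_trans lo up.
have -> : \sum_i e i * mu i = c / 2 * \sum_i mu i * gsl z i ^+ 2 * (mm i <= t)%R%:R - lewK * t * \sum_i mu i * gsl z i * (t < mm i)%R%:R.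
  by rewrite !mulr_sumr -sumrB; apply: eq_bigr => i _; rewrite /e; ring.
have -> : \sum_i mu i * (gsl z i + psi i) * (t < mm i)%R%:R = \sum_i mu i * gsl z i * (t < mm i)%R%:R + \sum_i mu i * psi i * (t < mm i)%R%:R.
  by rewrite -big_split/=; apply: eq_bigr => i _; ring.
by rewrite lerBlDr => h1; apply: le_trans h1 _; apply: eqle; ring.
Qed.

End Dual.

Hypothesis B0 : 0 <= B.

Lemma adm_test w : test_function Om w -> adm w.
Proof. by move=> /H10_test[_ _ z _] i m /z[]. Qed.

(** On a triangle the first Taylor polynomial of w at x is subtracted; the nodal values of the
    remainder are at most 2 C H^2, and [grad_bd] divides by k H. *)
Lemma interp_err w C b : test_function Om w -> 0 <= C -> taylor2 w (partial 0 w) (partial 1 w) C ->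
  n2p (fun x => Gr w b x - partial b w x) <= 2 * C / k * h * (2 * B).
Proof.
move=> tw C0 tay; have L2w := test_L2 (test_partial b tw).
have L2G : L2p (Gr w b) by exact: pc_L2.
have [_ _ wz _] := H10_test tw.
have h0 : 0 <= h by have [y Oy] := nO; have /(m_cov M)[i _] := subset_closure Oy; have /andP[/ltW + ] := m_H M i; exact: le_trans.
have e0 : 0 <= 2 * C / k * h by rewrite !mulr_ge0// invr_ge0 ltW.
have tri i x : Op i x -> `|Gr w b x - partial b w x| <= 2 * C / k * h.
  move=> xi; rewrite /Gr (pcE _ xi); have xT := Op_T xi; pose q := itq w i.
  have [H0 Hh] := andP (m_H M i); have tT := m_tri M i.
  have [|s1 s2] := grad_bd M k0 (i := i) (D := 2 * C * H i ^+ 2)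
    (q := (q.1.1 - (w x - partial 0 w x * x.1 - partial 1 w x * x.2), q.1.2 - partial 0 w x, q.2 - partial 1 w x)).
    move=> m; have [d1 d2] := m_out M xT (tri_vin tT m).
    have eq : ev q (v i m) = w (v i m) by rewrite itq_ev (itp_v tT).
    rewrite /ev/= in eq *; rewrite (_ : _ + _ = w (v i m) - w x - (partial 0 w x * ((v i m).1 - x.1) + partial 1 w x * ((v i m).2 - x.2))).
      apply: le_trans (tay _ _) _; rewrite (_ : 2 * C * H i ^+ 2 = C * (H i ^+ 2 + H i ^+ 2)); last by ring.
      apply: ler_wpM2l => //; apply: lerD; rewrite -[_ ^+ 2]real_normK ?num_real//;
        by apply: lerXn2r; rewrite ?nnegrE ?(ltW H0).
    by rewrite -eq; move: (w x) (partial 0 w x) (partial 1 w x) (v i m) => p p1 p2 y; ring.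
  have E : 2 * C * H i ^+ 2 / (k * H i) <= 2 * C / k * h.
    rewrite (_ : _ / _ = 2 * C / k * H i); last by field; rewrite !gt_eqF.
    by apply: ler_wpM2l => //; rewrite !mulr_ge0// invr_ge0 ltW.
  by case: (ord2P b) => ->; [apply: le_trans s1 E|apply: le_trans s2 E].
have [ib ibE] := itg_ibox 0 B0; have dif := L2B L2G L2w.
apply: n2_le; first by rewrite !mulr_ge0 ?invr_ge0 ?(ltW k0).
have -> : (2 * C / k * h * (2 * B)) ^+ 2 = itgp (fun x => (2 * C / k * h) ^+ 2 * ibox 0 B x) by rewrite itgZ// ibE exprMn.
apply: itg_le_ae; [by case: dif|exact: itbZ|].
apply: filterS (ae_mesh) => x [[i xi]|nx].
  rewrite ibox1 ?mulr1; last by apply: OB; exact: (Op_Om xi).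
  by rewrite -[_ ^+ 2]real_normK ?num_real//; apply: lerXn2r; rewrite ?nnegrE//; exact: tri xi.
have nx' : ~ Om x by move/subset_closure.
rewrite (wz x nx').2 subr0 /Gr (pc_out)// expr0n/=.
by rewrite mulr_ge0 ?sqr_ge0//; have /andP[] := ibox_ge0 0 B x.
Qed.

(** The error is orthogonal to admissible functions, so one argument of the form may be changed from
    the Galerkin error to the error of w'. The factor 2 comes from working with the sum of the two
    norms. *)
Lemma cea f u G w w' : L2p f -> H10 Om u G -> weq Om a f G -> adm w -> adm w' ->
  (forall w', adm w' -> bil a (Gr w) (Gr w') = - itgp (fun x => f x * fe w' x)) ->
  n2p (fun x => Gr w 0 x - G 0 x) + n2p (fun x => Gr w 1 x - G 1 x) <=
  2 * K / c * (n2p (fun x => Gr w' 0 x - G 0 x) + n2p (fun x => Gr w' 1 x - G 1 x)).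
Proof.
move=> f2 [_ G2 _ _] hw aw aw' hd; have L2G w1 : L2g (Gr w1) := Gr_L2 w1.
pose E b x := -1 * G b x + Gr w b x; pose D b x := -1 * G b x + Gr w' b x.
have EE w1 b : n2p (fun x => Gr w1 b x - G b x) = n2p (fun x => -1 * G b x + Gr w1 b x).
  by congr n2; apply: funext => x; ring.
have LE w1 : L2g (fun b x => -1 * G b x + Gr w1 b x) by move=> b; apply: L2D; [exact: L2Z|exact: L2G].
have E2 : L2g E := LE w; have D2 : L2g D := LE w'.
rewrite !EE -/(E 0) -/(E 1) -/(D 0) -/(D 1).
have orth w1 : adm w1 -> bil a E (Gr w1) = 0.
  move=> a1; rewrite (bil_lin1 (-1) ca G2 (L2G w) (L2G w1)) hd//.
  by rewrite (weq_H10 ca f2 G2 hw (fe_H10 a1)) mulN1r opprK subrr.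
have a2 : adm (fun x => -1 * w' x + w x) by exact: adm_lin.
have ED : E = fun b x => 1 * D b x + Gr (fun x => -1 * w' x + w x) b x.
  by apply: funext => b; apply: funext => x; rewrite (Gr_lin) /E /D; ring.
have EB : bil a E E = bil a E D.
  by rewrite {2}ED (bil_lin2 1 ca E2 D2 (L2G _)) orth// addr0 mul1r.
have := bil_coer ca E2; rewrite EB sum2 => h1.
have h2 := le_trans h1 (le_trans (ler_norm _) (bil_bd ca E2 D2)).
(* The same arithmetic as in the energy estimate, with K in the role of B. *)
apply: (energy_arith (coef_ge0 ca) c0 _ (n2_ge0 _ _) (n2_ge0 _ _)); last by rewrite addr_ge0 ?n2_ge0.
by apply: le_trans h2 _; apply: eqle; ring.
Qed.

End DiscreteProblem.

End MeshFunctions.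

(** * The discrete Meyers estimate *)

Section Meyers.
Implicit Types (b : 'I_2) (p q d : R).

Lemma powR_split q s (g : R) : 1 <= q -> 0 < s -> 0 <= g -> g <= s + s `^ (1 - q) * g `^ q.
Proof.
move=> q1 s0 g0; have [gs|sg] := leP g s; first by apply: le_trans gs _; rewrite lerDl mulr_ge0 ?powR_ge0.
have gp : 0 < g by exact: lt_trans sg.
have e : g `^ (1 - q) * g `^ q = g by rewrite -powRD ?(gt_eqF gp) ?implybT// subrK powRr1.
rewrite -[leLHS]e; apply: le_trans (_ : _ <= s `^ (1 - q) * g `^ q) _; last by rewrite lerDr ltW.
apply: ler_wpM2r; first exact: powR_ge0.
rewrite -opprB !powRN lef_pV2 ?posrE ?powR_gt0//.
by apply: ge0_ler_powR; rewrite ?nnegrE ?subr_ge0 ?(ltW s0) ?(ltW gp) ?(ltW sg).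
Qed.

(** X <= N Ga / 2, and Ga is split at height s. With s^(1-d) = N C the coefficient of Q becomes 1 /
    (N C), so that half of X is absorbed; the remaining power of N is (2-d)/(1-d). *)
Lemma meyers_arith d C V N X Ga Q : 0 < d <= 1 / 4 -> 0 < C -> 0 <= V -> 0 <= N -> 0 <= X -> X <= N * (Ga / 2) -> Q <= C * X ->
  (forall s, 0 < s -> Ga <= s * V + s `^ (1 - (2 - d)) * Q) ->
  X <= C `^ ((1 - d)^-1) * V * N `^ ((2 - d) / (1 - d)).
Proof.
move=> /andP[d0 d4] C0 V0 N0 X0 h1 h2 h3; have d1 : 0 < 1 - d by lra.
have dn : 1 - d != 0 by rewrite gt_eqF.
have [N1|Np] := leP N 0.
  have -> : N = 0 by apply/eqP; rewrite eq_le N1.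
  rewrite powR0 ?mulr0; last by rewrite mulf_neq0 ?invr_neq0// gt_eqF//; lra.
  by apply: le_trans h1 _; rewrite (_ : N = 0) ?mul0r//; apply/eqP; rewrite eq_le N1.
have NC : 0 < N * C by rewrite mulr_gt0.
pose s := (N * C) `^ ((1 - d)^-1); have s0 : 0 < s by rewrite powR_gt0.
have es : s `^ (1 - (2 - d)) = (N * C)^-1.
  rewrite (_ : 1 - (2 - d) = - (1 - d)); last by ring.
  by rewrite powRN /s -powRrM mulVf// powRr1// ltW.
have := h3 s s0; rewrite es => h4.
have h5 : (N * C)^-1 * Q <= N^-1 * X.
  by rewrite invfM -mulrA; apply: ler_wpM2l; rewrite ?invr_ge0// ler_pdivrMl.
have h6 : N * (Ga / 2) <= N * ((s * V + N^-1 * X) / 2).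
  by apply: ler_wpM2l => //; apply: ler_wpM2r; [rewrite invr_ge0|apply: le_trans h4 _; rewrite lerD2l].
have e6 : N * ((s * V + N^-1 * X) / 2) = N * s * V / 2 + X / 2 by field; rewrite gt_eqF.
have h7 : X <= N * s * V by move: (le_trans h1 h6); rewrite e6; move: (_ * V) => t; lra.
apply: le_trans h7 _; apply: eqle; rewrite /s powRM ?ltW//.
rewrite (_ : (2 - d) / (1 - d) = 1 + (1 - d)^-1); last by field.
by rewrite powRD ?(gt_eqF Np) ?implybT// powRr1//; ring.
Qed.

(** The exponent p = (2-d)/(1-d) is conjugate to 2 - d. The adjoint problem with density th^(p-1)
    times the signs of the slopes of w has a solution z for which the sum X of mu th^p equals - int
    f z. [lewis] bounds the slopes of z in exponent 2 - d by X, and [gag_L1] bounds |z|_2 by their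
    sum. *)
Lemma meyers k c K B : 0 < k -> 0 < c -> 0 <= K -> exists p C, [/\ 2 < p, 0 < C &
  forall (Om : set P) n (T : 'I_n -> set P) (v : 'I_n -> 'I_3 -> P) (l : 'I_n -> 'I_3 -> R * R * R) (H : 'I_n -> R) h a (f w : P -> R),
  mesh Om T v l H k h -> open Om -> is_convex Om -> Om !=set0 -> Om `<=` box 0 B -> coef a c K -> L2p f ->
  adm Om v w -> (forall w', adm Om v w' -> bil a (Gr v l w) (Gr v l w') = - itgp (fun x => f x * fe T v l w' x)) ->
  \sum_i mu l i * gsl v l w i `^ p <= C * n2p f `^ p].
Proof.
move=> k0 c0 K0; have c20 : 0 < c / 2 by rewrite divr_gt0.
have [lK _ _ _] : [/\ 1 <= lewK k K, trK k <= lewK k K, 2 * trK k <= lewK k K & K * (2 * trK k) <= lewK k K].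
  have t1 := trK_ge18 k0; have : 0 <= trK k * K by rewrite mulr_ge0//; apply: le_trans t1.
  by rewrite /lewK mulrDr mulr1; move: (trK k) t1 => t t1; split; lra.
have [d [C [dd C0 HL]]] := lewis c20 lK; have /andP[d0 d4] := dd.
have d1 : 0 < 1 - d by lra.
pose p := (2 - d) / (1 - d); have p2 : 2 < p by rewrite ltr_pdivlMr//; lra.
have p1 : p - 1 = (1 - d)^-1 by rewrite /p; field; rewrite gt_eqF.
have p0 : 0 < p by exact: lt_trans p2.
have V0 : 0 <= C `^ ((1 - d)^-1) * (2 * `|B|) ^+ 2 by rewrite mulr_ge0 ?powR_ge0// sqr_ge0.
exists p, (C `^ ((1 - d)^-1) * (2 * `|B|) ^+ 2 + 1); split=> //; first by rewrite ltr_wpDl.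
move=> Om n T v l H h a f w M oO cO nO OB ca f2 aw hw.
have mu0 i : 0 <= mu l i by apply: ltW; exact: (mu_gt0 M k0 oO cO nO OB).
have OB' : Om `<=` box 0 `|B|.
  by move=> x /OB[h1 h2]; split; [apply: le_trans h1 _|apply: le_trans h2 _]; exact: ler_norm.
pose th i := gsl v l w i; have th0 i : 0 <= th i by exact: gsl_ge0.
pose psi i := th i `^ (p - 1); pose Psi (b : 'I_2) i := psi i * Num.sg (slo b (itq v l w i)).
have hPsi b i : `|Psi b i| <= psi i.
  by rewrite normrM (ger0_norm (powR_ge0 _ _)) normr_sg ler_piMr ?powR_ge0//; case: (_ != 0).
have lin : ltr (pairg v l Psi).
  move=> s w1 w2; rewrite /pairg mulr_sumr -big_split/=; apply: eq_bigr => i _.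
  by rewrite !sum2 !(itq_lin v l s w1 w2) /slo/=; ring.
have nod w1 w2 : nodal v w1 w2 -> pairg v l Psi w1 = pairg v l Psi w2.
  by move=> e; apply: eq_bigr => i _; rewrite !sum2 !(itq_nodal l i e).
have [z az hz] := discrete_solve M k0 oO cO nO OB c0 (coef_tr ca) lin nod.
have hz' w' : adm Om v w' -> bil a (Gr v l w') (Gr v l z) = pairg v l Psi w'.
  by move=> aw'; rewrite -(hz _ aw') bil_tr.
have [t1 t2 _] := truncation M k0 oO cO nO OB az; have [_ lt _ _] := lewK_ge k0 ca.
have mm0 i : 0 <= mx v l H (gsl v l z) i.
  by have := le_trans (gsl_ge0 v l z i) (t1 i); rewrite pmulr_rge0//; apply: lt_le_trans (trK_ge18 k0).
have S0 t : 0 <= \sum_i mu l i * gsl v l z i * (t < 2 * gsl v l z i)%R%:R.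
  by apply: sumr_ge0 => i _; rewrite mulr_ge0// mulr_ge0 ?gsl_ge0.
have H3 t (tp : 0 < t) := le_trans (t2 t tp) (ler_wpM2r (S0 t) lt).
have Q := HL n (mu l) (gsl v l z) psi (mx v l H (gsl v l z)) mu0 (gsl_ge0 v l z) (fun i => powR_ge0 _ _)
  (fun i => le_trans (t1 i) (ler_wpM2r (mm0 i) lt)) (dual_truncation M k0 oO cO nO OB c0 ca hPsi az hz')
  H3.
have eX : \sum_i mu l i * psi i `^ (2 - d) = \sum_i mu l i * th i `^ p.
  (* Conjugacy of the exponents makes the right-hand side in [lewis] the same sum X. *)
  have pq : (p - 1) * (2 - d) = p by rewrite p1 mulrC.
  by apply: eq_bigr => i _; rewrite /psi -powRrM pq.
rewrite eX in Q; set X := \sum_i mu l i * th i `^ p in Q *.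
have X0 : 0 <= X by apply: sumr_ge0 => i _; rewrite mulr_ge0 ?powR_ge0.
have XF : X = - itgp (fun x => f x * fe T v l z x).
  rewrite -(hw z az) hz'// /pairg; apply: eq_bigr => i _; congr (_ * _).
  rewrite -(mulr_powRB1 (th0 i) p0) sum2 /Psi -!mulrA -!normrEsg -mulrDr mulrC; congr (_ * _).
have Hz := fe_H10 M k0 oO cO nO OB az; have [z2 _ _ _] := Hz.
pose Ga := \sum_i mu l i * gsl v l z i.
have Gz : n2p (fe T v l z) <= Ga / 2.
  rewrite ler_pdivlMr// mulrC; apply: le_trans (gag_L1 (normr_ge0 B) OB' Hz) _; apply: eqle.
  have [i0 i1] : itbp (fun x => `|Gr v l z 0 x|) /\ itbp (fun x => `|Gr v l z 1 x|).
    by split; apply: itb_norm; [have [] := pc_itg M k0 oO cO nO OB (fun i => slo 0 (itq v l z i))|have [] := pc_itg M k0 oO cO nO OB (fun i => slo 1 (itq v l z i))].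
  have -> : Ga = itgp (pc l (gsl v l z)).
    by have [_ ->] := pc_itg M k0 oO cO nO OB (gsl v l z); apply: eq_bigr => i _; rewrite mulrC.
  by rewrite -itgD//; congr itg; apply: funext => x; exact: (gslE M).
have V1 : \sum_i mu l i <= (2 * `|B|) ^+ 2.
  have [ib eb] := itg_ibox 0 (normr_ge0 B); rewrite -eb.
  have [i1 e1] := pc_itg M k0 oO cO nO OB (fun=> 1).
  rewrite (eq_bigr (fun i => 1 * mu l i)) => [|i _]; last by rewrite mul1r.
  rewrite -e1; apply: itg_le => // x; have /andP[b0 _] := ibox_ge0 0 `|B| x.
  have [->//|[i xi ->]] := pcP M (fun=> 1) x; rewrite ibox1//.
  by apply: OB'; exact: (Op_Om M k0 oO cO nO xi).
have h1 : X <= n2p f * (Ga / 2).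
  rewrite XF; apply: le_trans (ler_norm _) _; rewrite normrN; apply: le_trans (CS f2 z2) _.
  by apply: ler_wpM2l => //; exact: n2_ge0.
have V00 : 0 <= \sum_i mu l i by exact: sumr_ge0.
have main := meyers_arith dd C0 V00 (n2_ge0 leb2 f) X0 h1 Q.
apply: le_trans (main _) _ => [s s0|].
  rewrite mulr_sumr mulr_sumr -big_split/=; apply: ler_sum => i _.
  have q1 : 1 <= 2 - d by lra.
  have := ler_wpM2l (mu0 i) (powR_split q1 s0 (gsl_ge0 v l z i)).
  by move/le_trans; apply; apply: eqle; ring.
apply: ler_wpM2r; first exact: powR_ge0.
apply: (@le_trans _ _ (C `^ ((1 - d)^-1) * (2 * `|B|) ^+ 2)); last by rewrite lerDl.
by apply: ler_wpM2l => //; exact: powR_ge0.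
Qed.

End Meyers.

(** * The rate in the energy norm *)

Section EnergyError.
Implicit Types (w : P -> R) (b : 'I_2) (D : 'I_2 -> P -> R).

Variables (Om : set P) (x0 : P) (r0 B k h0 : R) (a : 'I_2 -> 'I_2 -> P -> R) (c K : R).
Hypotheses (oO : open Om) (cO : is_convex Om) (OB : Om `<=` box 0 B) (B0 : 0 <= B) (r00 : 0 < r0) (Bx : box x0 r0 `<=` Om).
Hypotheses (k0 : 0 < k) (h00 : 0 < h0) (c0 : 0 < c) (ca : coef a c K).
Variable CL : R.
Hypotheses (CL0 : 0 <= CL).
Hypothesis hCL : forall f u G, L2p f -> H10 Om u G -> weq Om a f G ->
  forall phi, test_function Om phi -> \sum_i itgp (fun x => G i x * partial i phi x) <= CL * n2p f * n2p phi.

Lemma rate_arith (Cm U N I s L : R) : 0 < s -> s <= 1 -> 0 <= Cm -> 0 <= U * N -> I <= U * N -> L = s ^+ 2 ->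
  2 * (Cm * L ^- 4 * I) / k * (h0 * s ^+ 16) * (2 * B) <= 4 * Cm * U / k * h0 * B * (s * N).
Proof.
move=> s0 s1 Cm0 N0 IU ->; have sn : s != 0 by rewrite gt_eqF.
rewrite (_ : _ * (2 * B) = 4 * Cm / k * h0 * B * (s ^+ 8 * I)); last by field; rewrite sn gt_eqF.
rewrite (_ : 4 * Cm * U / k * h0 * B * (s * N) = 4 * Cm / k * h0 * B * (s * (U * N))); last by ring.
have w0 : 0 <= 4 * Cm / k * h0 * B by rewrite !mulr_ge0 ?invr_ge0 ?(ltW k0) ?(ltW h00).
have p8 : s ^+ 8 <= s by rewrite exprS ler_piMr ?(ltW s0)// exprn_ile1// ltW.
apply: ler_wpM2l => //; apply: (@le_trans _ _ (s ^+ 8 * (U * N))); last exact: ler_wpM2r.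
by apply: ler_wpM2l => //; rewrite exprn_ge0// ltW.
Qed.

(** The mesh size is written h0 s^16 and the dilation parameter is l = s^2. The squared distance of
    the mollified dilation to u is of order l = s^2. Its second differences are of order l^-4 =
    s^-8, so interpolation costs s^-8 s^16 = s^8 <= s. Both errors are thus of order s. *)
Lemma l2_rate : exists2 C, 0 <= C & forall n (T : 'I_n -> set P) v l H s, 0 < s -> s <= 1 ->
  mesh Om T v l H k (h0 * s ^+ 16) -> forall f u G w, L2p f -> H10 Om u G -> weq Om a f G -> adm Om v w ->
  (forall w', adm Om v w' -> bil a (Gr v l w) (Gr v l w') = - itgp (fun x => f x * fe T v l w' x)) ->
  n2p (fun x => Gr v l w 0 x - G 0 x) + n2p (fun x => Gr v l w 1 x - G 1 x) <= C * (s * n2p f).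
Proof.
have [Cm Cm0 tay] := moll_taylor x0 OB r00.
have q0 : 0 <= 2 * B / c by rewrite !mulr_ge0 ?invr_ge0 ?(ltW c0).
pose U := 2 * B * (B * (2 * B / c)); have U0 : 0 <= U by rewrite !mulr_ge0 ?invr_ge0 ?(ltW c0).
pose V := 2 * (CL * ((3 * B + 2 * r0) * (2 * B / c))).
have V0 : 0 <= V.
  by apply: mulr_ge0 => //; apply: mulr_ge0 => //; apply: mulr_ge0 => //; rewrite addr_ge0 ?mulr_ge0 ?(ltW r00).
pose W := 4 * Cm * U / k * h0 * B.
have W0 : 0 <= W by rewrite /W; do !apply: mulr_ge0 => //; rewrite ?invr_ge0 ltW.
exists (2 * K / c * (2 * (W + Num.sqrt V))).
  by rewrite !mulr_ge0 ?addr_ge0 ?sqrtr_ge0 ?invr_ge0 ?(ltW c0) ?(coef_ge0 ca).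
move=> n T v l H s s0 s1 M f u G w f2 hu hw aw hd; set N := n2p f.
have N0 : 0 <= N by exact: n2_ge0.
have nO : Om !=set0 by exists x0; apply: Bx; split; rewrite subrr normr0 ltW.
have l0 : 0 < s ^+ 2 by rewrite exprn_gt0.
have l1 : s ^+ 2 <= 1 by rewrite exprn_ile1// ltW.
have [u2 G2 uz _] := hu; have en := energy B0 OB c0 ca f2 hu hw.
have sT : 0 <= s * N by rewrite mulr_ge0// ltW.
have uI : itgp (fun x => `|u x|) <= U * N.
  have -> : (fun x => `|u x|) = (fun x => ibox 0 B x * `|u x|).
    apply: funext => x; have [/OB xB|/uz[-> _]] := pselect (Om x); first by rewrite ibox1 ?mul1r.
    by rewrite normr0 mulr0.
  apply: le_trans (itg_ibox_abs 0 B0 u2) _; rewrite /U -[leRHS]mulrA; apply: ler_wpM2l; first by rewrite mulr_ge0.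
  by apply: le_trans (poincare B0 OB hu) _; rewrite -[leRHS]mulrA; exact: ler_wpM2l.
pose m := moll x0 r0 (s ^+ 2) u; have [tm _] := moll_test cO OB r00 Bx l0 (H10_wpair hu).
have CI0 : 0 <= Cm * (s ^+ 2) ^- 4 * itgp (fun x => `|u x|).
  by rewrite !mulr_ge0 ?invr_ge0 ?exprn_ge0 ?(ltW s0)// itg_ge0.
have d1 b : n2p (fun x => Gr v l m b x - partial b m x) <= W * (s * N).
  apply: le_trans (interp_err M k0 oO cO nO OB B0 b tm CI0 (tay _ _ _ l0 l1 hu)) _.
  by apply: rate_arith => //; exact: mulr_ge0.
have d2 b : n2p (fun x => partial b m x - G b x) <= Num.sqrt V * (s * N).
  have h1 := moll_laplace cO OB r00 Bx l0 l1 hu (mulr_ge0 CL0 N0) (hCL f2 hu hw).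
  have h2 : 2 * (CL * N * (s ^+ 2 * (3 * B + 2 * r0) * (n2p (G 0) + n2p (G 1)))) <= V * (s * N) ^+ 2.
    rewrite (_ : V * (s * N) ^+ 2 = 2 * (CL * N * (s ^+ 2 * (3 * B + 2 * r0) * (2 * B / c * N)))); last by rewrite /V; ring.
    apply: ler_wpM2l => //; apply: ler_wpM2l; first exact: mulr_ge0.
    by apply: ler_wpM2l => //; rewrite mulr_ge0 ?(ltW l0)// addr_ge0 ?mulr_ge0 ?(ltW r00).
  rewrite -(ler_pXn2r (n := 2))// ?nnegrE ?n2_ge0 ?mulr_ge0 ?sqrtr_ge0 ?(ltW s0)//.
  have e : (Num.sqrt V * (s * N)) ^+ 2 = V * (s * N) ^+ 2 by rewrite exprMn sqr_sqrtr.
  rewrite e; apply: (le_trans _ h2); apply: (le_trans _ h1).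
  by rewrite (bigD1 b)//= lerDl; apply: sumr_ge0 => i _; exact: sqr_ge0.
have L2G b : L2p (Gr v l m b) := Gr_L2 M k0 oO cO nO OB m b.
have d b : n2p (fun x => Gr v l m b x - G b x) <= (W + Num.sqrt V) * (s * N).
  apply: le_trans (n2_split (L2G b) (test_L2 (test_partial b tm)) (G2 b)) _.
  by rewrite mulrDl; exact: lerD.
have am : adm Om v m by exact: adm_test tm.
have hc := cea M k0 oO cO nO OB c0 ca f2 hu hw aw am hd; apply: (le_trans hc).
rewrite -[leRHS]mulrA; apply: ler_wpM2l; first by rewrite !mulr_ge0 ?invr_ge0 ?(ltW c0) ?(coef_ge0 ca).
by rewrite -mulrA mulr_natl mulr2n; exact: lerD.
Qed.

End EnergyError.

(** * Interpolation between L^2 and L^q, and the error in W^{1,p} *)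

Section LpRate.
Implicit Types (w : P -> R) (p q m N : R) (b : 'I_2).

Lemma powR_anti r s t : r <= 0 -> 0 < s -> s <= t -> t `^ r <= s `^ r.
Proof.
move=> r0 s0 st; have t0 : 0 < t by exact: lt_le_trans st.
have E (m : R) : m `^ r = (m `^ (- r))^-1 by rewrite -powRN opprK.
rewrite !E lef_pV2 ?posrE ?powR_gt0//.
by apply: ge0_ler_powR; rewrite ?nnegrE ?oppr_ge0 ?(ltW s0) ?(ltW t0).
Qed.

Lemma powR_interp p q m t : 2 < p -> p < q -> 0 < m -> 0 <= t -> t `^ p <= m `^ (p - 2) * t ^+ 2 + m `^ (p - q) * t `^ q.
Proof.
move=> p2 pq m0; rewrite le_eqVlt => /predU1P[<-|t0].
  by rewrite powR0 ?addr_ge0 ?mulr_ge0 ?powR_ge0 ?sqr_ge0// gt_eqF// (lt_trans _ p2).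
have tn : t != 0 by rewrite gt_eqF.
have [tm|mt] := leP t m.
  apply: le_trans (_ : _ <= m `^ (p - 2) * t ^+ 2) _; last by rewrite lerDl mulr_ge0 ?powR_ge0.
  have -> : t `^ p = t `^ (p - 2) * t ^+ 2 by rewrite -powR_mulrn ?(ltW t0)// -powRD ?tn ?implybT// subrK.
  apply: ler_wpM2r; first exact: sqr_ge0.
  by apply: ge0_ler_powR; rewrite ?nnegrE ?subr_ge0 ?(ltW p2) ?(ltW t0) ?(ltW m0).
apply: le_trans (_ : _ <= m `^ (p - q) * t `^ q) _; last by rewrite lerDr mulr_ge0 ?powR_ge0 ?sqr_ge0.
have -> : t `^ p = t `^ (p - q) * t `^ q by rewrite -powRD ?tn ?implybT// subrK.
apply: ler_wpM2r; first exact: powR_ge0.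
by apply: powR_anti => //; [rewrite subr_le0 ltW|exact: ltW].
Qed.

(** |f| is split at the height m = N s^(-1/(p-2)). Then m^(p-2) (s N)^2 = N^p s and m^(p-q) N^q =
    N^p s^((q-p)/(p-2)), which explains the two conditions on ga. *)
Lemma Lp_rate f p q ga N s C1 C2 : 2 < p -> p < q -> ga <= 1 -> ga <= (q - p) / (p - 2) -> 0 < N -> 0 < s -> s <= 1 ->
  0 <= C1 -> 0 <= C2 -> L2p f -> itbp (fun x => `|f x| `^ q) -> itgp (fun x => f x ^+ 2) <= C1 * (s * N) ^+ 2 ->
  itgp (fun x => `|f x| `^ q) <= C2 * N `^ q ->
  itbp (fun x => `|f x| `^ p) /\ itgp (fun x => `|f x| `^ p) <= (C1 + C2) * (N `^ p * s `^ ga).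
Proof.
move=> p2 pq g1 gq N0 s0 s1 C10 C20 [mf f2] fq h1 h2; pose m := N * s `^ (- (p - 2)^-1).
have pp : 0 < p - 2 by rewrite subr_gt0.
have m0 : 0 < m by rewrite mulr_gt0// powR_gt0.
have i1 := itbZ (m `^ (p - 2)) f2; have i2 := itbZ (m `^ (p - q)) fq.
have le x : `|f x| `^ p <= m `^ (p - 2) * f x ^+ 2 + m `^ (p - q) * `|f x| `^ q.
  by have := powR_interp p2 pq m0 (normr_ge0 (f x)); rewrite real_normK ?num_real.
have ip : itbp (fun x => `|f x| `^ p).
  apply: itb_le (itbD i1 i2); first exact: itb_abs_eq.
  by move=> x; rewrite ger0_norm ?powR_ge0.
split=> //; apply: le_trans (itg_le ip (itbD i1 i2) le) _; rewrite itgD// !itgZ// mulrDl.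
have Nn : N != 0 by rewrite gt_eqF.
have ms r : m `^ r = N `^ r * s `^ (- r / (p - 2)).
  by rewrite powRM ?powR_ge0 ?(ltW N0)// -powRrM; congr (_ * _ `^ _); ring.
have sg r : ga <= r -> s `^ r <= s `^ ga by move=> h; apply: ger_powR => //; rewrite s0.
apply: lerD.
  apply: le_trans (ler_wpM2l (powR_ge0 _ _) h1) _; rewrite ms (_ : - (p - 2) / (p - 2) = -1); last by field; rewrite gt_eqF.
  rewrite powR_inv1 ?(ltW s0)// mulrCA; apply: ler_wpM2l => //.
  rewrite (_ : N `^ (p - 2) / s * (s * N) ^+ 2 = N `^ (p - 2) * N ^+ 2 * s); last by field; rewrite gt_eqF.
  rewrite -powR_mulrn ?(ltW N0)// -powRD ?Nn ?implybT// subrK; apply: ler_wpM2l; first exact: powR_ge0.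
  by rewrite -[leLHS]powRr1 ?(ltW s0)//; exact: sg.
apply: le_trans (ler_wpM2l (powR_ge0 _ _) h2) _; rewrite ms mulrCA; apply: ler_wpM2l => //.
rewrite mulrAC -powRD ?Nn ?implybT// subrK; apply: ler_wpM2l; first exact: powR_ge0.
by rewrite opprB; exact: sg.
Qed.

Lemma powR_cvg q (g : nat -> R) t : 0 < q -> (forall n, 0 <= g n) -> g n @[n --> \oo] --> t -> g n `^ q @[n --> \oo] --> t `^ q.
Proof.
move=> q0 g0 hg; have t0 : 0 <= t.
  have -> : t = lim (g n @[n --> \oo]) by apply/esym/cvg_lim.
  by apply: limr_ge; [apply/cvg_ex; exists t|exact: nearW].
move: t0; rewrite le_eqVlt => /predU1P[t0|t0].
  rewrite -t0 powR0 ?gt_eqF//; rewrite -t0 in hg; apply/cvgrPdist_le => e e0.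
  have e1 : 0 < e `^ q^-1 by rewrite powR_gt0.
  move/cvgrPdist_le: hg => /(_ _ e1); apply: filterS => n; rewrite !sub0r !normrN !ger0_norm ?powR_ge0// => h.
  apply: le_trans (_ : _ <= (e `^ q^-1) `^ q) _.
    by apply: ge0_ler_powR; rewrite ?nnegrE ?(ltW q0) ?powR_ge0.
  by rewrite -powRrM mulVf ?gt_eqF// powRr1// ltW.
have ct : {for t, continuous (fun m : R => m `^ q)}.
  have ti : t \in `]0, +oo[ by rewrite in_itv/= t0.
  by have /derivable1_diffP/differentiable_continuous := @derivable_powR R 1 q t ti.
exact: (cvg_comp _ _ hg ct).
Qed.

Lemma powR_sub q (s t : R) : 0 <= q -> `|s - t| `^ q <= 2 `^ q * (`|s| `^ q + `|t| `^ q).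
Proof.
move=> q0; have hm (u v : R) : `|u| <= `|v| -> `|u - v| `^ q <= 2 `^ q * `|v| `^ q.
  move=> uv; rewrite -powRM//; apply: ge0_ler_powR; rewrite ?nnegrE ?mulr_ge0//.
  by apply: le_trans (ler_normB _ _) _; rewrite mulr_natl mulr2n lerD2r.
rewrite mulrDr; have [st|/ltW ts] := leP `|s| `|t|.
  by apply: le_trans (hm _ _ st) _; rewrite lerDr mulr_ge0 ?powR_ge0.
by rewrite distrC; apply: le_trans (hm _ _ ts) _; rewrite lerDl mulr_ge0 ?powR_ge0.
Qed.

Definition galerkin Om n (T : 'I_n -> set P) v l a f w := adm Om v w /\
  forall w', adm Om v w' -> bil a (Gr v l w) (Gr v l w') = - itgp (fun x => f x * fe T v l w' x).

Section Estimates.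
Variables (Om : set P) (B k h0 : R) (a : 'I_2 -> 'I_2 -> P -> R) (c K : R) (q CM CR : R).
Hypotheses (oO : open Om) (cO : is_convex Om) (nO : Om !=set0) (OB : Om `<=` box 0 B) (B0 : 0 <= B).
Hypotheses (k0 : 0 < k) (h00 : 0 < h0) (c0 : 0 < c) (ca : coef a c K) (q2 : 2 < q) (CM0 : 0 <= CM) (CR0 : 0 <= CR).
Hypothesis hmesh : forall s, 0 < s -> s <= 1 -> exists n (T : 'I_n -> set P) v l H, mesh Om T v l H k (h0 * s ^+ 16).
Hypothesis hCM : forall n (T : 'I_n -> set P) v l H h f w, mesh Om T v l H k h -> L2p f -> galerkin Om T v l a f w ->
  \sum_i mu l i * gsl v l w i `^ q <= CM * n2p f `^ q.
Hypothesis hCR : forall n (T : 'I_n -> set P) v l H s, 0 < s -> s <= 1 ->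
  mesh Om T v l H k (h0 * s ^+ 16) -> forall f u G w, L2p f -> H10 Om u G -> weq Om a f G -> galerkin Om T v l a f w ->
  n2p (fun x => Gr v l w 0 x - G 0 x) + n2p (fun x => Gr v l w 1 x - G 1 x) <= CR * (s * n2p f).

Lemma galerkin_ex n (T : 'I_n -> set P) v l H h f : mesh Om T v l H k h -> L2p f -> exists w, galerkin Om T v l a f w.
Proof.
(* The functional must be linear in all nodal data, while the finite element function is square
   integrable for admissible ones; the indicator of Om makes any data admissible. *)
move=> M f2; pose cut w := fun x => w x * \1_Om x.
have ac w : adm Om v (cut w) by move=> i m nOm; rewrite /cut indicE memNset// mulr0.
have F2 w : L2p (fe T v l (cut w)) by have [] := fe_H10 M k0 oO cO nO OB (ac w).
pose F w := - itgp (fun x => f x * fe T v l (cut w) x).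
have [||w aw hw] := @discrete_solve _ _ _ _ _ _ _ _ _ M k0 oO cO nO OB a c K c0 ca F.
- move=> s w w'; have i1 := L2M f2 (F2 w); have i2 := L2M f2 (F2 w').
  rewrite /F mulrN -opprD -itgZ// -itgD//; last exact: itbZ.
  congr (- itg _ _); apply: funext => x.
  have -> : cut (fun y => s * w y + w' y) = fun y => s * cut w y + cut w' y by apply: funext => y; rewrite /cut; ring.
  by rewrite (fe_lin M); ring.
- move=> w w' e; rewrite /F (@fe_nodal _ _ _ _ _ _ _ _ M (cut w) (cut w'))// => i m.
  by rewrite /cut e.
exists w; split=> // w' aw'; rewrite hw// /F (@fe_nodal _ _ _ _ _ _ _ _ M (cut w') w')// => i m.
rewrite /cut indicE; have [Ov|nOv] := pselect (Om (v i m)); first by rewrite mem_set ?mulr1.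
by rewrite memNset// mulr0 aw'.
Qed.

Lemma Gr_pow n (T : 'I_n -> set P) v l H h w b : mesh Om T v l H k h ->
  itbp (fun x => `|Gr v l w b x| `^ q) /\ itgp (fun x => `|Gr v l w b x| `^ q) <= \sum_i mu l i * gsl v l w i `^ q.
Proof.
move=> M; have q0 : 0 < q by exact: lt_trans q2.
have -> : (fun x => `|Gr v l w b x| `^ q) = pc l (fun i => `|slo b (itq v l w i)| `^ q).
  apply: funext => x; rewrite /Gr (pc_map M (F := fun t : R => `|t| `^ q))//.
  by rewrite normr0 powR0// gt_eqF.
have [ip ->] := pc_itg M k0 oO cO nO OB (fun i => `|slo b (itq v l w i)| `^ q); split=> //.
apply: ler_sum => i _; rewrite mulrC; apply: ler_wpM2l; first by apply: ltW; exact: (mu_gt0 M k0 oO cO nO OB).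
apply: ge0_ler_powR; rewrite ?nnegrE ?(ltW q0) ?gsl_ge0//.
by case: (ord2P b) => ->; rewrite /gsl ?lerDl ?lerDr.
Qed.

(** Galerkin gradients on finer and finer meshes converge to G almost everywhere and are bounded in
    L^q by the discrete estimate; Fatou's lemma concludes. *)
Lemma grad_pow f u G N b : L2p f -> H10 Om u G -> weq Om a f G -> n2p f < N ->
  itbp (fun x => `|G b x| `^ q) /\ itgp (fun x => `|G b x| `^ q) <= CM * N `^ q.
Proof.
move=> f2 hu hw fN; have q0 : 0 < q by exact: lt_trans q2.
have [_ G2 _ _] := hu; have N0 : 0 < N by apply: le_lt_trans fN; exact: n2_ge0.
have D0 : 0 < 1 + 2 * CR * N by rewrite ltr_wpDr// !mulr_ge0// ltW.
(* The mesh parameter is chosen so that the energy error is at most 4^-j / 2, fast enough for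
   convergence almost everywhere. *)
pose s j : R := 4^-1 ^+ j / 2 / (1 + 2 * CR * N).
have s0 j : 0 < s j by rewrite !divr_gt0// exprn_gt0// invr_gt0.
have s1 j : s j <= 1.
  rewrite ler_pdivrMr// mul1r; apply: (@le_trans _ _ 1); last by rewrite lerDl !mulr_ge0// ltW.
  rewrite ler_pdivrMr// mul1r; apply: (@le_trans _ _ 1); last by rewrite ler1n.
  by apply: exprn_ile1; rewrite ?invr_ge0// invf_le1// ler1n.
have pick j : exists g, [/\ L2p g, n2p (fun x => g x - G b x) <= 4^-1 ^+ j / 2,
    itbp (fun x => `|g x| `^ q) & itgp (fun x => `|g x| `^ q) <= CM * N `^ q].
  have [n [T [v [l [H M]]]]] := hmesh (s0 j) (s1 j); have [w hg] := galerkin_ex M f2.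
  have [i1 i2] := Gr_pow w b M; exists (Gr v l w b); split=> //; first exact: (pc_L2 M k0 oO cO nO OB).
    have := hCR (s0 j) (s1 j) M f2 hu hw hg => h1.
    apply: (@le_trans _ _ (CR * (s j * N))).
      apply: le_trans (_ : _ <= CR * (s j * n2p f)) _.
        by apply: le_trans h1; case: (ord2P b) => ->; rewrite ?lerDl ?lerDr n2_ge0.
      by apply: ler_wpM2l => //; apply: ler_wpM2l; exact: ltW.
    rewrite (_ : CR * (s j * N) = 4^-1 ^+ j / 2 * (CR * N / (1 + 2 * CR * N))); last by rewrite /s; field; rewrite gt_eqF.
    rewrite ler_piMr//.
    have r0 : 0 <= CR * N by rewrite mulr_ge0// ltW.
    by rewrite ler_pdivrMr// mul1r -mulrA; move: (CR * N) r0 => r; lra.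
  apply: le_trans i2 _; apply: le_trans (hCM M f2 hg) _; apply: ler_wpM2l => //.
  by apply: ge0_ler_powR; rewrite ?nnegrE ?(ltW q0) ?n2_ge0 ?(ltW N0) ?(ltW fN).
have [g hg] := choice pick; have g2 j : L2p (g j) by have [] := hg j.
have ae := ae_seq g2 (G2 b) (fun j => let: And4 _ h _ _ := hg j in h).
apply: (@fatouR _ _ _ leb2 (fun j x => `|g j x| `^ q)).
- by move=> j; have [] := hg j.
- by apply: itb_abs_eq; case: (G2 b).
- by move=> j x; exact: powR_ge0.
- apply: filterS ae => x hx.
  by apply: powR_cvg => //; exact: cvg_norm.
- by move=> j; have [] := hg j.
Qed.

Definition errC : R := (CR ^+ 2 + 2 `^ q * (2 * CM)) + ((B * CR) ^+ 2 + 4 * (B * CR + CR + 1) ^+ 4).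

(** The gradients are interpolated with exponent q. The function itself is interpolated with
    exponent 4, where [H10_L4] bounds it by the energy; hence the condition p < 4 and the third
    bound on ga. *)
Lemma error_rate p ga f u G n (T : 'I_n -> set P) v l H w s N : 2 < p -> p < q -> p < 4 -> ga <= 1 ->
  ga <= (q - p) / (p - 2) -> ga <= (4 - p) / (p - 2) -> 0 < s -> s <= 1 -> mesh Om T v l H k (h0 * s ^+ 16) ->
  L2p f -> H10 Om u G -> weq Om a f G -> galerkin Om T v l a f w -> n2p f < N ->
  (itbp (fun x => `|fe T v l w x - u x| `^ p) /\
    itgp (fun x => `|fe T v l w x - u x| `^ p) <= errC * (N `^ p * s `^ ga)) /\
  forall b, itbp (fun x => `|Gr v l w b x - G b x| `^ p) /\
    itgp (fun x => `|Gr v l w b x - G b x| `^ p) <= errC * (N `^ p * s `^ ga).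
Proof.
move=> p2 pq p4 g1 gq g4 s0 s1 M f2 hu hw hg fN; have [aw _] := hg; have q0 : 0 < q by exact: lt_trans q2.
have N0 : 0 < N by apply: le_lt_trans fN; exact: n2_ge0.
have [u2 G2 _ _] := hu; have L2G b : L2p (Gr v l w b) := Gr_L2 M k0 oO cO nO OB w b.
have sN0 : 0 <= s * N by rewrite mulr_ge0 ?ltW.
have rate : n2p (fun x => Gr v l w 0 x - G 0 x) + n2p (fun x => Gr v l w 1 x - G 1 x) <= CR * (s * N).
  apply: le_trans (hCR s0 s1 M f2 hu hw hg) _; apply: ler_wpM2l => //; apply: ler_wpM2l; exact: ltW.
have rb b : n2p (fun x => Gr v l w b x - G b x) <= CR * (s * N).
  by apply: le_trans rate; case: (ord2P b) => ->; rewrite ?lerDl ?lerDr n2_ge0.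
have sq g C : 0 <= C -> n2p g <= C * (s * N) -> itgp (fun x => g x ^+ 2) <= C ^+ 2 * (s * N) ^+ 2.
  move=> C0 h; have w0 : 0 <= C * (s * N) by exact: mulr_ge0.
  by rewrite -n2K -exprMn; apply: lerXn2r; rewrite ?nnegrE ?n2_ge0.
have pos : 0 <= N `^ p * s `^ ga by rewrite mulr_ge0 ?powR_ge0.
have c1 : 0 <= CR ^+ 2 + 2 `^ q * (2 * CM) by rewrite addr_ge0 ?sqr_ge0// mulr_ge0 ?powR_ge0// mulr_ge0.
have d0 : 0 <= B * CR + CR + 1 by rewrite !addr_ge0// mulr_ge0.
have c2 : 0 <= (B * CR) ^+ 2 + 4 * (B * CR + CR + 1) ^+ 4 by rewrite addr_ge0 ?sqr_ge0// mulr_ge0// exprn_ge0.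
have hE : H10 Om (fun x => fe T v l w x - u x) (fun b x => Gr v l w b x - G b x).
  have -> : (fun x => fe T v l w x - u x) = (fun x => -1 * u x + fe T v l w x) by apply: funext => x; ring.
  have -> : (fun b x => Gr v l w b x - G b x) = (fun b x => -1 * G b x + Gr v l w b x).
    by apply: funext => b; apply: funext => x; ring.
  by apply: H10_lin hu _; exact: (fe_H10 M k0 oO cO nO OB aw).
split.
  have [e2 _ _ _] := hE; have ne : n2p (fun x => fe T v l w x - u x) <= B * CR * (s * N).
    by apply: le_trans (poincare B0 OB hE) _; rewrite -mulrA; exact: ler_wpM2l.
  have lt C : 0 <= C -> C <= B * CR + CR -> C * (s * N) < (B * CR + CR + 1) * N.
    move=> C0 hC; apply: le_lt_trans (_ : _ <= C * N) _.
      by apply: ler_wpM2l => //; rewrite ler_piMl// ltW.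
    by rewrite ltr_pM2r//; apply: le_lt_trans hC _; rewrite ltrDl.
  have BC : 0 <= B * CR by rewrite mulr_ge0.
  have [||e4 le4] := H10_L4 hE (K := (B * CR + CR + 1) * N).
  - by apply: le_lt_trans ne _; apply: lt => //; rewrite lerDl.
  - by move=> i; apply: le_lt_trans (rb i) _; apply: lt => //; rewrite lerDr.
  have E4 : (fun x => `|fe T v l w x - u x| `^ 4) = (fun x => (fe T v l w x - u x) ^+ 4).
    by apply: funext => x; rewrite powR_mulrn// -normrX ger0_norm// -[4%N]/((2 * 2)%N) exprM sqr_ge0.
  have [||i1 i2] := @Lp_rate (fun x => fe T v l w x - u x) p 4 ga N s ((B * CR) ^+ 2) (4 * (B * CR + CR + 1) ^+ 4)
    p2 p4 g1 g4 N0 s0 s1 (sqr_ge0 _) _ e2 (eq_ind_r (itbp) e4 E4) (sq _ _ BC ne).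
  - by rewrite mulr_ge0// exprn_ge0.
  - by rewrite E4 powR_mulrn ?(ltW N0)// -mulrA -exprMn.
  split=> //; apply: le_trans i2 _; apply: ler_wpM2r => //; by rewrite lerDr.
move=> b; have [i1 l1] := Gr_pow w b M; have [i3 l3] := grad_pow b f2 hu hw fN.
have l2 : itgp (fun x => `|Gr v l w b x| `^ q) <= CM * N `^ q.
  apply: le_trans l1 _; apply: le_trans (hCM M f2 hg) _; apply: ler_wpM2l => //.
  by apply: ge0_ler_powR; rewrite ?nnegrE ?(ltW q0) ?n2_ge0 ?(ltW N0) ?(ltW fN).
have dif := L2B (L2G b) (G2 b); have i4 := itbZ (2 `^ q) (itbD i1 i3).
have le x : `|Gr v l w b x - G b x| `^ q <= 2 `^ q * (`|Gr v l w b x| `^ q + `|G b x| `^ q).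
  exact: powR_sub (ltW q0).
have iq : itbp (fun x => `|Gr v l w b x - G b x| `^ q).
  apply: itb_le i4; first by apply: itb_abs_eq; case: dif.
  by move=> x; rewrite ger0_norm ?powR_ge0.
have lq : itgp (fun x => `|Gr v l w b x - G b x| `^ q) <= 2 `^ q * (2 * CM) * N `^ q.
  apply: le_trans (itg_le iq i4 le) _; rewrite itgZ ?itgD//; last exact: itbD.
  rewrite -mulrA; apply: ler_wpM2l; first exact: powR_ge0.
  by rewrite -mulrA mulr_natl mulr2n; exact: lerD.
have [|j1 j2] := Lp_rate p2 pq g1 gq N0 s0 s1 (sqr_ge0 CR) _ dif iq (sq _ _ CR0 (rb b)) lq.
  by rewrite mulr_ge0 ?powR_ge0// mulr_ge0.
by split=> //; apply: le_trans j2 _; apply: ler_wpM2r => //; rewrite lerDl.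
Qed.

End Estimates.

End LpRate.

End Plane.

(** * The convergence theorem *)

Lemma sol_rhs (R : realType) (Om : set (plane R)) (f phi : plane R -> R) : (forall x, ~ Om x -> phi x = 0) ->
  itg (leb2 R) (fun x => (f \_ Om) x * phi x) = itg (leb2 R) (fun x => f x * phi x).
Proof.
move=> z; congr itg; apply: funext => x; rewrite patchE; case: ifPn => // /negP nO.
by rewrite z ?mulr0// => /mem_set.
Qed.

Theorem corollary1p4 (R : realType) (Om : set (plane R)) (h0 : R)
    (Th : R -> set (set (plane R))) (A : plane R -> 'M[R]_2)
    (hOm : convex_polygonal_domain Om)
    (hh0 : 0 < h0)
    (hTh : triangulation_family Om h0 Th)
    (hreg : regular_family h0 Th)
    (hA : in_Linfty_mx Om A)
    (hell : uniformly_elliptic Om A)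
    (hW22 : forall f : plane R -> R, in_Lp Om 2%:E f ->
       forall u, weak_solution Om A f u -> in_Sobolev Om 2 2%:E u) :
  exists2 eps : R, 0 < eps &
    forall p : R, 2 < p < 2 + eps ->
    exists theta C : R, [/\ 0 < theta < 1, 0 < C &
      forall f : plane R -> R, in_Lp Om 2%:E f ->
      forall h : R, 0 < h <= h0 ->
      exists uh : plane R -> R,
        [/\ discrete_solution Om A (Th h) f uh,
            (forall vh, discrete_solution Om A (Th h) f vh ->
               forall x : plane R, closure Om x -> vh x = uh x) &
            forall u, weak_solution Om A f u ->
              in_Sobolev Om 1 p%:E (uh \- u) /\
              (W1p_norm Om p (uh \- u)%R <=
                 (C * h `^ theta)%:E * Lp_norm Om 2%:E f)%E]].

Proof.
have [oO nO cO _] := hOm.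
have [k k0 hmesh] := family_mesh hTh hreg.
have sub0 : 0 < h0 <= h0 by rewrite hh0 lexx.
(* The domain is bounded because finitely many triangles of the mesh of size h0 cover it. *)
have [B B0 OB] : exists2 B, 0 <= B & Om `<=` box 0 B.
  have [n [T [v [l [H [M _]]]]]] := hmesh h0 sub0.
  pose C := \sum_i (`|(v i 0).1| + `|(v i 0).2| + H i).
  have C0 i : 0 <= `|(v i 0).1| + `|(v i 0).2| + H i by rewrite !addr_ge0// ltW// (H_gt0 M).
  exists C => [|x Ox]; first exact: sumr_ge0.
  have /(m_cov M)[i xi] := subset_closure Ox; have [d1 d2] := T_box M xi.
  have le : `|(v i 0).1| + `|(v i 0).2| + H i <= C by rewrite /C (bigD1 i)//= lerDl sumr_ge0.
  have tri (s t e : R) : `|s - t| <= e -> `|s| <= `|t| + e.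
    by move=> d; rewrite -[s](subrK t) addrC; apply: le_trans (ler_normD _ _) _; rewrite lerD2l.
  by split; rewrite subr0; apply: le_trans (tri _ _ _ _) (le_trans _ le); [exact: d1|rewrite -addrA lerD2l lerDr|exact: d2|rewrite lerD2r lerDr].
have [x0 [r0 r00 Bx]] := inner_box oO nO.
have [a [c [K [c0 ca hb]]]] := bilin_coef oO hA hell.
(* The only use of the regularity hypothesis: each solution has a Laplacian in L^2, with a bound
   that depends on the solution. *)
have hN X : sol Om a X -> exists2 N, 0 <= N & forall phi, test_function Om phi -> lap phi X <= N * n2 (leb2 R) phi.
  move=> [f2 hu hw]; have uE : X.1.2 \_ Om = X.1.2 by apply: patch_out => x nOx; have [_ _ z _] := hu; have [] := z x nOx.
  have hu' : H10 Om (X.1.2 \_ Om) X.2 by rewrite uE.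
  have fO : L2 (leb2 R) (X.1.1 \_ Om).
    apply: (L2_le _ f2).
      by apply/(measurable_restrict _ (open_meas oO) measurableT); rewrite setTI; apply: measurable_funTS; case: f2.
    by move=> x; rewrite patchE; case: ifPn => _ //; rewrite normr0.
  apply: (W22_lap oO hu'); apply: (hW22 X.1.1); first exact/in_Lp2.
  apply: (weq_weak oO hb hu) => phi tp; rewrite hw// sol_rhs// => x nOx.
  by have [_ _ /(_ x nOx)[] ] := H10_test tp.
have [CL CL0 hCL] := lap_bound B0 OB c0 ca hN (open_meas oO).
have [q [CM [q2 CM0 hCM]]] := meyers B k0 c0 (coef_ge0 ca).
have [CR CR0 hCR] := l2_rate oO cO OB B0 r00 Bx k0 hh0 c0 ca CL0 hCL.
have hmesh' s : 0 < s -> s <= 1 -> exists n (T : 'I_n -> set (plane R)) v l H, mesh Om T v l H k (h0 * s ^+ 16).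
  move=> s0 s1; have [|n [T [v [l [H [M _]]]]]] := hmesh (h0 * s ^+ 16); last by exists n, T, v, l, H.
  by rewrite mulr_gt0 ?exprn_gt0//= ler_piMr ?(ltW hh0)// exprn_ile1// ltW.
have hCM' n (T : 'I_n -> set (plane R)) v l H h f w : mesh Om T v l H k h -> L2 (leb2 R) f -> galerkin Om T v l a f w ->
    \sum_i mu l i * gsl v l w i `^ q <= CM * n2 (leb2 R) f `^ q.
  by move=> M f2 [aw hw]; exact: (hCM _ _ _ _ _ _ _ _ _ _ M oO cO nO OB ca f2 aw hw).
have hCR' n (T : 'I_n -> set (plane R)) v l H s : 0 < s -> s <= 1 ->
    mesh Om T v l H k (h0 * s ^+ 16) -> forall f u G w, L2 (leb2 R) f -> H10 Om u G -> weq Om a f G -> galerkin Om T v l a f w ->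
    n2 (leb2 R) (fun x => Gr v l w 0 x - G 0 x) + n2 (leb2 R) (fun x => Gr v l w 1 x - G 1 x) <= CR * (s * n2 (leb2 R) f).
  by move=> s0 s1 M f u G w f2 hu hw [aw hd]; exact: (hCR _ _ _ _ _ _ s0 s1 M _ _ _ _ f2 hu hw aw hd).
(* p must stay below q for the gradients and below 4 for the function. *)
exists (Num.min q 4 - 2); first by rewrite subr_gt0 lt_min q2 ltr_nat.
move=> p /andP[p2]; rewrite addrC subrK lt_min => /andP[pq p4].
have pp : 0 < p - 2 by rewrite subr_gt0.
have p0 : 0 < p by exact: lt_trans p2.
pose ga := Num.min 1 (Num.min ((q - p) / (p - 2)) ((4 - p) / (p - 2))).
have ga0 : 0 < ga by rewrite !lt_min ltr01 !divr_gt0 ?subr_gt0.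
have g1 : ga <= 1 by rewrite ge_min lexx.
have gq : ga <= (q - p) / (p - 2) by rewrite !ge_min lexx orbT.
have g4 : ga <= (4 - p) / (p - 2) by rewrite !ge_min lexx !orbT.
(* The p-th power of the error is of order s^ga with s = (h / h0)^(1/16); the p-th root divides by
   p. The summand 1 in C below only makes it positive. *)
pose th := ga / (16 * p); pose CE := errC B q CM CR.
pose C := (3 * CE) `^ p^-1 * h0 `^ (- th) + 1.
have C1 : 0 <= (3 * CE) `^ p^-1 * h0 `^ (- th) by rewrite mulr_ge0 ?powR_ge0.
exists th, C; split.
- rewrite divr_gt0 ?mulr_gt0//= ltr_pdivrMr ?mulr_gt0// mul1r; apply: le_lt_trans g1 _; lra.
- by rewrite ltr_wpDl.
move=> f fLp h /andP[h1 hh]; pose f0 := f \_ Om; have f2 : L2 (leb2 R) f0 by apply/in_Lp2.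
pose s := (h / h0) `^ 16^-1.
have hr : 0 < h / h0 by rewrite divr_gt0.
have s0 : 0 < s by rewrite powR_gt0.
have s1 : s <= 1.
  by rewrite -[leRHS](powRr0 (h / h0)); apply: ger_powR; rewrite ?hr ?ler_pdivrMr ?mul1r ?invr_ge0.
have s16 : h0 * s ^+ 16 = h.
  by rewrite -powR_mulrn ?(ltW s0)// -powRrM mulVf ?pnatr_eq0// powRr1 ?(ltW hr)// mulrC divfK// gt_eqF.
have [n [T [v [l [H [M hT]]]]]] := hmesh h (introT andP (conj h1 hh)).
have M' : mesh Om T v l H k (h0 * s ^+ 16) by rewrite s16.
have [w hw] := galerkin_ex oO cO nO OB k0 c0 ca M f2; have [aw wE] := hw.
pose uh := fe T v l w; exists uh.
have uO : uh \_ Om = uh by apply: patch_out => x nOx; exact: (fe_bd M oO cO aw nOx).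
have hU : H10 Om (uh \_ Om) (Gr v l w) by rewrite uO; exact: (fe_H10 M k0 oO cO nO OB aw).
have rhs u w' : adm Om v w' -> (forall x, closure Om x -> u x = fe T v l w' x) ->
    \int[leb2 R]_(x in Om) (f x * u x) = itg (leb2 R) (fun x => f0 x * fe T v l w' x).
  move=> _ e; rewrite itg_rhs//; congr itg; apply: funext => x; rewrite /f0 patchE.
  by case: ifPn => [/set_mem Ox|_]; [rewrite e//; exact: subset_closure|rewrite !mul0r].
split.
- split=> [|u hu]; first exact: (fe_V10 M oO cO hT aw).
  have [au ue] := V10_fe M oO hT hu.
  by rewrite (hb _ _ _ _ hU (V10_H10 M k0 oO cO nO OB hT hu)) wE// (rhs _ _ au ue).
- move=> vh [vV vE] x cx; have [av ve] := V10_fe M oO hT vV; have hV := V10_H10 M k0 oO cO nO OB hT vV.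
  (* Uniqueness: the difference of two discrete solutions is admissible and has energy at most 0. *)
  pose z := fun y => -1 * w y + vh y; have az : adm Om v z by exact: adm_lin.
  have L2G w1 : L2g (Gr v l w1) := Gr_L2 M k0 oO cO nO OB w1.
  have bz : bil a (Gr v l z) (Gr v l z) <= 0.
    have -> : bil a (Gr v l z) (Gr v l z) = -1 * bil a (Gr v l w) (Gr v l z) + bil a (Gr v l vh) (Gr v l z).
      rewrite -(bil_lin1 (-1) ca (L2G w) (L2G vh) (L2G z)); congr bil.
      by apply: funext => b; apply: funext => y; exact: (Gr_lin M).
    have zV := fe_V10 M oO cO hT az.
    have zO : H10 Om (fe T v l z \_ Om) (Gr v l z).
      rewrite patch_out; first exact: (fe_H10 M k0 oO cO nO OB az).
      by move=> y nOy; exact: (fe_bd M oO cO az nOy).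
    have := vE _ zV; rewrite (hb _ _ _ _ hV zO) (rhs _ _ az (fun _ _ => erefl)) => ->.
    by rewrite wE// mulN1r opprK subrr.
  have := adm_zero M k0 oO cO nO OB c0 ca az bz x; rewrite (fe_lin M) mulN1r addrC => /eqP.
  by rewrite subr_eq0 (ve x cx) => /eqP ->.
move=> u hu; have [G hG gE] := weak_weq oO ca hb fLp hu.
pose u0 := u \_ Om; pose E b x := Gr v l w b x - G b x.
have weqG : weq Om a f0 G by move=> phi tp; exact: gE (H10_test tp).
have eE : (uh \- u)%R \_ Om = fun x => fe T v l w x - u0 x by rewrite patchB uO.
have hE : H10 Om ((uh \- u)%R \_ Om) E.
  rewrite eE (_ : (fun x => _) = (fun x => -1 * u0 x + fe T v l w x)); last by apply: funext => x; ring.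
  rewrite (_ : E = fun b x => -1 * G b x + Gr v l w b x); first by apply: H10_lin hG _; rewrite uO in hU.
  by apply: funext => b; apply: funext => x; rewrite /E; ring.
have EO b : E b \_ Om = E b by apply: patch_out => x nOx; have [_ _ /(_ x nOx)[]] := hE.
have est := fun N => error_rate (N := N) oO cO nO OB B0 k0 c0 ca q2 (ltW CM0) CR0 hmesh' hCM' hCR'
  p2 pq p4 g1 gq g4 s0 s1 M' f2 hG weqG hw.
have N1 : n2 (leb2 R) f0 < n2 (leb2 R) f0 + 1 by rewrite ltrDl.
have [[i1 _] i2] := est _ N1.
have [||| S ->] := W1p_eval (u := (uh \- u)%R) (G := E) oO (ltW (lt_trans (ltr1n _ 2) p2)) (fun b => H10_wp b oO hE).
- by have [[]] := hE.
- by rewrite eE.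
- by move=> b; rewrite EO; have [] := i2 b.
split=> //; rewrite Lp_norm2// -EFinM lee_fin eE.
under eq_bigr do rewrite EO.
set W := _ `^ p^-1; pose D := (3 * CE) `^ p^-1 * s `^ (ga / p).
(* The estimates ask for a bound N strictly above the norm of f; the homogeneous estimate follows as
   N decreases to that norm, and this includes f = 0. *)
have bd N : n2 (leb2 R) f0 < N -> W <= D * N.
  move=> fN; have N0 : 0 < N by apply: le_lt_trans fN; exact: n2_ge0.
  have [[_ e1] e2] := est N fN; have [_ e3] := e2 0; have [_ e4] := e2 1.
  rewrite /W sum2; have le := lerD e1 (lerD e3 e4).
  have CE0 : 0 <= CE.
    have pos : 0 < N `^ p * s `^ ga by rewrite mulr_gt0 ?powR_gt0.
    rewrite -(pmulr_lge0 _ pos); apply: le_trans e1; apply: itg_ge0 => x; exact: powR_ge0.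
  apply: (@le_trans _ _ ((3 * CE * (N `^ p * s `^ ga)) `^ p^-1)).
    apply: ge0_ler_powR; rewrite ?nnegrE ?invr_ge0 ?(ltW p0) ?mulr_ge0 ?powR_ge0//.
      by rewrite !addr_ge0// itg_ge0// => x; exact: powR_ge0.
    by apply: le_trans le _; apply: eqle; rewrite -/CE; ring.
  rewrite (powRM _ (mulr_ge0 (ler0n R 3) CE0) (mulr_ge0 (powR_ge0 N p) (powR_ge0 s ga))).
  rewrite (powRM _ (powR_ge0 N p) (powR_ge0 s ga)) -(powRrM N) -(powRrM s) mulfV ?gt_eqF// powRr1 ?(ltW N0)//.
  by apply: eqle; rewrite /D; ring.
have WD : W <= D * n2 (leb2 R) f0.
  rewrite -subr_le0; apply: (@le_lim _ _ D) => e e0.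
  by rewrite lerBlDr addrC -mulrDr; apply: bd; rewrite ltrDl.
apply: le_trans WD _; apply: ler_wpM2r; first exact: n2_ge0.
rewrite /D /s -powRrM (_ : 16^-1 * (ga / p) = th); last by rewrite /th; field; rewrite gt_eqF.
have -> : (h / h0) `^ th = h0 `^ (- th) * h `^ th.
  by rewrite powRM ?invr_ge0 ?(ltW h1) ?(ltW hh0)// -powR_inv1 ?(ltW hh0)// -powRrM mulN1r mulrC.
by rewrite mulrA; apply: ler_wpM2r; rewrite ?powR_ge0// /C lerDl.
Qed.
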